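(* Let $g(n)$ be defined by $$G(q):=\sum_{n\ge 0}g(n)q^n=\frac{1}{(q,-q^3;q^4)_\infty}.$$ Then, as $n\to\infty$, $$g(n)\sim \frac{\pi^{\frac14}\Gamma(\tfrac14)}{2^{\frac94}3^{\frac38}n^{\frac38}}\,I_{-\frac34}\!\left(\frac{\pi}{2}\sqrt{\frac n3}\right)+(-1)^n\frac{\pi^{\frac34}\Gamma(\tfrac34)}{2^{\frac{11}4}3^{\frac58}n^{\frac58}}\,I_{-\frac54}\!\left(\frac{\pi}{2}\sqrt{\frac n3}\right).$$ Further, when $n\ge 2.4\times 10^{14}$, we have $g(n)>0$.
   Context: For $|q|<1$, $(A;q)_\infty:=\prod_{j\ge 0}(1-Aq^j)$ and $(A,B;q)_\infty:=(A;q)_\infty(B;q)_\infty$; thus $(q,-q^3;q^4)_\infty=\prod_{j\ge0}(1-q^{4j+1})(1+q^{4j+3})$. $\Gamma$ is the Gamma function and $I_s(x)$ is the modified Bessel function of the first kind of order $s$. *)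

(* Defs.v *)
From Stdlib Require Import Reals ZArith.
From Coquelicot Require Import Coquelicot.

Open Scope R_scope.

Fixpoint qpoch (A q : C) (N : nat) : C :=
  match N with
  | O => RtoC 1
  | S n => Cmult (qpoch A q n) (Cminus (RtoC 1) (Cmult A (Cpow q n)))
  end.

(* [iota] picks the limit of the partial products, which exists for |q| < 1. *)
Definition qpoch_inf (A q : C) : C :=
  iota (fun l : C_CompleteNormedModule =>
          filterlim (qpoch A q) eventually (locally l)).

Definition qpoch_inf2 (A B q : C) : C := Cmult (qpoch_inf A q) (qpoch_inf B q).

(* Euler's integral, convergent exactly for s > 0. *)
Definition Gamma_int (s : R) : R :=
  RInt_gen (fun t => Rpower t (s - 1) * exp (- t))
           (at_right 0) (Rbar_locally p_infty).

(* s (s + 1) ... (s + k - 1) *)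
Fixpoint rising (s : R) (k : nat) : R :=
  match k with
  | O => 1
  | S j => rising s j * (s + INR j)
  end.

(* The least k with s + k > 0: [up] is the least integer strictly above its
   argument, and [Z.to_nat] sends negative integers to 0. *)
Definition Gamma_shift (s : R) : nat := Z.to_nat (up (- s)).

(* The Gamma function on the real line, continued to s <= 0 by
   Gamma (s + 1) = s Gamma s.  At the poles 0, -1, -2, ... the denominator
   vanishes, so Gamma is 0 there and hence so is / Gamma, which is the right
   value of the entire function 1 / Gamma. *)
Definition Gamma (s : R) : R :=
  Gamma_int (s + INR (Gamma_shift s)) / rising s (Gamma_shift s).

(* The real branch on x > 0; [Rpower] is not meaningful for x <= 0. *)
Definition BesselI (s x : R) : R :=
  Series (fun m : nat =>
    Rpower (x / 2) (2 * INR m + s) / (INR (fact m) * Gamma (INR m + s + 1))).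

(* Main.v *)
Require Import Defs.
From Stdlib Require Import Reals Arith Lra Lia Psatz.
From Coquelicot Require Import Coquelicot.

Open Scope R_scope.

(** Write [q = e^(-z)]. Taking logarithms of the product and separating the terms of the resulting
    series by the parity of their index gives [G(q) = exp (Ev(z) + O(z))] and
    [G(-q) = exp (Ev(z) - O(z))], where

      [Ev(z) = sum over k >= 1 of 1 / (4 k sinh (2 k z))]  and
      [O(z) = sum over odd m of 1 / (2 m cosh (m z))].

    This is [gen_fun_exp] together with [ev_log_evz] and [od_log_odz]. The even part has a pole at
    0 with residue [PI^2/48] and, in absolute value, every one of its terms is largest on the real
    axis. The odd part has only a logarithmic singularity at 0, where it tends to infinity.

    The n-th coefficient is an integral of G over the circle [|q| = e^(-s)] ([coef_integral]). It
    is taken at [s = PI / sqrt (48 n)], where the saddle point lies on the real axis. On the ray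
    with [z = s (1 - iu)] the logarithm of [G(q) / G(e^(-s))], corrected by [i n th], is
    [- N u^2 / (1 - iu) + D] with [N = n s] and [|D| <= 2 |u|] ([odz_sub_le], [evz_sub_le]). The
    second estimate needs no modular transformation: [1 / sinh y - 2 / sinh (2 y)] has no pole and
    decays exponentially, so the relation between [Ev(z/2)] and [2 Ev(z)] can be iterated until
    only the pole is left. The values at [-q] are smaller by [exp (-2 O(s))], which tends to 0 as
    n grows. For [|u| >= 1/2] the integrand is exponentially small compared with [G(e^(-s))]
    ([minor_arc]). This is delicate only near [q = i] and [q = -i], where both parts have poles
    again: there the first 20 terms of each part are compared with their poles, with signs, and
    the claim becomes the positivity of a quadratic form. All constants are explicit, and
    [saddle_estimate] expresses the coefficient by a Gaussian integral with an error that is small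
    enough for positivity as soon as n exceeds the stated bound ([coef_pos]).

    For the asymptotic formula the value [G(e^(-s))] is needed up to a factor tending to 1. On the
    real axis both parts can be related to alternating sums over arithmetic progressions of values
    of convex functions, which lie between half of their first term and a similar upper bound
    ([alt_sandwich]). For the even part this gives the constant [- ln 2 / 4] ([evz_asymp]). For
    the odd part it gives [- ln s / 4] plus a constant involving the product of the quotients
    [(4k+3)/(4k+1)], hence [Gamma (1/4) / Gamma (3/4)] ([odz_asymp]), and
    [Gamma (1/4) * Gamma (3/4) = sqrt 2 * PI] leaves [Gamma (1/4)] alone.

    Finally both Bessel functions are compared with cosh: by the duplication formula their series
    is that of cosh with weights which are quotients of Gamma values, hence nearly powers of the
    index, and the terms of the series of [cosh x] concentrate at indices near [x/2]
    ([bessel_first], [bessel_second]). The first Bessel term has the order of magnitude and the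
    constant found for the coefficient; the second one is smaller by a power of n. *)


(** * Complex exponential and hyperbolic functions *)

Definition Cexp (z : C) : C := (exp (Re z) * cos (Im z), exp (Re z) * sin (Im z)).
Definition Cch (z : C) : C := (cosh (Re z) * cos (Im z), sinh (Re z) * sin (Im z)).
Definition Csh (z : C) : C := (sinh (Re z) * cos (Im z), cosh (Re z) * sin (Im z)).

Lemma C_ext (a b : C) : Re a = Re b -> Im a = Im b -> a = b.
Proof. destruct a, b; cbn; intros; subst; reflexivity. Qed.

Lemma Re_plus (a b : C) : Re (a + b)%C = Re a + Re b.
Proof. reflexivity. Qed.
Lemma Im_plus (a b : C) : Im (a + b)%C = Im a + Im b.
Proof. reflexivity. Qed.
Lemma Re_opp (a : C) : Re (- a)%C = - Re a.
Proof. reflexivity. Qed.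
Lemma Im_opp (a : C) : Im (- a)%C = - Im a.
Proof. reflexivity. Qed.
Lemma Re_minus (a b : C) : Re (a - b)%C = Re a - Re b.
Proof. reflexivity. Qed.
Lemma Im_minus (a b : C) : Im (a - b)%C = Im a - Im b.
Proof. reflexivity. Qed.
Lemma Re_mult (a b : C) : Re (a * b)%C = Re a * Re b - Im a * Im b.
Proof. reflexivity. Qed.
Lemma Im_mult (a b : C) : Im (a * b)%C = Re a * Im b + Im a * Re b.
Proof. reflexivity. Qed.
Lemma Re_RtoC (x : R) : Re (RtoC x) = x.
Proof. reflexivity. Qed.
Lemma Im_RtoC (x : R) : Im (RtoC x) = 0.
Proof. reflexivity. Qed.
Lemma Re_scal (x : R) (a : C) : Re (RtoC x * a)%C = x * Re a.
Proof. rewrite Re_mult, Re_RtoC, Im_RtoC; ring. Qed.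
Lemma Im_scal (x : R) (a : C) : Im (RtoC x * a)%C = x * Im a.
Proof. rewrite Im_mult, Re_RtoC, Im_RtoC; ring. Qed.
Lemma Re_pair (x y : R) : Re (x, y) = x. Proof. reflexivity. Qed.
Lemma Im_pair (x y : R) : Im (x, y) = y. Proof. reflexivity. Qed.

#[global] Hint Rewrite Re_plus Im_plus Re_opp Im_opp Re_minus Im_minus Re_scal Im_scal
  Re_mult Im_mult Re_RtoC Im_RtoC Re_pair Im_pair : cplx.

Lemma Cinv_uniq (a b : C) : (a * b = 1)%C -> a = (/ b)%C.
Proof.
  intros h.
  assert (hb : b <> RtoC 0).
  { intros e. rewrite e, Cmult_0_r in h. apply RtoC_inj in h. lra. }
  transitivity (a * b * / b)%C; [field; exact hb|rewrite h; ring].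
Qed.

Lemma Cexp_plus (a b : C) : Cexp (a + b)%C = (Cexp a * Cexp b)%C.
Proof.
  apply C_ext; unfold Cexp; autorewrite with cplx;
    rewrite exp_plus, ?cos_plus, ?sin_plus; ring.
Qed.

Lemma Cexp_0 : Cexp (RtoC 0) = RtoC 1.
Proof.
  apply C_ext; unfold Cexp; autorewrite with cplx; rewrite exp_0, ?cos_0, ?sin_0; ring.
Qed.

Lemma Cmod_Cexp (z : C) : Cmod (Cexp z) = exp (Re z).
Proof.
  unfold Cmod, Cexp; cbn [fst snd].
  replace ((exp (Re z) * cos (Im z)) ^ 2 + (exp (Re z) * sin (Im z)) ^ 2)
    with (exp (Re z) ^ 2).
  - apply sqrt_pow2. left; apply exp_pos.
  - pose proof (sin2_cos2 (Im z)) as H; unfold Rsqr in H.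
    transitivity (exp (Re z) ^ 2 * (sin (Im z) * sin (Im z) + cos (Im z) * cos (Im z))).
    + rewrite H; ring.
    + ring.
Qed.

Lemma Cexp_neq0 (z : C) : Cexp z <> RtoC 0.
Proof.
  apply Cmod_gt_0. rewrite Cmod_Cexp. apply exp_pos.
Qed.

Lemma Cexp_opp (z : C) : Cexp (- z)%C = (/ Cexp z)%C.
Proof.
  assert (H : (Cexp (- z) * Cexp z = 1)%C).
  { rewrite <- Cexp_plus. replace (- z + z)%C with (RtoC 0) by ring. apply Cexp_0. }
  apply Cinv_uniq; assumption.
Qed.

Lemma Cexp_pow (z : C) (n : nat) : (Cexp z ^ n)%C = Cexp (RtoC (INR n) * z)%C.
Proof.
  induction n as [|n IH].
  - cbn [Cpow INR]. rewrite <- Cexp_0. f_equal. ring.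
  - rewrite Cpow_S, IH, <- Cexp_plus, S_INR, RtoC_plus. f_equal. ring.
Qed.

Lemma cosh_Cexp (z : C) : Cch z = ((Cexp z + Cexp (- z)) / 2)%C.
Proof.
  apply C_ext; unfold Cch, Cexp, cosh, sinh, Cdiv;
    replace (/ RtoC 2)%C with (RtoC (/ 2)) by (rewrite RtoC_inv; [reflexivity|lra]);
    autorewrite with cplx; rewrite ?cos_neg, ?sin_neg; field.
Qed.

Lemma sinh_Cexp (z : C) : Csh z = ((Cexp z - Cexp (- z)) / 2)%C.
Proof.
  apply C_ext; unfold Csh, Cexp, cosh, sinh, Cdiv;
    replace (/ RtoC 2)%C with (RtoC (/ 2)) by (rewrite RtoC_inv; [reflexivity|lra]);
    autorewrite with cplx; rewrite ?cos_neg, ?sin_neg; field.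
Qed.

Lemma cosh_sqr (x : R) : cosh x ^ 2 = 1 + sinh x ^ 2.
Proof.
  unfold cosh, sinh.
  assert (H : exp x * exp (- x) = 1) by (rewrite <- exp_plus, Rplus_opp_r; apply exp_0).
  replace (((exp x + exp (- x)) / 2) ^ 2)
    with (exp x * exp (-x) + ((exp x - exp (- x)) / 2) ^ 2) by field.
  rewrite H; reflexivity.
Qed.

Lemma cos_sqr (x : R) : cos x ^ 2 = 1 - sin x ^ 2.
Proof. pose proof (sin2_cos2 x); unfold Rsqr in *; nra. Qed.

Lemma Cmod_sqr (z : C) : Cmod z ^ 2 = Re z ^ 2 + Im z ^ 2.
Proof. apply Cmod2_alt. Qed.

Lemma Cmod_Csh_sqr (z : C) : Cmod (Csh z) ^ 2 = sinh (Re z) ^ 2 + sin (Im z) ^ 2.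
Proof.
  rewrite Cmod_sqr; unfold Csh; autorewrite with cplx.
  rewrite !Rpow_mult_distr, cosh_sqr, cos_sqr. ring.
Qed.

Lemma Cmod_Cch_sqr (z : C) : Cmod (Cch z) ^ 2 = sinh (Re z) ^ 2 + cos (Im z) ^ 2.
Proof.
  rewrite Cmod_sqr; unfold Cch; autorewrite with cplx.
  rewrite !Rpow_mult_distr, cosh_sqr, cos_sqr. ring.
Qed.

Lemma exp_sub1_le (x : R) : Rabs (exp x - 1) <= Rabs x * exp (Rmax 0 x).
Proof.
  destruct (Rle_dec 0 x) as [h|h].
  - rewrite Rmax_right by lra.
    pose proof (exp_ineq1_le x). rewrite !Rabs_pos_eq by lra.
    pose proof (exp_ineq1_le (- x)) as H1. rewrite exp_Ropp in H1.
    pose proof (exp_pos x).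
    assert (exp x * (1 + - x) <= exp x * / exp x) by (apply Rmult_le_compat_l; lra).
    rewrite Rinv_r in H2 by lra. lra.
  - rewrite Rmax_left by lra. rewrite exp_0.
    pose proof (exp_ineq1_le x).
    assert (exp x < exp 0) by (apply exp_increasing; lra). rewrite exp_0 in H0.
    rewrite !Rabs_left by lra. lra.
Qed.

Lemma one_sub_cos_le (y : R) : 1 - cos y <= y ^ 2 / 2.
Proof.
  replace y with (2 * (y / 2)) at 1 by field.
  rewrite cos_2a_sin.
  assert (sin (y/2) ^ 2 <= (y/2)^2).
  { rewrite <- (pow2_abs (sin (y/2))), <- (pow2_abs (y/2)).
    apply pow_incr; split; [apply Rabs_pos|].
    destruct (Rtotal_order (y/2) 0) as [h|[h|h]].
    - pose proof (sin_lt_x (- (y/2))) as H. rewrite sin_neg in H.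
      pose proof (SIN_bound (y/2)).
      rewrite (Rabs_left (y/2)) by lra. apply Rabs_le; split; [lra|].
      destruct (Rle_dec (- (y/2)) 1) as [h1|h1].
      + assert (0 < sin (- (y/2))).
        { apply sin_gt_0; [lra|]. pose proof PI_RGT_0. pose proof PI2_1. lra. }
        rewrite sin_neg in H1. lra.
      + lra.
    - rewrite h, sin_0. lra.
    - pose proof (sin_lt_x (y/2)) as H.
      pose proof (SIN_bound (y/2)).
      rewrite (Rabs_pos_eq (y/2)) by lra. apply Rabs_le; split; [|lra].
      destruct (Rle_dec (y/2) 1) as [h1|h1].
      + assert (0 < sin (y/2)).
        { apply sin_gt_0; [lra|]. pose proof PI2_1. lra. }
        lra.
      + lra. }
  nra.
Qed.

Lemma sin_sqr_le (y : R) : sin y ^ 2 <= y ^ 2.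
Proof.
  pose proof (one_sub_cos_le (2 * y)) as H. rewrite cos_2a_sin in H. nra.
Qed.

Lemma Rabs_sin_le (y : R) : Rabs (sin y) <= Rabs y.
Proof.
  apply Rsqr_le_abs_0. pose proof (sin_sqr_le y). unfold Rsqr. nra.
Qed.

Lemma Cmod_le_of_sqr (z : C) (b : R) : 0 <= b -> Cmod z ^ 2 <= b ^ 2 -> Cmod z <= b.
Proof.
  intros hb h. pose proof (Cmod_ge_0 z). nra.
Qed.

Lemma Cmod_ge_of_sqr (z : C) (b : R) : 0 <= b -> b ^ 2 <= Cmod z ^ 2 -> b <= Cmod z.
Proof.
  intros hb h. pose proof (Cmod_ge_0 z). nra.
Qed.

(** Squared, the left side is [(e^x - 1)^2 + 2 e^x (1 - cos y)], and each summand is at most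
    its share of [(x^2 + y^2) e^(2 max(0,x))]. *)
Lemma Cexp_sub1_le (w : C) : Cmod (Cexp w - 1)%C <= Cmod w * exp (Rmax 0 (Re w)).
Proof.
  pose proof (exp_pos (Rmax 0 (Re w))) as He.
  apply Cmod_le_of_sqr.
  { apply Rmult_le_pos; [apply Cmod_ge_0|lra]. }
  rewrite Rpow_mult_distr, !Cmod_sqr.
  unfold Cexp; autorewrite with cplx.
  set (x := Re w) in *. set (y := Im w).
  replace ((exp x * cos y - 1) ^ 2 + (exp x * sin y - 0) ^ 2)
    with ((exp x - 1) ^ 2 + 2 * exp x * (1 - cos y))
    by (transitivity (exp x ^ 2 * (cos y ^ 2 + sin y ^ 2) - 2 * exp x * cos y + 1);
        [rewrite cos_sqr|]; ring).
  pose proof (one_sub_cos_le y) as Hc.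
  pose proof (exp_pos x) as Hx.
  assert (H1 : (exp x - 1) ^ 2 <= x ^ 2 * exp (Rmax 0 x) ^ 2).
  { rewrite <- Rpow_mult_distr, <- (pow2_abs (exp x - 1)), <- (pow2_abs (x * _)).
    apply pow_incr; split; [apply Rabs_pos|].
    rewrite Rabs_mult, (Rabs_pos_eq (exp _)) by lra. apply exp_sub1_le. }
  assert (H2 : exp x <= exp (Rmax 0 x) ^ 2).
  { destruct (Rle_dec 0 x) as [h|h].
    - rewrite Rmax_right by lra. pose proof (exp_ineq1_le x). nra.
    - rewrite Rmax_left, exp_0 by lra.
      assert (exp x < exp 0) by (apply exp_increasing; lra). rewrite exp_0 in H. lra. }
  assert (2 * exp x * (1 - cos y) <= exp x * y ^ 2) by nra.
  assert (exp x * y ^ 2 <= exp (Rmax 0 x) ^ 2 * y ^ 2).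
  { apply Rmult_le_compat_r; [apply pow2_ge_0|assumption]. }
  nra.
Qed.

(** * Absolutely convergent complex series *)

Definition Csum (a : nat -> C) : C :=
  (Series (fun n => Re (a n)), Series (fun n => Im (a n))).

Definition Cabs_conv (a : nat -> C) : Prop := ex_series (fun n => Cmod (a n)).

Lemma im_le_Cmod (c : C) : Rabs (Im c) <= Cmod c.
Proof.
  pose proof (Rmax_Cmod c). eapply Rle_trans; [|exact H]. apply Rmax_r.
Qed.

Lemma ex_series_dom (a b : nat -> R) :
  (forall n, Rabs (a n) <= b n) -> ex_series b -> ex_series a.
Proof. intros h hb. exact (ex_series_le (V := R_CompleteNormedModule) a b h hb). Qed.

Lemma Cabs_conv_le (a : nat -> C) (b : nat -> R) :
  (forall n, Cmod (a n) <= b n) -> ex_series b -> Cabs_conv a.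
Proof.
  intros h hb. apply ex_series_dom with b; [|exact hb].
  intros n. rewrite Rabs_pos_eq by apply Cmod_ge_0. apply h.
Qed.

Lemma Cabs_conv_Re (a : nat -> C) : Cabs_conv a -> ex_series (fun n => Re (a n)).
Proof. intros h. apply ex_series_dom with (2 := h). intros; apply re_le_Cmod. Qed.

Lemma Cabs_conv_Im (a : nat -> C) : Cabs_conv a -> ex_series (fun n => Im (a n)).
Proof. intros h. apply ex_series_dom with (2 := h). intros; apply im_le_Cmod. Qed.

Lemma Csum_ext (a b : nat -> C) : (forall n, a n = b n) -> Csum a = Csum b.
Proof.
  intros h; unfold Csum; f_equal; apply Series_ext; intros n; rewrite h; reflexivity.
Qed.

Lemma ex_series_scalR (c : R) (a : nat -> R) : ex_series a -> ex_series (fun n => c * a n).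
Proof. intros h. exact (ex_series_scal_l c a h). Qed.

Lemma ex_series_plusR (a b : nat -> R) :
  ex_series a -> ex_series b -> ex_series (fun n => a n + b n).
Proof. intros ha hb. exact (ex_series_plus a b ha hb). Qed.

Lemma Cabs_conv_plus (a b : nat -> C) :
  Cabs_conv a -> Cabs_conv b -> Cabs_conv (fun n => (a n + b n)%C).
Proof.
  intros ha hb. apply Cabs_conv_le with (fun n => Cmod (a n) + Cmod (b n)).
  - intros; apply Cmod_triangle.
  - apply ex_series_plusR; assumption.
Qed.

Lemma Cabs_conv_scal (c : C) (a : nat -> C) :
  Cabs_conv a -> Cabs_conv (fun n => (c * a n)%C).
Proof.
  intros ha. apply Cabs_conv_le with (fun n => Cmod c * Cmod (a n)).
  - intros; rewrite Cmod_mult; lra.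
  - apply ex_series_scalR; assumption.
Qed.

Lemma Csum_plus (a b : nat -> C) :
  Cabs_conv a -> Cabs_conv b -> Csum (fun n => (a n + b n)%C) = (Csum a + Csum b)%C.
Proof.
  intros ha hb; unfold Csum; apply C_ext; autorewrite with cplx.
  - rewrite <- Series_plus by (apply Cabs_conv_Re; assumption). apply Series_ext; reflexivity.
  - rewrite <- Series_plus by (apply Cabs_conv_Im; assumption). apply Series_ext; reflexivity.
Qed.

Lemma Csum_scal (c : C) (a : nat -> C) :
  Cabs_conv a -> Csum (fun n => (c * a n)%C) = (c * Csum a)%C.
Proof.
  intros ha; unfold Csum; apply C_ext; autorewrite with cplx.
  - rewrite <- !Series_scal_l, <- Series_minus;
      try (apply ex_series_scalR; (apply Cabs_conv_Re || apply Cabs_conv_Im); assumption).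
    apply Series_ext; intros; autorewrite with cplx; ring.
  - rewrite <- !Series_scal_l, <- Series_plus;
      try (apply ex_series_scalR; (apply Cabs_conv_Re || apply Cabs_conv_Im); assumption).
    apply Series_ext; intros; autorewrite with cplx; ring.
Qed.

Lemma RtoC_m1 : RtoC (-1) = (- (1))%C.
Proof. apply C_ext; autorewrite with cplx; ring. Qed.

Lemma Csum_opp (a : nat -> C) :
  Cabs_conv a -> Csum (fun n => (- a n)%C) = (- Csum a)%C.
Proof.
  intros ha. rewrite (Csum_ext _ (fun n => (RtoC (-1) * a n)%C)).
  - rewrite Csum_scal by assumption. rewrite RtoC_m1. ring.
  - intros; rewrite RtoC_m1. ring.
Qed.

Lemma Csum_minus (a b : nat -> C) :
  Cabs_conv a -> Cabs_conv b -> Csum (fun n => (a n - b n)%C) = (Csum a - Csum b)%C.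
Proof.
  intros ha hb. unfold Cminus.
  rewrite (Csum_ext _ (fun n => (a n + RtoC (-1) * b n)%C)).
  - rewrite Csum_plus, Csum_scal; try assumption; [rewrite RtoC_m1; ring|].
    apply Cabs_conv_scal; assumption.
  - intros; rewrite RtoC_m1. ring.
Qed.

Lemma Series_le_gen (a b : nat -> R) :
  (forall n, a n <= b n) -> ex_series a -> ex_series b -> Series a <= Series b.
Proof.
  intros h ha hb.
  cut (0 <= Series b - Series a); [lra|].
  rewrite <- Series_minus by assumption.

  replace 0 with (Series (fun n => 0 * a n)) by (rewrite Series_scal_l; ring).
  apply Series_le.
  - intros n; specialize (h n); lra.
  - apply (ex_series_minus b a hb ha).
Qed.

(* The modulus is computed after rotating the sum onto the positive real axis. *)
Lemma Cmod_Csum_le (a : nat -> C) (b : nat -> R) :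
  (forall n, Cmod (a n) <= b n) -> ex_series b -> Cmod (Csum a) <= Series b.
Proof.
  intros h hb.
  assert (ha : Cabs_conv a) by (apply Cabs_conv_le with b; assumption).
  set (S := Csum a).
  assert (H : Cmod S ^ 2 <= Cmod S * Series b).
  { replace (Cmod S ^ 2) with (Re (Cconj S * S)%C).
    2:{ rewrite Cmult_comm, <- Cmod2_conj. apply Re_RtoC. }
    unfold S at 2. rewrite <- Csum_scal by assumption.
    unfold Csum; rewrite Re_pair, <- Series_scal_l.
    apply Series_le_gen.
    - intros n. eapply Rle_trans; [apply Rle_abs|].
      eapply Rle_trans; [apply re_le_Cmod|]. rewrite Cmod_mult, Cmod_conj.
      apply Rmult_le_compat_l; [apply Cmod_ge_0|apply h].
    - apply Cabs_conv_Re, Cabs_conv_scal; assumption.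
    - apply ex_series_scalR; assumption. }
  pose proof (Cmod_ge_0 S).
  destruct (Req_dec (Cmod S) 0) as [e|e].
  - rewrite e.
    replace 0 with (Series (fun n => 0 * b n)) by (rewrite Series_scal_l; ring).
    apply Series_le; [|assumption].
    intros n; specialize (h n); pose proof (Cmod_ge_0 (a n)); lra.
  - nra.
Qed.

Lemma Csum_incr_1 (a : nat -> C) :
  Cabs_conv a -> Csum a = (a 0%nat + Csum (fun n => a (S n)))%C.
Proof.
  intros h; unfold Csum; apply C_ext; autorewrite with cplx; rewrite Series_incr_1;
    try reflexivity; [apply Cabs_conv_Re|apply Cabs_conv_Im]; assumption.
Qed.

Lemma Csum_0 (a : nat -> C) : (forall n, a n = RtoC 0) -> Csum a = RtoC 0.
Proof.
  intros h. unfold Csum; apply C_ext; autorewrite with cplx.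
  - rewrite (Series_ext _ (fun n => 0 * 0)) by (intros; rewrite h; autorewrite with cplx; ring).
    rewrite Series_scal_l; ring.
  - rewrite (Series_ext _ (fun n => 0 * 0)) by (intros; rewrite h; autorewrite with cplx; ring).
    rewrite Series_scal_l; ring.
Qed.

Lemma Cpow_geom_conv (w : C) : Cmod w < 1 -> Cabs_conv (fun n => (w ^ n)%C).
Proof.
  intros h. apply Cabs_conv_le with (fun n => Cmod w ^ n).
  - intros; rewrite Cmod_pow; lra.
  - apply ex_series_geom. rewrite Rabs_pos_eq; [assumption|apply Cmod_ge_0].
Qed.

Lemma one_sub_neq0 (w : C) : Cmod w < 1 -> (1 - w)%C <> RtoC 0.
Proof.
  intros h e. assert (w = RtoC 1) by (rewrite <- (Cplus_0_l w), <- e; ring).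
  subst w. rewrite Cmod_1 in h. lra.
Qed.

Lemma Csum_geom (w : C) : Cmod w < 1 -> Csum (fun n => (w ^ n)%C) = (/ (1 - w))%C.
Proof.
  intros h. pose proof (Cpow_geom_conv w h) as hc.
  pose proof (Csum_incr_1 _ hc) as H; cbv beta in H.
  rewrite (Csum_ext (fun n => (w ^ S n)%C) (fun n => (w * w ^ n)%C)) in H
    by (intros; apply Cpow_S).
  rewrite Csum_scal in H by assumption. cbn [Cpow] in H.
  set (S := Csum _) in *.
  assert (H' : (S * (1 - w) = 1)%C).
  { replace (S * (1 - w))%C with (S - w * S)%C by ring. rewrite H at 1. ring. }
  apply Cinv_uniq; assumption.
Qed.

(** * The logarithmic series and infinite products *)

Lemma RtoC_INR_neq0 (n : nat) : RtoC (INR (S n)) <> RtoC 0.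
Proof. intros h. apply RtoC_inj in h. pose proof (pos_INR n). rewrite S_INR in h. lra. Qed.

Definition log_term (A : C) (n : nat) : C := (A ^ S n / RtoC (INR (S n)))%C.

Lemma Cmod_div_INR (a : C) (n : nat) : Cmod (a / RtoC (INR (S n)))%C = Cmod a / INR (S n).
Proof.
  rewrite Cmod_div by apply RtoC_INR_neq0. rewrite Cmod_R, Rabs_pos_eq; [reflexivity|].
  apply pos_INR.
Qed.

Lemma div_INR_le (x : R) (n : nat) : 0 <= x -> x / INR (S n) <= x.
Proof.
  intros h. pose proof (pos_INR n). rewrite S_INR.
  apply Rmult_le_reg_r with (INR n + 1); [lra|]. unfold Rdiv.
  rewrite Rmult_assoc, Rinv_l by lra. nra.
Qed.

Lemma log_term_le (A : C) (n : nat) : Cmod (log_term A n) <= Cmod A ^ S n.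
Proof.
  unfold log_term. rewrite Cmod_div_INR, Cmod_pow.
  apply div_INR_le. apply pow_le, Cmod_ge_0.
Qed.

Lemma ex_series_geom_S (r : R) : 0 <= r < 1 -> ex_series (fun n => r ^ S n).
Proof.
  intros h. apply (ex_series_scalR r (fun n => r ^ n)). apply ex_series_geom.
  rewrite Rabs_pos_eq; lra.
Qed.

Lemma Cabs_conv_log (A : C) : Cmod A < 1 -> Cabs_conv (log_term A).
Proof.
  intros h. apply Cabs_conv_le with (fun n => Cmod A ^ S n).
  - apply log_term_le.
  - apply ex_series_geom_S. split; [apply Cmod_ge_0|assumption].
Qed.

Section LogSeries.
Variable A : C.
Hypothesis hA : Cmod A < 1.

(* [pr] is the projection Re or Im *)
Let coef (pr : C -> R) (n : nat) : R :=
  match n with O => 0 | S k => pr (log_term A k) end.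

Lemma log_coef_radius (pr : C -> R) (t : R) :
  (forall c, Rabs (pr c) <= Cmod c) ->
  Rabs t <= 1 -> Rbar_lt (Rabs t) (CV_radius (coef pr)).
Proof.
  intros hpr ht.
  pose proof (Cmod_ge_0 A) as h0.
  set (r := 2 / (1 + Cmod A)).
  assert (hr : 1 < r).
  { unfold r. apply Rmult_lt_reg_r with (1 + Cmod A); [lra|]. unfold Rdiv.
    rewrite Rmult_assoc, Rinv_l by lra. lra. }
  assert (hAr : 0 <= Cmod A * r <= 1).
  { split; [apply Rmult_le_pos; lra|].
    unfold r. apply Rmult_le_reg_r with (1 + Cmod A); [lra|]. unfold Rdiv.
    rewrite Rmult_assoc, Rmult_assoc, Rinv_l by lra. lra. }
  apply Rbar_lt_le_trans with (Finite r); [cbn; lra|].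
  apply (CV_radius_bounded (coef pr)).
  exists 1. intros [|n].
  - cbn. rewrite Rmult_0_l, Rabs_R0. lra.
  - cbn [coef]. rewrite Rabs_mult, (Rabs_pos_eq (r ^ _)) by (apply pow_le; lra).
    apply Rle_trans with (Cmod A ^ S n * r ^ S n).
    + apply Rmult_le_compat_r; [apply pow_le; lra|].
      eapply Rle_trans; [apply hpr|apply log_term_le].
    + rewrite <- Rpow_mult_distr. rewrite <- (pow1 (S n)). apply pow_incr; lra.
Qed.

Let f (pr : C -> R) (t : R) := PSeries (coef pr) t.

Lemma log_series_derive (pr : C -> R) (t : R) :
  (forall c, Rabs (pr c) <= Cmod c) -> (forall x c, pr (RtoC x * c)%C = x * pr c) ->
  0 <= t <= 1 ->
  is_derive (f pr) t (Series (fun n => pr (A * (RtoC t * A) ^ n)%C)).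
Proof.
  intros hpr hsc ht.
  assert (hr : Rbar_lt (Rabs t) (CV_radius (coef pr))).
  { apply log_coef_radius; [assumption|]. rewrite Rabs_pos_eq; lra. }
  replace (Series _) with (PSeries (PS_derive (coef pr)) t).
  - apply is_derive_PSeries; assumption.
  - unfold PSeries. apply Series_ext; intros n.
    unfold PS_derive; cbn [coef]. unfold log_term.
    rewrite Cpow_mult_l, <- RtoC_pow.
    replace (A * (RtoC (t ^ n) * A ^ n))%C with (RtoC (t ^ n) * (A ^ S n))%C
      by (rewrite Cpow_S; ring).
    rewrite hsc.
    replace (A ^ S n / RtoC (INR (S n)))%C with (RtoC (/ INR (S n)) * A ^ S n)%C.
    + rewrite hsc. field. pose proof (pos_INR n); rewrite S_INR; lra.
    + rewrite RtoC_inv. { unfold Cdiv; ring. }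
      pose proof (pos_INR n); rewrite S_INR; lra.
Qed.

(** Along the ray from 0 to A the product of [1 - tA] with the exponential of the series has
    derivative 0, because the series has derivative [A / (1 - tA)]. *)
Lemma Cexp_log_series : ((1 - A) * Cexp (Csum (log_term A)) = 1)%C.
Proof.
  set (f1 := f Re). set (f2 := f Im).
  set (a := Re A). set (b := Im A).
  assert (hsmall : forall t, 0 <= t <= 1 -> Cmod (RtoC t * A)%C < 1).
  { intros t ht. rewrite Cmod_mult, Cmod_R, Rabs_pos_eq by lra.
    pose proof (Cmod_ge_0 A). nra. }
  assert (hd : forall t, 0 <= t <= 1 -> exists g1 g2, is_derive f1 t g1 /\ is_derive f2 t g2 /\
      (1 - t * a) * g1 + t * b * g2 = a /\ (1 - t * a) * g2 - t * b * g1 = b).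
  { intros t ht.
    exists (Series (fun n => Re (A * (RtoC t * A) ^ n)%C)),
           (Series (fun n => Im (A * (RtoC t * A) ^ n)%C)).
    split; [apply log_series_derive; [apply re_le_Cmod|intros; apply Re_scal|assumption]|].
    split; [apply log_series_derive; [apply im_le_Cmod|intros; apply Im_scal|assumption]|].
    assert (H : ((1 - RtoC t * A) * Csum (fun n => (A * (RtoC t * A) ^ n)%C) = A)%C).
    { rewrite Csum_scal by (apply Cpow_geom_conv; auto).
      rewrite Csum_geom by auto. field. apply one_sub_neq0; auto. }
    unfold Csum in H.
    set (s1 := Series _) in *. set (s2 := Series _) in *.
    pose proof (f_equal Re H) as H1. pose proof (f_equal Im H) as H2.
    autorewrite with cplx in H1, H2. unfold a, b. lra. }
  set (F1 := fun t => exp (f1 t) * ((1 - t * a) * cos (f2 t) + t * b * sin (f2 t))).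
  set (F2 := fun t => exp (f1 t) * ((1 - t * a) * sin (f2 t) - t * b * cos (f2 t))).
  assert (D : forall t, 0 <= t <= 1 -> is_derive F1 t 0 /\ is_derive F2 t 0).
  { intros t ht. destruct (hd t ht) as (g1 & g2 & d1 & d2 & e1 & e2).
    assert (ex1 : ex_derive f1 t) by (exists g1; exact d1).
    assert (ex2 : ex_derive f2 t) by (exists g2; exact d2).
    apply is_derive_unique in d1. apply is_derive_unique in d2.
    split; unfold F1, F2.
    - auto_derive; [repeat split; auto|].
      replace (Derive (fun x : R => f1 x) t) with g1 by (symmetry; exact d1).
      replace (Derive (fun x : R => f2 x) t) with g2 by (symmetry; exact d2).
      transitivity (exp (f1 t) * (cos (f2 t) * ((1 - t * a) * g1 + t * b * g2 - a)
                      + sin (f2 t) * (b - ((1 - t * a) * g2 - t * b * g1)))); [ring|].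
      rewrite e1, e2; ring.
    - auto_derive; [repeat split; auto|].
      replace (Derive (fun x : R => f1 x) t) with g1 by (symmetry; exact d1).
      replace (Derive (fun x : R => f2 x) t) with g2 by (symmetry; exact d2).
      transitivity (exp (f1 t) * (sin (f2 t) * ((1 - t * a) * g1 + t * b * g2 - a)
                      + cos (f2 t) * ((1 - t * a) * g2 - t * b * g1 - b))); [ring|].
      rewrite e1, e2; ring. }
  assert (E1 : F1 0 = F1 1) by (apply eq_is_derive; [intros; apply D; assumption|lra]).
  assert (E2 : F2 0 = F2 1) by (apply eq_is_derive; [intros; apply D; assumption|lra]).
  assert (f10 : f1 0 = 0) by (unfold f1, f; rewrite PSeries_0; reflexivity).
  assert (f20 : f2 0 = 0) by (unfold f2, f; rewrite PSeries_0; reflexivity).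
  assert (f11 : f1 1 = Re (Csum (log_term A))).
  { unfold f1, f, Csum. rewrite PSeries_1, Re_pair, Series_incr_1_aux; reflexivity. }
  assert (f21 : f2 1 = Im (Csum (log_term A))).
  { unfold f2, f, Csum. rewrite PSeries_1, Im_pair, Series_incr_1_aux; reflexivity. }
  unfold F1, F2 in E1, E2. rewrite f10, f20, f11, f21, exp_0, cos_0, sin_0 in E1, E2.
  apply C_ext; unfold Cexp; autorewrite with cplx; fold a b; lra.
Qed.

End LogSeries.

Lemma Cexp_close (a b : C) : Cmod (Cexp a - Cexp b)%C
  <= exp (Re b) * (Cmod (a - b)%C * exp (Cmod (a - b)%C)).
Proof.
  replace (Cexp a - Cexp b)%C with (Cexp b * (Cexp (a - b) - 1))%C.
  - rewrite Cmod_mult, Cmod_Cexp. apply Rmult_le_compat_l; [left; apply exp_pos|].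
    eapply Rle_trans; [apply Cexp_sub1_le|].
    apply Rmult_le_compat_l; [apply Cmod_ge_0|].
    assert (h : Rmax 0 (Re (a - b)%C) <= Cmod (a - b)%C).
    { apply Rmax_lub; [apply Cmod_ge_0|].
      eapply Rle_trans; [apply Rle_abs|apply re_le_Cmod]. }
    destruct h as [h|h]; [left; apply exp_increasing; assumption|rewrite h; right; reflexivity].
  - replace a with (b + (a - b))%C at 2 by ring. rewrite Cexp_plus. ring.
Qed.

Lemma pow_le_1 (x : R) (n : nat) : 0 <= x <= 1 -> 0 <= x ^ n <= 1.
Proof.
  intros h; split; [apply pow_le; lra|]. rewrite <- (pow1 n). apply pow_incr; lra.
Qed.

Lemma pow_le_self (x : R) (n : nat) : 0 <= x <= 1 -> x ^ S n <= x.
Proof.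
  intros h. pose proof (pow_le_1 x n h). cbn [pow]. nra.
Qed.

Lemma one_sub_pow_ge (Q : C) (n : nat) : Cmod Q < 1 -> 1 - Cmod Q <= Cmod (1 - Q ^ S n)%C.
Proof.
  intros h. pose proof (Cmod_ge_0 Q) as h0.
  pose proof (Cmod_triangle (1 - Q ^ S n) (Q ^ S n)) as H.
  replace (1 - Q ^ S n + Q ^ S n)%C with (RtoC 1) in H by ring.
  rewrite Cmod_1, Cmod_pow in H.
  pose proof (pow_le_self (Cmod Q) n). lra.
Qed.

Lemma pow_one_sub_neq0 (Q : C) (n : nat) : Cmod Q < 1 -> (1 - Q ^ S n)%C <> RtoC 0.
Proof.
  intros h. apply Cmod_gt_0. pose proof (one_sub_pow_ge Q n h). lra.
Qed.

Definition poch_term (A Q : C) (n : nat) : C := (log_term A n / (1 - Q ^ S n))%C.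

Lemma poch_term_le (A Q : C) (n : nat) : Cmod Q < 1 ->
  Cmod (poch_term A Q n) <= / (1 - Cmod Q) * Cmod A ^ S n.
Proof.
  intros hQ. unfold poch_term. rewrite Cmod_div by (apply pow_one_sub_neq0; assumption).
  rewrite Rmult_comm. unfold Rdiv.
  apply Rmult_le_compat; [apply Cmod_ge_0| |apply log_term_le|].
  - left; apply Rinv_0_lt_compat. apply Cmod_gt_0, pow_one_sub_neq0; assumption.
  - apply Rinv_le_contravar; [lra|apply one_sub_pow_ge; assumption].
Qed.

Lemma Cabs_conv_poch (A Q : C) : Cmod A < 1 -> Cmod Q < 1 -> Cabs_conv (poch_term A Q).
Proof.
  intros hA hQ. apply Cabs_conv_le with (fun n => / (1 - Cmod Q) * Cmod A ^ S n).
  - intros; apply poch_term_le; assumption.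
  - apply ex_series_scalR, ex_series_geom_S. split; [apply Cmod_ge_0|assumption].
Qed.

(** The logarithms of the first [J] factors are summed under the sign of the logarithmic
    series, where they form a finite geometric series. *)
Lemma qpoch_exp (A Q : C) (J : nat) : Cmod A < 1 -> Cmod Q < 1 ->
  (qpoch A Q J * Cexp (Csum (fun n => poch_term A Q n - poch_term A Q n * (Q ^ S n) ^ J)) = 1)%C.
Proof.
  intros hA hQ.
  assert (hc : forall J, Cabs_conv (fun n => (poch_term A Q n - poch_term A Q n * (Q ^ S n) ^ J)%C)).
  { intros J'. apply Cabs_conv_le with (fun n => 2 * Cmod (poch_term A Q n)).
    - intros n. unfold Cminus. eapply Rle_trans; [apply Cmod_triangle|].
      rewrite Cmod_opp, Cmod_mult, !Cmod_pow.
      pose proof (Cmod_ge_0 (poch_term A Q n)).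
      assert (h1 : 0 <= (Cmod Q ^ S n) ^ J' <= 1).
      { apply pow_le_1, pow_le_1. pose proof (Cmod_ge_0 Q); lra. }
      nra.
    - apply ex_series_scalR. apply Cabs_conv_poch; assumption. }
  induction J as [|J IH].
  - rewrite (Csum_0 (fun n => (poch_term A Q n - poch_term A Q n * (Q ^ S n) ^ 0)%C)).
    + rewrite Cexp_0. cbn [qpoch]. ring.
    + intros; cbn [Cpow]; ring.
  - assert (hAQ : Cmod (A * Q ^ J)%C < 1).
    { rewrite Cmod_mult, Cmod_pow. pose proof (Cmod_ge_0 A).
      assert (0 <= Cmod Q ^ J <= 1) by (apply pow_le_1; pose proof (Cmod_ge_0 Q); lra). nra. }
    rewrite (Csum_ext (fun n => (poch_term A Q n - poch_term A Q n * (Q ^ S n) ^ S J)%C)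
      (fun n => ((poch_term A Q n - poch_term A Q n * (Q ^ S n) ^ J) + log_term (A * Q ^ J) n)%C)).
    + rewrite Csum_plus, Cexp_plus by (auto; apply Cabs_conv_log; assumption).
      cbn [qpoch].
      transitivity ((qpoch A Q J * Cexp (Csum (fun n => (poch_term A Q n - poch_term A Q n * (Q ^ S n) ^ J)%C)))
         * ((1 - A * Q ^ J) * Cexp (Csum (log_term (A * Q ^ J)))))%C; [ring|].
      rewrite IH, Cexp_log_series by assumption. ring.
    + intros n. unfold poch_term, log_term.
      rewrite Cpow_mult_l, <- !Cpow_mult_r.
      replace (S n * S J)%nat with (S n + J * S n)%nat by lia.
      replace (S n * J)%nat with (J * S n)%nat by lia.
      rewrite Cpow_add_r. field.
      split; [apply RtoC_INR_neq0|apply pow_one_sub_neq0; assumption].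
Qed.

(** The terms by which the series of [qpoch_exp] differs from the full one carry the factor
    [Q^((n+1)J)], which tends to 0 uniformly in n. *)
Lemma qpoch_inf_exp (A Q : C) : Cmod A < 1 -> Cmod Q < 1 ->
  qpoch_inf A Q = Cexp (- Csum (poch_term A Q))%C.
Proof.
  intros hA hQ. unfold qpoch_inf.
  apply (iota_filterlim_locally (V := C_CompleteNormedModule) (F := eventually)).
  apply filterlim_locally. intros eps.
  set (S0 := Csum (poch_term A Q)).
  pose proof (Cabs_conv_poch A Q hA hQ) as hc.
  set (K := Series (fun n => Cmod (poch_term A Q n))).
  assert (hK : 0 <= K).
  { unfold K. replace 0 with (Series (fun n => 0 * Cmod (poch_term A Q n)))
      by (rewrite Series_scal_l; ring).
    apply Series_le; [|exact hc]. intros n; pose proof (Cmod_ge_0 (poch_term A Q n)); lra. }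
  assert (hQ0 := Cmod_ge_0 Q).
  assert (hJ : forall J, Cmod (qpoch A Q J - Cexp (- S0))%C
     <= exp (Re (- S0)%C) * ((K * Cmod Q ^ J) * exp K)).
  { intros J.
    set (D := Csum (fun n => (poch_term A Q n * (Q ^ S n) ^ J)%C)).
    assert (hterm : forall n, Cmod (poch_term A Q n * (Q ^ S n) ^ J)%C
       <= Cmod Q ^ J * Cmod (poch_term A Q n)).
    { intros n. rewrite Cmod_mult, !Cmod_pow, Rmult_comm.
      apply Rmult_le_compat_r; [apply Cmod_ge_0|].
      apply pow_incr. split; [apply pow_le; lra|]. apply pow_le_self; lra. }
    assert (hex : ex_series (fun n => Cmod Q ^ J * Cmod (poch_term A Q n)))
      by (apply ex_series_scalR; exact hc).
    assert (hDc : Cabs_conv (fun n => (poch_term A Q n * (Q ^ S n) ^ J)%C)).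
    { eapply Cabs_conv_le; [exact hterm|exact hex]. }
    assert (hD : Cmod D <= K * Cmod Q ^ J).
    { unfold D. eapply Rle_trans; [apply Cmod_Csum_le; [exact hterm|exact hex]|].
      rewrite Series_scal_l. fold K. lra. }
    pose proof (qpoch_exp A Q J hA hQ) as H.
    rewrite Csum_minus in H by assumption. fold S0 in H. fold D in H.
    apply Cinv_uniq in H. rewrite <- Cexp_opp in H. rewrite H.
    eapply Rle_trans; [apply Cexp_close|].
    replace (- (S0 - D) - - S0)%C with D by ring.
    apply Rmult_le_compat_l; [left; apply exp_pos|].
    apply Rmult_le_compat; [apply Cmod_ge_0|left; apply exp_pos|assumption|].
    assert (h : Cmod D <= K).
    { pose proof (pow_le_1 (Cmod Q) J). nra. }
    destruct h as [h|h]; [left; apply exp_increasing; assumption|rewrite h; right; reflexivity]. }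
  set (E := exp (Re (- S0)%C) * (K * exp K)) in *.
  assert (hE : 0 <= E).
  { unfold E. pose proof (exp_pos (Re (- S0)%C)). pose proof (exp_pos K).
    apply Rmult_le_pos; [lra|]. apply Rmult_le_pos; lra. }
  assert (hlim : is_lim_seq (fun J => E * Cmod Q ^ J) 0).
  { replace (Finite 0) with (Rbar_mult (Finite E) (Finite 0)) by (cbn; f_equal; ring).
    apply is_lim_seq_scal_l. apply is_lim_seq_geom. rewrite Rabs_pos_eq; lra. }
  apply is_lim_seq_spec in hlim. destruct (hlim eps) as [N HN].
  exists N. intros J hNJ. specialize (HN J hNJ).
  apply C_NormedModule_mixin_compat1.
  eapply Rle_lt_trans; [apply hJ|].
  rewrite Rminus_0_r in HN. eapply Rle_lt_trans; [|exact HN].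
  eapply Rle_trans; [|apply Rle_abs]. unfold E. right; ring.
Qed.

(** * The two halves of the logarithm of the generating function *)

(** With [p = e^(-y)] these are [1 / (2 sinh y)] and [1 / (2 cosh y)]. *)
Definition ek (p : C) : C := (p / (1 - p ^ 2))%C.
Definition ck (p : C) : C := (p / (1 + p ^ 2))%C.

Definition ev_term (q : C) (i : nat) : C := (/ RtoC (INR (2 * i + 2)) * ek (q ^ (2 * i + 2)))%C.
Definition od_term (q : C) (i : nat) : C := (/ RtoC (INR (2 * i + 1)) * ck (q ^ (2 * i + 1)))%C.

Definition ev_log (q : C) : C := Csum (ev_term q).
Definition od_log (q : C) : C := Csum (od_term q).

Lemma sum_n_pairs (a : nat -> R) (N : nat) :
  sum_n (fun i => a (2 * i)%nat + a (2 * i + 1)%nat) N = sum_n a (2 * N + 1)%nat.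
Proof.
  induction N as [|N IH].
  - cbn [Nat.mul Nat.add]. rewrite sum_Sn, !sum_O. reflexivity.
  - rewrite sum_Sn, IH. replace (2 * S N + 1)%nat with (S (S (2 * N + 1))) by lia.
    rewrite !sum_Sn. replace (2 * S N)%nat with (S (2 * N + 1)) by lia.
    replace (S (2 * N + 1) + 1)%nat with (S (S (2 * N + 1))) by lia.
    unfold plus; cbn. ring.
Qed.

Lemma is_series_pairs (a : nat -> R) (l : R) :
  is_series a l -> is_series (fun i => a (2 * i)%nat + a (2 * i + 1)%nat) l.
Proof.
  intros h.
  change (is_lim_seq (sum_n (fun i => a (2 * i)%nat + a (2 * i + 1)%nat)) (Finite l)).
  apply (is_lim_seq_ext (fun N => sum_n a (2 * N + 1)%nat)).
  { intros; symmetry; apply sum_n_pairs. }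
  apply (is_lim_seq_subseq (sum_n a)); [|exact h].
  apply eventually_subseq. intros; lia.
Qed.

Lemma Series_pairs (a : nat -> R) : ex_series a ->
  Series a = Series (fun i => a (2 * i)%nat + a (2 * i + 1)%nat).
Proof.
  intros h. symmetry. apply is_series_unique, is_series_pairs, Series_correct, h.
Qed.

Lemma Csum_pairs (a : nat -> C) : Cabs_conv a ->
  Csum a = Csum (fun i => (a (2 * i)%nat + a (2 * i + 1)%nat)%C).
Proof.
  intros h. unfold Csum; f_equal; rewrite Series_pairs;
   try (apply Series_ext; reflexivity); [apply Cabs_conv_Re|apply Cabs_conv_Im]; assumption.
Qed.

Lemma Cmod_pow_lt1 (q : C) (n : nat) : Cmod q < 1 -> Cmod (q ^ S n)%C < 1.
Proof.
  intros h. rewrite Cmod_pow. pose proof (Cmod_ge_0 q).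
  eapply Rle_lt_trans; [apply pow_le_self|]; lra.
Qed.

Lemma one_add_sqr_ge (p : C) : 1 - Cmod p ^ 2 <= Cmod (1 + p ^ 2)%C.
Proof.
  pose proof (Cmod_triangle (1 + p ^ 2) (- p ^ 2)) as H.
  replace (1 + p ^ 2 + - p ^ 2)%C with (RtoC 1) in H by ring.
  rewrite Cmod_1, Cmod_opp, Cmod_pow in H. lra.
Qed.

Lemma one_sub_sqr_ge (p : C) : 1 - Cmod p ^ 2 <= Cmod (1 - p ^ 2)%C.
Proof.
  pose proof (Cmod_triangle (1 - p ^ 2) (p ^ 2)) as H.
  replace (1 - p ^ 2 + p ^ 2)%C with (RtoC 1) in H by ring.
  rewrite Cmod_1, Cmod_pow in H. lra.
Qed.

Lemma Cmod_ek_le (p : C) (r : R) : Cmod p <= r -> r < 1 -> Cmod (ek p) <= / (1 - r) * Cmod p.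
Proof.
  intros hp hr. pose proof (Cmod_ge_0 p) as h0. pose proof (one_sub_sqr_ge p) as h.
  assert (h1 : 1 - r <= Cmod (1 - p ^ 2)%C) by nra.
  unfold ek. rewrite Cmod_div by (apply Cmod_gt_0; lra).
  rewrite Rmult_comm. apply Rmult_le_compat_l; [assumption|].
  apply Rinv_le_contravar; lra.
Qed.

Lemma Cmod_ck_le (p : C) (r : R) : Cmod p <= r -> r < 1 -> Cmod (ck p) <= / (1 - r) * Cmod p.
Proof.
  intros hp hr. pose proof (Cmod_ge_0 p) as h0. pose proof (one_add_sqr_ge p) as h.
  assert (h1 : 1 - r <= Cmod (1 + p ^ 2)%C) by nra.
  unfold ck. rewrite Cmod_div by (apply Cmod_gt_0; lra).
  rewrite Rmult_comm. apply Rmult_le_compat_l; [assumption|].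
  apply Rinv_le_contravar; lra.
Qed.

Lemma Cmod_inv_INR_le (n : nat) : (0 < n)%nat -> Cmod (/ RtoC (INR n))%C <= 1.
Proof.
  intros h. destruct n as [|n]; [lia|].
  rewrite Cmod_inv by apply RtoC_INR_neq0. rewrite Cmod_R.
  pose proof (pos_INR n). rewrite S_INR, Rabs_pos_eq by lra.
  rewrite <- Rinv_1. apply Rinv_le_contravar; lra.
Qed.

Lemma pow_mono_exp (x : R) (m n : nat) : 0 <= x <= 1 -> (m <= n)%nat -> x ^ n <= x ^ m.
Proof.
  intros hx h. replace n with (m + (n - m))%nat by lia. rewrite pow_add.
  pose proof (pow_le_1 x m hx). pose proof (pow_le_1 x (n - m) hx). nra.
Qed.

Lemma ev_term_le (q : C) (i : nat) : Cmod q < 1 ->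
  Cmod (ev_term q i) <= / (1 - Cmod q) * Cmod q ^ S i.
Proof.
  intros h. pose proof (Cmod_ge_0 q) as h0. unfold ev_term. rewrite Cmod_mult.
  assert (h2 : Cmod (q ^ (2 * i + 2))%C <= Cmod q).
  { replace (2 * i + 2)%nat with (S (2 * i + 1)) by lia. rewrite Cmod_pow. apply pow_le_self; lra. }
  pose proof (Cmod_ek_le (q ^ (2 * i + 2))%C (Cmod q) h2 h) as h3.
  pose proof (Cmod_inv_INR_le (2 * i + 2)%nat ltac:(lia)).
  pose proof (Cmod_ge_0 (ek (q ^ (2 * i + 2))%C)).
  pose proof (Cmod_ge_0 (/ RtoC (INR (2 * i + 2)))%C).
  apply Rle_trans with (Cmod (ek (q ^ (2 * i + 2))%C)); [nra|].
  eapply Rle_trans; [exact h3|]. rewrite Cmod_pow.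
  apply Rmult_le_compat_l; [left; apply Rinv_0_lt_compat; lra|].
  apply pow_mono_exp; [lra|lia].
Qed.

Lemma od_term_le (q : C) (i : nat) : Cmod q < 1 ->
  Cmod (od_term q i) <= / (1 - Cmod q) * Cmod q ^ S i.
Proof.
  intros h. pose proof (Cmod_ge_0 q) as h0. unfold od_term. rewrite Cmod_mult.
  assert (h2 : Cmod (q ^ (2 * i + 1))%C <= Cmod q).
  { replace (2 * i + 1)%nat with (S (2 * i)) by lia. rewrite Cmod_pow. apply pow_le_self; lra. }
  pose proof (Cmod_ck_le (q ^ (2 * i + 1))%C (Cmod q) h2 h) as h3.
  pose proof (Cmod_inv_INR_le (2 * i + 1)%nat ltac:(lia)).
  pose proof (Cmod_ge_0 (ck (q ^ (2 * i + 1))%C)).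
  pose proof (Cmod_ge_0 (/ RtoC (INR (2 * i + 1)))%C).
  apply Rle_trans with (Cmod (ck (q ^ (2 * i + 1))%C)); [nra|].
  eapply Rle_trans; [exact h3|]. rewrite Cmod_pow.
  apply Rmult_le_compat_l; [left; apply Rinv_0_lt_compat; lra|].
  apply pow_mono_exp; [lra|lia].
Qed.

Lemma Cabs_conv_ev (q : C) : Cmod q < 1 -> Cabs_conv (ev_term q).
Proof.
  intros h. eapply Cabs_conv_le; [intros; apply ev_term_le; assumption|].
  apply ex_series_scalR, ex_series_geom_S. split; [apply Cmod_ge_0|assumption].
Qed.

Lemma Cabs_conv_od (q : C) : Cmod q < 1 -> Cabs_conv (od_term q).
Proof.
  intros h. eapply Cabs_conv_le; [intros; apply od_term_le; assumption|].
  apply ex_series_scalR, ex_series_geom_S. split; [apply Cmod_ge_0|assumption].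
Qed.

Lemma sqr_lt1_neq (p : C) : Cmod p < 1 -> (1 - p ^ 2)%C <> RtoC 0 /\ (1 + p ^ 2)%C <> RtoC 0.
Proof.
  intros h. pose proof (Cmod_ge_0 p). pose proof (one_sub_sqr_ge p). pose proof (one_add_sqr_ge p).
  split; apply Cmod_gt_0; nra.
Qed.

(** The logarithm of the product is a sum over m of
    [(q^m + (-1)^m q^(3m)) / (m (1 - q^(4m)))]; a factor [1 + q^(2m)] or [1 - q^(2m)] cancels
    according to the parity of m, which separates a part even in q from a part odd in q. *)
Theorem gen_fun_exp (q : C) : Cmod q < 1 ->
  Cinv (qpoch_inf2 q (Copp (Cpow q 3)) (Cpow q 4)) = Cexp (ev_log q + od_log q)%C.
Proof.
  intros h. pose proof (Cmod_ge_0 q) as h0.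
  assert (h3 : Cmod (- q ^ 3)%C < 1) by (rewrite Cmod_opp; apply Cmod_pow_lt1; assumption).
  assert (h4 : Cmod (q ^ 4)%C < 1) by (apply Cmod_pow_lt1; assumption).
  unfold qpoch_inf2. rewrite !qpoch_inf_exp, <- Cexp_plus, <- Cexp_opp by assumption.
  f_equal.
  transitivity (Csum (poch_term q (q ^ 4)) + Csum (poch_term (- q ^ 3) (q ^ 4)))%C; [ring|].
  rewrite <- Csum_plus by (apply Cabs_conv_poch; assumption).
  rewrite Csum_pairs by (apply Cabs_conv_plus; apply Cabs_conv_poch; assumption).
  unfold ev_log, od_log. rewrite <- Csum_plus by (apply Cabs_conv_ev || apply Cabs_conv_od; assumption).
  apply Csum_ext. intros i.
  assert (T : forall n, (poch_term q (q ^ 4) n + poch_term (- q ^ 3) (q ^ 4) n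
     = / RtoC (INR (S n)) * ((q ^ S n + RtoC (-1) ^ S n * (q ^ S n) ^ 3) / (1 - (q ^ S n) ^ 4)))%C).
  { intros n. unfold poch_term, log_term.
    replace (- q ^ 3)%C with (RtoC (-1) * q ^ 3)%C by (rewrite RtoC_m1; ring).
    rewrite Cpow_mult_l, <- !Cpow_mult_r.
    replace (3 * S n)%nat with (S n * 3)%nat by lia.
    replace (4 * S n)%nat with (S n * 4)%nat by lia.
    field. split; [|apply RtoC_INR_neq0].
    rewrite Nat.mul_comm, Cpow_mult_r. apply pow_one_sub_neq0; assumption. }
  rewrite !T.
  replace (S (2 * i + 1)) with (2 * i + 2)%nat by lia.
  replace (S (2 * i)) with (2 * i + 1)%nat by lia.
  unfold ev_term, od_term, ek, ck. rewrite Cplus_comm.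
  assert (hm1 : (RtoC (-1) ^ (2 * i + 2) = 1)%C).
  { replace (2 * i + 2)%nat with (2 * (i + 1))%nat by lia. rewrite Cpow_mult_r.
    replace (RtoC (-1) ^ 2)%C with (RtoC 1) by (rewrite RtoC_m1; ring). apply Cpow_1_l. }
  assert (hm2 : (RtoC (-1) ^ (2 * i + 1) = - (1))%C).
  { rewrite Cpow_add_r, Cpow_mult_r.
    replace (RtoC (-1) ^ 2)%C with (RtoC 1) by (rewrite RtoC_m1; ring).
    rewrite Cpow_1_l, RtoC_m1. ring. }
  rewrite hm1, hm2.
  f_equal.
  - destruct (sqr_lt1_neq (q ^ (2 * i + 2))%C) as [n1 n2].
    { replace (2 * i + 2)%nat with (S (2 * i + 1)) by lia. apply Cmod_pow_lt1; assumption. }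
    set (p := (q ^ (2 * i + 2))%C) in *.
    f_equal. field. split; [exact n1|].
    replace (1 - p ^ 4)%C with ((1 - p ^ 2) * (1 + p ^ 2))%C by ring.
    apply Cmult_neq_0; assumption.
  - destruct (sqr_lt1_neq (q ^ (2 * i + 1))%C) as [n1 n2].
    { replace (2 * i + 1)%nat with (S (2 * i)) by lia. apply Cmod_pow_lt1; assumption. }
    set (p := (q ^ (2 * i + 1))%C) in *.
    f_equal. field. split; [exact n2|].
    replace (1 - p ^ 4)%C with ((1 - p ^ 2) * (1 + p ^ 2))%C by ring.
    apply Cmult_neq_0; assumption.
Qed.

Lemma Cpow_opp_even (q : C) (n : nat) : ((- q) ^ (2 * n) = q ^ (2 * n))%C.
Proof.
  rewrite !Cpow_mult_r. f_equal. ring.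
Qed.

Lemma ev_log_opp (q : C) : ev_log (- q)%C = ev_log q.
Proof.
  apply Csum_ext; intros i. unfold ev_term.
  replace (2 * i + 2)%nat with (2 * (i + 1))%nat by lia. rewrite Cpow_opp_even. reflexivity.
Qed.

Lemma od_log_opp (q : C) : Cmod q < 1 -> od_log (- q)%C = (- od_log q)%C.
Proof.
  intros h. unfold od_log. rewrite <- Csum_opp by (apply Cabs_conv_od; assumption).
  apply Csum_ext; intros i. unfold od_term, ck.
  rewrite !Cpow_add_r, Cpow_opp_even, !Cpow_1_r.
  replace ((q ^ (2 * i) * - q) ^ 2)%C with ((q ^ (2 * i) * q) ^ 2)%C by ring.
  unfold Cdiv. ring.
Qed.

(** * Elementary inequalities for the hyperbolic functions *)

Lemma nonneg_of_deriv (f f' : R -> R) (x : R) :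
  0 <= x -> (forall t, 0 <= t <= x -> is_derive f t (f' t)) ->
  (forall t, 0 <= t <= x -> 0 <= f' t) -> f 0 = 0 -> 0 <= f x.
Proof.
  intros hx hd hp h0.
  destruct (MVT_gen f 0 x f') as (c & hc & e).
  - rewrite Rmin_left, Rmax_right by lra. intros t ht. apply hd; lra.
  - rewrite Rmin_left, Rmax_right by lra. intros t ht.
    apply continuity_pt_filterlim, (ex_derive_continuous f t). exists (f' t). apply hd; lra.
  - rewrite Rmin_left, Rmax_right in hc by lra. rewrite h0 in e.
    specialize (hp c hc). nra.
Qed.

Lemma cosh_ge_1 (x : R) : 1 <= cosh x.
Proof.
  pose proof (cosh_sqr x). assert (0 < cosh x).
  { unfold cosh. pose proof (exp_pos x). pose proof (exp_pos (- x)). lra. }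
  pose proof (pow2_ge_0 (sinh x)). nra.
Qed.

Lemma is_derive_sinh (x : R) : is_derive sinh x (cosh x).
Proof. unfold sinh, cosh. auto_derive; [auto|]. field. Qed.

Lemma sinh_ge (x : R) : 0 <= x -> x <= sinh x.
Proof.
  intros h. cut (0 <= sinh x - x); [lra|].
  apply (nonneg_of_deriv (fun t => sinh t - t) (fun t => cosh t - 1)); [assumption| | |].
  - intros t _. apply (is_derive_minus sinh (fun t => t)); [apply is_derive_sinh|].
    apply (is_derive_id t).
  - intros t _. pose proof (cosh_ge_1 t). lra.
  - rewrite sinh_0. ring.
Qed.

Lemma sinh_pos (x : R) : 0 < x -> 0 < sinh x.
Proof. intros h. pose proof (sinh_ge x). lra. Qed.

Lemma sinh_le_mul_cosh (x : R) : 0 <= x -> sinh x <= x * cosh x.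
Proof.
  intros h. cut (0 <= x * cosh x - sinh x); [lra|].
  apply (nonneg_of_deriv (fun t => t * cosh t - sinh t) (fun t => t * sinh t)); [assumption| | |].
  - intros t _. unfold sinh, cosh. auto_derive; [auto|]. field.
  - intros t ht. pose proof (sinh_ge t). nra.
  - rewrite sinh_0. ring.
Qed.

Lemma cosh_minus_1 (x : R) : cosh x - 1 = 2 * sinh (x / 2) ^ 2.
Proof.
  unfold cosh, sinh.
  replace x with (x / 2 + x / 2) at 1 by field.
  replace (- x) with (- (x / 2) + - (x / 2)) at 1 by field.
  rewrite !exp_plus.
  assert (H : exp (x / 2) * exp (- (x / 2)) = 1)
    by (rewrite <- exp_plus, Rplus_opp_r; apply exp_0).
  transitivity ((exp (x / 2) * exp (x / 2) + exp (- (x / 2)) * exp (- (x / 2))) / 2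
     - exp (x / 2) * exp (- (x / 2))); [rewrite H; ring|field].
Qed.

Lemma cosh_mono (x y : R) : 0 <= x <= y -> cosh x <= cosh y.
Proof.
  intros h. assert (sinh x <= sinh y).
  { destruct (proj2 h) as [h1|h1]; [left; apply sinh_lt; assumption|rewrite h1; lra]. }
  pose proof (cosh_sqr x). pose proof (cosh_sqr y).
  pose proof (cosh_ge_1 x). pose proof (cosh_ge_1 y). pose proof (sinh_ge x). nra.
Qed.

Lemma cosh_1_le : cosh 1 <= 2.
Proof.
  unfold cosh. pose proof exp_le_3. rewrite exp_Ropp.
  assert (/ exp 1 <= / 1).
  { apply Rinv_le_contravar; [lra|]. pose proof (exp_ineq1_le 1). lra. }
  lra.
Qed.

Lemma cosh_sub1_le (x : R) : 0 <= x <= 1 -> cosh x - 1 <= 2 * x ^ 2.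
Proof.
  intros h. rewrite cosh_minus_1.
  pose proof (sinh_le_mul_cosh (x / 2)). pose proof (cosh_mono (x / 2) 1).
  pose proof cosh_1_le. pose proof (sinh_ge (x / 2)).
  assert (sinh (x / 2) <= x) by nra. nra.
Qed.

Lemma cosh_ge_self (x : R) : x <= cosh x.
Proof.
  destruct (Rle_dec 0 x) as [h|h].
  - pose proof (sinh_ge x h). pose proof (cosh_sqr x). pose proof (cosh_ge_1 x). nra.
  - pose proof (cosh_ge_1 x). lra.
Qed.

Lemma mul_cos_le_sin (b : R) : 0 <= b <= 1 -> b * cos b <= sin b.
Proof.
  intros h. cut (0 <= sin b - b * cos b); [lra|].
  apply (nonneg_of_deriv (fun t => sin t - t * cos t) (fun t => t * sin t)); [lra| | |].
  - intros t _. auto_derive; [auto|]. ring.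
  - intros t ht. apply Rmult_le_pos; [lra|]. apply sin_ge_0; [lra|]. pose proof PI2_1. lra.
  - rewrite sin_0, cos_0. ring.
Qed.

Lemma cos_ge_half (b : R) : Rabs b <= 1 -> 1 / 2 <= cos b.
Proof.
  intros h. pose proof (one_sub_cos_le b). rewrite <- (pow2_abs b) in H.
  pose proof (Rabs_pos b). nra.
Qed.

Lemma Rabs_sin_ge (b : R) : Rabs b <= 1 -> Rabs b * cos b <= Rabs (sin b).
Proof.
  intros h. destruct (Rle_dec 0 b) as [hb|hb].
  - rewrite (Rabs_pos_eq b) in * by assumption.
    eapply Rle_trans; [apply mul_cos_le_sin; lra|apply Rle_abs].
  - rewrite (Rabs_left b) in * by lra.
    rewrite <- cos_neg, <- Rabs_Ropp, <- sin_neg.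
    eapply Rle_trans; [apply mul_cos_le_sin; lra|apply Rle_abs].
Qed.

Lemma sin_sub_le (b : R) : Rabs b <= 1 -> Rabs (sin b - b) <= Rabs b * b ^ 2 / 2.
Proof.
  assert (P : forall b, 0 <= b <= 1 -> Rabs (sin b - b) <= b * b ^ 2 / 2).
  { intros c hc. pose proof (mul_cos_le_sin c hc). pose proof (one_sub_cos_le c).
    pose proof (Rabs_sin_le c) as h. rewrite (Rabs_pos_eq c) in h by lra.
    pose proof (Rle_abs (sin c)). rewrite Rabs_left1 by lra. nra. }
  intros h. destruct (Rle_dec 0 b) as [hb|hb].
  - rewrite (Rabs_pos_eq b) in * by assumption. apply P; lra.
  - rewrite (Rabs_left b) in * by lra.
    specialize (P (- b) ltac:(lra)). rewrite sin_neg in P.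
    rewrite <- Rabs_Ropp. replace (- (sin b - b)) with (- sin b - - b) by ring.
    eapply Rle_trans; [exact P|]. right; field.
Qed.

Lemma Cmod_le_add (z : C) : Cmod z <= Rabs (Re z) + Rabs (Im z).
Proof.
  pose proof (Rabs_pos (Re z)). pose proof (Rabs_pos (Im z)).
  apply Cmod_le_of_sqr; [lra|]. rewrite Cmod_sqr.
  rewrite <- (pow2_abs (Re z)), <- (pow2_abs (Im z)). nra.
Qed.

Lemma Csh_ge_sinh (y : C) : 0 <= Re y -> sinh (Re y) <= Cmod (Csh y).
Proof.
  intros h. pose proof (sinh_ge _ h). apply Cmod_ge_of_sqr; [lra|].
  rewrite Cmod_Csh_sqr. pose proof (pow2_ge_0 (sin (Im y))). lra.
Qed.

Lemma Cch_ge_sinh (y : C) : 0 <= Re y -> sinh (Re y) <= Cmod (Cch y).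
Proof.
  intros h. pose proof (sinh_ge _ h). apply Cmod_ge_of_sqr; [lra|].
  rewrite Cmod_Cch_sqr. pose proof (pow2_ge_0 (cos (Im y))). lra.
Qed.

Lemma Csh_ge_sin (y : C) : Rabs (sin (Im y)) <= Cmod (Csh y).
Proof.
  apply Cmod_ge_of_sqr; [apply Rabs_pos|].
  rewrite Cmod_Csh_sqr, pow2_abs. pose proof (pow2_ge_0 (sinh (Re y))). lra.
Qed.

Lemma Cch_ge_cos (y : C) : Rabs (cos (Im y)) <= Cmod (Cch y).
Proof.
  apply Cmod_ge_of_sqr; [apply Rabs_pos|].
  rewrite Cmod_Cch_sqr, pow2_abs. pose proof (pow2_ge_0 (sinh (Re y))). lra.
Qed.

Lemma Csh_neq0 (y : C) : 0 < Re y -> Csh y <> RtoC 0.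
Proof.
  intros h. apply Cmod_gt_0. pose proof (Csh_ge_sinh y). pose proof (sinh_pos _ h). lra.
Qed.

Lemma Cch_neq0 (y : C) : 0 < Re y -> Cch y <> RtoC 0.
Proof.
  intros h. apply Cmod_gt_0. pose proof (Cch_ge_sinh y). pose proof (sinh_pos _ h). lra.
Qed.

Lemma Cmod_inv_le (y : C) (b : R) : 0 < b -> b <= Cmod y -> Cmod (/ y)%C <= / b.
Proof.
  intros hb h. rewrite Cmod_inv by (apply Cmod_gt_0; lra). apply Rinv_le_contravar; assumption.
Qed.

Lemma Cinv_Csh_le (y : C) : 0 < Re y -> Cmod (/ Csh y)%C <= / sinh (Re y).
Proof.
  intros h. apply Cmod_inv_le; [apply sinh_pos; assumption|apply Csh_ge_sinh; lra].
Qed.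

Lemma Cinv_Cch_le_inv (y : C) : 0 < Re y -> Cmod (/ Cch y)%C <= / Re y.
Proof.
  intros h. apply Cmod_inv_le; [assumption|].
  pose proof (sinh_ge (Re y)). pose proof (Cch_ge_sinh y). lra.
Qed.

(** In the sector [|b| <= x/2] the modulus of cosh is comparable with its real value. *)
Lemma Cch_ge_sector (y : C) : 0 <= Re y -> Rabs (Im y) <= Re y / 2 ->
  4 / 5 * cosh (Re y) <= Cmod (Cch y).
Proof.
  intros h hb. pose proof (cosh_ge_1 (Re y)). pose proof (cosh_ge_self (Re y)).
  apply Cmod_ge_of_sqr; [lra|].
  rewrite Cmod_Cch_sqr, cos_sqr. pose proof (cosh_sqr (Re y)).
  pose proof (sin_sqr_le (Im y)). rewrite <- (pow2_abs (Im y)) in H2.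
  pose proof (Rabs_pos (Im y)). nra.
Qed.

(** The function [1/sinh - 1/id] is regular at 0. An explicit bound allows finitely many terms of
    the logarithms to be replaced by their poles, at a cost that is negligible against [1/s]. *)
Lemma Cinv_Csh_sub_inv_le (y : C) : 0 < Re y <= 1 -> Rabs (Im y) <= 1 ->
  Cmod (/ Csh y - / y)%C <= 20.
Proof.
  intros hx hb.
  set (x := Re y) in *. set (b := Im y) in *.
  assert (hy : 0 < Cmod y).
  { eapply Rlt_le_trans; [|apply re_le_Cmod]. rewrite Rabs_pos_eq; fold x; lra. }
  assert (hxy : x <= Cmod y) by (eapply Rle_trans; [|apply re_le_Cmod]; apply Rle_abs).
  assert (hby : Rabs b <= Cmod y) by apply im_le_Cmod.
  assert (hy2 : Cmod y <= 2).
  { eapply Rle_trans; [apply Cmod_le_add|]. fold x b. rewrite Rabs_pos_eq; lra. }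
  assert (hsq : Cmod y ^ 2 = x ^ 2 + Rabs b ^ 2) by (rewrite pow2_abs; apply Cmod_sqr).
  assert (h1 : Cmod y / 2 <= Cmod (Csh y)).
  { apply Cmod_ge_of_sqr; [lra|]. rewrite Cmod_Csh_sqr. fold x b.
    pose proof (sinh_ge x). pose proof (Rabs_sin_ge b hb). pose proof (cos_ge_half b hb).
    rewrite <- (pow2_abs (sin b)). pose proof (Rabs_pos b).
    assert (Rabs b / 2 <= Rabs (sin b)) by nra. nra. }
  assert (h2 : Cmod (Csh y - y)%C <= 5 * Cmod y * Cmod y ^ 2).
  { eapply Rle_trans; [apply Cmod_le_add|].
    unfold Csh; autorewrite with cplx. fold x b.
    pose proof (one_sub_cos_le b) as hc. pose proof (COS_bound b).
    pose proof (cosh_sub1_le x ltac:(lra)) as hch.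
    pose proof (sinh_le_mul_cosh x ltac:(lra)). pose proof (sinh_ge x ltac:(lra)).
    pose proof (sin_sub_le b hb) as hs. pose proof (Rabs_sin_le b) as hs'.
    pose proof (cosh_ge_1 x).
    assert (e1 : Rabs (sinh x * cos b - x) <= 2 * x * x ^ 2 + x * Rabs b ^ 2 / 2).
    { replace (sinh x * cos b - x) with ((sinh x - x) * cos b + - (x * (1 - cos b))) by ring.
      eapply Rle_trans; [apply Rabs_triang|]. rewrite Rabs_Ropp, !Rabs_mult.
      rewrite (Rabs_pos_eq (sinh x - x)), (Rabs_pos_eq x), (Rabs_pos_eq (1 - cos b)) by lra.
      assert (Rabs (cos b) <= 1) by (apply Rabs_le; lra).
      rewrite pow2_abs.
      apply Rplus_le_compat.
      - apply Rle_trans with (sinh x - x); [|nra]. rewrite <- (Rmult_1_r (sinh x - x)) at 2.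
        apply Rmult_le_compat_l; lra.
      - nra. }
    assert (e2 : Rabs (cosh x * sin b - b) <= 2 * x ^ 2 * Rabs b + Rabs b * Rabs b ^ 2 / 2).
    { replace (cosh x * sin b - b) with ((cosh x - 1) * sin b + (sin b - b)) by ring.
      eapply Rle_trans; [apply Rabs_triang|]. rewrite Rabs_mult, (Rabs_pos_eq (cosh x - 1)) by lra.
      rewrite pow2_abs. apply Rplus_le_compat; [|exact hs].
      apply Rmult_le_compat; [lra|apply Rabs_pos|lra|assumption]. }
    pose proof (Rabs_pos b).
    rewrite hsq.
    set (c := Rabs b) in *. set (r := Cmod y) in *.
    apply Rle_trans with (5 / 2 * x * (x ^ 2 + c ^ 2) + 5 / 2 * c * (x ^ 2 + c ^ 2)); [nra|].
    assert (0 <= x ^ 2 + c ^ 2) by nra. nra. }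
  replace (/ Csh y - / y)%C with (- (Csh y - y) / (Csh y * y))%C.
  2:{ field. split; apply Cmod_gt_0; lra. }
  rewrite Cmod_div by (apply Cmult_neq_0; apply Cmod_gt_0; lra).
  rewrite Cmod_opp, Cmod_mult.
  apply Rmult_le_reg_r with (Cmod (Csh y) * Cmod y); [nra|].
  unfold Rdiv. rewrite Rmult_assoc, Rinv_l, Rmult_1_r by nra.
  eapply Rle_trans; [exact h2|]. nra.
Qed.

(** * The two logarithms as functions of [z = - log q] *)

Definition evT (z : C) (i : nat) : C :=
  (RtoC (/ (4 * INR (S i))) * / Csh (RtoC (2 * INR (S i)) * z))%C.
Definition odT (z : C) (i : nat) : C :=
  (RtoC (/ (2 * (2 * INR i + 1))) * / Cch (RtoC (2 * INR i + 1) * z))%C.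
Definition evz (z : C) : C := Csum (evT z).
Definition odz (z : C) : C := Csum (odT z).

Lemma ek_Cexp (y : C) : 0 < Re y -> ek (Cexp (- y)) = (/ RtoC 2 * / Csh y)%C.
Proof.
  intros h. pose proof (Csh_neq0 y h) as hs. pose proof (Cexp_neq0 y) as he.
  unfold ek. rewrite sinh_Cexp in *. rewrite Cexp_opp in *.
  set (E := Cexp y) in *.
  assert (h2 : (E ^ 2 - 1)%C <> RtoC 0).
  { intros e. apply hs. replace ((E - / E) / 2)%C with ((E ^ 2 - 1) / (2 * E))%C by (field; exact he).
    rewrite e. unfold Cdiv. ring. }
  field. repeat split; try assumption.
  replace (E * E - 1)%C with (E ^ 2 - 1)%C by ring. exact h2.
Qed.

Lemma ck_Cexp (y : C) : 0 < Re y -> ck (Cexp (- y)) = (/ RtoC 2 * / Cch y)%C.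
Proof.
  intros h. pose proof (Cch_neq0 y h) as hs. pose proof (Cexp_neq0 y) as he.
  unfold ck. rewrite cosh_Cexp in *. rewrite Cexp_opp in *.
  set (E := Cexp y) in *.
  assert (h2 : (E ^ 2 + 1)%C <> RtoC 0).
  { intros e. apply hs. replace ((E + / E) / 2)%C with ((E ^ 2 + 1) / (2 * E))%C by (field; exact he).
    rewrite e. unfold Cdiv. ring. }
  field. repeat split; try assumption.
  replace (E * E + 1)%C with (E ^ 2 + 1)%C by ring. exact h2.
Qed.

Lemma Cexp_neg_pow (z : C) (n : nat) : (Cexp (- z) ^ n = Cexp (- (RtoC (INR n) * z)))%C.
Proof. rewrite Cexp_pow. f_equal. ring. Qed.

Lemma ev_term_evT (z : C) (i : nat) : 0 < Re z -> ev_term (Cexp (- z)) i = evT z i.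
Proof.
  intros h. unfold ev_term, evT. pose proof (pos_INR i).
  assert (e : INR (2 * i + 2) = 2 * INR (S i)).
  { rewrite plus_INR, mult_INR, (S_INR i). cbn [INR]. ring. }
  assert (hp : 0 < INR (2 * i + 2)) by (apply lt_0_INR; lia).
  rewrite Cexp_neg_pow, ek_Cexp.
  2:{ rewrite Re_scal. apply Rmult_lt_0_compat; assumption. }
  rewrite Cmult_assoc, e in *. f_equal.
  rewrite <- !RtoC_inv by lra. rewrite <- RtoC_mult. f_equal. field. lra.
Qed.

Lemma od_term_odT (z : C) (i : nat) : 0 < Re z -> od_term (Cexp (- z)) i = odT z i.
Proof.
  intros h. unfold od_term, odT. pose proof (pos_INR i).
  assert (e : INR (2 * i + 1) = 2 * INR i + 1).
  { rewrite plus_INR, mult_INR. cbn [INR]. ring. }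
  assert (hp : 0 < INR (2 * i + 1)) by (apply lt_0_INR; lia).
  rewrite Cexp_neg_pow, ck_Cexp.
  2:{ rewrite Re_scal. apply Rmult_lt_0_compat; assumption. }
  rewrite Cmult_assoc, e in *. f_equal.
  rewrite <- !RtoC_inv by lra. rewrite <- RtoC_mult. f_equal. field. lra.
Qed.

Lemma Cmod_Cexp_neg (z : C) : 0 < Re z -> Cmod (Cexp (- z)) < 1.
Proof.
  intros h. rewrite Cmod_Cexp, Re_opp, <- exp_0. apply exp_increasing. lra.
Qed.

Lemma ev_log_evz (z : C) : 0 < Re z -> ev_log (Cexp (- z)) = evz z.
Proof. intros h. apply Csum_ext; intros; apply ev_term_evT; assumption. Qed.

Lemma od_log_odz (z : C) : 0 < Re z -> od_log (Cexp (- z)) = odz z.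
Proof. intros h. apply Csum_ext; intros; apply od_term_odT; assumption. Qed.

Lemma Cabs_conv_evT (z : C) : 0 < Re z -> Cabs_conv (evT z).
Proof.
  intros h. eapply ex_series_ext; [|apply (Cabs_conv_ev (Cexp (- z)))].
  - intros n; cbv beta. rewrite ev_term_evT by assumption. reflexivity.
  - apply Cmod_Cexp_neg; assumption.
Qed.

Lemma Cabs_conv_odT (z : C) : 0 < Re z -> Cabs_conv (odT z).
Proof.
  intros h. eapply ex_series_ext; [|apply (Cabs_conv_od (Cexp (- z)))].
  - intros n; cbv beta. rewrite od_term_odT by assumption. reflexivity.
  - apply Cmod_Cexp_neg; assumption.
Qed.

Lemma INR_S_pos (i : nat) : 0 < INR (S i).
Proof. apply lt_0_INR; lia. Qed.

Lemma INR_odd_pos (i : nat) : 0 < 2 * INR i + 1.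
Proof. pose proof (pos_INR i); lra. Qed.

Lemma evT_le_real (z : C) (i : nat) : 0 < Re z ->
  Cmod (evT z i) <= / (4 * INR (S i)) * / sinh (2 * INR (S i) * Re z).
Proof.
  intros h. pose proof (INR_S_pos i). unfold evT.
  rewrite Cmod_mult, Cmod_R, Rabs_pos_eq by (left; apply Rinv_0_lt_compat; lra).
  apply Rmult_le_compat_l; [left; apply Rinv_0_lt_compat; lra|].
  rewrite <- Re_scal. apply Cinv_Csh_le. rewrite Re_scal. nra.
Qed.

Lemma evT_le (z : C) (i : nat) : 0 < Re z ->
  Cmod (evT z i) <= / (8 * Re z) * / INR (S i) ^ 2.
Proof.
  intros h. pose proof (INR_S_pos i). eapply Rle_trans; [apply evT_le_real; assumption|].
  assert (0 < 2 * INR (S i) * Re z) by nra.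
  apply Rle_trans with (/ (4 * INR (S i)) * / (2 * INR (S i) * Re z)).
  - apply Rmult_le_compat_l; [left; apply Rinv_0_lt_compat; lra|].
    apply Rinv_le_contravar; [assumption|apply sinh_ge; lra].
  - right. field. lra.
Qed.

Lemma odT_le (z : C) (i : nat) : 0 < Re z ->
  Cmod (odT z i) <= / (2 * Re z) * / (2 * INR i + 1) ^ 2.
Proof.
  intros h. pose proof (INR_odd_pos i). unfold odT.
  rewrite Cmod_mult, Cmod_R, Rabs_pos_eq by (left; apply Rinv_0_lt_compat; lra).
  apply Rle_trans with (/ (2 * (2 * INR i + 1)) * / ((2 * INR i + 1) * Re z)).
  - apply Rmult_le_compat_l; [left; apply Rinv_0_lt_compat; lra|].
    rewrite <- Re_scal. apply Cinv_Cch_le_inv. rewrite Re_scal. nra.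
  - right. field. lra.
Qed.

Lemma evT_real (s : R) (i : nat) : 0 < s ->
  evT (RtoC s) i = RtoC (/ (4 * INR (S i)) * / sinh (2 * INR (S i) * s)).
Proof.
  intros h. pose proof (INR_S_pos i). unfold evT. rewrite <- RtoC_mult.
  replace (Csh (RtoC (2 * INR (S i) * s))) with (RtoC (sinh (2 * INR (S i) * s))).
  - rewrite <- RtoC_inv, <- RtoC_mult; [reflexivity|].
    assert (0 < 2 * INR (S i) * s) by nra. pose proof (sinh_pos _ H0). lra.
  - apply C_ext; unfold Csh; autorewrite with cplx; rewrite ?cos_0, ?sin_0; ring.
Qed.

Lemma odT_real (s : R) (i : nat) : 0 < s ->
  odT (RtoC s) i = RtoC (/ (2 * (2 * INR i + 1)) * / cosh ((2 * INR i + 1) * s)).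
Proof.
  intros h. pose proof (INR_odd_pos i). unfold odT. rewrite <- RtoC_mult.
  replace (Cch (RtoC ((2 * INR i + 1) * s))) with (RtoC (cosh ((2 * INR i + 1) * s))).
  - rewrite <- RtoC_inv, <- RtoC_mult; [reflexivity|].
    pose proof (cosh_ge_1 ((2 * INR i + 1) * s)). lra.
  - apply C_ext; unfold Cch; autorewrite with cplx; rewrite ?cos_0, ?sin_0; ring.
Qed.

(** * Comparison of the logarithms on the ray and on the real axis *)

Lemma inv_cosh_le (x : R) : / cosh x <= 2 * exp (- x).
Proof.
  pose proof (exp_pos x). pose proof (exp_pos (- x)). unfold cosh.
  apply Rmult_le_reg_l with ((exp x + exp (- x)) / 2); [lra|].
  rewrite Rinv_r by lra.
  assert (exp x * exp (- x) = 1) by (rewrite <- exp_plus, Rplus_opp_r; apply exp_0). nra.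
Qed.

(** Half of [cosh b - cosh a] is a product of two values of sinh, at the half sum and at the
    half difference; the latter is purely imaginary when the real parts agree. *)
Lemma Cch_sub (a b : C) :
  (Cch a - Cch b = 2 * (Csh ((a + b) / 2) * Csh ((a - b) / 2)))%C.
Proof.
  rewrite !sinh_Cexp, !cosh_Cexp, !Cexp_opp.
  assert (ea : Cexp a = (Cexp ((a + b) / 2) * Cexp ((a - b) / 2))%C).
  { rewrite <- Cexp_plus. f_equal. field. }
  assert (eb : Cexp b = (Cexp ((a + b) / 2) * / Cexp ((a - b) / 2))%C).
  { rewrite <- Cexp_opp, <- Cexp_plus. f_equal. field. }
  rewrite ea, eb. clear ea eb.
  pose proof (Cexp_neq0 ((a + b) / 2)) as hu. pose proof (Cexp_neq0 ((a - b) / 2)) as hv.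
  set (u := Cexp ((a + b) / 2)) in *. set (v := Cexp ((a - b) / 2)) in *.
  field. split; assumption.
Qed.

Lemma RtoC_half : (/ RtoC 2)%C = RtoC (/ 2).
Proof. rewrite RtoC_inv; [reflexivity|lra]. Qed.

Lemma Re_half (a : C) : Re (a / 2)%C = Re a / 2.
Proof. unfold Cdiv. rewrite RtoC_half, Cmult_comm, Re_scal. field. Qed.

Lemma Im_half (a : C) : Im (a / 2)%C = Im a / 2.
Proof. unfold Cdiv. rewrite RtoC_half, Cmult_comm, Im_scal. field. Qed.

Lemma Cch_RtoC (x : R) : Cch (RtoC x) = RtoC (cosh x).
Proof. apply C_ext; unfold Cch; autorewrite with cplx; rewrite ?cos_0, ?sin_0; ring. Qed.

Lemma Csh_RtoC (x : R) : Csh (RtoC x) = RtoC (sinh x).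
Proof. apply C_ext; unfold Csh; autorewrite with cplx; rewrite ?cos_0, ?sin_0; ring. Qed.

Lemma Cch_sub_real_le (y : C) :
  Cmod (Cch (RtoC (Re y)) - Cch y)%C <= Rabs (Im y) * cosh (Re y).
Proof.
  rewrite Cch_sub, !Cmod_mult, Cmod_R, (Rabs_pos_eq 2) by lra.
  pose proof (cosh_ge_1 (Re y)).
  assert (h1 : Cmod (Csh ((RtoC (Re y) + y) / 2)) <= cosh (Re y)).
  { apply Cmod_le_of_sqr; [lra|]. rewrite Cmod_Csh_sqr, Re_half, Im_half.
    autorewrite with cplx. replace ((Re y + Re y) / 2) with (Re y) by field.
    rewrite cosh_sqr. pose proof (SIN_bound ((0 + Im y) / 2)). nra. }
  assert (h2 : Cmod (Csh ((RtoC (Re y) - y) / 2)) <= Rabs (Im y) / 2).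
  { pose proof (Rabs_pos (Im y)). apply Cmod_le_of_sqr; [lra|].
    rewrite Cmod_Csh_sqr, Re_half, Im_half. autorewrite with cplx.
    replace ((Re y - Re y) / 2) with 0 by field. rewrite sinh_0.
    pose proof (sin_sqr_le ((0 - Im y) / 2)).
    pose proof (pow2_abs (Im y)). nra. }
  pose proof (Cmod_ge_0 (Csh ((RtoC (Re y) + y) / 2))).
  pose proof (Cmod_ge_0 (Csh ((RtoC (Re y) - y) / 2))).
  nra.
Qed.

Lemma Cinv_Cch_sub_le (y : C) : 0 < Re y -> Rabs (Im y) <= Re y / 2 ->
  Cmod (/ Cch y - / Cch (RtoC (Re y)))%C <= 5 / 4 * (Rabs (Im y) * / cosh (Re y)).
Proof.
  intros h hb. pose proof (Cch_ge_sector y ltac:(lra) hb) as h1.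
  pose proof (cosh_ge_1 (Re y)). pose proof (Cch_sub_real_le y) as h2.
  replace (/ Cch y - / Cch (RtoC (Re y)))%C
    with ((Cch (RtoC (Re y)) - Cch y) / (Cch y * Cch (RtoC (Re y))))%C.
  2:{ field. split; apply Cch_neq0; [exact h|assumption]. }
  rewrite Cmod_div by (apply Cmult_neq_0; apply Cch_neq0; [|rewrite Re_RtoC]; assumption).
  rewrite Cmod_mult, (Cch_RtoC (Re y)), Cmod_R, (Rabs_pos_eq (cosh _)) in * by lra.
  set (c := cosh (Re y)) in *. pose proof (Rabs_pos (Im y)).
  apply Rmult_le_reg_r with (Cmod (Cch y) * c); [nra|].
  unfold Rdiv at 1. rewrite Rmult_assoc, Rinv_l, Rmult_1_r by nra.
  eapply Rle_trans; [exact h2|].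
  replace (5 / 4 * (Rabs (Im y) * / c) * (Cmod (Cch y) * c))
    with (5 / 4 * Rabs (Im y) * Cmod (Cch y)) by (field; lra).
  nra.
Qed.

(** [tau y = tanh (y/2) / cosh y] measures the failure of [1 / sinh] to be homogeneous:
    [tau y = 1 / sinh y - 2 / sinh (2 y)]. *)
Definition Cth2 (y : C) : C := (Csh (y / 2) / Cch (y / 2))%C.
Definition Ctau (y : C) : C := (Cth2 y * / Cch y)%C.

Lemma Cexp_half_sqr (y : C) : Cexp y = (Cexp (y / 2) * Cexp (y / 2))%C.
Proof. rewrite <- Cexp_plus. f_equal. field. Qed.

Lemma Ctau_eq (y : C) : 0 < Re y -> Ctau y = (/ Csh y - 2 * / Csh (2 * y))%C.
Proof.
  intros h. unfold Ctau, Cth2.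
  assert (h0 : 0 < Re (y / 2)%C) by (rewrite Re_half; lra).
  assert (h2 : 0 < Re (2 * y)%C) by (rewrite Re_scal; lra).
  pose proof (Csh_neq0 _ h0) as n1. pose proof (Cch_neq0 _ h0) as n2.
  pose proof (Csh_neq0 _ h) as n3. pose proof (Cch_neq0 _ h) as n4.
  assert (e1 : Csh (2 * y) = (2 * (Csh y * Cch y))%C).
  { rewrite !sinh_Cexp, cosh_Cexp, !Cexp_opp.
    replace (2 * y)%C with (y + y)%C by ring. rewrite Cexp_plus. field. apply Cexp_neq0. }
  assert (e2 : Csh y = (2 * (Csh (y / 2) * Cch (y / 2)))%C).
  { rewrite !sinh_Cexp, cosh_Cexp, !Cexp_opp, (Cexp_half_sqr y). field. apply Cexp_neq0. }
  assert (e3 : Cch y = (1 + 2 * (Csh (y / 2) * Csh (y / 2)))%C).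
  { rewrite !sinh_Cexp, cosh_Cexp, !Cexp_opp, (Cexp_half_sqr y). field. apply Cexp_neq0. }
  rewrite e1.
  transitivity ((Cch y - 1) / (Csh y * Cch y))%C.
  - rewrite e3 at 2. rewrite e2. field.
    repeat split; try assumption.
  - field. repeat split; try assumption.
Qed.

Lemma Cth2_sub_le (y : C) : 0 < Re y -> Rabs (Im y) <= Re y / 2 ->
  Cmod (Cth2 y - Cth2 (RtoC (Re y)))%C <= 5 / 8 * Rabs (Im y).
Proof.
  intros h hb. unfold Cth2.
  set (a := (y / 2)%C). set (b := (RtoC (Re y) / 2)%C).
  assert (ra : Re a = Re y / 2) by (unfold a; apply Re_half).
  assert (rb : b = RtoC (Re y / 2)).
  { unfold b. apply C_ext; rewrite ?Re_half, ?Im_half; autorewrite with cplx; field. }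
  assert (ia : Im a = Im y / 2) by (unfold a; apply Im_half).
  assert (n1 : Cch a <> RtoC 0) by (apply Cch_neq0; lra).
  assert (n2 : Cch b <> RtoC 0) by (apply Cch_neq0; rewrite rb, Re_RtoC; lra).
  replace (Csh a / Cch a - Csh b / Cch b)%C with (Csh (a - b) / (Cch a * Cch b))%C.
  2:{ transitivity ((Csh a * Cch b - Csh b * Cch a) / (Cch a * Cch b))%C; [|field; split; assumption].
      f_equal. rewrite !sinh_Cexp, !cosh_Cexp, !Cexp_opp.
      replace (a - b)%C with (a + - b)%C by ring. rewrite Cexp_plus, Cexp_opp.
      field. split; apply Cexp_neq0. }
  rewrite Cmod_div by (apply Cmult_neq_0; assumption). rewrite Cmod_mult.
  assert (h1 : 4 / 5 <= Cmod (Cch a)).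
  { pose proof (Cch_ge_sector a) as H. pose proof (cosh_ge_1 (Re a)).
    rewrite ra, ia in *.
    assert (Rabs (Im y / 2) <= Re y / 2 / 2).
    { unfold Rdiv at 1. rewrite Rabs_mult, (Rabs_pos_eq (/ 2)) by lra. lra. }
    specialize (H ltac:(lra) H1). lra. }
  assert (h2 : 1 <= Cmod (Cch b)).
  { rewrite rb, Cch_RtoC, Cmod_R. pose proof (cosh_ge_1 (Re y / 2)). rewrite Rabs_pos_eq; lra. }
  assert (h3 : Cmod (Csh (a - b)) <= Rabs (Im y) / 2).
  { pose proof (Rabs_pos (Im y)). apply Cmod_le_of_sqr; [lra|].
    rewrite Cmod_Csh_sqr, Re_minus, Im_minus, ra, ia, rb, Re_RtoC, Im_RtoC.
    replace (Re y / 2 - Re y / 2) with 0 by ring. rewrite sinh_0.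
    pose proof (sin_sqr_le (Im y / 2 - 0)). pose proof (pow2_abs (Im y)). nra. }
  pose proof (Cmod_ge_0 (Csh (a - b))).
  apply Rmult_le_reg_r with (Cmod (Cch a) * Cmod (Cch b)); [nra|].
  unfold Rdiv at 1. rewrite Rmult_assoc, Rinv_l, Rmult_1_r by nra.
  assert (4 / 5 <= Cmod (Cch a) * Cmod (Cch b)) by nra.
  pose proof (Rabs_pos (Im y)). nra.
Qed.

Lemma Ctau_sub_le (y : C) : 0 < Re y -> Rabs (Im y) <= Re y / 2 ->
  Cmod (Ctau y - Ctau (RtoC (Re y)))%C <= 41 / 20 * (Rabs (Im y) * / cosh (Re y)).
Proof.
  intros h hb. unfold Ctau. set (x := RtoC (Re y)).
  replace (Cth2 y * / Cch y - Cth2 x * / Cch x)%C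
    with ((Cth2 y - Cth2 x) * / Cch y + Cth2 x * (/ Cch y - / Cch x))%C by ring.
  eapply Rle_trans; [apply Cmod_triangle|]. rewrite !Cmod_mult.
  pose proof (Cth2_sub_le y h hb) as h1. fold x in h1.
  pose proof (Cinv_Cch_sub_le y h hb) as h2. fold x in h2.
  pose proof (cosh_ge_1 (Re y)) as hc.
  assert (h3 : Cmod (/ Cch y)%C <= 5 / 4 * / cosh (Re y)).
  { replace (5 / 4 * / cosh (Re y)) with (/ (4 / 5 * cosh (Re y))) by (field; lra).
    apply Cmod_inv_le; [lra|]. apply Cch_ge_sector; lra. }
  assert (h4 : Cmod (Cth2 x) <= 1).
  { unfold Cth2, x.
    replace (RtoC (Re y) / 2)%C with (RtoC (Re y / 2))
      by (apply C_ext; rewrite ?Re_half, ?Im_half; autorewrite with cplx; field).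
    rewrite Csh_RtoC, Cch_RtoC. pose proof (cosh_ge_1 (Re y / 2)).
    rewrite Cmod_div by (intros e; apply RtoC_inj in e; lra).
    pose proof (sinh_ge (Re y / 2)). pose proof (cosh_sqr (Re y / 2)).
    rewrite !Cmod_R, !Rabs_pos_eq by lra.
    apply Rmult_le_reg_r with (cosh (Re y / 2)); [lra|].
    unfold Rdiv at 1. rewrite Rmult_assoc, Rinv_l by lra. nra. }
  pose proof (Rabs_pos (Im y)). pose proof (Cmod_ge_0 (Cth2 x)).
  pose proof (Cmod_ge_0 (Cth2 y - Cth2 x)%C). pose proof (Cmod_ge_0 (/ Cch y)%C).
  pose proof (Cmod_ge_0 (/ Cch y - / Cch x)%C).
  assert (hi : 0 < / cosh (Re y)) by (apply Rinv_0_lt_compat; lra).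
  apply Rle_trans with (5 / 8 * Rabs (Im y) * (5 / 4 * / cosh (Re y))
     + 1 * (5 / 4 * (Rabs (Im y) * / cosh (Re y)))).
  - apply Rplus_le_compat; apply Rmult_le_compat; assumption.
  - assert (0 <= Rabs (Im y) * / cosh (Re y)) by (apply Rmult_le_pos; lra). lra.
Qed.

Lemma Series_nonneg (a : nat -> R) : (forall n, 0 <= a n) -> ex_series a -> 0 <= Series a.
Proof.
  intros h ha. replace 0 with (Series (fun n => 0 * a n)) by (rewrite Series_scal_l; ring).
  apply Series_le; [|exact ha]. intros n; specialize (h n); lra.
Qed.

Lemma exp_INR (x : R) (n : nat) : exp (INR n * x) = exp x ^ n.
Proof.
  induction n as [|n IH]; [cbn; rewrite Rmult_0_l; apply exp_0|].
  rewrite S_INR, Rmult_plus_distr_r, exp_plus, IH, Rmult_1_l. cbn [pow]. ring.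
Qed.

Lemma exp_neg_lt1 (s : R) : 0 < s -> 0 < exp (- s) < 1.
Proof.
  intros h; split; [apply exp_pos|]. rewrite <- exp_0. apply exp_increasing; lra.
Qed.

Lemma series_exp_all (s : R) : 0 < s ->
  ex_series (fun i => exp (- (INR (S i) * s))) /\ Series (fun i => exp (- (INR (S i) * s))) <= / s.
Proof.
  intros h. pose proof (exp_neg_lt1 s h) as hr. set (r := exp (- s)) in *.
  assert (e : forall i, r * r ^ i = exp (- (INR (S i) * s))).
  { intros i. rewrite tech_pow_Rmult. unfold r. rewrite <- exp_INR. f_equal. ring. }
  assert (hx : ex_series (fun i => r * r ^ i)).
  { apply ex_series_scalR, ex_series_geom. rewrite Rabs_pos_eq; lra. }
  split; [apply ex_series_ext with (2 := hx); exact e|].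
  rewrite <- (Series_ext _ _ e), Series_scal_l, Series_geom by (rewrite Rabs_pos_eq; lra).
  apply Rmult_le_reg_r with (s * (1 - r)); [nra|].
  replace (r * / (1 - r) * (s * (1 - r))) with (r * s) by (field; lra).
  replace (/ s * (s * (1 - r))) with (1 - r) by (field; lra).
  pose proof (exp_ineq1_le s) as h1.
  assert (exp s * r = 1) by (unfold r; rewrite <- exp_plus, Rplus_opp_r; apply exp_0).
  nra.
Qed.

Lemma series_exp_odd (s : R) : 0 < s ->
  ex_series (fun i => exp (- ((2 * INR i + 1) * s))) /\
  Series (fun i => exp (- ((2 * INR i + 1) * s))) <= / (2 * s).
Proof.
  intros h. pose proof (exp_neg_lt1 s h) as hr. set (r := exp (- s)) in *.
  assert (e : forall i, r * (r ^ 2) ^ i = exp (- ((2 * INR i + 1) * s))).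
  { intros i. rewrite <- pow_mult, tech_pow_Rmult. unfold r. rewrite <- exp_INR. f_equal.
    rewrite S_INR, mult_INR. cbn [INR]. ring. }
  assert (h2 : 0 < r ^ 2 < 1) by nra.
  assert (hx : ex_series (fun i => r * (r ^ 2) ^ i)).
  { apply ex_series_scalR, ex_series_geom. rewrite Rabs_pos_eq; lra. }
  split; [apply ex_series_ext with (2 := hx); exact e|].
  rewrite <- (Series_ext _ _ e), Series_scal_l, Series_geom by (rewrite Rabs_pos_eq; lra).
  pose proof (sinh_ge s ltac:(lra)) as h1. unfold sinh in h1. fold r in h1.
  assert (exp s * r = 1) by (unfold r; rewrite <- exp_plus, Rplus_opp_r; apply exp_0).
  apply Rmult_le_reg_r with (2 * s * (1 - r ^ 2)); [nra|].
  replace (r * / (1 - r ^ 2) * (2 * s * (1 - r ^ 2))) with (2 * s * r) by (field; lra).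
  replace (/ (2 * s) * (2 * s * (1 - r ^ 2))) with (1 - r ^ 2) by (field; lra).
  nra.
Qed.

(** The odd part has no pole at 0, only a logarithmic singularity, so on a ray through 0 it
    differs from its value on the axis by a multiple of the slope of the ray. *)
Lemma odz_sub_le (z : C) : 0 < Re z -> Rabs (Im z) <= Re z / 2 ->
  Cmod (odz z - odz (RtoC (Re z)))%C <= 5 / 8 * (Rabs (Im z) / Re z).
Proof.
  intros h hb. set (s := Re z) in *.
  unfold odz. rewrite <- Csum_minus by (apply Cabs_conv_odT; [exact h||(rewrite Re_RtoC; exact h)]).
  destruct (series_exp_odd s h) as [hx hS].
  apply Rle_trans with (Series (fun i => 5 / 4 * Rabs (Im z) * exp (- ((2 * INR i + 1) * s)))).
  - apply Cmod_Csum_le; [|apply ex_series_scalR; exact hx].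
    intros i. pose proof (INR_odd_pos i) as hm. set (m := 2 * INR i + 1) in *.
    unfold odT. fold m.
    set (y := (RtoC m * z)%C).
    assert (ry : Re y = m * s) by (apply Re_scal).
    assert (iy : Im y = m * Im z) by (apply Im_scal).
    replace (RtoC m * RtoC s)%C with (RtoC (Re y)) by (rewrite ry, RtoC_mult; reflexivity).
    replace (RtoC (/ (2 * m)) * / Cch y - RtoC (/ (2 * m)) * / Cch (RtoC (Re y)))%C
      with (RtoC (/ (2 * m)) * (/ Cch y - / Cch (RtoC (Re y))))%C by ring.
    rewrite Cmod_mult, Cmod_R, Rabs_pos_eq by (left; apply Rinv_0_lt_compat; lra).
    assert (aiy : Rabs (Im y) = m * Rabs (Im z)) by (rewrite iy, Rabs_mult, Rabs_pos_eq; lra).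
    assert (hy : 0 < Re y) by (rewrite ry; nra).
    assert (hyb : Rabs (Im y) <= Re y / 2) by (rewrite ry, aiy; nra).
    pose proof (Cinv_Cch_sub_le y hy hyb) as H. rewrite aiy, ry in H.
    pose proof (inv_cosh_le (m * s)) as H2.
    rewrite ry. pose proof (Rabs_pos (Im z)).
    apply Rle_trans with (/ (2 * m) * (5 / 4 * (m * Rabs (Im z) * (2 * exp (- (m * s)))))).
    + apply Rmult_le_compat_l; [left; apply Rinv_0_lt_compat; lra|].
      eapply Rle_trans; [exact H|]. apply Rmult_le_compat_l; [lra|].
      apply Rmult_le_compat_l; [nra|exact H2].
    + right; field; lra.
  - rewrite Series_scal_l. pose proof (Rabs_pos (Im z)).
    apply Rle_trans with (5 / 4 * Rabs (Im z) * / (2 * s)).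
    + apply Rmult_le_compat_l; [lra|exact hS].
    + right; field; lra.
Qed.

Definition tauT (z : C) (i : nat) : C :=
  (RtoC (/ (4 * INR (S i))) * Ctau (RtoC (INR (S i)) * z))%C.

Lemma tauT_eq (z : C) (i : nat) : 0 < Re z ->
  tauT z i = (evT (RtoC (/ 2) * z) i - RtoC 2 * evT z i)%C.
Proof.
  intros h. pose proof (INR_S_pos i). unfold tauT, evT. rewrite Ctau_eq by (rewrite Re_scal; nra).
  replace (RtoC (2 * INR (S i)) * (RtoC (/ 2) * z))%C with (RtoC (INR (S i)) * z)%C.
  2:{ rewrite Cmult_assoc, <- RtoC_mult. f_equal. f_equal. field. }
  replace (RtoC (2 * INR (S i)) * z)%C with (2 * (RtoC (INR (S i)) * z))%C
    by (rewrite RtoC_mult; ring).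
  ring.
Qed.

Lemma Re_pos_half (z : C) : 0 < Re z -> 0 < Re (RtoC (/ 2) * z)%C.
Proof. rewrite Re_scal. lra. Qed.

Lemma Cabs_conv_tauT (z : C) : 0 < Re z -> Cabs_conv (tauT z).
Proof.
  intros h.
  apply ex_series_ext with (fun n => Cmod (evT (RtoC (/ 2) * z) n + RtoC (-2) * evT z n)%C).
  - intros n. rewrite tauT_eq by assumption. f_equal.
    replace (RtoC (-2)) with (- RtoC 2)%C by (rewrite <- RtoC_opp; reflexivity). ring.
  - apply Cabs_conv_plus; [|apply Cabs_conv_scal]; apply Cabs_conv_evT;
      [apply Re_pos_half|]; assumption.
Qed.

Lemma Csum_tauT (z : C) : 0 < Re z ->
  Csum (tauT z) = (evz (RtoC (/ 2) * z) - RtoC 2 * evz z)%C.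
Proof.
  intros h. unfold evz. pose proof (Re_pos_half z h).
  rewrite <- Csum_scal by (apply Cabs_conv_evT; assumption).
  rewrite <- Csum_minus;
    [|apply Cabs_conv_evT; assumption|apply Cabs_conv_scal, Cabs_conv_evT; assumption].
  apply Csum_ext; intros i. apply tauT_eq; assumption.
Qed.

Lemma Csum_tauT_sub_le (z : C) : 0 < Re z -> Rabs (Im z) <= Re z / 2 ->
  Cmod (Csum (tauT z) - Csum (tauT (RtoC (Re z))))%C <= 41 / 40 * (Rabs (Im z) / Re z).
Proof.
  intros h hb. set (s := Re z) in *.
  rewrite <- Csum_minus by (apply Cabs_conv_tauT; [exact h||(rewrite Re_RtoC; exact h)]).
  destruct (series_exp_all s h) as [hx hS].
  apply Rle_trans with (Series (fun i => 41 / 40 * Rabs (Im z) * exp (- (INR (S i) * s)))).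
  - apply Cmod_Csum_le; [|apply ex_series_scalR; exact hx].
    intros i. pose proof (INR_S_pos i) as hm. set (m := INR (S i)) in *.
    unfold tauT. fold m.
    set (y := (RtoC m * z)%C).
    assert (ry : Re y = m * s) by (apply Re_scal).
    assert (iy : Im y = m * Im z) by (apply Im_scal).
    replace (RtoC m * RtoC s)%C with (RtoC (Re y)) by (rewrite ry, RtoC_mult; reflexivity).
    replace (RtoC (/ (4 * m)) * Ctau y - RtoC (/ (4 * m)) * Ctau (RtoC (Re y)))%C
      with (RtoC (/ (4 * m)) * (Ctau y - Ctau (RtoC (Re y))))%C by ring.
    rewrite Cmod_mult, Cmod_R, Rabs_pos_eq by (left; apply Rinv_0_lt_compat; lra).
    assert (aiy : Rabs (Im y) = m * Rabs (Im z)) by (rewrite iy, Rabs_mult, Rabs_pos_eq; lra).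
    assert (hy : 0 < Re y) by (rewrite ry; nra).
    assert (hyb : Rabs (Im y) <= Re y / 2) by (rewrite ry, aiy; nra).
    pose proof (Ctau_sub_le y hy hyb) as H. rewrite aiy, ry in H.
    pose proof (inv_cosh_le (m * s)) as H2.
    rewrite ry. pose proof (Rabs_pos (Im z)).
    apply Rle_trans with (/ (4 * m) * (41 / 20 * (m * Rabs (Im z) * (2 * exp (- (m * s)))))).
    + apply Rmult_le_compat_l; [left; apply Rinv_0_lt_compat; lra|].
      eapply Rle_trans; [exact H|]. apply Rmult_le_compat_l; [lra|].
      apply Rmult_le_compat_l; [nra|exact H2].
    + right; field; lra.
  - rewrite Series_scal_l. pose proof (Rabs_pos (Im z)).
    apply Rle_trans with (41 / 40 * Rabs (Im z) * / s).
    + apply Rmult_le_compat_l; [lra|exact hS].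
    + right; field; lra.
Qed.

(** ** Dominated convergence for series *)

Lemma series_tail_small (M : nat -> R) (eps : R) : ex_series M -> (forall n, 0 <= M n) -> 0 < eps ->
  exists N, (0 < N)%nat /\ Series (fun k => M (N + k)%nat) < eps.
Proof.
  intros hM hp he.
  pose proof (Series_correct M hM) as hs.
  assert (hl : is_lim_seq (sum_n M) (Series M)) by exact hs.
  apply is_lim_seq_spec in hl. destruct (hl (mkposreal eps he)) as [N hN]. cbn [pos] in hN.
  exists (S N). split; [lia|].
  specialize (hN N (Nat.le_refl N)).
  rewrite (Series_incr_n M (S N)) in hN by (lia || assumption).
  cbn [Init.Nat.pred] in hN. rewrite sum_n_Reals in hN.
  apply Rabs_def2 in hN. lra.
Qed.

Lemma tannery (a : nat -> nat -> R) (M : nat -> R) :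
  (forall J n, 0 <= a J n <= M n) -> ex_series M ->
  (forall n, is_lim_seq (fun J => a J n) 0) ->
  is_lim_seq (fun J => Series (a J)) 0.
Proof.
  intros ha hM hl.
  assert (hMp : forall n, 0 <= M n) by (intros n; specialize (ha 0%nat n); lra).
  assert (hex : forall J, ex_series (a J)).
  { intros J. apply ex_series_dom with M; [|assumption].
    intros n. specialize (ha J n). rewrite Rabs_pos_eq; lra. }
  apply is_lim_seq_spec. intros eps.
  destruct (series_tail_small M (eps / 2) hM hMp) as (N & hN & hNt).
  { pose proof (cond_pos eps); lra. }
  assert (hfin : is_lim_seq (fun J => sum_f_R0 (a J) (Init.Nat.pred N)) 0).
  { generalize (Init.Nat.pred N) as p. induction p as [|p IH].
    - cbn. apply hl.
    - cbn [sum_f_R0]. replace (Finite 0) with (Rbar_plus (Finite 0) (Finite 0)) by (cbn; f_equal; ring).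
      apply is_lim_seq_plus'; [exact IH|apply hl]. }
  apply is_lim_seq_spec in hfin.
  destruct (hfin (mkposreal (eps / 2) ltac:(pose proof (cond_pos eps); lra))) as [J0 hJ0].
  exists J0. intros J hJ. specialize (hJ0 J hJ). cbn [pos] in hJ0.
  rewrite Rminus_0_r in *.
  rewrite Rabs_pos_eq by (apply Series_nonneg; [intros; apply ha|apply hex]).
  rewrite (Series_incr_n (a J) N) by (lia || apply hex).
  apply Rabs_def2 in hJ0.
  assert (Series (fun k => a J (N + k)%nat) <= Series (fun k => M (N + k)%nat)).
  { apply Series_le; [intros; apply ha|]. apply (ex_series_incr_n M N). exact hM. }
  lra.
Qed.

Lemma Csum_tannery (a : nat -> nat -> C) (l : nat -> C) (M : nat -> R) :
  (forall J n, Cmod (a J n - l n)%C <= M n) -> ex_series M ->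
  (forall n, is_lim_seq (fun J => Cmod (a J n - l n)%C) 0) ->
  (forall J, Cabs_conv (a J)) -> Cabs_conv l ->
  is_lim_seq (fun J => Cmod (Csum (a J) - Csum l)%C) 0.
Proof.
  intros ha hM hl hca hcl.
  apply is_lim_seq_le_le with (fun _ => 0) (fun J => Series (fun n => Cmod (a J n - l n)%C)).
  - intros J. split; [apply Cmod_ge_0|].
    rewrite <- Csum_minus by auto. apply Cmod_Csum_le; [intros; lra|].
    apply ex_series_dom with M; [|assumption].
    intros n. rewrite Rabs_pos_eq by apply Cmod_ge_0. apply ha.
  - apply is_lim_seq_const.
  - apply tannery with M; [|assumption|assumption].
    intros J n; split; [apply Cmod_ge_0|apply ha].
Qed.

(** ** The pole of the even part *)

Lemma inv_sqr_le_tel (n : nat) : / INR (S (S n)) ^ 2 <= / INR (S n) - / INR (S (S n)).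
Proof.
  pose proof (INR_S_pos n). rewrite (S_INR (S n)). set (x := INR (S n)) in *.
  apply Rmult_le_reg_r with (x * (x + 1) ^ 2); [nra|].
  replace (/ (x + 1) ^ 2 * (x * (x + 1) ^ 2)) with x by (field; lra).
  replace ((/ x - / (x + 1)) * (x * (x + 1) ^ 2)) with (x + 1) by (field; lra). lra.
Qed.

Lemma is_lim_seq_inv_INR : is_lim_seq (fun n => / INR (S n)) 0.
Proof.
  replace (Finite 0) with (Rbar_inv p_infty) by reflexivity.
  apply is_lim_seq_inv; [|discriminate].
  apply (is_lim_seq_incr_1 INR). apply is_lim_seq_INR.
Qed.

Lemma ex_series_inv_sqr : ex_series (fun i => / INR (S i) ^ 2).
Proof.
  apply (ex_series_incr_1 (fun i => / INR (S i) ^ 2)).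
  apply ex_series_dom with (fun i => / INR (S i) - / INR (S (S i))).
  - intros n. rewrite Rabs_pos_eq; [apply inv_sqr_le_tel|].
    left; apply Rinv_0_lt_compat, pow_lt, INR_S_pos.
  - exists 1. change (is_lim_seq (sum_n (fun i => / INR (S i) - / INR (S (S i)))) (Finite 1)).
    apply is_lim_seq_ext with (fun n => 1 - / INR (S (S n))).
    + intros n. induction n as [|n IH].
      * rewrite sum_O. cbn. field.
      * rewrite sum_Sn, <- IH. unfold plus; cbn -[INR]. ring.
    + replace (Finite 1) with (Finite (1 - 0)) by (f_equal; ring).
      apply is_lim_seq_minus'; [apply is_lim_seq_const|].
      apply (is_lim_seq_incr_1 (fun n => / INR (S n))). apply is_lim_seq_inv_INR.
Qed.

Definition zeta2 : R := Series (fun i => / INR (S i) ^ 2).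

(** The point of the ray through z reached after J halvings. *)
Definition dyad (J : nat) (z : C) : C := (RtoC (/ 2 ^ J) * z)%C.

Lemma two_pow_pos (J : nat) : 0 < 2 ^ J.
Proof. apply pow_lt; lra. Qed.

Lemma is_lim_seq_inv_pow2 : is_lim_seq (fun J => / 2 ^ J) 0.
Proof.
  apply is_lim_seq_ext with (fun J => (/ 2) ^ J).
  - intros; symmetry; rewrite pow_inv; reflexivity.
  - apply is_lim_seq_geom. rewrite Rabs_pos_eq; lra.
Qed.

Lemma is_lim_seq_scal0 (c : R) (u : nat -> R) : is_lim_seq u 0 -> is_lim_seq (fun n => c * u n) 0.
Proof.
  intros h. replace (Finite 0) with (Rbar_mult (Finite c) (Finite 0)) by (cbn; f_equal; ring).
  apply is_lim_seq_scal_l, h.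
Qed.

Lemma Cneq0_of_Re_pos (z : C) : 0 < Re z -> z <> RtoC 0.
Proof. intros h e. subst z. rewrite Re_RtoC in h. lra. Qed.

Lemma evz_dyad_lim (z : C) : 0 < Re z ->
  is_lim_seq (fun J => Cmod (RtoC (/ 2 ^ J) * evz (dyad J z) - RtoC (zeta2 / 8) * / z)%C) 0.
Proof.
  intros h. pose proof (Cneq0_of_Re_pos z h) as hz.
  set (l := fun i => (RtoC (/ (8 * INR (S i) ^ 2)) * / z)%C).
  assert (hlc : Cabs_conv l).
  { apply Cabs_conv_le with (fun i => / 8 * Cmod (/ z)%C * / INR (S i) ^ 2).
    - intros i. pose proof (INR_S_pos i). pose proof (pow_lt _ 2 H). unfold l. rewrite Cmod_mult, Cmod_R.
      rewrite Rabs_pos_eq by (left; apply Rinv_0_lt_compat; lra). right. field. lra.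
    - apply ex_series_scalR, ex_series_inv_sqr. }
  assert (hl : Csum l = (RtoC (zeta2 / 8) * / z)%C).
  { unfold l. rewrite (Csum_ext _ (fun i => (/ z * RtoC (/ 8 * / INR (S i) ^ 2))%C)).
    - rewrite Csum_scal.
      + rewrite Cmult_comm. f_equal. unfold Csum. apply C_ext; autorewrite with cplx.
        * rewrite (Series_ext _ (fun i => / 8 * / INR (S i) ^ 2)) by reflexivity.
          rewrite Series_scal_l. unfold zeta2. field.
        * rewrite (Series_ext _ (fun i => 0 * 0)) by (intros; autorewrite with cplx; ring).
          rewrite Series_scal_l. ring.
      + apply Cabs_conv_le with (fun i => / 8 * / INR (S i) ^ 2).
        * intros i. pose proof (INR_S_pos i). rewrite Cmod_R, Rabs_pos_eq; [lra|].
          left. apply Rmult_lt_0_compat; [lra|]. apply Rinv_0_lt_compat, pow_lt, H.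
        * apply ex_series_scalR, ex_series_inv_sqr.
    - intros i. rewrite Cmult_comm, Rinv_mult. reflexivity. }
  assert (hR : forall J, 0 < Re (dyad J z)).
  { intros J. unfold dyad. rewrite Re_scal.
    apply Rmult_lt_0_compat; [apply Rinv_0_lt_compat, two_pow_pos|assumption]. }
  assert (H : is_lim_seq (fun J => Cmod (Csum (fun i => (RtoC (/ 2 ^ J) * evT (dyad J z) i)%C)
     - Csum l)%C) 0).
  { apply Csum_tannery with (fun i => / (4 * Re z) * / INR (S i) ^ 2).
    - intros J i. pose proof (INR_S_pos i). pose proof (two_pow_pos J) as hJ.
      unfold Cminus. eapply Rle_trans; [apply Cmod_triangle|]. rewrite Cmod_opp, Cmod_mult, Cmod_R.
      rewrite Rabs_pos_eq by (left; apply Rinv_0_lt_compat; assumption).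
      assert (h1 : / 2 ^ J * Cmod (evT (dyad J z) i) <= / (8 * Re z) * / INR (S i) ^ 2).
      { apply Rle_trans with (/ 2 ^ J * (/ (8 * Re (dyad J z)) * / INR (S i) ^ 2)).
        - apply Rmult_le_compat_l; [left; apply Rinv_0_lt_compat; assumption|].
          apply evT_le, hR.
        - right. unfold dyad. rewrite Re_scal. field. lra. }
      assert (h2 : Cmod (l i) <= / (8 * Re z) * / INR (S i) ^ 2).
      { pose proof (pow_lt _ 2 H). unfold l. rewrite Cmod_mult, Cmod_R, Rabs_pos_eq
          by (left; apply Rinv_0_lt_compat; lra).
        apply Rle_trans with (/ (8 * INR (S i) ^ 2) * / Re z).
        - apply Rmult_le_compat_l; [left; apply Rinv_0_lt_compat; lra|].
          apply Cmod_inv_le; [assumption|]. eapply Rle_trans; [|apply re_le_Cmod]. apply Rle_abs.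
        - right; field. lra. }
      replace (/ (4 * Re z) * / INR (S i) ^ 2)
        with (/ (8 * Re z) * / INR (S i) ^ 2 + / (8 * Re z) * / INR (S i) ^ 2) by (field; lra).
      lra.
    - apply ex_series_scalR, ex_series_inv_sqr.
    - intros i. pose proof (INR_S_pos i).
      (* w = 2 k z; once w / 2^J is small, 1 / sinh is within a constant of 1 / id *)
      set (w := (RtoC (2 * INR (S i)) * z)%C).
      assert (hw : w <> RtoC 0) by (apply Cmult_neq_0; [intros e; apply RtoC_inj in e; lra|assumption]).
      assert (hrw : 0 < Re w) by (unfold w; rewrite Re_scal; nra).
      pose proof (is_lim_seq_scal0 (Cmod w) _ is_lim_seq_inv_pow2) as hs.
      apply is_lim_seq_spec in hs. destruct (hs (mkposreal 1 Rlt_0_1)) as [J0 hJ0].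
      apply (is_lim_seq_incr_n _ J0).
      apply is_lim_seq_le_le with (fun _ => 0) (fun n => 20 * / 2 ^ (n + J0)).
      + intros n. split; [apply Cmod_ge_0|].
        specialize (hJ0 (n + J0)%nat ltac:(lia)). cbn [pos] in hJ0. rewrite Rminus_0_r in hJ0.
        set (J := (n + J0)%nat) in *. pose proof (two_pow_pos J) as hJ.
        assert (hJi : 0 < / 2 ^ J) by (apply Rinv_0_lt_compat; assumption).
        set (y := (RtoC (/ 2 ^ J) * w)%C).
        assert (hmy : Cmod y < 1).
        { unfold y. rewrite Cmod_mult, Cmod_R, Rabs_pos_eq by lra.
          pose proof (Rle_abs (Cmod w * / 2 ^ J)). lra. }
        assert (hry : 0 < Re y) by (unfold y; rewrite Re_scal; nra).
        pose proof (Cinv_Csh_sub_inv_le y) as H1.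
        pose proof (re_le_Cmod y). pose proof (im_le_Cmod y). pose proof (Rle_abs (Re y)).
        specialize (H1 ltac:(lra) ltac:(lra)).
        assert (e : (RtoC (/ 2 ^ J) * evT (dyad J z) i - l i =
          RtoC (/ 2 ^ J) * (RtoC (/ (4 * INR (S i))) * (/ Csh y - / y)))%C).
        { unfold evT, l, dyad.
          replace (RtoC (2 * INR (S i)) * (RtoC (/ 2 ^ J) * z))%C with y
            by (unfold y, w; ring).
          replace (/ y)%C with (RtoC (2 ^ J) * (RtoC (/ (2 * INR (S i))) * / z))%C.
          2:{ unfold y, w. rewrite !RtoC_inv by lra. rewrite RtoC_mult. field.
              repeat split; try assumption; intros e; apply RtoC_inj in e; lra. }
          replace (RtoC (/ (8 * INR (S i) ^ 2)) * / z)%C with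
            (RtoC (/ 2 ^ J * / (4 * INR (S i)) * 2 ^ J * / (2 * INR (S i))) * / z)%C.
          2:{ f_equal. f_equal. field. lra. }
          rewrite !RtoC_mult. ring. }
        rewrite e, !Cmod_mult, !Cmod_R, !Rabs_pos_eq by (left; try assumption; apply Rinv_0_lt_compat; lra).
        rewrite (Rmult_comm 20). apply Rmult_le_compat_l; [lra|].
        assert (/ (4 * INR (S i)) <= 1).
        { rewrite <- Rinv_1. apply Rinv_le_contravar; [lra|]. rewrite S_INR in *. pose proof (pos_INR i). lra. }
        assert (0 < / (4 * INR (S i))) by (apply Rinv_0_lt_compat; lra).
        pose proof (Cmod_ge_0 (/ Csh y - / y)%C). nra.
      + apply is_lim_seq_const.
      + apply is_lim_seq_scal0. apply (is_lim_seq_incr_n (fun J => / 2 ^ J)).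
        apply is_lim_seq_inv_pow2.
    - intros J. apply Cabs_conv_scal, Cabs_conv_evT, hR.
    - exact hlc. }
  eapply is_lim_seq_ext; [|exact H].
  intros J. cbv beta. rewrite hl. rewrite Csum_scal by (apply Cabs_conv_evT, hR). reflexivity.
Qed.

(** Halving z repeatedly removes everything but the pole: the differences between consecutive
    stages are the sums of [Ctau], which nearly agree at z and at its real part because the
    ratio of the imaginary to the real part does not change under halving. *)
Lemma evz_sub_le (z : C) : 0 < Re z -> Rabs (Im z) <= Re z / 2 ->
  Cmod (evz z - evz (RtoC (Re z)) - RtoC (zeta2 / 8) * (/ z - / RtoC (Re z)))%C
    <= 41 / 40 * (Rabs (Im z) / Re z).
Proof.
  intros h hb. set (s := RtoC (Re z)).
  assert (hs : 0 < Re s) by (unfold s; rewrite Re_RtoC; assumption).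
  set (c := 41 / 40 * (Rabs (Im z) / Re z)).
  set (E := fun J => (RtoC (/ 2 ^ J) * (evz (dyad J z) - evz (dyad J s)))%C).
  assert (hd : forall w, dyad 0 w = w).
  { intros w. unfold dyad. cbn [pow]. rewrite Rinv_1. ring. }
  assert (hstep : forall J, Cmod (E J - E (S J))%C <= / 2 ^ S J * c).
  { intros J. pose proof (two_pow_pos J) as hJ.
    assert (hJi : 0 < / 2 ^ J) by (apply Rinv_0_lt_compat; assumption).
    assert (hz' : 0 < Re (dyad J z)) by (unfold dyad; rewrite Re_scal; nra).
    assert (es : dyad J s = RtoC (Re (dyad J z))).
    { unfold dyad, s. rewrite Re_scal, RtoC_mult. reflexivity. }
    assert (hs' : 0 < Re (dyad J s)) by (rewrite es, Re_RtoC; assumption).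
    assert (ed : forall w, dyad (S J) w = (RtoC (/ 2) * dyad J w)%C).
    { intros w. unfold dyad. cbn [pow]. rewrite Rinv_mult, RtoC_mult. ring. }
    assert (hbJ : Rabs (Im (dyad J z)) <= Re (dyad J z) / 2).
    { unfold dyad. rewrite Re_scal, Im_scal, Rabs_mult, (Rabs_pos_eq (/ 2 ^ J)) by lra. nra. }
    pose proof (Csum_tauT_sub_le (dyad J z) hz' hbJ) as H. rewrite <- es in H.
    rewrite !Csum_tauT in H by assumption. rewrite <- !ed in H.
    assert (ec : 41 / 40 * (Rabs (Im (dyad J z)) / Re (dyad J z)) = c).
    { unfold c, dyad. rewrite Re_scal, Im_scal, Rabs_mult, (Rabs_pos_eq (/ 2 ^ J)) by lra.
      field. lra. }
    rewrite ec in H.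
    assert (eE : (E J - E (S J) = RtoC (- / 2 ^ S J) *
       ((evz (dyad (S J) z) - 2 * evz (dyad J z)) - (evz (dyad (S J) s) - 2 * evz (dyad J s))))%C).
    { unfold E. replace (/ 2 ^ J) with (2 * / 2 ^ S J) by (cbn [pow]; field; lra).
      rewrite RtoC_mult, RtoC_opp. ring. }
    rewrite eE, Cmod_mult, Cmod_R, Rabs_Ropp, Rabs_pos_eq
      by (left; apply Rinv_0_lt_compat, two_pow_pos).
    apply Rmult_le_compat_l; [left; apply Rinv_0_lt_compat, two_pow_pos|exact H]. }
  assert (hc : 0 <= c).
  { unfold c. apply Rmult_le_pos; [lra|]. apply Rmult_le_pos; [apply Rabs_pos|].
    left; apply Rinv_0_lt_compat; assumption. }
  assert (htot : forall J, Cmod (E 0%nat - E J)%C <= (1 - / 2 ^ J) * c).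
  { induction J as [|J IH].
    - replace (E 0%nat - E 0%nat)%C with (RtoC 0) by ring. rewrite Cmod_0. cbn. lra.
    - replace (E 0%nat - E (S J))%C with ((E 0%nat - E J) + (E J - E (S J)))%C by ring.
      eapply Rle_trans; [apply Cmod_triangle|]. specialize (hstep J).
      replace (1 - / 2 ^ S J) with (1 - / 2 ^ J + / 2 ^ S J).
      + lra.
      + cbn [pow]. pose proof (two_pow_pos J). field. lra. }
  set (L := (RtoC (zeta2 / 8) * (/ z - / s))%C).
  replace (evz z - evz s - L)%C with (E 0%nat - L)%C
    by (unfold E; rewrite !hd; cbn [pow]; rewrite Rinv_1; ring).
  assert (hlim : is_lim_seq (fun J => Cmod (RtoC (/ 2 ^ J) * evz (dyad J z) - RtoC (zeta2 / 8) * / z)%C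
      + Cmod (RtoC (/ 2 ^ J) * evz (dyad J s) - RtoC (zeta2 / 8) * / s)%C) 0).
  { replace (Finite 0) with (Finite (0 + 0)) by (f_equal; ring).
    apply is_lim_seq_plus'; apply evz_dyad_lim; assumption. }
  assert (hle : is_lim_seq (fun J => c + (Cmod (RtoC (/ 2 ^ J) * evz (dyad J z) - RtoC (zeta2 / 8) * / z)%C
      + Cmod (RtoC (/ 2 ^ J) * evz (dyad J s) - RtoC (zeta2 / 8) * / s)%C)) (c + 0)).
  { apply is_lim_seq_plus'; [apply is_lim_seq_const|exact hlim]. }
  rewrite Rplus_0_r in hle.
  assert (hfin : Rbar_le (Cmod (E 0%nat - L)%C) c); [|exact hfin].
  apply (is_lim_seq_le (fun _ => Cmod (E 0%nat - L)%C) _ _ _) with (2 := is_lim_seq_const _) (3 := hle).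
  intros J.
  replace (E 0%nat - L)%C with ((E 0%nat - E J) + ((RtoC (/ 2 ^ J) * evz (dyad J z) - RtoC (zeta2 / 8) * / z)
    + - (RtoC (/ 2 ^ J) * evz (dyad J s) - RtoC (zeta2 / 8) * / s)))%C
    by (unfold L, E; ring).
  eapply Rle_trans; [apply Cmod_triangle|]. apply Rplus_le_compat.
  - eapply Rle_trans; [apply htot|]. pose proof (two_pow_pos J).
    assert (0 < / 2 ^ J) by (apply Rinv_0_lt_compat; assumption). nra.
  - eapply Rle_trans; [apply Cmod_triangle|]. rewrite Cmod_opp. lra.
Qed.

(** * Away from the two dominant points *)

(** Unlike [sum_n], this sum is empty for [n = 0]. *)
Fixpoint psum (a : nat -> R) (n : nat) : R :=
  match n with O => 0 | S k => psum a k + a k end.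

Lemma psum_sum_n (a : nat -> R) (n : nat) : psum a (S n) = sum_n a n.
Proof.
  induction n as [|n IH].
  - rewrite sum_O. cbn. ring.
  - rewrite sum_Sn, <- IH. reflexivity.
Qed.

Lemma psum_lim (a : nat -> R) : ex_series a -> is_lim_seq (psum a) (Series a).
Proof.
  intros h. apply is_lim_seq_incr_1.
  apply is_lim_seq_ext with (sum_n a); [intros; symmetry; apply psum_sum_n|].
  exact (Series_correct a h).
Qed.

Lemma psum_le (a b : nat -> R) (n : nat) :
  (forall i, (i < n)%nat -> a i <= b i) -> psum a n <= psum b n.
Proof.
  intros h. induction n as [|n IH]; cbn; [lra|].
  assert (psum a n <= psum b n) by (apply IH; intros; apply h; lia).
  specialize (h n ltac:(lia)). lra.
Qed.

Lemma psum_plus (a b : nat -> R) (n : nat) : psum (fun i => a i + b i) n = psum a n + psum b n.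
Proof. induction n as [|n IH]; cbn; [ring|rewrite IH; ring]. Qed.

Lemma psum_split (a b : nat -> R) (n : nat) :
  psum a n = psum b n + psum (fun i => a i - b i) n.
Proof. induction n as [|n IH]; cbn; [ring|rewrite IH; ring]. Qed.

Lemma psum_scal (c : R) (a : nat -> R) (n : nat) : psum (fun i => c * a i) n = c * psum a n.
Proof. induction n as [|n IH]; cbn; [ring|rewrite IH; ring]. Qed.

Lemma psum_const (c : R) (n : nat) : psum (fun _ => c) n = INR n * c.
Proof.
  induction n as [|n IH]; [cbn; ring|]. rewrite S_INR. cbn [psum]. rewrite IH. ring.
Qed.

Lemma Rabs_psum_le (a b : nat -> R) (n : nat) :
  (forall i, (i < n)%nat -> Rabs (a i) <= b i) -> Rabs (psum a n) <= psum b n.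
Proof.
  intros h. induction n as [|n IH]; cbn; [rewrite Rabs_R0; lra|].
  assert (Rabs (psum a n) <= psum b n) by (apply IH; intros; apply h; lia).
  specialize (h n ltac:(lia)). pose proof (Rabs_triang (psum a n) (a n)). lra.
Qed.

Lemma psum_le_Series (a : nat -> R) (n : nat) :
  (forall i, 0 <= a i) -> ex_series a -> psum a n <= Series a.
Proof.
  intros h ha. assert (H : Rbar_le (psum a n) (Series a)); [|exact H].
  apply (is_lim_seq_le_loc (fun _ => psum a n) (psum a)).
  - exists n. intros m hm. induction hm as [|m hm IH]; [lra|]. cbn. specialize (h m). lra.
  - apply is_lim_seq_const.
  - apply psum_lim; assumption.
Qed.

Lemma Series_abs_split (a t : nat -> R) (M : nat) :
  ex_series a -> (forall i, (M <= i)%nat -> Rabs (a i) <= t i - t (S i)) ->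
  (forall i, 0 <= t i) -> Rabs (Series a) <= Rabs (psum a M) + t M.
Proof.
  intros ha h ht.
  assert (H : Rbar_le (Rabs (Series a)) (Rabs (psum a M) + t M)); [|exact H].
  apply (is_lim_seq_le_loc (fun n => Rabs (psum a n)) (fun _ => Rabs (psum a M) + t M)).
  - exists M. intros n hn.
    assert (G : Rabs (psum a n) <= Rabs (psum a M) + t M - t n).
    { induction hn as [|n hn IH]; [lra|]. cbn [psum].
      pose proof (Rabs_triang (psum a n) (a n)). specialize (h n hn). lra. }
    specialize (ht n). lra.
  - change (Finite (Rabs (Series a))) with (Rbar_abs (Finite (Series a))).
    apply is_lim_seq_abs, psum_lim, ha.
  - apply is_lim_seq_const.
Qed.

Lemma Cinv_parts (c : C) :
  Re (/ c)%C = Re c / Cmod c ^ 2 /\ Im (/ c)%C = - Im c / Cmod c ^ 2.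
Proof.
  rewrite Cmod_sqr. destruct c as [x y]. split; reflexivity.
Qed.

Definition csh_den (x b : R) : R := sinh x ^ 2 + sin b ^ 2.

Lemma Re_inv_Csh (x b : R) : Re (/ Csh (x, b))%C = sinh x * cos b / csh_den x b.
Proof. rewrite (proj1 (Cinv_parts _)), Cmod_Csh_sqr. reflexivity. Qed.

Lemma Im_inv_Csh (x b : R) : Im (/ Csh (x, b))%C = - (cosh x * sin b) / csh_den x b.
Proof. rewrite (proj2 (Cinv_parts _)), Cmod_Csh_sqr. reflexivity. Qed.

Lemma Re_inv_Cch (x b : R) : Re (/ Cch (x, b))%C = cosh x * cos b / (sinh x ^ 2 + cos b ^ 2).
Proof. rewrite (proj1 (Cinv_parts _)), Cmod_Cch_sqr. reflexivity. Qed.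

Lemma scal_pair (c x b : R) : (RtoC c * (x, b))%C = (c * x, c * b).
Proof. apply C_ext; rewrite ?Re_scal, ?Im_scal; reflexivity. Qed.

Lemma Re_evT (s b : R) (i : nat) : Re (evT (s, b) i) = / (4 * INR (S i)) *
  (sinh (2 * INR (S i) * s) * cos (2 * INR (S i) * b) / csh_den (2 * INR (S i) * s) (2 * INR (S i) * b)).
Proof. unfold evT. rewrite Re_scal, scal_pair, Re_inv_Csh. reflexivity. Qed.

Lemma Re_odT (s b : R) (i : nat) : Re (odT (s, b) i) = / (2 * (2 * INR i + 1)) *
  (cosh ((2 * INR i + 1) * s) * cos ((2 * INR i + 1) * b) /
    (sinh ((2 * INR i + 1) * s) ^ 2 + cos ((2 * INR i + 1) * b) ^ 2)).
Proof. unfold odT. rewrite Re_scal, scal_pair, Re_inv_Cch. reflexivity. Qed.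

Lemma Re_evz_even (s b : R) : Re (evz (s, - b)) = Re (evz (s, b)).
Proof.
  unfold evz, Csum. rewrite !Re_pair. apply Series_ext; intros i. rewrite !Re_evT. unfold csh_den.
  replace (2 * INR (S i) * - b) with (- (2 * INR (S i) * b)) by ring.
  rewrite cos_neg, sin_neg. do 3 f_equal. ring.
Qed.

Lemma Re_odz_even (s b : R) : Re (odz (s, - b)) = Re (odz (s, b)).
Proof.
  unfold odz, Csum. rewrite !Re_pair. apply Series_ext; intros i. rewrite !Re_odT.
  replace ((2 * INR i + 1) * - b) with (- ((2 * INR i + 1) * b)) by ring.
  rewrite cos_neg. reflexivity.
Qed.

(** Every term of the even part is largest on the real axis, so any finite number of terms
    gives a lower bound for what is lost off the axis. *)
Lemma evz_deficit (s b : R) (K : nat) : 0 < s ->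
  Re (evz (s, b)) <= Re (evz (RtoC s)) - psum (fun i => Re (evT (RtoC s) i) - Re (evT (s, b) i)) K.
Proof.
  intros h.
  assert (c1 : ex_series (fun i => Re (evT (RtoC s) i)))
    by (apply Cabs_conv_Re, Cabs_conv_evT; exact h).
  assert (c2 : ex_series (fun i => Re (evT (s, b) i)))
    by (apply Cabs_conv_Re, Cabs_conv_evT; exact h).
  pose proof (psum_le_Series (fun i => Re (evT (RtoC s) i) - Re (evT (s, b) i)) K) as H.
  rewrite Series_minus in H by assumption.
  unfold evz, Csum. rewrite !Re_pair.
  assert (psum (fun i => Re (evT (RtoC s) i) - Re (evT (s, b) i)) K <=
    Series (fun i => Re (evT (RtoC s) i)) - Series (fun i => Re (evT (s, b) i))); [|lra].
  apply H.
  - intros i. rewrite evT_real, Re_RtoC by assumption.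
    pose proof (evT_le_real (s, b) i h) as H1. rewrite Re_pair in H1.
    pose proof (re_le_Cmod (evT (s, b) i)) as H2. pose proof (Rle_abs (Re (evT (s, b) i))). lra.
  - apply (ex_series_minus (V := R_NormedModule) _ _ c1 c2).
Qed.

Lemma odz_tail (s b : R) (M : nat) : 0 < s -> (0 < M)%nat ->
  Rabs (Re (odz (s, b))) <= Rabs (psum (fun i => Re (odT (s, b) i)) M) + / (8 * INR M * s).
Proof.
  intros h hM. unfold odz, Csum. rewrite Re_pair.
  set (t := fun i : nat => match i with O => 1 | _ => / (8 * INR i * s) end).
  replace (/ (8 * INR M * s)) with (t M) by (destruct M; [lia|reflexivity]).
  apply Series_abs_split.
  - apply Cabs_conv_Re, Cabs_conv_odT. exact h.
  - intros i hi. destruct i as [|i]; [lia|]. unfold t.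
    eapply Rle_trans; [apply re_le_Cmod|]. eapply Rle_trans; [apply odT_le; exact h|].
    rewrite Re_pair. pose proof (INR_S_pos i). rewrite (S_INR (S i)). set (x := INR (S i)) in *.
    replace (/ (8 * x * s) - / (8 * (x + 1) * s)) with (/ (2 * s) * / (4 * x * (x + 1))) by (field; lra).
    apply Rmult_le_compat_l; [left; apply Rinv_0_lt_compat; lra|].
    apply Rinv_le_contravar; nra.
  - intros [|i]; unfold t; [lra|]. left. apply Rinv_0_lt_compat. pose proof (INR_S_pos i). nra.
Qed.

Lemma exp_small_le (x : R) : 0 <= x <= 1 / 1000 -> exp x <= 10011 / 10000.
Proof.
  intros h. pose proof (exp_sub1_le x) as H.
  rewrite (Rabs_pos_eq x), Rmax_right in H by lra. pose proof (Rle_abs (exp x - 1)).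
  pose proof (exp_pos x). nra.
Qed.

Lemma sinh_small_le (x : R) : 0 <= x <= 1 / 1000 -> sinh x <= 10011 / 10000 * x.
Proof.
  intros h. pose proof (sinh_le_mul_cosh x ltac:(lra)).
  assert (cosh x <= exp x).
  { unfold cosh. assert (exp (- x) <= exp x).
    { destruct (Req_dec x 0) as [e|e]; [rewrite e, Ropp_0; lra|].
      left; apply exp_increasing; lra. }
    lra. }
  pose proof (exp_small_le x h).
  assert (x * cosh x <= x * (10011 / 10000)) by (apply Rmult_le_compat_l; lra). lra.
Qed.

Section MinorArc.
Variables s b : R.
Hypothesis hs : 0 < s <= 1 / 10000000.

Lemma s_inv_big : 10000000 <= / s.
Proof.
  replace 10000000 with (/ (1 / 10000000)) by field. apply Rinv_le_contravar; lra.
Qed.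

Lemma ev_first_real_ge : 1248 / 10000 * / s <= Re (evT (RtoC s) 0).
Proof.
  rewrite evT_real, Re_RtoC by lra. cbn [INR].
  replace (2 * 1 * s) with (2 * s) by ring. replace (4 * 1) with 4 by ring.
  pose proof (sinh_small_le (2 * s) ltac:(lra)). pose proof (sinh_ge (2 * s) ltac:(lra)).
  assert (/ (10011 / 10000 * (2 * s)) <= / sinh (2 * s)) by (apply Rinv_le_contravar; lra).
  replace (/ (10011 / 10000 * (2 * s))) with (10000 / 20022 * / s) in H1 by (field; lra).
  pose proof s_inv_big. lra.
Qed.

(** Close to the real axis the first term of the even part already loses a fixed proportion,
    while only terms of the odd part with large index can be large. *)
Lemma minor_arc_near : s / 2 <= b <= 1 / 100 ->
  Re (evz (s, b)) + Rabs (Re (odz (s, b))) <= Re (evz (RtoC s)) - / (400 * s).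
Proof.
  intros hb. pose proof s_inv_big as hbig.
  pose proof (evz_deficit s b 1 ltac:(lra)) as H1. cbn [psum] in H1.
  pose proof (odz_tail s b 50 ltac:(lra) ltac:(lia)) as H2.
  assert (H3 : Rabs (psum (fun i => Re (odT (s, b) i)) 50) <= 50).
  { eapply Rle_trans; [apply Rabs_psum_le with (b := fun _ => 1)|].
    - intros i hi. eapply Rle_trans; [apply re_le_Cmod|].
      assert (hm : 1 <= 2 * INR i + 1 <= 99).
      { pose proof (pos_INR i). assert (INR i <= INR 49) by (apply le_INR; lia).
        replace (INR 49) with 49 in H0 by (cbn; ring). lra. }
      set (m := 2 * INR i + 1) in *. unfold odT. fold m. rewrite scal_pair.
      rewrite Cmod_mult, Cmod_R, Rabs_pos_eq by (left; apply Rinv_0_lt_compat; lra).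
      assert (hc : Cmod (/ Cch (m * s, m * b)%R)%C <= / (1 / 2)).
      { apply Cmod_inv_le; [lra|]. eapply Rle_trans; [|apply Cch_ge_cos].
        rewrite Im_pair. eapply Rle_trans; [|apply Rle_abs]. apply cos_ge_half.
        rewrite Rabs_pos_eq; nra. }
      assert (/ (2 * m) <= / 2) by (apply Rinv_le_contravar; lra).
      assert (0 < / (2 * m)) by (apply Rinv_0_lt_compat; lra).
      pose proof (Cmod_ge_0 (/ Cch (m * s, m * b)%R)%C). nra.
    - rewrite psum_const. replace (INR 50) with 50 by (cbn; ring). lra. }
  replace (INR 50) with 50 in H2 by (cbn; ring).
  rewrite evT_real, Re_RtoC, Re_evT in H1 by lra. cbn [INR] in H1.
  replace (2 * 1 * s) with (2 * s) in H1 by ring. replace (2 * 1 * b) with (2 * b) in H1 by ring.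
  unfold csh_den in H1.
  pose proof (sinh_small_le (2 * s) ltac:(lra)) as hS1. pose proof (sinh_ge (2 * s) ltac:(lra)) as hS0.
  set (S := sinh (2 * s)) in *.
  pose proof (mul_cos_le_sin (2 * b) ltac:(lra)) as hsin.
  pose proof (one_sub_cos_le (2 * b)) as hcos. pose proof (COS_bound (2 * b)) as [_ hcos1].
  set (c := cos (2 * b)) in *. set (v := sin (2 * b)) in *.
  assert (hc9 : 99 / 100 <= c) by nra.
  assert (hv : 99 / 100 * s <= v) by nra.
  assert (hd : 0 < S ^ 2 + v ^ 2) by nra.
  (* since c <= 1, the left factor of the deficit is at least v^2 / (S (S^2 + v^2)) *)
  assert (hdef : 3 / 20 * / S <= / S - S * c / (S ^ 2 + v ^ 2)).
  { apply Rmult_le_reg_r with (S * (S ^ 2 + v ^ 2)); [nra|].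
    replace ((/ S - S * c / (S ^ 2 + v ^ 2)) * (S * (S ^ 2 + v ^ 2)))
      with (S ^ 2 + v ^ 2 - S ^ 2 * c) by (field; lra).
    replace (3 / 20 * / S * (S * (S ^ 2 + v ^ 2))) with (3 / 20 * (S ^ 2 + v ^ 2)) by (field; lra).
    assert (S ^ 2 * c <= S ^ 2) by nra.
    assert (S ^ 2 <= 1003 / 250 * s ^ 2) by nra.
    assert (49 / 50 * s ^ 2 <= v ^ 2) by nra.
    nra. }
  assert (hiS : 998 / 2000 * / s <= / S).
  { replace (998 / 2000 * / s) with (/ (2000 / 998 * s)) by (field; lra).
    apply Rinv_le_contravar; [lra|]. lra. }
  assert (H4 : / (4 * 1) * / S - / (4 * 1) * (S * c / (S ^ 2 + v ^ 2)) =
     / 4 * (/ S - S * c / (S ^ 2 + v ^ 2))) by (field; lra).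
  replace (/ (8 * 50 * s)) with (/ 400 * / s) in H2 by (field; lra).
  replace (/ (400 * s)) with (/ 400 * / s) by (field; lra).
  lra.
Qed.

Lemma sin_mono_small (x y : R) : 0 <= x <= y -> y <= PI / 2 -> sin x <= sin y.
Proof.
  intros h hy. pose proof PI_RGT_0.
  destruct (Rle_lt_or_eq_dec x y (proj2 h)) as [h1|h1]; [left; apply sin_increasing_1; lra|subst; lra].
Qed.

Lemma sin_small_ge (x : R) : 0 <= x <= 1 -> x / 2 <= sin x.
Proof.
  intros h. pose proof (mul_cos_le_sin x h). pose proof (cos_ge_half x).
  rewrite Rabs_pos_eq in H0 by lra. nra.
Qed.

(** In the middle range the first term of each part is bounded; what the even part loses,
    [1/(8s)], exceeds the sum of the remaining terms of the odd part in absolute value. *)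
Lemma minor_arc_middle : 1 / 100 <= b <= PI / 2 - 1 / 100 ->
  Re (evz (s, b)) + Rabs (Re (odz (s, b))) <= Re (evz (RtoC s)) - / (400 * s).
Proof.
  intros hb. pose proof s_inv_big as hbig. pose proof PI_RGT_0. pose proof PI2_1.
  pose proof (evz_deficit s b 1 ltac:(lra)) as H1. cbn [psum] in H1.
  pose proof (odz_tail s b 2 ltac:(lra) ltac:(lia)) as H2. cbn [psum INR] in H2.
  pose proof ev_first_real_ge as H3.
  assert (H4 : Re (evT (s, b) 0) <= 100).
  { eapply Rle_trans; [apply Rle_abs|]. eapply Rle_trans; [apply re_le_Cmod|].
    unfold evT. rewrite scal_pair, Cmod_mult, Cmod_R. cbn [INR].
    rewrite Rabs_pos_eq by (left; apply Rinv_0_lt_compat; lra).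
    assert (Cmod (/ Csh (2 * 1 * s, 2 * 1 * b)%R)%C <= / (1 / 100)); [|lra].
    apply Cmod_inv_le; [lra|]. eapply Rle_trans; [|apply Csh_ge_sin]. rewrite Im_pair.
    eapply Rle_trans; [|apply Rle_abs]. replace (2 * 1 * b) with (2 * b) by ring.
    pose proof (sin_small_ge (2 / 100) ltac:(lra)).
    destruct (Rle_dec (2 * b) (PI / 2)) as [h|h].
    - pose proof (sin_mono_small (2 / 100) (2 * b) ltac:(lra) h). lra.
    - rewrite <- (sin_PI_x (2 * b)).
      pose proof (sin_mono_small (2 / 100) (PI - 2 * b) ltac:(lra) ltac:(lra)). lra. }
  assert (H5 : Rabs (Re (odT (s, b) 0)) <= 100).
  { eapply Rle_trans; [apply re_le_Cmod|].
    unfold odT. rewrite scal_pair, Cmod_mult, Cmod_R. cbn [INR].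
    rewrite Rabs_pos_eq by (left; apply Rinv_0_lt_compat; lra).
    assert (Cmod (/ Cch ((2 * 0 + 1) * s, (2 * 0 + 1) * b)%R)%C <= / (1 / 200)).
    2:{ replace (/ (2 * (2 * 0 + 1))) with (/ 2) by (f_equal; ring). lra. }
    apply Cmod_inv_le; [lra|]. eapply Rle_trans; [|apply Cch_ge_cos]. rewrite Im_pair.
    eapply Rle_trans; [|apply Rle_abs]. replace ((2 * 0 + 1) * b) with b by ring.
    rewrite <- sin_shift.
    pose proof (sin_small_ge (1 / 100) ltac:(lra)).
    pose proof (sin_mono_small (1 / 100) (PI / 2 - b) ltac:(lra) ltac:(lra)). lra. }
  assert (H6 : Rabs (Re (odT (s, b) 1)) <= / 18 * / s).
  { eapply Rle_trans; [apply re_le_Cmod|]. eapply Rle_trans; [apply odT_le; cbn; lra|].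
    cbn [INR]. rewrite Re_pair. right. field. lra. }
  pose proof (Rabs_triang (0 + Re (odT (s, b) 0)) (Re (odT (s, b) 1))) as H7.
  rewrite Rplus_0_l in H2, H7.
  replace (/ (8 * (1 + 1) * s)) with (/ 16 * / s) in H2 by (field; lra).
  replace (/ (400 * s)) with (/ 400 * / s) by (field; lra).
  lra.
Qed.


Lemma cos_sin_INR_PI (k : nat) (x : R) :
  cos (INR k * PI - x) = (-1) ^ k * cos x /\ sin (INR k * PI - x) ^ 2 = sin x ^ 2.
Proof.
  assert (H : forall k, cos (INR k * PI) = (-1) ^ k /\ sin (INR k * PI) = 0).
  { induction k0 as [|n [IH1 IH2]].
    - cbn [INR]. rewrite Rmult_0_l, cos_0, sin_0. auto.
    - rewrite S_INR, Rmult_plus_distr_r, Rmult_1_l, neg_cos, neg_sin, IH1, IH2. cbn. split; ring. }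
  destruct (H k) as [h1 h2]. rewrite cos_minus, sin_minus, h1, h2. split; [ring|].
  assert (E : ((-1) ^ k) ^ 2 = 1).
  { rewrite <- pow_mult, Nat.mul_comm, pow_mult. replace ((-1) ^ 2) with 1 by ring. apply pow1. }
  transitivity (((-1) ^ k) ^ 2 * sin x ^ 2); [ring|rewrite E; ring].
Qed.

Lemma cos_odd_half_PI (i : nat) (x : R) :
  cos ((2 * INR i + 1) * (PI / 2) - x) = (-1) ^ i * sin x.
Proof.
  replace ((2 * INR i + 1) * (PI / 2) - x) with (INR i * PI - (x - PI / 2)) by field.
  rewrite (proj1 (cos_sin_INR_PI i _)). f_equal.
  rewrite <- cos_neg. replace (- (x - PI / 2)) with (PI / 2 - x) by ring. apply cos_shift.
Qed.

Lemma Rabs_pow_m1 (k : nat) : Rabs ((-1) ^ k) = 1.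
Proof. rewrite <- RPow_abs. replace (Rabs (-1)) with 1 by (rewrite Rabs_left; lra). apply pow1. Qed.

(* [phi] is the distance to the angle of i. *)
Lemma odT_near_i (phi : R) (i : nat) : 0 <= phi <= 1 / 100 -> (i < 20)%nat ->
  Rabs (Re (odT (s, PI / 2 - phi) i)
     - phi / (s ^ 2 + phi ^ 2) * ((-1) ^ i * / (2 * (2 * INR i + 1) ^ 2))) <= 10.
Proof.
  intros hp hi.
  assert (hm : 1 <= 2 * INR i + 1 <= 39).
  { pose proof (pos_INR i). assert (INR i <= INR 19) by (apply le_INR; lia).
    replace (INR 19) with 19 in H0 by (cbn; ring). lra. }
  rewrite Re_odT. set (m := 2 * INR i + 1) in *.
  replace (m * (PI / 2 - phi)) with (m * (PI / 2) - m * phi) by ring.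
  assert (ec : cos (m * (PI / 2) - m * phi) = (-1) ^ i * sin (m * phi))
    by (unfold m at 1; apply cos_odd_half_PI).
  rewrite ec.
  set (y := (m * s, - (m * phi)) : C).
  pose proof (Cinv_Csh_sub_inv_le y) as H.
  specialize (H ltac:(unfold y; rewrite Re_pair; nra)
    ltac:(unfold y; rewrite Im_pair, Rabs_Ropp, Rabs_pos_eq; nra)).
  pose proof (im_le_Cmod (/ Csh y - / y)%C) as H1.
  rewrite Im_minus in H1. unfold y in H1 at 1. rewrite Im_inv_Csh, (proj2 (Cinv_parts y)), Cmod_sqr in H1.
  unfold y in H1; rewrite Re_pair, Im_pair in H1. unfold csh_den in H1. rewrite sin_neg in H1.
  assert (hD : 0 < s ^ 2 + phi ^ 2) by nra.
  replace ((m * s) ^ 2 + (- (m * phi)) ^ 2) with (m ^ 2 * (s ^ 2 + phi ^ 2)) in H1 by ring.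
  replace (- - (m * phi) / (m ^ 2 * (s ^ 2 + phi ^ 2))) with (phi / (m * (s ^ 2 + phi ^ 2))) in H1
    by (field; lra).
  assert (E : ((-1) ^ i) ^ 2 = 1).
  { rewrite <- pow_mult, Nat.mul_comm, pow_mult. replace ((-1) ^ 2) with 1 by ring. apply pow1. }
  replace (((-1) ^ i * sin (m * phi)) ^ 2) with ((- sin (m * phi)) ^ 2)
    by (transitivity (((-1) ^ i) ^ 2 * sin (m * phi) ^ 2); [rewrite E; ring|ring]).
  set (P := - (cosh (m * s) * - sin (m * phi)) / (sinh (m * s) ^ 2 + (- sin (m * phi)) ^ 2)) in *.
  replace (/ (2 * m) * (cosh (m * s) * ((-1) ^ i * sin (m * phi)) /
     (sinh (m * s) ^ 2 + (- sin (m * phi)) ^ 2))) with (/ (2 * m) * ((-1) ^ i * P))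
    by (unfold P, Rdiv; ring).
  replace (phi / (s ^ 2 + phi ^ 2) * ((-1) ^ i * / (2 * m ^ 2)))
    with (/ (2 * m) * ((-1) ^ i * (phi / (m * (s ^ 2 + phi ^ 2))))) by (field; lra).
  set (Q := phi / (m * (s ^ 2 + phi ^ 2))) in *.
  replace (/ (2 * m) * ((-1) ^ i * P) - / (2 * m) * ((-1) ^ i * Q))
    with (/ (2 * m) * ((-1) ^ i * (P - Q))) by ring.
  rewrite !Rabs_mult, Rabs_pow_m1.
  rewrite (Rabs_pos_eq (/ (2 * m))) by (left; apply Rinv_0_lt_compat; lra).
  assert (/ (2 * m) <= / 2) by (apply Rinv_le_contravar; lra).
  assert (0 < / (2 * m)) by (apply Rinv_0_lt_compat; lra).
  fold y in H1. assert (hPQ : Rabs (P - Q) <= 20) by lra.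
  pose proof (Rabs_pos (P - Q)). nra.
Qed.

(** Each term of the even part is compared with its pole, once on the axis and once at
    distance [phi] from the angle of i, where the pole comes with an alternating sign. *)
Lemma evT_near_i (phi : R) (i : nat) : 0 <= phi <= 1 / 100 -> (i < 20)%nat ->
  / s * (/ (8 * INR (S i) ^ 2)) + s / (s ^ 2 + phi ^ 2) * ((-1) ^ i * / (8 * INR (S i) ^ 2)) - 10 <=
  Re (evT (RtoC s) i) - Re (evT (s, PI / 2 - phi) i).
Proof.
  intros hp hi.
  assert (hm : 1 <= INR (S i) <= 20).
  { rewrite S_INR. pose proof (pos_INR i). assert (INR i <= INR 19) by (apply le_INR; lia).
    replace (INR 19) with 19 in H0 by (cbn; ring). lra. }
  assert (hD : 0 < s ^ 2 + phi ^ 2) by nra.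
  assert (R1 : / s * (/ (8 * INR (S i) ^ 2)) - 5 <= Re (evT (RtoC s) i)).
  { set (m := INR (S i)) in *.
    set (y := RtoC (2 * m * s)).
    pose proof (Cinv_Csh_sub_inv_le y) as H.
    specialize (H ltac:(unfold y; rewrite Re_RtoC; nra)
      ltac:(unfold y; rewrite Im_RtoC, Rabs_R0; lra)).
    pose proof (re_le_Cmod (/ Csh y - / y)%C) as H1.
    unfold evT. rewrite Re_scal. fold m.
    replace (RtoC (2 * m) * RtoC s)%C with y by (unfold y; rewrite RtoC_mult; reflexivity).
    rewrite Re_minus in H1. unfold y in H1 at 2. rewrite <- RtoC_inv, Re_RtoC in H1 by nra.
    assert (H2 := Rle_abs (- (Re (/ Csh y)%C - / (2 * m * s)))). rewrite Rabs_Ropp in H2.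
    assert (0 < / (4 * m)) by (apply Rinv_0_lt_compat; lra).
    assert (/ (4 * m) <= / 4) by (apply Rinv_le_contravar; lra).
    replace (/ s * / (8 * m ^ 2)) with (/ (4 * m) * / (2 * m * s)) by (field; lra).
    nra. }
  assert (R2 : Re (evT (s, PI / 2 - phi) i) <=
     - (s / (s ^ 2 + phi ^ 2) * ((-1) ^ i * / (8 * INR (S i) ^ 2))) + 5).
  { rewrite Re_evT. unfold csh_den.
    replace (2 * INR (S i) * (PI / 2 - phi)) with (INR (S i) * PI - 2 * INR (S i) * phi) by field.
    destruct (cos_sin_INR_PI (S i) (2 * INR (S i) * phi)) as [e1 e2]. rewrite e1, e2.
    set (m := INR (S i)) in *.
    set (y := (2 * m * s, - (2 * m * phi)) : C).
    pose proof (Cinv_Csh_sub_inv_le y) as H.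
    specialize (H ltac:(unfold y; rewrite Re_pair; nra)
      ltac:(unfold y; rewrite Im_pair, Rabs_Ropp, Rabs_pos_eq; nra)).
    pose proof (re_le_Cmod (/ Csh y - / y)%C) as H1.
    rewrite Re_minus in H1. unfold y in H1 at 1. rewrite Re_inv_Csh, (proj1 (Cinv_parts y)), Cmod_sqr in H1.
    unfold y in H1; rewrite Re_pair, Im_pair in H1. unfold csh_den in H1.
    rewrite sin_neg, cos_neg in H1.
    replace ((2 * m * s) ^ 2 + (- (2 * m * phi)) ^ 2)
      with ((2 * m) ^ 2 * (s ^ 2 + phi ^ 2)) in H1 by ring.
    replace (2 * m * s / ((2 * m) ^ 2 * (s ^ 2 + phi ^ 2)))
      with (s / (2 * m * (s ^ 2 + phi ^ 2))) in H1 by (field; lra).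
    replace ((- sin (2 * m * phi)) ^ 2) with (sin (2 * m * phi) ^ 2) in H1 by ring.
    set (P := sinh (2 * m * s) * cos (2 * m * phi) / (sinh (2 * m * s) ^ 2 + sin (2 * m * phi) ^ 2)) in *.
    replace (/ (4 * m) * (sinh (2 * m * s) * ((-1) ^ S i * cos (2 * m * phi)) /
       (sinh (2 * m * s) ^ 2 + sin (2 * m * phi) ^ 2))) with (/ (4 * m) * ((-1) ^ S i * P))
      by (unfold P, Rdiv; ring).
    replace (s / (s ^ 2 + phi ^ 2) * ((-1) ^ i * / (8 * m ^ 2)))
      with (/ (4 * m) * ((-1) ^ i * (s / (2 * m * (s ^ 2 + phi ^ 2))))) by (field; lra).
    set (Q := s / (2 * m * (s ^ 2 + phi ^ 2))) in *.
    assert (0 < / (4 * m)) by (apply Rinv_0_lt_compat; lra).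
    assert (/ (4 * m) <= / 4) by (apply Rinv_le_contravar; lra).
    assert (H4 : (-1) ^ S i * P + (-1) ^ i * Q <= 20).
    { eapply Rle_trans; [apply Rle_abs|].
      replace ((-1) ^ S i * P + (-1) ^ i * Q) with ((-1) ^ S i * (P - Q)) by (cbn; ring).
      rewrite Rabs_mult, Rabs_pow_m1. fold y in H1. lra. }
    nra. }
  lra.
Qed.

(** The numerical input of [minor_arc_i]: these sums approximate half of Catalan's constant and,
    in [psum_ev_num], [PI^2/48] and [PI^2/96]. *)
Lemma psum_od_num : psum (fun i => (-1) ^ i * / (2 * (2 * INR i + 1) ^ 2)) 20 <= 4584 / 10000 /\
  0 <= psum (fun i => (-1) ^ i * / (2 * (2 * INR i + 1) ^ 2)) 20.
Proof. cbn [psum INR pow]. split; lra. Qed.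

Lemma psum_ev_num : 1990 / 10000 <= psum (fun i => / (8 * INR (S i) ^ 2)) 20 /\
  1020 / 10000 <= psum (fun i => (-1) ^ i * / (8 * INR (S i) ^ 2)) 20.
Proof. cbn [psum INR pow]. split; lra. Qed.

(** Near the angle of i both parts have poles, so neither term-by-term bounds nor the triangle
    inequality suffice: the alternating signs of the leading terms are needed, and lead to the
    positivity of a quadratic form in [s] and [phi]. *)
Lemma minor_arc_i (phi : R) : 0 <= phi <= 1 / 100 ->
  Re (evz (s, PI / 2 - phi)) + Rabs (Re (odz (s, PI / 2 - phi))) <=
    Re (evz (RtoC s)) - / (400 * s).
Proof.
  intros hp. pose proof s_inv_big as hbig.
  pose proof (evz_deficit s (PI / 2 - phi) 20 ltac:(lra)) as H1.
  pose proof (odz_tail s (PI / 2 - phi) 20 ltac:(lra) ltac:(lia)) as H2.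
  replace (INR 20) with 20 in H2 by (cbn; ring).
  set (D := s ^ 2 + phi ^ 2). assert (hD : 0 < D) by (unfold D; nra).
  pose proof psum_od_num as N1. pose proof psum_ev_num as N2.
  set (S := psum (fun i => (-1) ^ i * / (2 * (2 * INR i + 1) ^ 2)) 20) in *.
  set (A := psum (fun i => / (8 * INR (Datatypes.S i) ^ 2)) 20) in *.
  set (B := psum (fun i => (-1) ^ i * / (8 * INR (Datatypes.S i) ^ 2)) 20) in *.
  assert (H3 : Rabs (psum (fun i => Re (odT (s, PI / 2 - phi) i)) 20) <= phi / D * S + 200).
  { set (u := fun i => phi / D * ((-1) ^ i * / (2 * (2 * INR i + 1) ^ 2))).
    rewrite (psum_split _ u). eapply Rle_trans; [apply Rabs_triang|].
    apply Rplus_le_compat.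
    - unfold u. rewrite psum_scal. fold S. rewrite Rabs_pos_eq; [lra|].
      apply Rmult_le_pos; [|lra]. apply Rmult_le_pos; [lra|left; apply Rinv_0_lt_compat; exact hD].
    - eapply Rle_trans; [apply Rabs_psum_le with (b := fun _ => 10)|].
      + intros i hi. apply odT_near_i; assumption.
      + rewrite psum_const. replace (INR 20) with 20 by (cbn; ring). lra. }
  assert (H4 : / s * A + s / D * B - 200 <=
     psum (fun i => Re (evT (RtoC s) i) - Re (evT (s, PI / 2 - phi) i)) 20).
  { eapply Rle_trans; [|apply psum_le; intros i hi; apply evT_near_i; assumption].
    fold D. unfold Rminus.
    rewrite (psum_plus (fun i => / s * / (8 * INR (Datatypes.S i) ^ 2)
        + s / D * ((-1) ^ i * / (8 * INR (Datatypes.S i) ^ 2)))).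
    rewrite psum_plus, !psum_scal, psum_const. fold A B.
    replace (INR 20) with 20 by (cbn; ring). lra. }
  (* after multiplication by s D *)
  assert (Q : phi / D * S + / 160 * / s + / 400 * / s + 400 <= / s * A + s / D * B).
  { apply Rmult_le_reg_r with (s * D); [nra|].
    replace ((phi / D * S + / 160 * / s + / 400 * / s + 400) * (s * D))
      with (phi * S * s + (/ 160 + / 400 + 400 * s) * D) by (field; lra).
    replace ((/ s * A + s / D * B) * (s * D)) with (A * D + s ^ 2 * B) by (field; lra).
    assert (hps : 0 <= phi * s) by nra.
    assert (phi * S * s <= 4584 / 10000 * (phi * s)).
    { replace (phi * S * s) with (S * (phi * s)) by ring. apply Rmult_le_compat_r; lra. }
    assert (1902 / 10000 * D <= (A - / 160 - / 400 - 400 * s) * D).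
    { apply Rmult_le_compat_r; lra. }
    assert (1020 / 10000 * s ^ 2 <= s ^ 2 * B) by nra.
    assert (0 <= 1902 / 10000 * D + 1020 / 10000 * s ^ 2 - 4584 / 10000 * (phi * s)).
    { unfold D. pose proof (pow2_ge_0 (phi - 4584 / 3804 * s)) as hq.
      pose proof (pow2_ge_0 s) as hs2.
      replace (1902 / 10000 * (s ^ 2 + phi ^ 2) + 1020 / 10000 * s ^ 2 - 4584 / 10000 * (phi * s))
        with (1902 / 10000 * (phi - 4584 / 3804 * s) ^ 2
          + (2922 / 10000 - 1902 / 10000 * (4584 / 3804) ^ 2) * s ^ 2) by field.
      lra. }
    nra. }
  replace (/ (8 * 20 * s)) with (/ 160 * / s) in H2 by (field; lra).
  replace (/ (400 * s)) with (/ 400 * / s) by (field; lra).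
  lra.
Qed.

End MinorArc.

(** The first two ranges are separated at a fixed angle so small that no odd multiple of it
    with multiplier below 100 comes near [PI/2]. *)
Theorem minor_arc (s b : R) : 0 < s <= 1 / 10000000 -> s / 2 <= Rabs b <= PI / 2 ->
  Re (evz (s, b)) + Rabs (Re (odz (s, b))) <= Re (evz (RtoC s)) - / (400 * s).
Proof.
  intros hs hb.
  assert (e : Re (evz (s, b)) = Re (evz (s, Rabs b)) /\ Re (odz (s, b)) = Re (odz (s, Rabs b))).
  { unfold Rabs. destruct (Rcase_abs b); [|auto].
    rewrite Re_evz_even, Re_odz_even. auto. }
  rewrite (proj1 e), (proj2 e). set (c := Rabs b) in *. clear e.
  destruct (Rle_dec c (1 / 100)) as [h1|h1]; [apply minor_arc_near; lra|].
  destruct (Rle_dec c (PI / 2 - 1 / 100)) as [h2|h2]; [apply minor_arc_middle; lra|].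
  replace c with (PI / 2 - (PI / 2 - c)) by ring. apply minor_arc_i; lra.
Qed.

(** * The coefficients as integrals *)

Lemma is_series_Re (a : nat -> C) (l : C) :
  is_series (V := C_NormedModule) a l -> is_series (fun n => Re (a n)) (Re l).
Proof.
  intros h.
  assert (hc : filterlim (fun c : C => Re c) (locally l) (locally (Re l))).
  { apply (continuous_fst (U := R_UniformSpace) (V := R_UniformSpace) (fst l) (snd l)). }
  pose proof (filterlim_comp _ _ _ (sum_n a) (fun c : C => Re c) _ _ _ h hc) as H.
  eapply filterlim_ext; [|exact H].
  intros n. cbv beta. induction n as [|n IH].
  - rewrite !sum_O. reflexivity.
  - rewrite !sum_Sn, <- IH. reflexivity.
Qed.

Lemma Cexp_real (x : R) : Cexp (RtoC x) = RtoC (exp x).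
Proof. apply C_ext; unfold Cexp; autorewrite with cplx; rewrite ?cos_0, ?sin_0; ring. Qed.

Lemma lim0_bounded (u : nat -> R) : is_lim_seq u 0 -> exists M, 0 < M /\ forall n, Rabs (u n) <= M.
Proof.
  intros h. apply is_lim_seq_spec in h. destruct (h (mkposreal 1 Rlt_0_1)) as [N hN].
  cbn [pos] in hN.
  assert (F : forall n, exists M, 0 < M /\ forall k, (k < n)%nat -> Rabs (u k) <= M).
  { induction n as [|n (M & hM & IH)].
    - exists 1. split; [lra|intros; lia].
    - exists (M + Rabs (u n)). pose proof (Rabs_pos (u n)). split; [lra|].
      intros k hk. destruct (Nat.eq_dec k n) as [->|e]; [lra|].
      specialize (IH k ltac:(lia)). lra. }
  destruct (F N) as (M & hM & hF). exists (M + 1). split; [lra|].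
  intros n. destruct (Nat.lt_ge_cases n N) as [h1|h1].
  - specialize (hF n h1). lra.
  - specialize (hN n h1). rewrite Rminus_0_r in hN. lra.
Qed.

(** Equations between reals may be stated over the carrier of a normed module, where [ring] does
    not recognize them. *)
Ltac eqR := match goal with |- @eq _ ?a ?b => change (@eq R a b) end.

Section Coefficients.
Variable g : nat -> R.
Hypothesis Hg : forall q : C, Cmod q < 1 ->
     is_pseries (fun n => RtoC (g n)) q
       (Cinv (qpoch_inf2 q (Copp (Cpow q 3)) (Cpow q 4))).

Lemma pow_n_Cpow (q : C) (k : nat) : pow_n (K := C_Ring) q k = (q ^ k)%C.
Proof. induction k as [|k IH]; [reflexivity|]. cbn [pow_n Cpow]. rewrite IH. reflexivity. Qed.

Lemma g_series (q : C) : Cmod q < 1 ->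
  is_series (V := C_NormedModule) (fun k => (q ^ k * RtoC (g k))%C) (Cexp (ev_log q + od_log q)).
Proof.
  intros h. rewrite <- gen_fun_exp by assumption.
  eapply is_series_ext; [|exact (Hg q h)].
  intros k. cbv beta. rewrite pow_n_Cpow. reflexivity.
Qed.

Lemma g_bound (t : R) : 0 < t -> exists M, 0 < M /\ forall k, Rabs (g k) <= M * exp (INR k * t).
Proof.
  intros h.
  assert (hq : Cmod (Cexp (RtoC (- t))) < 1).
  { rewrite Cmod_Cexp, Re_RtoC, <- exp_0. apply exp_increasing; lra. }
  pose proof (is_series_Re _ _ (g_series _ hq)) as H.
  assert (hl : is_lim_seq (fun k => exp (- (INR k * t)) * g k) 0).
  { apply ex_series_lim_0. eexists. eapply is_series_ext; [|exact H].
    intros k. cbv beta. rewrite Cexp_pow, <- RtoC_mult, Cexp_real, Re_scal, Re_RtoC. f_equal.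
    f_equal. ring. }
  destruct (lim0_bounded _ hl) as (M & hM & hb). exists M. split; [assumption|].
  intros k. specialize (hb k). rewrite Rabs_mult, (Rabs_pos_eq (exp _)) in hb by (left; apply exp_pos).
  rewrite exp_Ropp in hb. pose proof (exp_pos (INR k * t)) as he.
  apply Rmult_le_reg_l with (/ exp (INR k * t)); [apply Rinv_0_lt_compat; assumption|].
  replace (/ exp (INR k * t) * (M * exp (INR k * t))) with M by (field; lra). exact hb.
Qed.

(** The values of the generating function at [q = e^(-s + i th)] and at [-q]; integrating both over
    half a circle brings the two dominant points [1] and [-1] together at [th = 0]. *)
Definition circle_val (s th : R) : C := Cexp (evz (s, - th) + odz (s, - th)).
Definition circle_opp (s th : R) : C := Cexp (evz (s, - th) - odz (s, - th)).

Definition Cis (t : R) : C := Cexp (0, t).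

Definition kernel (n : nat) (s th : R) : R :=
  Re (Cis (- (INR n * th)) * (circle_val s th + RtoC ((-1) ^ n) * circle_opp s th))%C.

Definition kernel_term (n : nat) (s th : R) (k : nat) : R :=
  g k * exp (- (INR k * s)) * (1 + (-1) ^ n * (-1) ^ k) * cos ((INR k - INR n) * th).

Lemma Cexp_neg_point (s th : R) : 0 < s -> Cmod (Cexp (- (s, - th))) < 1.
Proof. intros h. apply Cmod_Cexp_neg. exact h. Qed.

Lemma kernel_series (n : nat) (s th : R) : 0 < s ->
  is_series (kernel_term n s th) (kernel n s th).
Proof.
  intros hs. set (q := Cexp (- (s, - th))).
  assert (hq : Cmod q < 1) by (apply Cexp_neg_point; assumption).
  assert (hq' : Cmod (- q)%C < 1) by (rewrite Cmod_opp; assumption).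
  pose proof (g_series q hq) as H1. pose proof (g_series (- q)%C hq') as H2.
  rewrite ev_log_opp, od_log_opp in H2 by assumption.
  unfold q in H1 at 2 3. unfold q in H2 at 2 3.
  rewrite !ev_log_evz, !od_log_odz in H1 by exact hs.
  rewrite !ev_log_evz, !od_log_odz in H2 by exact hs.
  pose proof (is_series_plus (V := C_NormedModule) _ _ _ _ H1
    (is_series_scal (V := C_NormedModule) (RtoC ((-1) ^ n)) _ _ H2)) as H3.
  pose proof (is_series_scal (V := C_NormedModule) (Cis (- (INR n * th))) _ _ H3) as H4.
  apply is_series_Re in H4.
  eapply is_series_ext; [|exact H4].
  intros k. cbv beta. unfold kernel_term.
  change (Re (Cis (- (INR n * th)) *
    ((q ^ k * RtoC (g k)) + RtoC ((-1) ^ n) * ((- q) ^ k * RtoC (g k))))%C =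
    g k * exp (- (INR k * s)) * (1 + (-1) ^ n * (-1) ^ k) * cos ((INR k - INR n) * th)).
  replace (- q)%C with (RtoC (-1) * q)%C by (rewrite RtoC_m1; ring).
  rewrite Cpow_mult_l, <- RtoC_pow.
  replace (Cis (- (INR n * th)) * (q ^ k * g k + RtoC ((-1) ^ n) * (RtoC ((-1) ^ k) * q ^ k * g k)))%C
    with (RtoC (g k * (1 + (-1) ^ n * (-1) ^ k)) * (Cis (- (INR n * th)) * q ^ k))%C.
  2:{ rewrite RtoC_mult, RtoC_plus, RtoC_mult. ring. }
  unfold q, Cis. rewrite Cexp_pow, <- Cexp_plus, Re_scal.
  unfold Cexp at 1. rewrite Re_pair, Re_plus, Im_plus, Re_scal, Im_scal, Re_opp, Im_opp, !Re_pair, !Im_pair.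
  replace (0 + INR k * - s) with (- (INR k * s)) by ring.
  replace (- (INR n * th) + INR k * - - th) with ((INR k - INR n) * th) by ring. ring.
Qed.

Lemma kernel_term_le (n : nat) (s th M : R) (k : nat) : 0 < s ->
  (forall k, Rabs (g k) <= M * exp (INR k * (s / 2))) ->
  Rabs (kernel_term n s th k) <= 2 * M * exp (- (s / 2)) ^ k.
Proof.
  intros hs hM. unfold kernel_term. rewrite !Rabs_mult.
  rewrite (Rabs_pos_eq (exp _)) by (left; apply exp_pos).
  assert (h1 : Rabs (1 + (-1) ^ n * (-1) ^ k) <= 2).
  { eapply Rle_trans; [apply Rabs_triang|]. rewrite Rabs_mult, !Rabs_pow_m1, Rabs_R1. lra. }
  assert (h2 : Rabs (cos ((INR k - INR n) * th)) <= 1) by (apply Rabs_le, COS_bound).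
  assert (h3 : Rabs (g k) * exp (- (INR k * s)) <= M * exp (- (s / 2)) ^ k).
  { apply Rle_trans with (M * exp (INR k * (s / 2)) * exp (- (INR k * s))).
    - apply Rmult_le_compat_r; [left; apply exp_pos|apply hM].
    - rewrite Rmult_assoc, <- exp_plus, <- exp_INR.
      replace (INR k * (s / 2) + - (INR k * s)) with (INR k * - (s / 2)) by field. lra. }
  pose proof (Rabs_pos (g k)). pose proof (exp_pos (- (INR k * s))).
  assert (0 <= Rabs (g k) * exp (- (INR k * s))) by nra.
  pose proof (Rabs_pos (1 + (-1) ^ n * (-1) ^ k)). pose proof (Rabs_pos (cos ((INR k - INR n) * th))).
  set (x := Rabs (g k) * exp (- (INR k * s))) in *.
  set (c1 := Rabs (1 + (-1) ^ n * (-1) ^ k)) in *. set (c2 := Rabs (cos _)) in *.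
  apply Rle_trans with (x * 2 * 1); [|lra].
  apply Rmult_le_compat; try nra.
Qed.

Lemma is_RInt_cos_zero (c : R) : c <> 0 -> sin (c * (PI / 2)) = 0 ->
  is_RInt (fun t => cos (c * t)) (- (PI / 2)) (PI / 2) 0.
Proof.
  intros hc h.
  replace 0 with (minus (sin (c * (PI / 2)) / c) (sin (c * (- (PI / 2))) / c)).
  - apply (is_RInt_derive (fun t => sin (c * t) / c)).
    + intros t _. auto_derive; [auto|]. field. assumption.
    + intros t _. apply (ex_derive_continuous (fun t => cos (c * t))). auto_derive. auto.
  - change (sin (c * (PI / 2)) / c - sin (c * - (PI / 2)) / c = 0).
    replace (c * - (PI / 2)) with (- (c * (PI / 2))) by ring. rewrite sin_neg, h.
    field. assumption.
Qed.

(** Over half a period only the coefficient of index n survives: odd differences of indices are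
    killed by the sign factor, and nonzero even ones integrate to 0. *)
Lemma kernel_term_RInt (n : nat) (s : R) (k : nat) :
  is_RInt (fun th => kernel_term n s th k) (- (PI / 2)) (PI / 2)
    (if Nat.eq_dec k n then 2 * PI * (g n * exp (- (INR n * s))) else 0).
Proof.
  unfold kernel_term. destruct (Nat.eq_dec k n) as [->|hkn].
  - apply is_RInt_ext with (fun _ => 2 * (g n * exp (- (INR n * s)))).
    + intros t _. replace ((INR n - INR n) * t) with 0 by ring. rewrite cos_0.
      replace ((-1) ^ n * (-1) ^ n) with 1; [eqR; ring|].
      rewrite <- Rpow_mult_distr. replace (-1 * -1) with 1 by ring. symmetry; apply pow1.
    + replace (2 * PI * (g n * exp (- (INR n * s))))
        with ((PI / 2 - - (PI / 2)) * (2 * (g n * exp (- (INR n * s))))) by field.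
      apply (is_RInt_const (V := R_NormedModule)).
  - set (c := INR k - INR n).
    assert (hc : c <> 0) by (unfold c; intros e; apply hkn, INR_eq; lra).
    destruct (Nat.Even_or_Odd (k + n)) as [[j hj]|[j hj]].
    + replace 0 with ((g k * exp (- (INR k * s)) * (1 + (-1) ^ n * (-1) ^ k)) * 0) by ring.
      apply (is_RInt_scal (V := R_NormedModule) (fun th => cos (c * th))).
      apply is_RInt_cos_zero; [exact hc|].
      replace (c * (PI / 2)) with (INR j * PI - INR n * PI).
      * destruct (cos_sin_INR_PI j (INR n * PI)) as [_ e].
        destruct (cos_sin_INR_PI n 0) as [_ e0]. rewrite Rminus_0_r, sin_0 in e0.
        rewrite e0 in e. nra.
      * unfold c. apply (f_equal INR) in hj. rewrite plus_INR, mult_INR in hj. cbn [INR] in hj.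
        replace (INR k) with (2 * INR j - INR n) by lra. field.
    + apply is_RInt_ext with (fun _ => 0).
      * intros t _. replace ((-1) ^ n * (-1) ^ k) with (-1); [eqR; ring|].
        rewrite <- pow_add, Nat.add_comm, hj, pow_add, pow_mult.
        replace ((-1) ^ 2) with 1 by ring. rewrite pow1. ring.
      * pose proof (is_RInt_const (V := R_NormedModule) (- (PI / 2)) (PI / 2) 0) as hz.
        change (scal (PI / 2 - - (PI / 2)) 0) with ((PI / 2 - - (PI / 2)) * 0) in hz.
        rewrite Rmult_0_r in hz. exact hz.
Qed.

Lemma kernel_sum_RInt (n : nat) (s : R) (N : nat) : (n <= N)%nat ->
  is_RInt (fun th => sum_n (kernel_term n s th) N) (- (PI / 2)) (PI / 2)
    (2 * PI * (g n * exp (- (INR n * s)))).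
Proof.
  set (v := 2 * PI * (g n * exp (- (INR n * s)))).
  assert (H : forall N, is_RInt (fun th => sum_n (kernel_term n s th) N) (- (PI / 2)) (PI / 2)
    (if le_lt_dec n N then v else 0)).
  { induction N0 as [|N0 IH].
    - apply is_RInt_ext with (fun th => kernel_term n s th 0).
      + intros; rewrite sum_O; reflexivity.
      + pose proof (kernel_term_RInt n s 0) as h. fold v in h.
        destruct (Nat.eq_dec 0 n) as [e|e]; destruct (le_lt_dec n 0); try lia; exact h.
    - apply is_RInt_ext with (fun th => plus (sum_n (kernel_term n s th) N0) (kernel_term n s th (S N0))).
      + intros; rewrite sum_Sn; reflexivity.
      + assert (h : is_RInt (fun th => plus (sum_n (kernel_term n s th) N0) (kernel_term n s th (S N0)))
          (- (PI / 2)) (PI / 2) ((if le_lt_dec n N0 then v else 0) + (if Nat.eq_dec (S N0) n then v else 0)))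
          by exact (is_RInt_plus _ _ _ _ _ _ IH (kernel_term_RInt n s (S N0))).
        destruct (Nat.eq_dec (S N0) n); destruct (le_lt_dec n N0); destruct (le_lt_dec n (S N0));
          try lia; rewrite ?Rplus_0_l, ?Rplus_0_r in h; exact h. }
  intros hN. specialize (H N). destruct (le_lt_dec n N); [exact H|lia].
Qed.

Theorem coef_integral (n : nat) (s : R) : 0 < s ->
  is_RInt (kernel n s) (- (PI / 2)) (PI / 2) (2 * PI * (g n * exp (- (INR n * s)))).
Proof.
  intros hs.
  destruct (g_bound (s / 2) ltac:(lra)) as (M & hM & hb).
  set (r := exp (- (s / 2))).
  assert (hr : 0 < r < 1) by (apply exp_neg_lt1; lra).
  set (v := 2 * PI * (g n * exp (- (INR n * s)))).
  assert (hex : ex_series (fun k => 2 * M * r ^ k)).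
  { apply ex_series_scalR, ex_series_geom. rewrite Rabs_pos_eq; lra. }
  assert (hunif : filterlim (fun N => (fun th => sum_n (kernel_term n s th) (n + N)) : R -> R_CompleteNormedModule)
    eventually (locally (T := fct_UniformSpace R R_CompleteNormedModule) (kernel n s))).
  { apply filterlim_locally. intros eps.
    destruct (series_tail_small (fun k => 2 * M * r ^ k) eps hex) as (N & hN & ht).
    { intros k. pose proof (pow_lt r k). nra. }
    { apply cond_pos. }
    exists N. intros m hm th.
    change (Rabs (minus (sum_n (kernel_term n s th) (n + m)) (kernel n s th)) < eps).
    pose proof (kernel_series n s th hs) as hk.
    assert (hexk : ex_series (kernel_term n s th)) by (eexists; exact hk).
    apply is_series_unique in hk. rewrite <- hk.
    rewrite (Series_incr_n (kernel_term n s th) (S (n + m))) by (lia || assumption).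
    cbn [Init.Nat.pred]. rewrite <- sum_n_Reals.
    replace (minus (sum_n (kernel_term n s th) (n + m))
      (sum_n (kernel_term n s th) (n + m) + Series (fun k => kernel_term n s th (S (n + m) + k)%nat)))
      with (- Series (fun k => kernel_term n s th (S (n + m) + k)%nat))
      by (unfold minus, plus, opp; cbn; ring).
    rewrite Rabs_Ropp.
    (* the tail beyond n + m is dominated by the tail beyond N *)
    eapply Rle_lt_trans; [|exact ht].
    assert (hexN : ex_series (fun k => 2 * M * r ^ (N + k)%nat))
      by (apply (ex_series_incr_n (fun k => 2 * M * r ^ k) N); exact hex).
    assert (hle : forall k, Rabs (kernel_term n s th (S (n + m) + k)%nat) <= 2 * M * r ^ (N + k)%nat).
    { intros k. eapply Rle_trans; [apply kernel_term_le with (M := M); [exact hs|exact hb]|].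
      fold r. apply Rmult_le_compat_l; [lra|]. apply pow_mono_exp; [lra|lia]. }
    eapply Rle_trans; [apply Series_Rabs|].
    - apply ex_series_dom with (2 := hexN). intros k. rewrite Rabs_Rabsolu. apply hle.
    - apply Series_le; [|exact hexN]. intros k; split; [apply Rabs_pos|apply hle]. }
  destruct (filterlim_RInt (V := R_CompleteNormedModule)
    (fun N => (fun th => sum_n (kernel_term n s th) (n + N)) : R -> R_CompleteNormedModule)
    (- (PI / 2)) (PI / 2) eventually _ (kernel n s) (fun _ => v)) as (If & h1 & h2).
  - intros N. apply kernel_sum_RInt. lia.
  - exact hunif.
  - replace v with If; [exact h2|].
    apply (filterlim_locally_unique (V := R_CompleteNormedModule) (F := eventually) (fun _ => v)).
    + exact h1.
    + apply filterlim_const.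
Qed.

End Coefficients.

(** * The saddle point estimate *)

Lemma exp_mono (x y : R) : x <= y -> exp x <= exp y.
Proof. intros [h|h]; [left; apply exp_increasing; exact h|rewrite h; lra]. Qed.

Lemma Cexp_sub_le (a b : C) (m : R) : Re a <= m -> Re b <= m ->
  Cmod (Cexp a - Cexp b)%C <= Cmod (a - b)%C * exp m.
Proof.
  intros ha hb.
  replace (Cexp a - Cexp b)%C with (Cexp b * (Cexp (a - b) - 1))%C.
  2:{ replace a with (b + (a - b))%C at 2 by ring. rewrite Cexp_plus. ring. }
  rewrite Cmod_mult, Cmod_Cexp.
  apply Rle_trans with (exp (Re b) * (Cmod (a - b)%C * exp (Rmax 0 (Re (a - b)%C)))).
  - apply Rmult_le_compat_l; [left; apply exp_pos|apply Cexp_sub1_le].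
  - replace (exp (Re b) * (Cmod (a - b)%C * exp (Rmax 0 (Re (a - b)%C))))
      with (Cmod (a - b)%C * (exp (Re b) * exp (Rmax 0 (Re (a - b)%C)))) by ring.
    rewrite <- exp_plus. apply Rmult_le_compat_l; [apply Cmod_ge_0|].
    apply exp_mono. rewrite Re_minus.
    destruct (Rle_dec 0 (Re a - Re b)); [rewrite Rmax_right|rewrite Rmax_left]; lra.
Qed.

Lemma evz_real (s : R) : 0 < s -> evz (RtoC s) = RtoC (Re (evz (RtoC s))).
Proof.
  intros h. apply C_ext; [reflexivity|]. unfold evz, Csum. rewrite Im_pair, Im_RtoC.
  rewrite (Series_ext _ (fun i => 0 * 0)); [rewrite Series_scal_l; ring|].
  intros i. rewrite evT_real, Im_RtoC by assumption. ring.
Qed.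

Lemma odz_real (s : R) : 0 < s -> odz (RtoC s) = RtoC (Re (odz (RtoC s))).
Proof.
  intros h. apply C_ext; [reflexivity|]. unfold odz, Csum. rewrite Im_pair, Im_RtoC.
  rewrite (Series_ext _ (fun i => 0 * 0)); [rewrite Series_scal_l; ring|].
  intros i. rewrite odT_real, Im_RtoC by assumption. ring.
Qed.

Lemma odz_nonneg (s : R) : 0 < s -> 0 <= Re (odz (RtoC s)).
Proof.
  intros h. unfold odz, Csum. rewrite Re_pair. apply Series_nonneg.
  - intros i. rewrite odT_real, Re_RtoC by assumption. pose proof (INR_odd_pos i).
    pose proof (cosh_ge_1 ((2 * INR i + 1) * s)).
    apply Rmult_le_pos; left; apply Rinv_0_lt_compat; lra.
  - apply Cabs_conv_Re, Cabs_conv_odT. exact h.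
Qed.

Lemma zeta2_ge_1 : 1 <= zeta2.
Proof.
  pose proof (psum_le_Series (fun i => / INR (S i) ^ 2) 1) as H.
  cbn [psum INR] in H. unfold zeta2. eapply Rle_trans; [|apply H].
  - right. field.
  - intros i. left. apply Rinv_0_lt_compat, pow_lt, INR_S_pos.
  - apply ex_series_inv_sqr.
Qed.

(** [1/(1-iu) - 1 - iu] agrees with [-u^2] up to the third order. *)
Lemma saddle_exponent (N s th : R) : 0 < s ->
  let u := th / s in
  let X := ((0, - (N * u))%R + RtoC (N * s) * (/ (s, - th)%R - / RtoC s))%C in
  Re X = - (N * u ^ 2 / (1 + u ^ 2)) /\ Im X = - (N * u ^ 3 / (1 + u ^ 2)).
Proof.
  intros hs u X.
  assert (hu : 0 < 1 + u ^ 2) by nra.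
  assert (ht : th = u * s) by (unfold u; field; lra).
  assert (hd : s ^ 2 + th ^ 2 = s ^ 2 * (1 + u ^ 2)) by (rewrite ht; ring).
  unfold X. rewrite Re_plus, Im_plus, Re_scal, Im_scal, Re_minus, Im_minus, Re_pair, Im_pair.
  rewrite (proj1 (Cinv_parts (s, (- th)%R))), (proj2 (Cinv_parts (s, (- th)%R))), Cmod_sqr.
  rewrite Re_pair, Im_pair, <- RtoC_inv, Re_RtoC, Im_RtoC by lra.
  replace (s ^ 2 + (- th) ^ 2) with (s ^ 2 * (1 + u ^ 2)) by (rewrite <- hd; ring).
  rewrite ht. split; field; split; lra.
Qed.

Lemma exp_ge_cubic (y : R) : 0 <= y -> 1 + y + y ^ 2 / 2 + y ^ 3 / 6 <= exp y.
Proof.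
  intros h.
  assert (P1 : forall y, 0 <= y -> 0 <= exp y - (1 + y)).
  { intros t _. pose proof (exp_ineq1_le t). lra. }
  assert (P2 : forall y, 0 <= y -> 0 <= exp y - (1 + y + y ^ 2 / 2)).
  { intros x hx. apply (nonneg_of_deriv (fun t => exp t - (1 + t + t ^ 2 / 2)) (fun t => exp t - (1 + t))).
    - exact hx.
    - intros t _. auto_derive; [auto|]. field.
    - intros t ht. apply P1; lra.
    - rewrite exp_0. field. }
  cut (0 <= exp y - (1 + y + y ^ 2 / 2 + y ^ 3 / 6)); [lra|].
  apply (nonneg_of_deriv (fun t => exp t - (1 + t + t ^ 2 / 2 + t ^ 3 / 6)) (fun t => exp t - (1 + t + t ^ 2 / 2))).
  - exact h.
  - intros t _. auto_derive; [auto|]. field.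
  - intros t ht. apply P2; lra.
  - rewrite exp_0. field.
Qed.

Lemma gauss_cubic_le (v : R) : 0 <= v ->
  (v ^ 3 + 2 * v) * exp (- (4 / 5 * v ^ 2)) <= 7 * / (1 + v ^ 2).
Proof.
  intros h. pose proof (exp_ge_cubic (4 / 5 * v ^ 2) ltac:(nra)) as H.
  rewrite exp_Ropp. pose proof (exp_pos (4 / 5 * v ^ 2)).
  set (E := exp _) in *.
  apply Rmult_le_reg_r with (E * (1 + v ^ 2)); [nra|].
  replace ((v ^ 3 + 2 * v) * / E * (E * (1 + v ^ 2))) with ((v ^ 3 + 2 * v) * (1 + v ^ 2)) by (field; lra).
  replace (7 * / (1 + v ^ 2) * (E * (1 + v ^ 2))) with (7 * E) by (field; nra).
  apply Rle_trans with (1 / 2 * v ^ 6 + 2 * v ^ 4 + 5 / 2 * v ^ 2 + 1).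
  - pose proof (pow2_ge_0 (v - 1)). pose proof (pow2_ge_0 (v ^ 2 - v)).
    pose proof (pow2_ge_0 (v ^ 3 - v ^ 2)). nra.
  - assert (0 <= v ^ 2) by nra. assert (0 <= v ^ 4) by (replace (v ^ 4) with (v ^ 2 * v ^ 2) by ring; nra).
    assert (0 <= v ^ 6) by (replace (v ^ 6) with (v ^ 3 * v ^ 3) by ring; nra).
    replace ((4 / 5 * v ^ 2) ^ 2) with (16 / 25 * v ^ 4) in H by field.
    replace ((4 / 5 * v ^ 2) ^ 3) with (64 / 125 * v ^ 6) in H by field.
    lra.
Qed.

Lemma gauss_le (v : R) : exp (- (4 / 5 * v ^ 2)) <= 5 / 4 * / (1 + v ^ 2).
Proof.
  pose proof (exp_ineq1_le (4 / 5 * v ^ 2)). pose proof (pow2_ge_0 v).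
  rewrite exp_Ropp.
  replace (5 / 4 * / (1 + v ^ 2)) with (/ (4 / 5 * (1 + v ^ 2))) by (field; lra).
  apply Rinv_le_contravar; lra.
Qed.

Section Saddle.
Variable n : nat.
Variable s : R.
Hypothesis hs : 0 < s <= 1 / 10000000.
Let N := INR n * s.
Hypothesis hN : N = zeta2 / 8 / s.
Let E0 := Re (evz (RtoC s)) + Re (odz (RtoC s)).
Let w := exp (- (2 * Re (odz (RtoC s)))).
Let c := sqrt N / s.

Lemma N_pos : 0 < N.
Proof.
  rewrite hN. pose proof zeta2_ge_1. apply Rmult_lt_0_compat; [lra|apply Rinv_0_lt_compat; lra].
Qed.

Lemma kernel_split (th : R) : exists r1 r2 : C,
  kernel n s th = Re r1 + (-1) ^ n * Re r2 /\
  r1 = Cexp ((0, - (N * (th / s)))%R + evz (s, - th)%R + odz (s, - th)%R)%C /\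
  r2 = Cexp ((0, - (N * (th / s)))%R + evz (s, - th)%R - odz (s, - th)%R)%C.
Proof.
  eexists; eexists; split; [|split; reflexivity].
  assert (e : N * (th / s) = INR n * th) by (unfold N; field; lra).
  rewrite e. unfold kernel, circle_val, circle_opp, Cis.
  rewrite Cmult_plus_distr_l.
  replace (Cexp (0, - (INR n * th))%R * (RtoC ((-1) ^ n) * Cexp (evz (s, - th)%R - odz (s, - th)%R)))%C
    with (RtoC ((-1) ^ n) * (Cexp (0, - (INR n * th))%R * Cexp (evz (s, - th)%R - odz (s, - th)%R)))%C by ring.
  rewrite <- !Cexp_plus, Re_plus, Re_scal.
  f_equal; [|f_equal]; do 2 f_equal; ring.
Qed.

(** At q the exponent is [-v^2] up to the third order term of the saddle and the two logarithmic
    errors, all of the order of [(v^3 + v) / sqrt N]; the point [-q] only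
    contributes a term smaller by the factor w. A multiple of [1/(1+v^2)] is used as majorant
    because its integral is an arctangent. *)
Lemma kernel_center (th : R) : Rabs th <= s / 2 ->
  Rabs (exp (- E0) * kernel n s th - exp (- (c * th) ^ 2))
    <= (21 / sqrt N + 4 * w) * / (1 + (c * th) ^ 2).
Proof.
  intros hth. pose proof N_pos as hNp.
  destruct (kernel_split th) as (r1 & r2 & ek & e1 & e2).
  set (u := th / s) in *.
  assert (hu : Rabs u <= 1 / 2).
  { unfold u, Rdiv at 1. rewrite Rabs_mult, (Rabs_pos_eq (/ s)) by (left; apply Rinv_0_lt_compat; lra).
    apply Rmult_le_reg_r with s; [lra|]. rewrite Rmult_assoc, Rinv_l by lra. lra. }
  pose proof (Rabs_pos u) as hu0.
  set (z := (s, - th)%R : C).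
  assert (hz : Rabs (Im z) / Re z = Rabs u).
  { unfold z, u, Rdiv. rewrite Re_pair, Im_pair, Rabs_Ropp, Rabs_mult, (Rabs_pos_eq (/ s)); [reflexivity|].
    left; apply Rinv_0_lt_compat; lra. }
  pose proof (evz_sub_le z ltac:(cbn; lra) ltac:(cbn; rewrite Rabs_Ropp; lra)) as H1.
  pose proof (odz_sub_le z ltac:(cbn; lra) ltac:(cbn; rewrite Rabs_Ropp; lra)) as H2.
  rewrite hz in H1, H2. change (Re z) with s in H1, H2.
  set (D1 := (evz z - evz (RtoC s) - RtoC (zeta2 / 8) * (/ z - / RtoC s))%C) in *.
  set (D2 := (odz z - odz (RtoC s))%C) in *.
  destruct (saddle_exponent N s th ltac:(lra)) as [x1 x2].
  set (X := ((0, - (N * (th / s)))%R + RtoC (N * s) * (/ (s, - th)%R - / RtoC s))%C) in *.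
  fold u in x1, x2.
  assert (hNs : N * s = zeta2 / 8) by (rewrite hN; field; lra).
  assert (a1 : ((0, - (N * u))%R + evz z + odz z = X + D1 + D2 + RtoC E0)%C).
  { unfold X, D1, D2, E0. rewrite hNs, RtoC_plus, <- evz_real, <- odz_real by lra. fold u z. ring. }
  assert (a2 : ((0, - (N * u))%R + evz z - odz z = X + D1 - D2 + RtoC (- (2 * Re (odz (RtoC s)))) + RtoC E0)%C).
  { unfold X, D1, D2, E0. rewrite hNs, RtoC_opp, RtoC_mult, RtoC_plus, <- evz_real, <- odz_real by lra.
    fold u z. ring. }
  fold z in e1, e2. rewrite a1, Cexp_plus, Cexp_real in e1. rewrite a2, Cexp_plus, Cexp_real in e2.
  assert (hEE : exp (- E0) * exp E0 = 1) by (rewrite <- exp_plus, Rplus_opp_l; apply exp_0).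
  assert (f1 : exp (- E0) * Re r1 = Re (Cexp (X + D1 + D2)%C)).
  { rewrite e1, Cmult_comm, Re_scal, <- Rmult_assoc, hEE. ring. }
  assert (f2 : exp (- E0) * Re r2 = Re (Cexp (X + D1 - D2 + RtoC (- (2 * Re (odz (RtoC s)))))%C)).
  { rewrite e2, Cmult_comm, Re_scal, <- Rmult_assoc, hEE. ring. }
  (* v = sqrt N |u| is the Gaussian variable *)
  set (q := sqrt N) in *.
  assert (hq : q * q = N) by (apply sqrt_sqrt; lra).
  assert (hq0 : 0 < q) by (apply sqrt_lt_R0; exact hNp).
  set (v := q * Rabs u).
  assert (hv0 : 0 <= v) by (unfold v; nra).
  assert (hv : (c * th) ^ 2 = v ^ 2).
  { unfold v. rewrite !Rpow_mult_distr, pow2_abs. unfold c, u. fold q. field. lra. }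
  assert (hNu : N * u ^ 2 = v ^ 2).
  { unfold v. rewrite Rpow_mult_distr, pow2_abs, <- hq. ring. }
  rewrite hv.
  set (m := - (4 / 5 * v ^ 2) + 1).
  assert (hu2 : 0 <= u ^ 2 <= 1 / 4) by (rewrite <- (pow2_abs u); nra).
  assert (rX : Re X <= - (4 / 5 * v ^ 2)).
  { rewrite x1, hNu. apply Ropp_le_contravar.
    apply Rmult_le_reg_r with (1 + u ^ 2); [lra|].
    replace (v ^ 2 / (1 + u ^ 2) * (1 + u ^ 2)) with (v ^ 2) by (field; lra).
    pose proof (pow2_ge_0 v). nra. }
  pose proof (re_le_Cmod D1) as rD1. pose proof (re_le_Cmod D2) as rD2.
  pose proof (Rle_abs (Re D1)). pose proof (Rle_abs (Re D2)).
  pose proof (Rle_abs (- Re D2)) as rD3. rewrite Rabs_Ropp in rD3.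
  assert (B1 : Rabs (Re (Cexp (X + D1 + D2)%C) - exp (- v ^ 2)) <= (N * Rabs u ^ 3 + 2 * Rabs u) * exp m).
  { replace (exp (- v ^ 2)) with (Re (Cexp (RtoC (- v ^ 2)))) by (rewrite Cexp_real; reflexivity).
    rewrite <- Re_minus. eapply Rle_trans; [apply re_le_Cmod|].
    eapply Rle_trans; [apply Cexp_sub_le with (m := m)|].
    - rewrite !Re_plus. unfold m. lra.
    - rewrite Re_RtoC. unfold m. pose proof (pow2_ge_0 v). lra.
    - apply Rmult_le_compat_r; [left; apply exp_pos|].
      replace (X + D1 + D2 - RtoC (- v ^ 2))%C with ((X - RtoC (- v ^ 2)) + (D1 + D2))%C by ring.
      eapply Rle_trans; [apply Cmod_triangle|].
      apply Rplus_le_compat; [|eapply Rle_trans; [apply Cmod_triangle|lra]].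
      assert (ha3 : 0 <= Rabs u ^ 3) by (apply pow_le; lra).
      apply Cmod_le_of_sqr; [nra|].
      rewrite Cmod_sqr, Re_minus, Im_minus, x1, x2, Re_RtoC, Im_RtoC, <- hNu.
      replace (- (N * u ^ 2 / (1 + u ^ 2)) - - (N * u ^ 2)) with (N * u ^ 4 * / (1 + u ^ 2)) by (field; lra).
      replace (- (N * u ^ 3 / (1 + u ^ 2)) - 0) with (- (N * u ^ 3 * / (1 + u ^ 2))) by (field; lra).
      replace ((N * u ^ 4 * / (1 + u ^ 2)) ^ 2 + (- (N * u ^ 3 * / (1 + u ^ 2))) ^ 2)
        with ((N ^ 2 * u ^ 6) * / (1 + u ^ 2)) by (field; lra).
      replace ((N * Rabs u ^ 3) ^ 2) with (N ^ 2 * u ^ 6).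
      2:{ rewrite Rpow_mult_distr. f_equal. replace (u ^ 6) with ((u ^ 2) ^ 3) by ring.
          rewrite <- (pow2_abs u). ring. }
      assert (0 <= N ^ 2 * u ^ 6).
      { apply Rmult_le_pos; [nra|]. replace (u ^ 6) with ((u ^ 3) ^ 2) by ring. apply pow2_ge_0. }
      rewrite <- (Rmult_1_r (N ^ 2 * u ^ 6)) at 2. apply Rmult_le_compat_l; [assumption|].
      rewrite <- Rinv_1. apply Rinv_le_contravar; lra. }
  assert (B2 : Rabs (Re (Cexp (X + D1 - D2 + RtoC (- (2 * Re (odz (RtoC s)))))%C)) <= w * exp m).
  { eapply Rle_trans; [apply re_le_Cmod|]. rewrite Cmod_Cexp. unfold w. rewrite <- exp_plus.
    apply exp_mono. rewrite Re_plus, Re_minus, Re_plus, Re_RtoC. unfold m. lra. }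
  assert (Em : exp m = exp 1 * exp (- (4 / 5 * v ^ 2))).
  { unfold m. rewrite exp_plus. ring. }
  rewrite Em in B1, B2.
  pose proof exp_le_3. pose proof (exp_pos 1).
  pose proof (gauss_cubic_le v hv0) as G1. pose proof (gauss_le v) as G2.
  assert (hw : 0 < w) by apply exp_pos.
  set (G := exp (- (4 / 5 * v ^ 2))) in *. assert (hG : 0 < G) by apply exp_pos.
  set (I := / (1 + v ^ 2)) in *.
  assert (hI : 0 < I) by (apply Rinv_0_lt_compat; pose proof (pow2_ge_0 v); lra).
  replace (exp (- E0) * kernel n s th - exp (- v ^ 2))
    with ((Re (Cexp (X + D1 + D2)%C) - exp (- v ^ 2)) +
      (-1) ^ n * Re (Cexp (X + D1 - D2 + RtoC (- (2 * Re (odz (RtoC s)))))%C)).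
  2:{ rewrite ek, <- f1, <- f2. ring. }
  eapply Rle_trans; [apply Rabs_triang|]. rewrite Rabs_mult, Rabs_pow_m1, Rmult_1_l.
  assert (K1 : N * Rabs u ^ 3 + 2 * Rabs u = (v ^ 3 + 2 * v) / q).
  { unfold v. rewrite <- hq. field. lra. }
  rewrite K1 in B1.
  assert (K2 : (v ^ 3 + 2 * v) / q * (exp 1 * G) <= 21 / q * I).
  { replace ((v ^ 3 + 2 * v) / q * (exp 1 * G)) with (/ q * (exp 1 * ((v ^ 3 + 2 * v) * G))) by (field; lra).
    replace (21 / q * I) with (/ q * (3 * (7 * I))) by (field; lra).
    apply Rmult_le_compat_l; [left; apply Rinv_0_lt_compat; lra|].
    apply Rmult_le_compat; try lra.
    apply Rmult_le_pos; [|lra]. pose proof (pow_le v 3 hv0). lra. }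
  assert (K3 : w * (exp 1 * G) <= 4 * w * I).
  { rewrite (Rmult_comm 4), Rmult_assoc. apply Rmult_le_compat_l; [lra|].
    apply Rle_trans with (3 * G); [apply Rmult_le_compat_r; lra|lra]. }
  lra.
Qed.

Lemma kernel_far (th : R) : s / 2 <= Rabs th <= PI / 2 ->
  Rabs (exp (- E0) * kernel n s th - exp (- (c * th) ^ 2)) <= 3 * exp (- (/ (400 * s))).
Proof.
  intros hth. pose proof N_pos as hNp.
  destruct (kernel_split th) as (r1 & r2 & ek & e1 & e2).
  pose proof (minor_arc s (- th) hs) as H. rewrite Rabs_Ropp in H. specialize (H hth).
  set (z := (s, - th)%R : C) in *.
  pose proof (odz_nonneg s ltac:(lra)) as ho.
  pose proof (Rle_abs (Re (odz z))) as q1. pose proof (Rle_abs (- Re (odz z))) as q2. rewrite Rabs_Ropp in q2.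
  assert (b1 : Rabs (Re r1) <= exp (E0 - / (400 * s))).
  { eapply Rle_trans; [apply re_le_Cmod|]. rewrite e1, Cmod_Cexp. apply exp_mono.
    rewrite !Re_plus, Re_pair. unfold E0. lra. }
  assert (b2 : Rabs (Re r2) <= exp (E0 - / (400 * s))).
  { eapply Rle_trans; [apply re_le_Cmod|]. rewrite e2, Cmod_Cexp. apply exp_mono.
    rewrite Re_minus, Re_plus, Re_pair. unfold E0. lra. }
  set (e := exp (- (/ (400 * s)))).
  assert (hE : exp (- E0) * exp (E0 - / (400 * s)) = e).
  { unfold e. rewrite <- exp_plus. f_equal. ring. }
  assert (b3 : exp (- (c * th) ^ 2) <= e).
  { apply exp_mono. apply Ropp_le_contravar.
    assert (E : (c * th) ^ 2 = N * (th / s) ^ 2).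
    { unfold c. replace ((sqrt N / s * th) ^ 2) with (sqrt N * sqrt N * (th / s) ^ 2) by (field; lra).
      rewrite sqrt_sqrt; lra. }
    rewrite E.
    assert (1 / 4 <= (th / s) ^ 2).
    { rewrite <- (pow2_abs (th / s)). unfold Rdiv at 2. rewrite Rabs_mult.
      rewrite (Rabs_pos_eq (/ s)) by (left; apply Rinv_0_lt_compat; lra).
      assert (1 / 2 <= Rabs th * / s); [|nra].
      apply Rmult_le_reg_r with s; [lra|]. rewrite Rmult_assoc, Rinv_l by lra. lra. }
    apply Rle_trans with (N * (1 / 4)); [|apply Rmult_le_compat_l; lra].
    rewrite hN. pose proof zeta2_ge_1.
    apply Rle_trans with (1 / 8 / s * (1 / 4)).
    - replace (1 / 8 / s * (1 / 4)) with (/ (32 * s)) by (field; lra). apply Rinv_le_contravar; lra.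
    - apply Rmult_le_compat_r; [lra|]. apply Rmult_le_compat_r; [left; apply Rinv_0_lt_compat; lra|lra]. }
  rewrite ek. pose proof (exp_pos (- E0)) as hp. pose proof (exp_pos (- (c * th) ^ 2)).
  replace (exp (- E0) * (Re r1 + (-1) ^ n * Re r2) - exp (- (c * th) ^ 2))
    with (exp (- E0) * Re r1 + (-1) ^ n * (exp (- E0) * Re r2) + - exp (- (c * th) ^ 2)) by ring.
  eapply Rle_trans; [apply Rabs_triang|]. rewrite Rabs_Ropp.
  pose proof (Rabs_triang (exp (- E0) * Re r1) ((-1) ^ n * (exp (- E0) * Re r2))) as T.
  rewrite !Rabs_mult, Rabs_pow_m1, Rmult_1_l, (Rabs_pos_eq (exp (- E0))) in T by lra.
  rewrite (Rabs_pos_eq (exp (- (c * th) ^ 2))) by lra.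
  assert (exp (- E0) * Rabs (Re r1) <= e) by (rewrite <- hE; apply Rmult_le_compat_l; lra).
  assert (exp (- E0) * Rabs (Re r2) <= e) by (rewrite <- hE; apply Rmult_le_compat_l; lra).
  lra.
Qed.

Definition gauss_int (V : R) : R := RInt (fun v => exp (- v ^ 2)) (- V) V.

Lemma ex_RInt_gauss (a b : R) : ex_RInt (fun v => exp (- v ^ 2)) a b.
Proof.
  apply (ex_RInt_continuous (V := R_CompleteNormedModule)).
  intros x _. apply (ex_derive_continuous (fun v => exp (- v ^ 2))). auto_derive. auto.
Qed.

(** Integration of [kernel_center] and [kernel_far] over half a circle, in the variable [c th]. *)
Theorem saddle_estimate (g : nat -> R)
  (Hg : forall q : C, Cmod q < 1 ->
     is_pseries (fun n => RtoC (g n)) q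
       (Cinv (qpoch_inf2 q (Copp (Cpow q 3)) (Cpow q 4)))) :
  Rabs (2 * PI * c * (g n * exp (- N) * exp (- E0)) - gauss_int (c * (PI / 2)))
   <= PI * (21 / sqrt N + 4 * w) + 3 * PI * (c * exp (- (/ (400 * s)))).
Proof.
  pose proof N_pos as hNp. pose proof PI_RGT_0 as hPI.
  assert (hq0 : 0 < sqrt N) by (apply sqrt_lt_R0; exact hNp).
  assert (hc : 0 < c) by (unfold c; apply Rmult_lt_0_compat; [assumption|apply Rinv_0_lt_compat; lra]).
  pose proof (coef_integral g Hg n s ltac:(lra)) as H1. fold N in H1.
  set (B := 21 / sqrt N + 4 * w). set (e := exp (- (/ (400 * s)))).
  assert (hw : 0 < w) by apply exp_pos.
  assert (hB : 0 < B).
  { unfold B. assert (0 < 21 / sqrt N); [|lra]. apply Rmult_lt_0_compat; [lra|apply Rinv_0_lt_compat; lra]. }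
  assert (he : 0 < e) by apply exp_pos.
  set (k := fun th => c * exp (- E0) * kernel n s th).
  assert (I1 : is_RInt k (- (PI / 2)) (PI / 2) (c * exp (- E0) * (2 * PI * (g n * exp (- N))))).
  { apply (is_RInt_scal (V := R_NormedModule)). exact H1. }
  assert (I2 : is_RInt (fun th => c * exp (- (c * th) ^ 2)) (- (PI / 2)) (PI / 2) (gauss_int (c * (PI / 2)))).
  { pose proof (is_RInt_comp_lin (V := R_NormedModule) (fun v => exp (- v ^ 2)) c 0 (- (PI / 2)) (PI / 2)
      (gauss_int (c * (PI / 2)))) as h.
    eapply is_RInt_ext; [|apply h].
    - intros x _. cbv beta. rewrite Rplus_0_r. reflexivity.
    - rewrite !Rplus_0_r. unfold gauss_int.
      replace (c * - (PI / 2)) with (- (c * (PI / 2))) by ring.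
      apply (RInt_correct (V := R_CompleteNormedModule)), ex_RInt_gauss. }
  assert (I3 : is_RInt (fun th => B * (c * / (1 + (c * th) ^ 2)) + 3 * c * e) (- (PI / 2)) (PI / 2)
     ((B * atan (c * (PI / 2)) + 3 * c * e * (PI / 2)) - (B * atan (c * - (PI / 2)) + 3 * c * e * (- (PI / 2))))).
  { apply (is_RInt_derive (fun th => B * atan (c * th) + 3 * c * e * th)).
    - intros x _. auto_derive; [auto|]. field. nra.
    - intros x _. apply (ex_derive_continuous (fun th => B * (c * / (1 + (c * th) ^ 2)) + 3 * c * e)).
      auto_derive. pose proof (pow2_ge_0 (c * x)). cbn in *. lra. }
  pose proof (is_RInt_minus _ _ _ _ _ _ I1 I2) as I4.
  assert (hpt : forall th, - (PI / 2) <= th <= PI / 2 ->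
    Rabs (k th - c * exp (- (c * th) ^ 2)) <= B * (c * / (1 + (c * th) ^ 2)) + 3 * c * e).
  { intros th hth.
    replace (k th - c * exp (- (c * th) ^ 2)) with (c * (exp (- E0) * kernel n s th - exp (- (c * th) ^ 2)))
      by (unfold k; ring).
    rewrite Rabs_mult, (Rabs_pos_eq c) by lra.
    assert (hI : 0 < / (1 + (c * th) ^ 2)).
    { apply Rinv_0_lt_compat. pose proof (pow2_ge_0 (c * th)). lra. }
    replace (B * (c * / (1 + (c * th) ^ 2)) + 3 * c * e) with (c * (B * / (1 + (c * th) ^ 2) + 3 * e)) by ring.
    apply Rmult_le_compat_l; [lra|].
    assert (0 < B * / (1 + (c * th) ^ 2)) by (apply Rmult_lt_0_compat; assumption).
    destruct (Rle_dec (Rabs th) (s / 2)) as [h|h].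
    - pose proof (kernel_center th h). fold B in H0. lra.
    - assert (hab : Rabs th <= PI / 2) by (apply Rabs_le; lra).
      pose proof (kernel_far th ltac:(lra)). fold e in H0. lra. }
  replace (2 * PI * c * (g n * exp (- N) * exp (- E0)))
    with (c * exp (- E0) * (2 * PI * (g n * exp (- N)))) by ring.
  pose proof (atan_bound (c * (PI / 2))) as A1. pose proof (atan_bound (c * - (PI / 2))) as A2.
  set (L := c * exp (- E0) * (2 * PI * (g n * exp (- N)))) in *.
  set (G := gauss_int (c * (PI / 2))) in *.
  change (is_RInt (fun y => k y - c * exp (- (c * y) ^ 2)) (- (PI / 2)) (PI / 2) (L - G)) in I4.
  set (T := (B * atan (c * (PI / 2)) + 3 * c * e * (PI / 2)) - (B * atan (c * - (PI / 2)) + 3 * c * e * (- (PI / 2)))) in *.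
  assert (hT : T <= PI * B + 3 * PI * (c * e)).
  { unfold T. nra. }
  assert (U : L - G <= T).
  { apply (is_RInt_le _ _ (- (PI / 2)) (PI / 2) _ _ ltac:(lra) I4 I3).
    intros x hx. eapply Rle_trans; [apply Rle_abs|]. apply hpt; lra. }
  assert (W : - T <= L - G).
  { pose proof (is_RInt_opp _ _ _ _ I3) as I5.
    apply (is_RInt_le _ _ (- (PI / 2)) (PI / 2) _ _ ltac:(lra) I5 I4).
    intros x hx. pose proof (hpt x ltac:(lra)) as h. apply Rabs_le_between in h. apply h. }
  apply Rabs_le. lra.
Qed.

End Saddle.

(** * Behaviour of the two logarithms on the real axis *)

Lemma ln_series (A : R) : Rabs A < 1 ->
  is_series (fun n => A ^ S n / INR (S n)) (- ln (1 - A)).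
Proof.
  intros h.
  assert (hC : Cmod (RtoC A) < 1) by (rewrite Cmod_R; exact h).
  assert (e : forall n, log_term (RtoC A) n = RtoC (A ^ S n / INR (S n))).
  { intros n. unfold log_term. rewrite <- RtoC_pow, <- RtoC_div; [reflexivity|].
    pose proof (INR_S_pos n). lra. }
  assert (hex : ex_series (fun n => A ^ S n / INR (S n))).
  { apply ex_series_ext with (fun n => Re (log_term (RtoC A) n)); [intros; rewrite e; reflexivity|].
    apply Cabs_conv_Re, Cabs_conv_log, hC. }
  pose proof (Cexp_log_series (RtoC A) hC) as H.
  set (S0 := Series (fun n => A ^ S n / INR (S n))).
  assert (hS : Csum (log_term (RtoC A)) = RtoC S0).
  { unfold Csum, S0. apply C_ext; autorewrite with cplx.
    - apply Series_ext; intros; rewrite e; reflexivity.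
    - rewrite (Series_ext _ (fun n => 0 * 0)); [rewrite Series_scal_l; ring|].
      intros; rewrite e; autorewrite with cplx; ring. }
  rewrite hS, Cexp_real in H.
  replace (1 - RtoC A)%C with (RtoC (1 - A)) in H by (rewrite RtoC_minus; reflexivity).
  rewrite <- RtoC_mult in H. apply RtoC_inj in H.
  apply Rabs_def2 in h. pose proof (exp_pos S0).
  replace (- ln (1 - A)) with S0; [apply Series_correct; exact hex|].
  rewrite <- ln_Rinv by lra.
  replace (/ (1 - A)) with (exp S0); [symmetry; apply ln_exp|].
  apply Rmult_eq_reg_l with (1 - A); [|lra]. rewrite H. field. lra.
Qed.

Definition l1 (x : R) : R := ln (1 + exp (- x)).
Definition l2 (x : R) : R := - ln (1 - exp (- x)).
(** The inverse hyperbolic tangent of [e^(-x)]. *)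
Definition hart (x : R) : R := (l1 x + l2 x) / 2.

Lemma exp_mult_nat (x : R) (n : nat) : exp (- x) ^ n = exp (- (INR n * x)).
Proof. rewrite <- exp_INR. f_equal. ring. Qed.

Lemma l1_series (x : R) : 0 < x ->
  is_series (fun n => (-1) ^ n / INR (S n) * exp (- (INR (S n) * x))) (l1 x).
Proof.
  intros h. pose proof (exp_neg_lt1 x h) as hr.
  pose proof (ln_series (- exp (- x))) as H. rewrite Rabs_Ropp, Rabs_pos_eq in H by lra.
  specialize (H ltac:(lra)). replace (1 - - exp (- x)) with (1 + exp (- x)) in H by ring.
  apply is_series_opp in H. unfold opp in H; cbn -[INR pow] in H. rewrite Ropp_involutive in H.
  eapply is_series_ext; [|exact H]. intros n. cbv beta. eqR.
  replace (- exp (- x)) with (-1 * exp (- x)) by ring.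
  rewrite Rpow_mult_distr, exp_mult_nat. cbn [pow]. unfold Rdiv. ring.
Qed.

Lemma hart_series (x : R) : 0 < x ->
  is_series (fun i => / (2 * INR i + 1) * exp (- ((2 * INR i + 1) * x))) (hart x).
Proof.
  intros h. pose proof (exp_neg_lt1 x h) as hr.
  pose proof (l1_series x h) as H1.
  pose proof (ln_series (exp (- x))) as H2. rewrite Rabs_pos_eq in H2 by lra.
  specialize (H2 ltac:(lra)).
  pose proof (is_series_scal_l (/ 2) _ _ (is_series_pairs _ _ (is_series_plus _ _ _ _ H1 H2))) as H.
  unfold hart. replace ((l1 x + l2 x) / 2) with (/ 2 * (l1 x + l2 x)) by field.
  eapply is_series_ext; [|exact H]. intros i. cbv beta.
  change (/ 2 * (((-1) ^ (2 * i) / INR (S (2 * i)) * exp (- (INR (S (2 * i)) * x))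
      + exp (- x) ^ S (2 * i) / INR (S (2 * i)))
     + ((-1) ^ (2 * i + 1) / INR (S (2 * i + 1)) * exp (- (INR (S (2 * i + 1)) * x))
      + exp (- x) ^ S (2 * i + 1) / INR (S (2 * i + 1)))) =
     / (2 * INR i + 1) * exp (- ((2 * INR i + 1) * x))).
  rewrite !exp_mult_nat, pow_add, pow_mult. replace ((-1) ^ 2) with 1 by ring. rewrite pow1.
  assert (e : INR (S (2 * i)) = 2 * INR i + 1) by (rewrite S_INR, mult_INR; cbn [INR]; ring).
  rewrite e. pose proof (INR_odd_pos i). pose proof (INR_S_pos (2 * i + 1)). field. lra.
Qed.

(** Summing a Dirichlet-type series over an alternating arithmetic progression of arguments. *)
Lemma alt_exchange (c m : nat -> R) (s t : R) : 0 < s -> 0 < t ->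
  (forall n, Rabs (c n) <= 1) -> (forall n, INR (S n) <= m n) ->
  is_lim_seq (psum (fun j => (-1) ^ j * Series (fun n => c n * exp (- (m n * (s + INR j * t))))))
    (Series (fun n => c n * exp (- (m n * s)) / (1 + exp (- (m n * t))))).
Proof.
  intros hs ht hc hm.
  set (r := fun n => exp (- (m n * t))).
  set (v := fun n => c n * exp (- (m n * s)) / (1 + r n)).
  assert (hmp : forall n, 0 < m n) by (intros n; specialize (hm n); pose proof (INR_S_pos n); lra).
  assert (hr : forall n, 0 < r n <= exp (- t)).
  { intros n. split; [apply exp_pos|]. apply exp_mono. specialize (hm n). rewrite S_INR in hm.
    pose proof (pos_INR n). nra. }
  pose proof (exp_neg_lt1 t ht) as het.
  destruct (series_exp_all s hs) as [hex _].
  assert (hdom : forall x n, s <= x -> Rabs (c n * exp (- (m n * x))) <= exp (- (INR (S n) * s))).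
  { intros x n hx. rewrite Rabs_mult, (Rabs_pos_eq (exp _)) by (left; apply exp_pos).
    assert (exp (- (m n * x)) <= exp (- (INR (S n) * s))).
    { apply exp_mono. specialize (hm n). specialize (hmp n). pose proof (INR_S_pos n). nra. }
    specialize (hc n). pose proof (Rabs_pos (c n)). pose proof (exp_pos (- (m n * x))). nra. }
  assert (hv : forall n, Rabs (v n) <= exp (- (INR (S n) * s))).
  { intros n. unfold v, Rdiv. rewrite Rabs_mult. destruct (hr n) as [r1 r2].
    rewrite (Rabs_pos_eq (/ (1 + r n))) by (left; apply Rinv_0_lt_compat; lra).
    assert (/ (1 + r n) <= 1) by (rewrite <- Rinv_1; apply Rinv_le_contravar; lra).
    specialize (hdom s n ltac:(lra)).
    pose proof (Rabs_pos (c n * exp (- (m n * s)))). nra. }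
  assert (exv : ex_series v) by (apply ex_series_dom with (2 := hex); exact hv).
  assert (hpow : forall J n, Rabs ((- r n) ^ J) <= exp (- t) ^ J).
  { intros J n. rewrite <- RPow_abs, Rabs_Ropp. destruct (hr n). rewrite Rabs_pos_eq by lra.
    apply pow_incr; lra. }
  assert (hpow1 : forall J, 0 <= exp (- t) ^ J <= 1) by (intros J; apply pow_le_1; lra).
  assert (exvJ : forall J, ex_series (fun n => v n * (- r n) ^ J)).
  { intros J. apply ex_series_dom with (2 := hex). intros n. rewrite Rabs_mult.
    specialize (hv n). specialize (hpow J n). specialize (hpow1 J).
    pose proof (Rabs_pos (v n)). pose proof (Rabs_pos ((- r n) ^ J)). nra. }
  assert (hps : forall J, psum (fun j => (-1) ^ j * Series (fun n => c n * exp (- (m n * (s + INR j * t))))) J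
     = Series v - Series (fun n => v n * (- r n) ^ J)).
  { induction J as [|J IH].
    - cbn [psum]. rewrite (Series_ext (fun n => v n * (- r n) ^ 0) v) by (intros; cbn; ring). ring.
    - cbn [psum]. rewrite IH, <- Series_scal_l.
      assert (E : Series (fun n => (-1) ^ J * (c n * exp (- (m n * (s + INR J * t))))) =
        Series (fun n => v n * (- r n) ^ J) - Series (fun n => v n * (- r n) ^ S J)).
      { rewrite <- Series_minus by apply exvJ. apply Series_ext. intros n.
        unfold v. destruct (hr n) as [r1 r2].
        replace (- (m n * (s + INR J * t))) with (- (m n * s) + INR J * - (m n * t)) by ring.
        rewrite exp_plus, exp_INR. fold (r n).
        replace (- r n) with (-1 * r n) by ring. rewrite !Rpow_mult_distr. cbn [pow]. field. lra. }
      rewrite E. ring. }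
  apply is_lim_seq_ext with (fun J => Series v - Series (fun n => v n * (- r n) ^ J));
    [intros; symmetry; apply hps|].
  replace (Finite (Series _)) with (Finite (Series v - 0)) by (f_equal; unfold v, r; ring).
  apply is_lim_seq_minus'; [apply is_lim_seq_const|].
  set (K := Series (fun n => exp (- (INR (S n) * s)))).
  apply is_lim_seq_abs_0.
  apply is_lim_seq_le_le with (fun _ => 0) (fun J => K * exp (- t) ^ J).
  - intros J. split; [apply Rabs_pos|].
    assert (hle : forall n, Rabs (v n * (- r n) ^ J) <= exp (- (INR (S n) * s)) * exp (- t) ^ J).
    { intros n. rewrite Rabs_mult. apply Rmult_le_compat; auto using Rabs_pos. }
    assert (hexJ : ex_series (fun n => exp (- (INR (S n) * s)) * exp (- t) ^ J)).
    { apply ex_series_ext with (fun n => exp (- t) ^ J * exp (- (INR (S n) * s))); [intros; eqR; ring|].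
      apply ex_series_scalR, hex. }
    eapply Rle_trans; [apply Series_Rabs|].
    + apply ex_series_dom with (2 := hexJ). intros n. rewrite Rabs_Rabsolu. apply hle.
    + unfold K. rewrite <- Series_scal_r. apply Series_le; [|exact hexJ].
      intros n; split; [apply Rabs_pos|apply hle].
  - apply is_lim_seq_const.
  - apply is_lim_seq_scal0. apply is_lim_seq_geom. rewrite Rabs_pos_eq; lra.
Qed.

(** For a convex null sequence every difference of even index dominates the next one, so the
    alternating sum is at least half of the first term. *)
Lemma alt_lower (a : nat -> R) (A : R) :
  (forall j, a (S j) - a (S (S j)) <= a j - a (S j)) -> is_lim_seq a 0 ->
  is_lim_seq (psum (fun j => (-1) ^ j * a j)) A -> a 0%nat / 2 <= A.
Proof.
  intros hcv h0 hA.
  assert (E : forall K, (a 0%nat - a (2 * K)%nat) / 2 <= psum (fun j => (-1) ^ j * a j) (2 * K)).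
  { induction K as [|K IH]; [cbn; lra|].
    replace (2 * S K)%nat with (S (S (2 * K))) by lia. cbn [psum].
    assert (e : (-1) ^ (2 * K) = 1).
    { rewrite pow_mult. replace ((-1) ^ 2) with 1 by ring. apply pow1. }
    cbn [pow]. rewrite e. specialize (hcv (2 * K)%nat). lra. }
  assert (H : Rbar_le (a 0%nat / 2) A); [|exact H].
  apply (is_lim_seq_le (fun K => (a 0%nat - a (2 * K)%nat) / 2)
    (fun K => psum (fun j => (-1) ^ j * a j) (2 * K)) _ _ E).
  - replace (Finite (a 0%nat / 2)) with (Rbar_mult (Finite (a 0%nat - 0)) (Finite (/ 2)))
      by (cbn; f_equal; field).
    apply is_lim_seq_scal_r. apply is_lim_seq_minus'; [apply is_lim_seq_const|].
    apply (is_lim_seq_subseq a 0 (fun K => (2 * K)%nat)); [|exact h0].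
    apply eventually_subseq. intros; lia.
  - apply (is_lim_seq_subseq (psum (fun j => (-1) ^ j * a j)) A (fun K => (2 * K)%nat)); [|exact hA].
    apply eventually_subseq. intros; lia.
Qed.

Lemma psum_shift (a : nat -> R) (p n : nat) : psum a (p + n) = psum a p + psum (fun j => a (p + j)%nat) n.
Proof.
  induction n as [|n IH]; [rewrite Nat.add_0_r; cbn; ring|].
  rewrite Nat.add_succ_r. cbn [psum]. rewrite IH. ring.
Qed.

(** [alt_lower] applied to the tails that start at an even and at an odd index. *)
Lemma alt_sandwich (a : nat -> R) (A : R) (M : nat) :
  (forall j, a (S j) - a (S (S j)) <= a j - a (S j)) -> is_lim_seq a 0 ->
  is_lim_seq (psum (fun j => (-1) ^ j * a j)) A ->
  psum (fun j => (-1) ^ j * a j) (2 * M) + a (2 * M)%nat / 2 <= A /\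
  A <= psum (fun j => (-1) ^ j * a j) (2 * M + 1) - a (2 * M + 1)%nat / 2.
Proof.
  intros hcv h0 hA.
  assert (G : forall p sg, (-1) ^ p = sg -> sg * sg = 1 ->
    a p / 2 <= sg * (A - psum (fun j => (-1) ^ j * a j) p)).
  { intros p sg hsg hsq.
    pose proof (alt_lower (fun j => a (p + j)%nat) (sg * (A - psum (fun j => (-1) ^ j * a j) p))) as H.
    cbv beta in H. rewrite Nat.add_0_r in H. apply H.
    - intros j. rewrite !Nat.add_succ_r. apply hcv.
    - apply is_lim_seq_ext with (fun j => a (j + p)%nat); [intros; f_equal; lia|].
      apply (is_lim_seq_incr_n a p), h0.
    - apply is_lim_seq_ext with (fun n => sg * (psum (fun j => (-1) ^ j * a j) (n + p)
         - psum (fun j => (-1) ^ j * a j) p)).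
      + intros n. rewrite Nat.add_comm, psum_shift.
        replace (psum (fun j => (-1) ^ (p + j) * a (p + j)%nat) n)
          with (sg * psum (fun j => (-1) ^ j * a (p + j)%nat) n).
        * transitivity ((sg * sg) * psum (fun j => (-1) ^ j * a (p + j)%nat) n); [ring|rewrite hsq; ring].
        * rewrite <- psum_scal. clear - hsg. induction n as [|n IH]; [reflexivity|].
          cbn [psum]. rewrite IH, pow_add, hsg. ring.
      + apply (is_lim_seq_scal_l _ sg (A - psum (fun j => (-1) ^ j * a j) p)).
        apply is_lim_seq_minus'; [|apply is_lim_seq_const].
        apply (is_lim_seq_incr_n (psum (fun j => (-1) ^ j * a j)) p), hA. }
  assert (e : (-1) ^ (2 * M) = 1).
  { rewrite pow_mult. replace ((-1) ^ 2) with 1 by ring. apply pow1. }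
  split.
  - pose proof (G (2 * M)%nat 1 e ltac:(ring)). lra.
  - assert (e' : (-1) ^ (2 * M + 1) = -1) by (rewrite pow_add, e; ring).
    pose proof (G (2 * M + 1)%nat (-1) e' ltac:(ring)). lra.
Qed.

Lemma ln_mono (x y : R) : 0 < x -> x <= y -> ln x <= ln y.
Proof. intros h [h1|h1]; [left; apply ln_increasing; assumption|rewrite h1; lra]. Qed.

Lemma l1_convex (x d : R) : l1 (x + d) - l1 (x + d + d) <= l1 x - l1 (x + d).
Proof.
  unfold l1. pose proof (exp_pos (- x)) as h1. pose proof (exp_pos (- d)) as h2.
  replace (- (x + d)) with (- x + - d) by ring.
  replace (- (x + d + d)) with (- x + - d + - d) by ring.
  rewrite !exp_plus. set (X := exp (- x)) in *. set (r := exp (- d)) in *.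
  cut (ln ((1 + X * r) * (1 + X * r)) <= ln ((1 + X) * (1 + X * r * r))).
  - rewrite !ln_mult by nra. lra.
  - apply ln_mono; [nra|]. assert (0 <= X * (1 - r) ^ 2) by (apply Rmult_le_pos; [lra|apply pow2_ge_0]). nra.
Qed.

Lemma l2_convex (x d : R) : 0 < x -> 0 < d -> l2 (x + d) - l2 (x + d + d) <= l2 x - l2 (x + d).
Proof.
  intros hx hd. unfold l2. pose proof (exp_neg_lt1 x hx) as h1. pose proof (exp_neg_lt1 d hd) as h2.
  replace (- (x + d)) with (- x + - d) by ring.
  replace (- (x + d + d)) with (- x + - d + - d) by ring.
  rewrite !exp_plus. set (X := exp (- x)) in *. set (r := exp (- d)) in *.
  assert (0 < X * r < 1) by nra. assert (0 < X * r * r < 1) by nra.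
  cut (ln ((1 - X) * (1 - X * r * r)) <= ln ((1 - X * r) * (1 - X * r))).
  - rewrite !ln_mult by lra. lra.
  - apply ln_mono; [nra|]. assert (0 <= X * (1 - r) ^ 2) by (apply Rmult_le_pos; [lra|apply pow2_ge_0]). nra.
Qed.

Lemma hart_convex (x d : R) : 0 < x -> 0 < d ->
  hart (x + d) - hart (x + d + d) <= hart x - hart (x + d).
Proof.
  intros hx hd. pose proof (l1_convex x d). pose proof (l2_convex x d hx hd). unfold hart. lra.
Qed.

Lemma is_lim_seq_exp_arith (x d : R) : 0 < d -> is_lim_seq (fun j => exp (- (x + INR j * d))) 0.
Proof.
  intros h. apply is_lim_seq_ext with (fun j => exp (- x) * exp (- d) ^ j).
  - intros j. rewrite exp_mult_nat, <- exp_plus. f_equal. ring.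
  - apply is_lim_seq_scal0. apply is_lim_seq_geom.
    pose proof (exp_neg_lt1 d h). rewrite Rabs_pos_eq; lra.
Qed.

Lemma is_lim_seq_ln (u : nat -> R) (l : R) : 0 < l -> is_lim_seq u l -> is_lim_seq (fun n => ln (u n)) (ln l).
Proof.
  intros hl h. apply (is_lim_seq_continuous ln); [|exact h].
  apply continuity_pt_filterlim. apply (ex_derive_continuous ln). exists (/ l).
  apply is_derive_ln. exact hl.
Qed.

Lemma l1_lim (u : nat -> R) (e : R) : 0 <= e -> is_lim_seq (fun n => exp (- u n)) e ->
  is_lim_seq (fun n => l1 (u n)) (ln (1 + e)).
Proof.
  intros he h. unfold l1. apply is_lim_seq_ln; [lra|].
  apply is_lim_seq_plus'; [apply is_lim_seq_const|exact h].
Qed.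

Lemma l2_lim0 (u : nat -> R) : is_lim_seq (fun n => exp (- u n)) 0 -> is_lim_seq (fun n => l2 (u n)) 0.
Proof.
  intros h. unfold l2. replace (Finite 0) with (Rbar_opp (Finite (ln (1 - 0))))
    by (cbn; f_equal; rewrite Rminus_0_r, ln_1; ring).
  apply -> is_lim_seq_opp. apply is_lim_seq_ln; [lra|].
  apply is_lim_seq_minus'; [apply is_lim_seq_const|exact h].
Qed.

Definition od_alt (s : R) (j : nat) : R := hart (s + INR j * (2 * s)).

Lemma odz_alt_lim (s : R) : 0 < s ->
  is_lim_seq (psum (fun j => (-1) ^ j * od_alt s j)) (Re (odz (RtoC s))).
Proof.
  intros h.
  pose proof (alt_exchange (fun i => / (2 * INR i + 1)) (fun i => 2 * INR i + 1) s (2 * s) h ltac:(lra)) as H.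
  specialize (H ltac:(intros i; pose proof (INR_odd_pos i) as hp; pose proof (pos_INR i);
    rewrite Rabs_pos_eq by (left; apply Rinv_0_lt_compat; lra);
    rewrite <- Rinv_1; apply Rinv_le_contravar; lra)).
  specialize (H ltac:(intros i; rewrite S_INR; pose proof (pos_INR i); lra)).
  replace (Re (odz (RtoC s))) with (Series (fun i => / (2 * INR i + 1) * exp (- ((2 * INR i + 1) * s)) /
     (1 + exp (- ((2 * INR i + 1) * (2 * s)))))).
  - eapply is_lim_seq_ext; [|exact H]. intros J. cbv beta.
    induction J as [|J IH]; [reflexivity|]. cbn [psum]. rewrite IH. f_equal. f_equal.
    unfold od_alt. apply is_series_unique, hart_series.
    pose proof (pos_INR J). nra.
  - unfold odz, Csum. rewrite Re_pair. apply Series_ext. intros i.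
    rewrite odT_real, Re_RtoC by exact h. pose proof (INR_odd_pos i).
    unfold cosh. set (x := (2 * INR i + 1) * s).
    replace ((2 * INR i + 1) * (2 * s)) with (x + x) by (unfold x; ring).
    rewrite Ropp_plus_distr, exp_plus, exp_Ropp. pose proof (exp_pos x). field. nra.
Qed.

Lemma od_alt_convex (s : R) : 0 < s -> forall j,
  od_alt s (S j) - od_alt s (S (S j)) <= od_alt s j - od_alt s (S j).
Proof.
  intros h j. unfold od_alt. rewrite (S_INR (S j)), (S_INR j). pose proof (pos_INR j).
  replace (s + (INR j + 1) * (2 * s)) with (s + INR j * (2 * s) + 2 * s) by ring.
  replace (s + (INR j + 1 + 1) * (2 * s)) with (s + INR j * (2 * s) + 2 * s + 2 * s) by ring.
  apply hart_convex; nra.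
Qed.

Lemma od_alt_lim0 (s : R) : 0 < s -> is_lim_seq (od_alt s) 0.
Proof.
  intros h. unfold od_alt, hart.
  pose proof (is_lim_seq_exp_arith s (2 * s) ltac:(lra)) as H.
  replace (Finite 0) with (Rbar_mult (Finite (ln (1 + 0) + 0)) (Finite (/ 2)))
    by (cbn; f_equal; rewrite !Rplus_0_r, ln_1; ring).
  apply is_lim_seq_scal_r. apply is_lim_seq_plus'.
  - apply l1_lim; [lra|exact H].
  - apply l2_lim0. exact H.
Qed.

Lemma odz_sandwich (s : R) (M : nat) : 0 < s ->
  psum (fun j => (-1) ^ j * od_alt s j) (2 * M) + od_alt s (2 * M) / 2 <= Re (odz (RtoC s)) /\
  Re (odz (RtoC s)) <= psum (fun j => (-1) ^ j * od_alt s j) (2 * M + 1) - od_alt s (2 * M + 1) / 2.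
Proof.
  intros h. apply alt_sandwich; [apply od_alt_convex|apply od_alt_lim0|apply odz_alt_lim]; exact h.
Qed.

Lemma hart_eq (x : R) : 0 < x -> hart x = - ln (sinh (x / 2) / cosh (x / 2)) / 2.
Proof.
  intros h. unfold hart, l1, l2. pose proof (exp_neg_lt1 x h).
  pose proof (sinh_pos (x / 2) ltac:(lra)). pose proof (cosh_ge_1 (x / 2)).
  replace (sinh (x / 2) / cosh (x / 2)) with ((1 - exp (- x)) / (1 + exp (- x))).
  - rewrite ln_div by lra. field.
  - unfold sinh, cosh in *. replace (- x) with (- (x / 2) + - (x / 2)) by field.
    rewrite exp_plus, !exp_Ropp. pose proof (exp_pos (x / 2)). field. nra.
Qed.

Lemma tanh_le (x : R) : 0 < x -> sinh x / cosh x <= x.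
Proof.
  intros h. pose proof (cosh_ge_1 x). pose proof (sinh_le_mul_cosh x ltac:(lra)).
  apply Rmult_le_reg_r with (cosh x); [lra|]. unfold Rdiv. rewrite Rmult_assoc, Rinv_l by lra. lra.
Qed.

(** In particular the odd part tends to infinity at 0. *)
Lemma exp_odz_le (s : R) : 0 < s -> exp (- (2 * Re (odz (RtoC s)))) <= sqrt (s / 2).
Proof.
  intros h. destruct (odz_sandwich s 0 h) as [H _]. change (2 * 0)%nat with 0%nat in H. cbn [psum] in H.
  unfold od_alt in H. cbn [INR] in H. replace (s + 0 * (2 * s)) with s in H by ring.
  rewrite hart_eq in H by exact h.
  pose proof (tanh_le (s / 2) ltac:(lra)) as ht.
  pose proof (sinh_pos (s / 2) ltac:(lra)). pose proof (cosh_ge_1 (s / 2)).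
  assert (hp : 0 < sinh (s / 2) / cosh (s / 2)) by (apply Rmult_lt_0_compat; [lra|apply Rinv_0_lt_compat; lra]).
  pose proof (ln_mono _ _ hp ht) as hl.
  apply Rle_trans with (exp (ln (s / 2) / 2)); [apply exp_mono; lra|].
  right. rewrite <- Rpower_sqrt by lra. unfold Rpower. f_equal. field.
Qed.

(** ** The even part *)

(** Expanding [l1] and exchanging sums gives the alternating series of [x n]; removing twice its
    terms of odd index from the series without signs produces the terms of [tauT]. *)
Lemma tau_sum_alt (s : R) : 0 < s ->
  is_lim_seq (psum (fun j => (-1) ^ j * l1 (s + INR j * s))) (2 * Re (Csum (tauT (RtoC s)))).
Proof.
  intros h.
  pose proof (alt_exchange (fun n => (-1) ^ n / INR (S n)) (fun n => INR (S n)) s s h h) as H.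
  assert (hc : forall n, Rabs ((-1) ^ n / INR (S n)) <= 1).
  { intros n. pose proof (INR_S_pos n). unfold Rdiv. rewrite Rabs_mult, Rabs_pow_m1, Rmult_1_l.
    rewrite Rabs_pos_eq by (left; apply Rinv_0_lt_compat; lra).
    rewrite <- Rinv_1. apply Rinv_le_contravar; [lra|]. rewrite S_INR. pose proof (pos_INR n). lra. }
  specialize (H hc ltac:(intros; lra)).
  (* p n = e^{-(n+1)s}; phi p = p / (1 + p) *)
  set (x := fun n => / INR (S n) * (exp (- (INR (S n) * s)) / (1 + exp (- (INR (S n) * s))))).
  assert (hx : ex_series x).
  { destruct (series_exp_all s h) as [hex _]. apply ex_series_dom with (2 := hex). intros n.
    unfold x. pose proof (exp_pos (- (INR (S n) * s))) as hp. pose proof (INR_S_pos n).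
    set (p := exp (- (INR (S n) * s))) in *.
    assert (a1 : 0 < / INR (S n) <= 1).
    { split; [apply Rinv_0_lt_compat; lra|]. rewrite <- Rinv_1. apply Rinv_le_contravar; [lra|].
      rewrite S_INR. pose proof (pos_INR n). lra. }
    assert (a2 : 0 < p / (1 + p) <= p).
    { split; [apply Rmult_lt_0_compat; [lra|apply Rinv_0_lt_compat; lra]|].
      apply Rmult_le_reg_r with (1 + p); [lra|]. unfold Rdiv. rewrite Rmult_assoc, Rinv_l by lra. nra. }
    rewrite Rabs_pos_eq by nra. nra. }
  assert (hxe : ex_series (fun i => x (2 * i + 1)%nat)).
  { apply ex_series_dom with (fun i => x (2 * i)%nat + x (2 * i + 1)%nat).
    - intros i. assert (P : forall n, 0 <= x n).
      { intros n. unfold x. pose proof (exp_pos (- (INR (S n) * s))). pose proof (INR_S_pos n).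
        apply Rmult_le_pos; [left; apply Rinv_0_lt_compat; lra|].
        apply Rmult_le_pos; [lra|left; apply Rinv_0_lt_compat; lra]. }
      pose proof (P (2 * i)%nat). pose proof (P (2 * i + 1)%nat). rewrite Rabs_pos_eq; lra.
    - eexists. apply is_series_pairs, Series_correct, hx. }
  assert (hxs : ex_series (fun n => (-1) ^ n * x n)).
  { apply ex_series_dom with (fun n => Rabs (x n)).
    - intros n. rewrite Rabs_mult, Rabs_pow_m1. lra.
    - apply ex_series_ext with x; [|exact hx]. intros n. symmetry. apply Rabs_pos_eq.
      unfold x. pose proof (exp_pos (- (INR (S n) * s))). pose proof (INR_S_pos n).
      apply Rmult_le_pos; [left; apply Rinv_0_lt_compat; lra|].
      apply Rmult_le_pos; [lra|left; apply Rinv_0_lt_compat; lra]. }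
  assert (E1 : Series (fun n => (-1) ^ n * x n) = Series (fun i => x i - 2 * x (2 * i + 1)%nat)).
  { rewrite Series_minus, Series_scal_l by (try apply ex_series_scalR; assumption).
    rewrite (Series_pairs _ hxs), (Series_pairs _ hx).
    rewrite <- Series_scal_l, <- Series_minus.
    - apply Series_ext. intros i. rewrite pow_add, pow_mult.
      replace ((-1) ^ 2) with 1 by ring. rewrite pow1. ring.
    - eexists. apply is_series_pairs, Series_correct, hx.
    - apply ex_series_scalR, hxe. }
  replace (2 * Re (Csum (tauT (RtoC s)))) with (Series (fun n =>
     (-1) ^ n / INR (S n) * exp (- (INR (S n) * s)) / (1 + exp (- (INR (S n) * s))))).
  - eapply is_lim_seq_ext; [|exact H]. intros J. cbv beta.
    induction J as [|J IH]; [reflexivity|]. cbn [psum]. rewrite IH. f_equal. f_equal.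
    apply is_series_unique, l1_series. pose proof (pos_INR J). nra.
  - rewrite (Series_ext _ (fun n => (-1) ^ n * x n)) by (intros; unfold x, Rdiv; ring).
    rewrite E1. unfold Csum. rewrite Re_pair, <- Series_scal_l. apply Series_ext. intros i.
    rewrite tauT_eq by exact h. rewrite Re_minus, Re_scal, <- RtoC_mult, !evT_real, !Re_RtoC by lra.
    unfold x. pose proof (INR_S_pos i) as hi.
    replace (INR (S (2 * i + 1))) with (2 * INR (S i)).
    2:{ replace (S (2 * i + 1)) with (2 * S i)%nat by lia. rewrite mult_INR. cbn [INR]. ring. }
    set (k := INR (S i)) in *.
    replace (2 * k * (/ 2 * s)) with (k * s) by field.
    pose proof (exp_neg_lt1 (k * s) ltac:(nra)) as hp.
    assert (e2 : exp (- (2 * k * s)) = exp (- (k * s)) ^ 2).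
    { replace (- (2 * k * s)) with (- (k * s) + - (k * s)) by ring. rewrite exp_plus. ring. }
    unfold sinh. rewrite !e2.
    replace (exp (k * s)) with (/ exp (- (k * s))) by (rewrite exp_Ropp, Rinv_inv; reflexivity).
    replace (exp (2 * k * s)) with (/ exp (- (k * s)) ^ 2) by (rewrite <- e2, exp_Ropp, Rinv_inv; reflexivity).
    set (p := exp (- (k * s))) in *.
    replace ((/ p - p) / 2) with ((1 - p) * (1 + p) / (2 * p)) by (field; lra).
    replace ((/ p ^ 2 - p ^ 2) / 2) with ((1 - p) * (1 + p) * (1 + p ^ 2) / (2 * p ^ 2)) by (field; lra).
    field. repeat split; nra.
Qed.

Lemma tau_sum_sandwich (s : R) : 0 < s ->
  l1 s / 4 <= Re (Csum (tauT (RtoC s))) <= l1 s / 2 - l1 (2 * s) / 4.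
Proof.
  intros h.
  destruct (alt_sandwich (fun j => l1 (s + INR j * s)) (2 * Re (Csum (tauT (RtoC s)))) 0) as [H1 H2].
  - intros j. rewrite (S_INR (S j)), (S_INR j).
    replace (s + (INR j + 1) * s) with (s + INR j * s + s) by ring.
    replace (s + (INR j + 1 + 1) * s) with (s + INR j * s + s + s) by ring. apply l1_convex.
  - replace 0 with (ln (1 + 0)) by (rewrite Rplus_0_r; apply ln_1).
    apply l1_lim; [lra|]. apply is_lim_seq_exp_arith, h.
  - apply tau_sum_alt, h.
  - change (2 * 0 + 1)%nat with 1%nat in H2. change (2 * 0)%nat with 0%nat in H1.
    cbn [psum INR pow] in H1, H2.
    replace (s + 0 * s) with s in H1, H2 by ring. replace (s + 1 * s) with (2 * s) in H2 by ring. lra.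
Qed.

Lemma l1_antitone (x y : R) : x <= y -> l1 y <= l1 x.
Proof.
  intros h. unfold l1. pose proof (exp_pos (- y)). apply ln_mono; [lra|].
  assert (exp (- y) <= exp (- x)) by (apply exp_mono; lra). lra.
Qed.

Lemma l1_le_ln2 (x : R) : 0 <= x -> l1 x <= ln 2.
Proof.
  intros h. pose proof (l1_antitone 0 x h) as H. unfold l1 at 2 in H.
  rewrite Ropp_0, exp_0 in H. replace (1 + 1) with 2 in H by ring. exact H.
Qed.

(** Iterating the halving relation, as for [evz_sub_le], now keeps the exact sizes of the sums of
    [Ctau]: at stage j such a sum enters with weight [2^(-j-1)], and these weights add up to 1.
    Both bounds tend to [ln 2 / 4] at 0. *)
Lemma evz_real_sandwich (s : R) : 0 < s ->
  l1 s / 4 <= zeta2 / 8 / s - Re (evz (RtoC s)) <= ln 2 / 2 - l1 (2 * s) / 4.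
Proof.
  intros h.
  set (E := fun J => / 2 ^ J * Re (evz (RtoC (/ 2 ^ J * s)))).
  set (lo := l1 s / 4). set (hi := ln 2 / 2 - l1 (2 * s) / 4).
  assert (hstep : forall J, / 2 ^ S J * lo <= E (S J) - E J <= / 2 ^ S J * hi).
  { intros J. pose proof (two_pow_pos J) as hJ.
    assert (hJ1 : 0 < / 2 ^ J) by (apply Rinv_0_lt_compat; exact hJ).
    assert (hle : / 2 ^ J <= 1).
    { rewrite <- Rinv_1. apply Rinv_le_contravar; [lra|]. apply pow_R1_Rle; lra. }
    set (t := / 2 ^ J * s). assert (ht : 0 < t <= s) by (unfold t; nra).
    pose proof (tau_sum_sandwich t ltac:(lra)) as H.
    rewrite Csum_tauT, Re_minus, Re_scal in H by (rewrite Re_RtoC; lra).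
    assert (e : / 2 ^ S J * s = / 2 * t) by (unfold t; cbn [pow]; field; lra).
    replace (E (S J) - E J) with (/ 2 ^ S J * (Re (evz (RtoC (/ 2) * RtoC t)) - 2 * Re (evz (RtoC t)))).
    2:{ unfold E. rewrite e, RtoC_mult. fold t. cbn [pow]. field. lra. }
    assert (0 < / 2 ^ S J) by (apply Rinv_0_lt_compat, two_pow_pos).
    pose proof (l1_antitone t s ltac:(lra)). pose proof (l1_antitone (2 * t) (2 * s) ltac:(lra)).
    pose proof (l1_le_ln2 t ltac:(lra)).
    split; apply Rmult_le_compat_l; unfold lo, hi; lra. }
  assert (htot : forall J, (1 - / 2 ^ J) * lo <= E J - E 0%nat <= (1 - / 2 ^ J) * hi).
  { induction J as [|J IH]; [cbn; lra|]. specialize (hstep J).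
    replace (1 - / 2 ^ S J) with (1 - / 2 ^ J + / 2 ^ S J)
      by (cbn [pow]; pose proof (two_pow_pos J); field; lra). lra. }
  assert (hE : is_lim_seq E (zeta2 / 8 / s)).
  { pose proof (evz_dyad_lim (RtoC s) ltac:(rewrite Re_RtoC; exact h)) as H.
    replace (Finite (zeta2 / 8 / s)) with (Finite (0 + zeta2 / 8 / s)) by (f_equal; ring).
    apply is_lim_seq_ext with (fun J => (E J - zeta2 / 8 / s) + zeta2 / 8 / s); [intros; ring|].
    apply is_lim_seq_plus'; [|apply is_lim_seq_const].
    apply is_lim_seq_abs_0. refine (is_lim_seq_le_le (fun _ => 0) _ _ _ _ (is_lim_seq_const 0) H).
    intros J. split; [apply Rabs_pos|].
    eapply Rle_trans; [|apply re_le_Cmod]. right. f_equal.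
    rewrite Re_minus, !Re_scal. unfold E, dyad. rewrite <- RtoC_mult, <- RtoC_inv, Re_RtoC by lra.
    unfold Rdiv. ring. }
  assert (hE0 : E 0%nat = Re (evz (RtoC s))).
  { unfold E. cbn [pow]. rewrite Rinv_1, !Rmult_1_l. reflexivity. }
  assert (hl : forall b, is_lim_seq (fun J => (1 - / 2 ^ J) * b) b).
  { intros b. replace (Finite b) with (Rbar_mult (Finite (1 - 0)) (Finite b)) by (cbn; f_equal; ring).
    apply is_lim_seq_scal_r, is_lim_seq_minus'; [apply is_lim_seq_const|apply is_lim_seq_inv_pow2]. }
  assert (hD : is_lim_seq (fun J => E J - E 0%nat) (zeta2 / 8 / s - Re (evz (RtoC s)))).
  { rewrite <- hE0. apply is_lim_seq_minus'; [exact hE|apply is_lim_seq_const]. }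
  split.
  - assert (G : Rbar_le lo (zeta2 / 8 / s - Re (evz (RtoC s)))); [|exact G].
    apply (is_lim_seq_le _ _ _ _ (fun J => proj1 (htot J)) (hl lo) hD).
  - assert (G : Rbar_le (zeta2 / 8 / s - Re (evz (RtoC s))) hi); [|exact G].
    apply (is_lim_seq_le _ _ _ _ (fun J => proj2 (htot J)) hD (hl hi)).
Qed.

(** * The sum of the inverse squares *)

Lemma mul_cos_le_sin_PI (b : R) : 0 <= b <= PI -> b * cos b <= sin b.
Proof.
  intros h. cut (0 <= sin b - b * cos b); [lra|].
  apply (nonneg_of_deriv (fun t => sin t - t * cos t) (fun t => t * sin t)); [lra| | |].
  - intros t _. auto_derive; [auto|]. ring.
  - intros t ht. apply Rmult_le_pos; [lra|]. apply sin_ge_0; lra.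
  - rewrite sin_0, cos_0. ring.
Qed.

Lemma psum_rev (a : nat -> R) (n : nat) : psum (fun k => a (n - 1 - k)%nat) n = psum a n.
Proof.
  revert a. induction n as [|n IH]; intros a; [reflexivity|].
  replace (psum a (S n)) with (psum a (1 + n)) by reflexivity. rewrite psum_shift.
  cbn [psum]. rewrite <- (IH (fun j => a (1 + j)%nat)).
  replace (S n - 1 - n)%nat with 0%nat by lia.
  assert (e : psum (fun k => a (S n - 1 - k)%nat) n = psum (fun k => a (1 + (n - 1 - k))%nat) n).
  { apply Rle_antisym; apply psum_le; intros i hi; right; f_equal; lia. }
  rewrite e. ring.
Qed.

Lemma psum_ext (a b : nat -> R) (n : nat) : (forall i, (i < n)%nat -> a i = b i) -> psum a n = psum b n.
Proof. intros h. apply Rle_antisym; apply psum_le; intros i hi; right; rewrite h; auto. Qed.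

Definition dyad_angle (n k : nat) : R := (2 * INR k + 1) * PI / (4 * 2 ^ n).

Lemma INR_two_pow (n : nat) : INR (2 ^ n) = 2 ^ n.
Proof. rewrite pow_INR. cbn [INR]. replace (1 + 1) with 2 by ring. reflexivity. Qed.

Lemma dyad_angle_bounds (n k : nat) : (k < 2 ^ n)%nat -> 0 < dyad_angle n k < PI / 2.
Proof.
  intros h. pose proof (two_pow_pos n) as hp. pose proof PI_RGT_0. pose proof (pos_INR k).
  assert (INR k + 1 <= 2 ^ n).
  { rewrite <- S_INR, <- INR_two_pow. apply le_INR. exact h. }
  unfold dyad_angle. split.
  - apply Rmult_lt_0_compat; [nra|apply Rinv_0_lt_compat; lra].
  - apply Rmult_lt_reg_r with (4 * 2 ^ n); [lra|].
    unfold Rdiv. rewrite Rmult_assoc, Rinv_l by lra. nra.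
Qed.

(** [1/sin^2 x = (1/sin^2 (x/2) + 1/cos^2 (x/2)) / 4] takes each sum to the next one. *)
Lemma sum_inv_sin_sqr (n : nat) : psum (fun k => / sin (dyad_angle n k) ^ 2) (2 ^ n) = 2 * 4 ^ n.
Proof.
  induction n as [|n IH].
  - cbn [Nat.pow psum INR pow]. unfold dyad_angle. cbn [INR pow].
    replace ((2 * 0 + 1) * PI / (4 * 1)) with (PI / 4) by field.
    rewrite sin_PI4. pose proof (sqrt_sqrt 2). pose proof (sqrt_lt_R0 2).
    replace ((1 / sqrt 2) * ((1 / sqrt 2) * 1)) with (/ (sqrt 2 * sqrt 2)) by (field; lra).
    rewrite H by lra. field.
  - replace (2 ^ S n)%nat with (2 ^ n + 2 ^ n)%nat by (cbn; lia).
    rewrite psum_shift.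
    rewrite <- (psum_rev (fun j => / sin (dyad_angle (S n) (2 ^ n + j)) ^ 2)).
    rewrite <- psum_plus. cbn [pow]. rewrite <- Rmult_assoc, (Rmult_comm 2 4), Rmult_assoc, <- IH, <- psum_scal.
    apply psum_ext. intros k hk. pose proof (dyad_angle_bounds n k hk) as hb.
    pose proof (two_pow_pos n) as hp.
    set (x := dyad_angle n k) in *.
    assert (e1 : dyad_angle (S n) k = x / 2) by (unfold x, dyad_angle; cbn [pow]; field; lra).
    assert (e2 : dyad_angle (S n) (2 ^ n + (2 ^ n - 1 - k)) = PI / 2 - x / 2).
    { unfold x, dyad_angle. rewrite plus_INR, !minus_INR, INR_two_pow by lia.
      cbn [INR pow]. field. lra. }
    rewrite e1, e2, sin_shift.
    assert (hs : 0 < sin (x / 2)) by (apply sin_gt_0; lra).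
    assert (hc : 0 < cos (x / 2)) by (apply cos_gt_0; lra).
    assert (ex : sin x = 2 * sin (x / 2) * cos (x / 2)).
    { rewrite <- sin_2a. f_equal. field. }
    rewrite ex.
    pose proof (sin2_cos2 (x / 2)) as E. unfold Rsqr in E.
    set (S := sin (x / 2)) in *. set (Q := cos (x / 2)) in *.
    transitivity ((S * S + Q * Q) * / (S ^ 2 * Q ^ 2)); [field; lra|]. rewrite E. field. lra.
Qed.

Lemma inv_sin_sqr_bounds (y : R) : 0 < y < PI / 2 -> / y ^ 2 <= / sin y ^ 2 <= 1 + / y ^ 2.
Proof.
  intros h. assert (hs : 0 < sin y) by (apply sin_gt_0; lra).
  pose proof (Rabs_sin_le y) as h1. rewrite !Rabs_pos_eq in h1 by lra.
  pose proof (mul_cos_le_sin_PI y ltac:(lra)) as h2.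
  assert (hc : 0 < cos y) by (apply cos_gt_0; lra).
  pose proof (cos_sqr y) as h3. split.
  - apply Rinv_le_contravar; nra.
  - apply Rmult_le_reg_r with (y ^ 2 * sin y ^ 2);
      [apply Rmult_lt_0_compat; apply pow_lt; lra|].
    replace (/ sin y ^ 2 * (y ^ 2 * sin y ^ 2)) with (y ^ 2) by (field; lra).
    replace ((1 + / y ^ 2) * (y ^ 2 * sin y ^ 2)) with (y ^ 2 * sin y ^ 2 + sin y ^ 2) by (field; lra).
    assert ((y * cos y) ^ 2 <= sin y ^ 2) by (apply pow_incr; split; [apply Rmult_le_pos; lra|exact h2]).
    rewrite Rpow_mult_distr, h3 in H. lra.
Qed.

Definition inv_odd_sqr (k : nat) : R := / (2 * INR k + 1) ^ 2.

(** By [inv_sin_sqr_bounds] the sum of inverse squared sines, known exactly, differs by at most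
    the number of its terms from the sum of inverse squared angles. *)
Lemma psum_inv_odd_sqr_bounds (n : nat) :
  PI ^ 2 / 8 - PI ^ 2 / 16 * / 2 ^ n <= psum inv_odd_sqr (2 ^ n) <= PI ^ 2 / 8.
Proof.
  pose proof PI_RGT_0. pose proof (two_pow_pos n) as hp.
  assert (h4 : 4 ^ n = 2 ^ n * 2 ^ n) by (rewrite <- Rpow_mult_distr; f_equal; ring).
  pose proof (sum_inv_sin_sqr n) as HS.
  assert (E : psum (fun k => / dyad_angle n k ^ 2) (2 ^ n) = 16 * 4 ^ n / PI ^ 2 * psum inv_odd_sqr (2 ^ n)).
  { rewrite <- psum_scal. apply psum_ext. intros k _. unfold dyad_angle, inv_odd_sqr. rewrite h4.
    pose proof (INR_odd_pos k). field. lra. }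
  assert (L : psum (fun k => / dyad_angle n k ^ 2) (2 ^ n) <= 2 * 4 ^ n).
  { rewrite <- HS. apply psum_le. intros k hk. apply inv_sin_sqr_bounds, dyad_angle_bounds, hk. }
  assert (U : 2 * 4 ^ n <= 2 ^ n + psum (fun k => / dyad_angle n k ^ 2) (2 ^ n)).
  { rewrite <- HS. replace (2 ^ n) with (psum (fun _ => 1) (2 ^ n)).
    2:{ rewrite psum_const, INR_two_pow. ring. }
    rewrite <- psum_plus. apply psum_le. intros k hk. apply inv_sin_sqr_bounds, dyad_angle_bounds, hk. }
  rewrite E, h4 in *. set (O := psum inv_odd_sqr (2 ^ n)) in *. set (t := 2 ^ n) in *.
  assert (hP : 0 < PI ^ 2) by nra.
  assert (hq : O = PI ^ 2 / (16 * (t * t)) * (16 * (t * t) / PI ^ 2 * O)) by (field; lra).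
  assert (hk : 0 < PI ^ 2 / (16 * (t * t))) by (apply Rmult_lt_0_compat; [lra|apply Rinv_0_lt_compat; nra]).
  split.
  - rewrite hq. replace (PI ^ 2 / 8 - PI ^ 2 / 16 * / t)
      with (PI ^ 2 / (16 * (t * t)) * (2 * (t * t) - t)) by (field; lra).
    apply Rmult_le_compat_l; lra.
  - rewrite hq. replace (PI ^ 2 / 8) with (PI ^ 2 / (16 * (t * t)) * (2 * (t * t))) by (field; lra).
    apply Rmult_le_compat_l; lra.
Qed.

Lemma ex_series_inv_odd_sqr : ex_series inv_odd_sqr.
Proof.
  apply ex_series_dom with (2 := ex_series_inv_sqr). intros n. unfold inv_odd_sqr.
  pose proof (INR_odd_pos n). rewrite Rabs_pos_eq by (left; apply Rinv_0_lt_compat, pow_lt; lra).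
  pose proof (pos_INR n). apply Rinv_le_contravar; rewrite S_INR; [apply pow_lt; lra|].
  apply pow_incr; lra.
Qed.

Theorem basel : zeta2 = PI ^ 2 / 6.
Proof.
  assert (hodd : Series inv_odd_sqr = PI ^ 2 / 8).
  { assert (hsub : is_lim_seq (fun n => psum inv_odd_sqr (2 ^ n)) (Series inv_odd_sqr)).
    { apply (is_lim_seq_subseq (psum inv_odd_sqr) _ (fun n => (2 ^ n)%nat)).
      - apply eventually_subseq. intros n. cbn. pose proof (Nat.pow_nonzero 2 n). lia.
      - apply psum_lim, ex_series_inv_odd_sqr. }
    assert (hsub2 : is_lim_seq (fun n => psum inv_odd_sqr (2 ^ n)) (PI ^ 2 / 8)).
    { apply is_lim_seq_le_le with (fun n => PI ^ 2 / 8 - PI ^ 2 / 16 * / 2 ^ n) (fun _ => PI ^ 2 / 8).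
      - intros n. apply psum_inv_odd_sqr_bounds.
      - replace (Finite (PI ^ 2 / 8)) with (Finite (PI ^ 2 / 8 - 0)) by (f_equal; ring).
        apply is_lim_seq_minus'; [apply is_lim_seq_const|].
        apply is_lim_seq_scal0, is_lim_seq_inv_pow2.
      - apply is_lim_seq_const. }
    apply is_lim_seq_unique in hsub. apply is_lim_seq_unique in hsub2.
    rewrite hsub in hsub2. injection hsub2. auto. }
  assert (E : zeta2 = Series inv_odd_sqr + zeta2 / 4).
  { unfold zeta2 at 1. rewrite Series_pairs by apply ex_series_inv_sqr.
    replace (zeta2 / 4) with (Series (fun i => / 4 * / INR (S i) ^ 2))
      by (rewrite Series_scal_l; unfold zeta2; field).
    rewrite <- Series_plus; [|apply ex_series_inv_odd_sqr|apply ex_series_scalR, ex_series_inv_sqr].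
    apply Series_ext. intros i. unfold inv_odd_sqr. f_equal.
    - do 2 f_equal. rewrite S_INR, mult_INR. cbn [INR]. ring.
    - replace (S (2 * i + 1)) with (2 * S i)%nat by lia. rewrite mult_INR.
      replace (INR 2) with 2 by (cbn; ring). pose proof (INR_S_pos i) as hp. field. lra. }
  rewrite hodd in E. lra.
Qed.

(** * The Gaussian integral *)

Definition gauss_half (x : R) : R := RInt (fun t => exp (- t ^ 2)) 0 x.
Definition gauss_aux (x : R) : R := RInt (fun t => exp (- (x ^ 2 * (1 + t ^ 2))) / (1 + t ^ 2)) 0 1.

Lemma one_add_sqr_pos (t : R) : 0 < 1 + t ^ 2.
Proof. pose proof (pow2_ge_0 t). lra. Qed.

Lemma is_derive_gauss_half (x : R) : is_derive gauss_half x (exp (- x ^ 2)).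
Proof.
  unfold gauss_half. apply (is_derive_RInt (fun t => exp (- t ^ 2)) _ 0).
  - apply filter_forall. intros y. apply (RInt_correct (V := R_CompleteNormedModule)), ex_RInt_gauss.
  - apply (ex_derive_continuous (fun t => exp (- t ^ 2))). auto_derive. auto.
Qed.

Lemma is_derive_gauss_aux (x : R) : is_derive gauss_aux x (- (2 * exp (- x ^ 2) * gauss_half x)).
Proof.
  assert (D : forall y t, is_derive (fun u => exp (- (u ^ 2 * (1 + t ^ 2))) / (1 + t ^ 2)) y
     (- (2 * y) * exp (- (y ^ 2 * (1 + t ^ 2))))).
  { intros y t. pose proof (one_add_sqr_pos t). auto_derive; [cbn in *; lra|].
    replace (y * (y * 1) * (1 + t * (t * 1))) with (y ^ 2 * (1 + t ^ 2)) by ring.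
    field. lra. }
  unfold gauss_aux.
  replace (- (2 * exp (- x ^ 2) * gauss_half x))
    with (RInt (fun t => Derive (fun u => exp (- (u ^ 2 * (1 + t ^ 2))) / (1 + t ^ 2)) x) 0 1).
  - apply (is_derive_RInt_param (fun u t => exp (- (u ^ 2 * (1 + t ^ 2))) / (1 + t ^ 2)) 0 1 x).
    + apply filter_forall. intros y t _. eexists. apply D.
    + intros t _.
      apply continuity_2d_pt_ext with (fun u v => - (2 * u) * exp (- (u ^ 2 * (1 + v ^ 2)))).
      * intros u v. symmetry. apply is_derive_unique, D.
      * apply continuity_2d_pt_mult.
        -- apply continuity_2d_pt_opp, continuity_2d_pt_mult;
             [apply continuity_2d_pt_const|apply continuity_2d_pt_id1].
        -- apply (continuity_1d_2d_pt_comp exp (fun u v => - (u ^ 2 * (1 + v ^ 2)))).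
           ++ apply derivable_continuous_pt, derivable_pt_exp.
           ++ apply continuity_2d_pt_opp, continuity_2d_pt_mult.
              ** apply continuity_2d_pt_ext with (fun u v => u * u); [intros; ring|].
                 apply continuity_2d_pt_mult; apply continuity_2d_pt_id1.
              ** apply continuity_2d_pt_plus; [apply continuity_2d_pt_const|].
                 apply continuity_2d_pt_ext with (fun u v => v * v); [intros; ring|].
                 apply continuity_2d_pt_mult; apply continuity_2d_pt_id2.
    + apply filter_forall. intros y. apply (ex_RInt_continuous (V := R_CompleteNormedModule)).
      intros t _. apply (ex_derive_continuous (fun t => exp (- (y ^ 2 * (1 + t ^ 2))) / (1 + t ^ 2))).
      pose proof (one_add_sqr_pos t). auto_derive. cbn in *; lra.
  - assert (H : is_RInt (fun w => exp (- w ^ 2)) (x * 0 + 0) (x * 1 + 0) (gauss_half x)).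
    { replace (x * 0 + 0) with 0 by ring. replace (x * 1 + 0) with x by ring.
      apply (RInt_correct (V := R_CompleteNormedModule)), ex_RInt_gauss. }
    pose proof (is_RInt_scal (V := R_NormedModule) _ _ _ (- (2 * exp (- x ^ 2))) _
      (is_RInt_comp_lin (V := R_NormedModule) _ x 0 0 1 _ H)) as H1.
    apply is_RInt_unique.
    replace (- (2 * exp (- x ^ 2) * gauss_half x)) with (- (2 * exp (- x ^ 2)) * gauss_half x) by ring.
    eapply is_RInt_ext; [|exact H1].
    intros t _. symmetry. etransitivity; [apply is_derive_unique, (D x t)|]. symmetry.
    change (- (2 * exp (- x ^ 2)) * (x * exp (- (x * t + 0) ^ 2)) = - (2 * x) * exp (- (x ^ 2 * (1 + t ^ 2)))).
    replace (- (x ^ 2 * (1 + t ^ 2))) with (- x ^ 2 + - (x * t + 0) ^ 2) by ring.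
    rewrite exp_plus. ring.
Qed.

(** The sum of [gauss_half ^ 2] and [gauss_aux] is constant; its value at 0 is [atan 1]. *)
Lemma gauss_identity (x : R) : 0 <= x -> gauss_half x ^ 2 + gauss_aux x = PI / 4.
Proof.
  intros hx.
  assert (e0 : gauss_half 0 ^ 2 + gauss_aux 0 = PI / 4).
  { assert (gauss_half 0 = 0) by (unfold gauss_half; rewrite RInt_point; reflexivity).
    assert (gauss_aux 0 = atan 1 - atan 0).
    { unfold gauss_aux. apply is_RInt_unique.
      apply is_RInt_ext with (fun t => / (1 + t ^ 2)).
      - intros t _. replace (- (0 ^ 2 * (1 + t ^ 2))) with 0 by ring. rewrite exp_0.
        unfold Rdiv. eqR. ring.
      - apply (is_RInt_derive atan).
        + intros t _. auto_derive; [auto|].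
          pose proof (one_add_sqr_pos t). field. cbn in *; lra.
        + intros t _. apply (ex_derive_continuous (fun t => / (1 + t ^ 2))).
          pose proof (one_add_sqr_pos t). auto_derive. cbn in *; lra. }
    rewrite H, H0, atan_1, atan_0. ring. }
  rewrite <- e0.
  destruct (Req_dec x 0) as [->|hx0]; [reflexivity|].
  symmetry. apply (eq_is_derive (fun x => gauss_half x ^ 2 + gauss_aux x)); [|lra].
  intros t _.
  assert (d1 := is_derive_gauss_half t). assert (d2 := is_derive_gauss_aux t).
  assert (d3 : is_derive (fun x => gauss_half x ^ 2) t (INR 2 * exp (- t ^ 2) * gauss_half t ^ 1)).
  { apply (is_derive_pow gauss_half 2 t _ d1). }
  pose proof (is_derive_plus _ _ _ _ _ d3 d2) as d.
  change (is_derive (fun x => gauss_half x ^ 2 + gauss_aux x) t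
    (INR 2 * exp (- t ^ 2) * gauss_half t ^ 1 + - (2 * exp (- t ^ 2) * gauss_half t))) in d.
  assert (e : INR 2 * exp (- t ^ 2) * gauss_half t ^ 1 + - (2 * exp (- t ^ 2) * gauss_half t) = 0).
  { cbn [INR]. ring. }
  rewrite e in d. exact d.
Qed.

Lemma gauss_aux_bounds (x : R) : 0 <= x -> 0 <= gauss_aux x <= exp (- x ^ 2).
Proof.
  intros hx.
  assert (hex : ex_RInt (fun t => exp (- (x ^ 2 * (1 + t ^ 2))) / (1 + t ^ 2)) 0 1).
  { apply (ex_RInt_continuous (V := R_CompleteNormedModule)). intros t _.
    apply (ex_derive_continuous (fun t => exp (- (x ^ 2 * (1 + t ^ 2))) / (1 + t ^ 2))).
    pose proof (one_add_sqr_pos t). auto_derive. cbn in *; lra. }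
  unfold gauss_aux. split.
  - apply RInt_ge_0; [lra|exact hex|]. intros t _. pose proof (one_add_sqr_pos t).
    apply Rmult_le_pos; [left; apply exp_pos|left; apply Rinv_0_lt_compat; lra].
  - replace (exp (- x ^ 2)) with (RInt (fun _ => exp (- x ^ 2)) 0 1).
    2:{ rewrite RInt_const. unfold scal; cbn -[pow]; unfold mult; cbn -[pow]. ring. }
    apply RInt_le; [lra|exact hex|apply ex_RInt_const|]. intros t ht.
    pose proof (one_add_sqr_pos t). pose proof (pow2_ge_0 t).
    apply Rle_trans with (exp (- x ^ 2) / 1).
    + apply Rmult_le_compat; [left; apply exp_pos|left; apply Rinv_0_lt_compat; lra| |].
      * apply exp_mono. pose proof (pow2_ge_0 x). nra.
      * apply Rinv_le_contravar; lra.
    + right; field.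
Qed.

Lemma gauss_half_nonneg (x : R) : 0 <= x -> 0 <= gauss_half x.
Proof.
  intros hx. unfold gauss_half. apply RInt_ge_0; [exact hx|apply ex_RInt_gauss|].
  intros; left; apply exp_pos.
Qed.

Lemma gauss_half_lim (V : nat -> R) : is_lim_seq V p_infty ->
  is_lim_seq (fun n => gauss_half (V n)) (sqrt PI / 2).
Proof.
  intros hV.
  assert (hpos : eventually (fun n => 1 < V n)).
  { apply is_lim_seq_spec in hV. exact (hV 1). }
  assert (h1 : is_lim_seq (fun n => exp (- V n ^ 2)) 0).
  { apply is_lim_seq_le_le_loc with (fun _ => 0) (fun n => / V n).
    - destruct hpos as [N hN]. exists N. intros n hn. specialize (hN n hn). split; [left; apply exp_pos|].
      rewrite exp_Ropp. apply Rinv_le_contravar; [lra|].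
      pose proof (exp_ineq1_le (V n ^ 2)). nra.
    - apply is_lim_seq_const.
    - replace (Finite 0) with (Rbar_inv p_infty) by reflexivity.
      apply is_lim_seq_inv; [exact hV|discriminate]. }
  assert (h2 : is_lim_seq (fun n => PI / 4 - gauss_aux (V n)) (PI / 4)).
  { replace (Finite (PI / 4)) with (Finite (PI / 4 - 0)) by (f_equal; ring).
    apply is_lim_seq_minus'; [apply is_lim_seq_const|].
    apply is_lim_seq_le_le_loc with (fun _ => 0) (fun n => exp (- V n ^ 2)); [|apply is_lim_seq_const|exact h1].
    destruct hpos as [N hN]. exists N. intros n hn. specialize (hN n hn). apply gauss_aux_bounds; lra. }
  replace (sqrt PI / 2) with (sqrt (PI / 4)).
  2:{ pose proof PI_RGT_0. rewrite sqrt_div by lra. f_equal. replace 4 with (2 * 2) by ring. apply sqrt_square; lra. }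
  apply is_lim_seq_ext_loc with (fun n => sqrt (PI / 4 - gauss_aux (V n))).
  - destruct hpos as [N hN]. exists N. intros n hn. specialize (hN n hn).
    pose proof (gauss_identity (V n) ltac:(lra)) as e.
    replace (PI / 4 - gauss_aux (V n)) with (gauss_half (V n) ^ 2) by lra.
    apply sqrt_pow2, gauss_half_nonneg. lra.
  - apply (is_lim_seq_continuous sqrt); [|exact h2].
    apply continuity_pt_sqrt. pose proof PI_RGT_0. lra.
Qed.

Lemma gauss_int_half (V : R) : gauss_int V = 2 * gauss_half V.
Proof.
  unfold gauss_int. rewrite <- (RInt_Chasles (fun v => exp (- v ^ 2)) (- V) 0 V) by apply ex_RInt_gauss.
  assert (e : RInt (fun v => exp (- v ^ 2)) (- V) 0 = gauss_half V).
  { unfold gauss_half. apply is_RInt_unique.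
    pose proof (is_RInt_comp_opp (V := R_NormedModule) (fun v => exp (- v ^ 2)) (- V) 0
      (opp (RInt (fun v => exp (- v ^ 2)) 0 V))) as H.
    rewrite Ropp_involutive, Ropp_0 in H.
    specialize (H (is_RInt_swap _ _ _ _ (RInt_correct (V := R_CompleteNormedModule) _ _ _ (ex_RInt_gauss 0 V)))).
    apply is_RInt_opp in H. rewrite opp_opp in H.
    eapply is_RInt_ext; [|exact H]. intros x _. cbv beta. rewrite opp_opp.
    replace ((- x) ^ 2) with (x ^ 2) by ring. reflexivity. }
  rewrite e. unfold gauss_half, plus; cbn -[pow]. ring.
Qed.

Lemma gauss_int_lim (V : nat -> R) : is_lim_seq V p_infty ->
  is_lim_seq (fun n => gauss_int (V n)) (sqrt PI).
Proof.
  intros h. apply is_lim_seq_ext with (fun n => 2 * gauss_half (V n)); [intros; symmetry; apply gauss_int_half|].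
  replace (Finite (sqrt PI)) with (Rbar_mult (Finite 2) (Finite (sqrt PI / 2))) by (cbn; f_equal; field).
  apply is_lim_seq_scal_l, gauss_half_lim, h.
Qed.

Lemma gauss_int_ge (V : R) : 1 <= V -> 4 / 3 <= gauss_int V.
Proof.
  intros h. rewrite gauss_int_half.
  assert (H : 2 / 3 <= gauss_half V); [|lra].
  apply Rle_trans with (gauss_half 1).
  - unfold gauss_half.
    assert (e : is_RInt (fun t => 1 - t ^ 2) 0 1 ((1 - 1 ^ 3 / 3) - (0 - 0 ^ 3 / 3))).
    { apply (is_RInt_derive (fun t => t - t ^ 3 / 3)).
      - intros t _. auto_derive; [auto|]. field.
      - intros t _. apply (ex_derive_continuous (fun t => 1 - t ^ 2)). auto_derive. auto. }
    replace (2 / 3) with ((1 - 1 ^ 3 / 3) - (0 - 0 ^ 3 / 3)) by field.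
    rewrite <- (is_RInt_unique _ _ _ _ e). apply RInt_le; [lra|eexists; exact e|apply ex_RInt_gauss|].
    intros t _. pose proof (exp_ineq1_le (- t ^ 2)). lra.
  - unfold gauss_half. rewrite <- (RInt_Chasles (fun v => exp (- v ^ 2)) 0 1 V) by apply ex_RInt_gauss.
    assert (0 <= RInt (fun v => exp (- v ^ 2)) 1 V).
    { apply RInt_ge_0; [exact h|apply ex_RInt_gauss|]. intros; left; apply exp_pos. }
    change (RInt (fun v => exp (- v ^ 2)) 0 1 <=
      RInt (fun v => exp (- v ^ 2)) 0 1 + RInt (fun v => exp (- v ^ 2)) 1 V). lra.
Qed.

(** * The Gamma function *)

Definition gam_f (s t : R) : R := Rpower t (s - 1) * exp (- t).

Lemma gam_f_pos (s t : R) : 0 < gam_f s t.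
Proof. unfold gam_f, Rpower. apply Rmult_lt_0_compat; apply exp_pos. Qed.

Lemma ex_derive_gam_f (s t : R) : 0 < t -> ex_derive (gam_f s) t.
Proof. intros h. unfold gam_f, Rpower. auto_derive. exact h. Qed.

Lemma ex_RInt_gam (s a b : R) : 0 < a -> a <= b -> ex_RInt (gam_f s) a b.
Proof.
  intros ha hab. apply (ex_RInt_continuous (V := R_CompleteNormedModule)). intros t ht.
  rewrite Rmin_left in ht by lra. apply (ex_derive_continuous (gam_f s)), ex_derive_gam_f. lra.
Qed.

Definition Gseq (s : R) (n : nat) : R := RInt (gam_f s) (/ INR (S (S n))) (INR (S (S n))).

Lemma INR_SS (n : nat) : 2 <= INR (S (S n)).
Proof. rewrite !S_INR. pose proof (pos_INR n). lra. Qed.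

Lemma inv_INR_SS (n : nat) : 0 < / INR (S (S n)) < 1.
Proof.
  pose proof (INR_SS n). split; [apply Rinv_0_lt_compat; lra|].
  rewrite <- Rinv_1. apply Rinv_lt_contravar; lra.
Qed.

Lemma RInt_gam_mono (s a b a' b' : R) : 0 < a' -> a' <= a -> a <= b -> b <= b' ->
  RInt (gam_f s) a b <= RInt (gam_f s) a' b'.
Proof.
  intros h1 h2 h3 h4.
  assert (E1 := RInt_Chasles (V := R_CompleteNormedModule) (gam_f s) a' a b'
    (ex_RInt_gam s a' a h1 h2) (ex_RInt_gam s a b' ltac:(lra) ltac:(lra))).
  assert (E2 := RInt_Chasles (V := R_CompleteNormedModule) (gam_f s) a b b'
    (ex_RInt_gam s a b ltac:(lra) h3) (ex_RInt_gam s b b' ltac:(lra) h4)).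
  change (RInt (gam_f s) a' a + RInt (gam_f s) a b' = RInt (gam_f s) a' b') in E1.
  change (RInt (gam_f s) a b + RInt (gam_f s) b b' = RInt (gam_f s) a b') in E2.
  assert (0 <= RInt (gam_f s) a' a).
  { apply RInt_ge_0; [lra|apply ex_RInt_gam; lra|]. intros; left; apply gam_f_pos. }
  assert (0 <= RInt (gam_f s) b b').
  { apply RInt_ge_0; [lra|apply ex_RInt_gam; lra|]. intros; left; apply gam_f_pos. }
  lra.
Qed.

Lemma ln_le_sub1 (x : R) : 0 < x -> ln x <= x - 1.
Proof.
  intros h. pose proof (exp_ineq1_le (ln x)) as H. rewrite exp_ln in H by exact h. lra.
Qed.

Lemma ln_nonneg (t : R) : 1 <= t -> 0 <= ln t.
Proof. intros h. rewrite <- ln_1. apply ln_mono; lra. Qed.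

Lemma is_derive_Rpower (s t : R) : 0 < t -> is_derive (fun x => Rpower x s) t (s * Rpower t (s - 1)).
Proof.
  intros h. unfold Rpower. auto_derive; [exact h|].
  replace ((s - 1) * ln t) with (s * ln t + - ln t) by ring.
  rewrite exp_plus, exp_Ropp, exp_ln by exact h. field. lra.
Qed.

Lemma RInt_gam_bounded (s : R) : 0 < s -> exists M, forall a b, 0 < a < 1 -> 1 < b -> RInt (gam_f s) a b <= M.
Proof.
  intros hs.
  (* for t >= 1 the power is absorbed by exp (t/2) *)
  set (k := Rabs (s - 1)). set (c := 2 * (k + 1)).
  assert (hk : 0 <= k) by apply Rabs_pos.
  set (K := exp (k * ln c)).
  assert (hK : 0 < K) by apply exp_pos.
  assert (hbig : forall t, 1 <= t -> gam_f s t <= K * exp (- (t / 2))).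
  { intros t ht. unfold gam_f, Rpower, K. rewrite <- !exp_plus. apply exp_mono.
    pose proof (ln_nonneg t ht) as hl.
    assert (h1 : ln t <= t / c + ln c).
    { pose proof (ln_le_sub1 (t / c)) as H. rewrite ln_div in H by (unfold c; lra).
      assert (0 < t / c) by (apply Rmult_lt_0_compat; [lra|apply Rinv_0_lt_compat; unfold c; lra]).
      specialize (H H0). lra. }
    assert (h2 : (s - 1) * ln t <= k * ln t).
    { apply Rmult_le_compat_r; [exact hl|apply Rle_abs]. }
    assert (h3 : k * ln t <= k * (t / c) + k * ln c) by nra.
    assert (h4 : k * (t / c) <= t / 2).
    { unfold c. apply Rmult_le_reg_r with (2 * (k + 1)); [lra|].
      replace (k * (t / (2 * (k + 1))) * (2 * (k + 1))) with (k * t) by (field; lra). nra. }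
    lra. }
  exists (/ s + 2 * K). intros a b ha hb.
  assert (E := RInt_Chasles (V := R_CompleteNormedModule) (gam_f s) a 1 b
    (ex_RInt_gam s a 1 ltac:(lra) ltac:(lra)) (ex_RInt_gam s 1 b ltac:(lra) ltac:(lra))).
  change (RInt (gam_f s) a 1 + RInt (gam_f s) 1 b = RInt (gam_f s) a b) in E.
  assert (L : RInt (gam_f s) a 1 <= / s).
  { assert (I : is_RInt (fun t => Rpower t (s - 1)) a 1 (Rpower 1 s / s - Rpower a s / s)).
    { apply (is_RInt_derive (fun t => Rpower t s / s)).
      - intros t ht. rewrite Rmin_left in ht by lra.
        apply is_derive_ext with (fun t => / s * Rpower t s); [intros; apply Rmult_comm|].
        replace (Rpower t (s - 1)) with (/ s * (s * Rpower t (s - 1))) by (field; lra).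
        apply (is_derive_scal (fun t => Rpower t s)). apply is_derive_Rpower; lra.
      - intros t ht. rewrite Rmin_left in ht by lra.
        apply (ex_derive_continuous (fun t => Rpower t (s - 1))). eexists. apply is_derive_Rpower; lra. }
    apply Rle_trans with (Rpower 1 s / s - Rpower a s / s).
    - rewrite <- (is_RInt_unique _ _ _ _ I). apply RInt_le; [lra|apply ex_RInt_gam; lra|eexists; exact I|].
      intros t ht. unfold gam_f. rewrite <- (Rmult_1_r (Rpower t (s - 1))) at 2.
      apply Rmult_le_compat_l; [left; apply exp_pos|]. apply Rlt_le, exp_neg_lt1. lra.
    - assert (Rpower 1 s = 1) by (unfold Rpower; rewrite ln_1, Rmult_0_r; apply exp_0).
      assert (0 < Rpower a s / s) by (apply Rmult_lt_0_compat; [apply exp_pos|apply Rinv_0_lt_compat; lra]).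
      rewrite H. unfold Rdiv in *. lra. }
  assert (U : RInt (gam_f s) 1 b <= 2 * K).
  { assert (I : is_RInt (fun t => K * exp (- (t / 2))) 1 b (- 2 * K * exp (- (b / 2)) - - 2 * K * exp (- (1 / 2)))).
    { apply (is_RInt_derive (fun t => - 2 * K * exp (- (t / 2)))).
      - intros t _. auto_derive; [auto|]. unfold Rdiv. field.
      - intros t _. apply (ex_derive_continuous (fun t => K * exp (- (t / 2)))). auto_derive. auto. }
    apply Rle_trans with (- 2 * K * exp (- (b / 2)) - - 2 * K * exp (- (1 / 2))).
    - rewrite <- (is_RInt_unique _ _ _ _ I). apply RInt_le; [lra|apply ex_RInt_gam; lra|eexists; exact I|].
      intros t ht. apply hbig; lra.
    - pose proof (exp_pos (- (b / 2))). pose proof (exp_neg_lt1 (1 / 2) ltac:(lra)).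
      nra. }
  lra.
Qed.

Lemma Gseq_incr (s : R) (n : nat) : Gseq s n <= Gseq s (S n).
Proof.
  unfold Gseq. pose proof (INR_SS n). pose proof (inv_INR_SS n).
  assert (h : INR (S (S n)) <= INR (S (S (S n)))) by (apply le_INR; lia).
  apply RInt_gam_mono; [apply inv_INR_SS|apply Rinv_le_contravar; lra|lra|exact h].
Qed.

Lemma Gseq_mono (s : R) (n m : nat) : (n <= m)%nat -> Gseq s n <= Gseq s m.
Proof.
  intros h. induction h as [|m h IH]; [lra|]. pose proof (Gseq_incr s m). lra.
Qed.

Lemma exists_INR_ge (x : R) : exists n, x <= INR (S (S n)).
Proof.
  destruct (INR_unbounded x) as [n hn]. exists n. rewrite !S_INR. lra.
Qed.

(** The integrals over [1/(n+2), n+2] increase and are bounded; by positivity of the integrand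
    their limit governs all integrals over larger intervals, as the improper integral demands. *)
Lemma Gamma_int_lim (s : R) : 0 < s -> is_lim_seq (Gseq s) (Gamma_int s).
Proof.
  intros hs. destruct (RInt_gam_bounded s hs) as [M hM].
  destruct (ex_finite_lim_seq_incr (Gseq s) M (Gseq_incr s)) as [l hl].
  { intros n. apply hM; [apply inv_INR_SS|pose proof (INR_SS n); lra]. }
  replace (Gamma_int s) with l; [exact hl|].
  symmetry. unfold Gamma_int.
  change (RInt_gen (gam_f s) (at_right 0) (Rbar_locally p_infty) = l).
  apply (is_RInt_gen_unique (V := R_CompleteNormedModule)).
  intros P [eps hP].
  assert (hle : forall n, Gseq s n <= l).
  { intros n. assert (G : Rbar_le (Gseq s n) l); [|exact G].
    apply (is_lim_seq_le_loc (fun _ => Gseq s n) (Gseq s)).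
    - exists n. intros m hm. apply Gseq_mono, hm.
    - apply is_lim_seq_const.
    - exact hl. }
  assert (hl' := hl). apply is_lim_seq_spec in hl'. destruct (hl' eps) as [N hN].
  specialize (hN N (Nat.le_refl N)).
  pose proof (inv_INR_SS N) as hi. pose proof (INR_SS N) as hS.
  apply (Filter_prod _ _ _ (fun a => 0 < a < / INR (S (S N))) (fun b => INR (S (S N)) < b)).
  - exists (mkposreal (/ INR (S (S N))) (proj1 hi)). intros y hy h0.
    unfold ball in hy; cbn -[INR] in hy. unfold AbsRing_ball, abs, minus, plus, opp in hy; cbn -[INR] in hy.
    apply Rabs_def2 in hy. lra.
  - exists (INR (S (S N))). auto.
  - intros a b ha hb. cbn [fst snd].
    exists (RInt (gam_f s) a b). split.
    + apply (RInt_correct (V := R_CompleteNormedModule)), ex_RInt_gam; lra.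
    + apply hP.
      change (Rabs (RInt (gam_f s) a b - l) < eps).
      assert (L : Gseq s N <= RInt (gam_f s) a b) by (apply RInt_gam_mono; lra).
      assert (U : RInt (gam_f s) a b <= l).
      { destruct (exists_INR_ge b) as [n1 h1]. destruct (exists_INR_ge (/ a)) as [n2 h2].
        set (m := Nat.max n1 n2).
        assert (m1 : INR (S (S n1)) <= INR (S (S m))) by (apply le_INR; lia).
        assert (m2 : INR (S (S n2)) <= INR (S (S m))) by (apply le_INR; lia).
        apply Rle_trans with (Gseq s m); [|apply hle].
        apply RInt_gam_mono; [apply inv_INR_SS| |lra|lra].
        rewrite <- (Rinv_inv a). apply Rinv_le_contravar; [apply Rinv_0_lt_compat; lra|lra]. }
      apply Rabs_def2 in hN. apply Rabs_def1; lra.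
Qed.

Lemma Gamma_shift_pos (s : R) : 0 < s -> Gamma_shift s = 0%nat.
Proof.
  intros h. unfold Gamma_shift. destruct (archimed (- s)) as [h1 h2].
  assert ((up (- s) <= 0)%Z).
  { apply le_IZR. apply Rnot_lt_le. intros hc.
    assert ((1 <= up (- s))%Z) by (apply lt_IZR in hc; lia).
    apply IZR_le in H. lra. }
  lia.
Qed.

Lemma Gamma_pos_eq (s : R) : 0 < s -> Gamma s = Gamma_int s.
Proof.
  intros h. unfold Gamma. rewrite Gamma_shift_pos by exact h. cbn [INR rising].
  rewrite Rplus_0_r. field.
Qed.

Lemma Gamma_lim (s : R) : 0 < s -> is_lim_seq (Gseq s) (Gamma s).
Proof. intros h. rewrite Gamma_pos_eq by exact h. apply Gamma_int_lim, h. Qed.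

Lemma Gamma_pos (s : R) : 0 < s -> 0 < Gamma s.
Proof.
  intros h. apply Rlt_le_trans with (Gseq s 0).
  - unfold Gseq. pose proof (inv_INR_SS 0). pose proof (INR_SS 0).
    apply RInt_gt_0; [lra|intros; apply gam_f_pos|].
    intros t ht. apply (ex_derive_continuous (gam_f s)), ex_derive_gam_f. lra.
  - assert (G : Rbar_le (Gseq s 0) (Gamma s)); [|exact G].
    apply (is_lim_seq_le (fun _ => Gseq s 0) (Gseq s)).
    + intros n. apply Gseq_mono. lia.
    + apply is_lim_seq_const.
    + apply Gamma_lim, h.
Qed.

Lemma Rpower_exp_lim_infty (s : R) : 0 < s ->
  is_lim_seq (fun n => Rpower (INR (S (S n))) s * exp (- INR (S (S n)))) 0.
Proof.
  intros hs.
  (* x^(s+1) e^(-x) is at most (s+1)^(s+1), by ln t <= t at t = x/(s+1) *)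
  set (c := exp ((s + 1) * ln (s + 1))).
  apply is_lim_seq_le_le with (fun _ => 0) (fun n => c * / INR (S (S n))).
  - intros n. pose proof (INR_SS n) as hx. set (x := INR (S (S n))) in *. split.
    + left. apply Rmult_lt_0_compat; apply exp_pos.
    + rewrite <- (exp_ln x) at 3 by lra. rewrite <- exp_Ropp. unfold c, Rpower. rewrite <- !exp_plus.
      apply exp_mono. pose proof (ln_le_sub1 (x / (s + 1))) as H.
      assert (h0 : 0 < x / (s + 1)) by (apply Rmult_lt_0_compat; [lra|apply Rinv_0_lt_compat; lra]).
      specialize (H h0). rewrite ln_div in H by lra.
      assert ((s + 1) * ln x <= (s + 1) * ln (s + 1) + x).
      { apply Rle_trans with ((s + 1) * (ln (s + 1) + x / (s + 1))).
        - apply Rmult_le_compat_l; lra.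
        - right. field. lra. }
      lra.
  - apply is_lim_seq_const.
  - apply is_lim_seq_scal0. apply (is_lim_seq_incr_1 (fun n => / INR (S n))). apply is_lim_seq_inv_INR.
Qed.

Lemma is_lim_seq_scal_infty (c : R) (u : nat -> R) : 0 < c ->
  is_lim_seq u p_infty -> is_lim_seq (fun n => c * u n) p_infty.
Proof.
  intros hc h. replace p_infty with (Rbar_mult c p_infty); [apply is_lim_seq_scal_l, h|].
  cbn. destruct (Rle_dec 0 c) as [r|r]; [destruct (Rle_lt_or_eq_dec 0 c r); [reflexivity|lra]|lra].
Qed.

Lemma Rpower_inv_lim (s : R) : 0 < s -> is_lim_seq (fun n => Rpower (/ INR (S (S n))) s) 0.
Proof.
  intros hs.
  assert (h : is_lim_seq (fun n => INR (S (S n))) p_infty).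
  { apply (is_lim_seq_incr_1 (fun n => INR (S n))), (is_lim_seq_incr_1 INR).
    apply is_lim_seq_INR. }
  assert (hln : is_lim_seq (fun n => ln (INR (S (S n)))) p_infty).
  { apply (filterlim_comp _ _ _ (fun n => INR (S (S n))) ln _ _ _ h).
    apply (is_lim_ln_p). }
  assert (hm : is_lim_seq (fun n => s * ln (INR (S (S n)))) p_infty).
  { apply is_lim_seq_scal_infty; [exact hs|exact hln]. }
  apply is_lim_seq_ext with (fun n => / exp (s * ln (INR (S (S n))))).
  - intros n. pose proof (INR_SS n). unfold Rpower. rewrite ln_Rinv by lra. rewrite <- exp_Ropp. f_equal. ring.
  - replace (Finite 0) with (Rbar_inv p_infty) by reflexivity.
    apply is_lim_seq_inv; [|discriminate].
    apply (filterlim_comp _ _ _ (fun n => s * ln (INR (S (S n)))) exp _ _ _ hm). apply is_lim_exp_p.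
Qed.

Lemma Gamma_succ (s : R) : 0 < s -> Gamma (s + 1) = s * Gamma s.
Proof.
  intros hs.
  assert (E : forall n, Gseq (s + 1) n + (Rpower (INR (S (S n))) s * exp (- INR (S (S n)))
     - Rpower (/ INR (S (S n))) s * exp (- / INR (S (S n)))) = s * Gseq s n).
  { intros n. unfold Gseq. pose proof (INR_SS n). pose proof (inv_INR_SS n).
    set (b := INR (S (S n))) in *. set (a := / b) in *.
    assert (hab : a <= b) by lra.
    assert (I1 := RInt_correct (V := R_CompleteNormedModule) _ _ _ (ex_RInt_gam s a b ltac:(lra) hab)).
    assert (I2 := RInt_correct (V := R_CompleteNormedModule) _ _ _ (ex_RInt_gam (s + 1) a b ltac:(lra) hab)).
    pose proof (is_RInt_minus (V := R_NormedModule) _ _ _ _ _ _ (is_RInt_scal (V := R_NormedModule) _ _ _ s _ I1) I2) as I3.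
    assert (I4 : is_RInt (fun t => s * gam_f s t - gam_f (s + 1) t) a b
       (Rpower b s * exp (- b) - Rpower a s * exp (- a))).
    { apply (is_RInt_derive (fun t => Rpower t s * exp (- t))).
      - intros t ht. rewrite Rmin_left in ht by lra.
        pose proof (is_derive_Rpower s t ltac:(lra)) as d.
        assert (d2 : is_derive (fun t => exp (- t)) t (- exp (- t))) by (auto_derive; [auto|ring]).
        pose proof (is_derive_mult (fun t => Rpower t s) (fun t => exp (- t)) t _ _ d d2 ltac:(intros; apply Rmult_comm)) as d3.
        replace (s * gam_f s t - gam_f (s + 1) t) with
          (s * Rpower t (s - 1) * exp (- t) + Rpower t s * - exp (- t)); [exact d3|].
        unfold gam_f. replace (s + 1 - 1) with s by ring. ring.
      - intros t ht. rewrite Rmin_left in ht by lra.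
        apply (ex_derive_continuous (fun t => s * gam_f s t - gam_f (s + 1) t)).
        apply (ex_derive_minus (fun t => s * gam_f s t) (gam_f (s + 1))).
        + apply (ex_derive_scal (gam_f s)). apply ex_derive_gam_f; lra.
        + apply ex_derive_gam_f; lra. }
    apply (is_RInt_unique (V := R_CompleteNormedModule)) in I4.
    apply (is_RInt_unique (V := R_CompleteNormedModule)) in I3.
    change (RInt (fun t => s * gam_f s t - gam_f (s + 1) t) a b = s * RInt (gam_f s) a b - RInt (gam_f (s + 1)) a b) in I3.
    rewrite I3 in I4. lra. }
  assert (L1 : is_lim_seq (fun n => s * Gseq s n) (Gamma (s + 1) + (0 - 0))).
  { apply is_lim_seq_ext with (1 := E).
    apply is_lim_seq_plus'; [apply Gamma_lim; lra|].
    apply is_lim_seq_minus'; [apply Rpower_exp_lim_infty, hs|].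
    apply is_lim_seq_le_le with (fun _ => 0) (fun n => Rpower (/ INR (S (S n))) s);
      [|apply is_lim_seq_const|apply Rpower_inv_lim, hs].
    intros n. pose proof (inv_INR_SS n).
    assert (hr : 0 < Rpower (/ INR (S (S n))) s) by apply exp_pos.
    pose proof (exp_pos (- / INR (S (S n)))).
    pose proof (exp_neg_lt1 (/ INR (S (S n))) ltac:(lra)). nra. }
  assert (L2 : is_lim_seq (fun n => s * Gseq s n) (s * Gamma s)).
  { apply (is_lim_seq_scal_l (Gseq s) s (Gamma s)). apply Gamma_lim, hs. }
  apply is_lim_seq_unique in L1. apply is_lim_seq_unique in L2. rewrite L1 in L2.
  injection L2 as L2. lra.
Qed.

(** [y^s <= 1 - s + s y], written with [y = exp a]. *)
Lemma exp_tangent (s a : R) : 0 <= s <= 1 -> exp (s * a) <= 1 - s + s * exp a.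
Proof.
  intros hs.
  pose proof (exp_ineq1_le ((1 - s) * a)) as h1. pose proof (exp_ineq1_le (- (s * a))) as h2.
  pose proof (exp_pos (s * a)) as h3.
  assert (e1 : exp a = exp (s * a) * exp ((1 - s) * a)) by (rewrite <- exp_plus; f_equal; ring).
  assert (e2 : exp (s * a) * exp (- (s * a)) = 1) by (rewrite <- exp_plus, Rplus_opp_r; apply exp_0).
  set (p := exp (s * a)) in *. set (u := exp ((1 - s) * a)) in *. set (v := exp (- (s * a))) in *.
  rewrite e1. replace (1 - s + s * (p * u)) with (p * (s * u + (1 - s) * v)).
  2:{ transitivity ((1 - s) * (p * v) + s * (p * u)); [ring|rewrite e2; ring]. }
  assert (1 <= s * u + (1 - s) * v); [|nra].
  assert (s * (1 + (1 - s) * a) <= s * u) by (apply Rmult_le_compat_l; lra).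
  assert ((1 - s) * (1 + - (s * a)) <= (1 - s) * v) by (apply Rmult_le_compat_l; lra). nra.
Qed.

Lemma gam_f_add_le (x s t : R) : 0 < x -> 0 <= s <= 1 -> 0 < t ->
  gam_f (x + s) t <= Rpower x s * ((1 - s) * gam_f x t + s / x * gam_f (x + 1) t).
Proof.
  intros hx hs ht. unfold gam_f.
  pose proof (exp_tangent s (ln t - ln x) hs) as H.
  assert (e : exp (ln t - ln x) = t / x).
  { unfold Rminus. rewrite exp_plus, exp_Ropp, !exp_ln by lra. reflexivity. }
  rewrite e in H.
  replace (Rpower t (x + s - 1)) with (Rpower x s * (exp (s * (ln t - ln x)) * Rpower t (x - 1))).
  2:{ unfold Rpower. rewrite <- !exp_plus. f_equal. ring. }
  replace (Rpower t (x + 1 - 1)) with (t * Rpower t (x - 1)).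
  2:{ rewrite <- (Rpower_1 t) at 1 by exact ht. rewrite <- Rpower_plus. f_equal. ring. }
  assert (hp : 0 < Rpower t (x - 1) * exp (- t)) by (apply Rmult_lt_0_compat; apply exp_pos).
  assert (hq : 0 < Rpower x s) by apply exp_pos.
  set (P := Rpower t (x - 1)) in *. set (E := exp (s * (ln t - ln x))) in *.
  replace (Rpower x s * (E * P) * exp (- t)) with (Rpower x s * (E * (P * exp (- t)))) by ring.
  apply Rmult_le_compat_l; [lra|].
  replace ((1 - s) * (P * exp (- t)) + s / x * (t * P * exp (- t)))
    with ((1 - s + s * (t / x)) * (P * exp (- t))) by (field; lra).
  apply Rmult_le_compat_r; lra.
Qed.

(** The tangent inequality at [t = x] under the integral sign. *)
Lemma Gamma_add_le (x s : R) : 0 < x -> 0 <= s <= 1 -> Gamma (x + s) <= Rpower x s * Gamma x.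
Proof.
  intros hx hs.
  assert (hq : 0 < Rpower x s) by apply exp_pos.
  assert (E : forall n, Gseq (x + s) n <= Rpower x s * ((1 - s) * Gseq x n + s / x * Gseq (x + 1) n)).
  { intros n. unfold Gseq. pose proof (INR_SS n). pose proof (inv_INR_SS n).
    set (b := INR (S (S n))) in *. set (a := / b) in *. assert (hab : a <= b) by lra.
    assert (ex : forall y, ex_RInt (gam_f y) a b) by (intros y; apply ex_RInt_gam; lra).
    assert (I : is_RInt (fun t => Rpower x s * ((1 - s) * gam_f x t + s / x * gam_f (x + 1) t)) a b
      (Rpower x s * ((1 - s) * RInt (gam_f x) a b + s / x * RInt (gam_f (x + 1)) a b))).
    { apply (is_RInt_scal (V := R_NormedModule)).
      apply (is_RInt_plus (V := R_NormedModule));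
        apply (is_RInt_scal (V := R_NormedModule)), (RInt_correct (V := R_CompleteNormedModule)), ex. }
    rewrite <- (is_RInt_unique (V := R_CompleteNormedModule) _ _ _ _ I).
    apply RInt_le; [exact hab|apply ex|eexists; exact I|].
    intros t ht. apply gam_f_add_le; lra. }
  assert (H : Rbar_le (Gamma (x + s)) (Rpower x s * ((1 - s) * Gamma x + s / x * Gamma (x + 1)))).
  { apply (is_lim_seq_le _ _ _ _ E).
    - apply Gamma_lim; lra.
    - apply (is_lim_seq_scal_l _ _ (Finite _)). apply is_lim_seq_plus';
        apply (is_lim_seq_scal_l _ _ (Finite _)), Gamma_lim; lra. }
  cbn in H. rewrite Gamma_succ in H by exact hx.
  replace ((1 - s) * Gamma x + s / x * (x * Gamma x)) with (Gamma x) in H by (field; lra). exact H.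
Qed.

Definition gratio (s x : R) : R := Gamma (x + s) / (Rpower x s * Gamma x).

Lemma Rpower_pos (x s : R) : 0 < Rpower x s.
Proof. apply exp_pos. Qed.

(** The upper bound is [Gamma_add_le] at x, the lower one is [Gamma_add_le] at [x + s]. *)
Lemma gratio_bounds (s x : R) : 0 < x -> 0 < s < 1 -> x / (x + s) <= gratio s x <= 1.
Proof.
  intros hx hs. unfold gratio. pose proof (Gamma_pos x hx) as hg. pose proof (Rpower_pos x s) as hp.
  assert (hd : 0 < Rpower x s * Gamma x) by nra.
  split.
  - pose proof (Gamma_add_le (x + s) (1 - s) ltac:(lra) ltac:(lra)) as H.
    replace (x + s + (1 - s)) with (x + 1) in H by ring. rewrite Gamma_succ in H by exact hx.
    pose proof (Rpower_pos (x + s) (1 - s)) as hr.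
    apply Rmult_le_reg_r with (Rpower x s * Gamma x); [exact hd|].
    unfold Rdiv at 2. rewrite Rmult_assoc, Rinv_l, Rmult_1_r by lra.
    apply Rmult_le_reg_l with (Rpower (x + s) (1 - s)); [exact hr|].
    eapply Rle_trans; [|exact H].
    assert (K : Rpower (x + s) (1 - s) * Rpower x s <= x + s).
    { replace (x + s) with (Rpower (x + s) (1 - s) * Rpower (x + s) s) at 2.
      - apply Rmult_le_compat_l; [lra|]. apply Rle_Rpower_l; lra.
      - rewrite <- Rpower_plus. replace (1 - s + s) with 1 by ring. apply Rpower_1. lra. }
    replace (Rpower (x + s) (1 - s) * (x / (x + s) * (Rpower x s * Gamma x)))
      with (x * Gamma x * / (x + s) * (Rpower (x + s) (1 - s) * Rpower x s)) by (field; lra).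
    replace (x * Gamma x) with (x * Gamma x * / (x + s) * (x + s)) at 2 by (field; lra).
    apply Rmult_le_compat_l; [|exact K].
    apply Rmult_le_pos; [nra|left; apply Rinv_0_lt_compat; lra].
  - apply Rmult_le_reg_r with (Rpower x s * Gamma x); [exact hd|].
    unfold Rdiv. rewrite Rmult_assoc, Rinv_l, Rmult_1_r, Rmult_1_l by lra.
    apply Gamma_add_le; lra.
Qed.

Lemma gratio_lim (s : R) (u : nat -> R) : 0 < s < 1 -> (forall n, 0 < u n) -> is_lim_seq u p_infty ->
  is_lim_seq (fun n => gratio s (u n)) 1.
Proof.
  intros hs hu hl.
  apply is_lim_seq_le_le with (fun n => 1 - s * / (u n + s)) (fun _ => 1).
  - intros n. pose proof (gratio_bounds s (u n) (hu n) hs) as H. specialize (hu n).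
    replace (1 - s * / (u n + s)) with (u n / (u n + s)) by (field; lra). exact H.
  - replace (Finite 1) with (Finite (1 - 0)) by (f_equal; ring).
    apply is_lim_seq_minus'; [apply is_lim_seq_const|].
    apply is_lim_seq_scal0.
    replace (Finite 0) with (Rbar_inv p_infty) by reflexivity.
    apply is_lim_seq_inv; [|discriminate].
    replace p_infty with (Rbar_plus p_infty s) by reflexivity.
    apply is_lim_seq_plus with p_infty s; [exact hl|apply is_lim_seq_const|reflexivity].
  - apply is_lim_seq_const.
Qed.

Lemma is_lim_seq_INR_S : is_lim_seq (fun n => INR (S n)) p_infty.
Proof. apply (is_lim_seq_incr_1 INR). apply is_lim_seq_INR. Qed.

Lemma gratio_INR_lim (s : R) : 0 < s < 1 -> is_lim_seq (fun n => gratio s (INR (S n))) 1.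
Proof. intros h. apply gratio_lim; [exact h|apply INR_S_pos|apply is_lim_seq_INR_S]. Qed.

Lemma Gamma_1 : Gamma 1 = 1.
Proof.
  assert (H := Gamma_lim 1 Rlt_0_1).
  assert (E : forall n, Gseq 1 n = exp (- / INR (S (S n))) - exp (- INR (S (S n)))).
  { intros n. unfold Gseq. pose proof (INR_SS n). pose proof (inv_INR_SS n).
    set (b := INR (S (S n))) in *.
    apply is_RInt_unique.
    replace (exp (- / b) - exp (- b)) with (- exp (- b) - - exp (- / b)) by ring.
    apply (is_RInt_derive (fun t => - exp (- t))).
    - intros t ht. rewrite Rmin_left in ht by lra. unfold gam_f.
      replace (1 - 1) with 0 by ring. rewrite Rpower_O by lra. auto_derive; [auto|ring].
    - intros t ht. rewrite Rmin_left in ht by lra.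
      apply (ex_derive_continuous (gam_f 1)), ex_derive_gam_f. lra. }
  assert (L : is_lim_seq (Gseq 1) (1 - 0)).
  { apply is_lim_seq_ext with (fun n => exp (- / INR (S (S n))) - exp (- INR (S (S n)))); [intros; symmetry; apply E|].
    apply is_lim_seq_minus'.
    - rewrite <- exp_0 at 1. apply (is_lim_seq_continuous exp).
      + apply derivable_continuous_pt, derivable_pt_exp.
      + replace (Finite 0) with (Rbar_opp 0) by (cbn; f_equal; ring). apply -> is_lim_seq_opp.
        apply (is_lim_seq_incr_1 (fun n => / INR (S n))). apply is_lim_seq_inv_INR.
    - apply is_lim_seq_ext with (fun n => exp (- (2 + INR n * 1))).
      + intros n. f_equal. rewrite !S_INR. ring.
      + apply is_lim_seq_exp_arith. lra. }
  apply is_lim_seq_unique in L. apply is_lim_seq_unique in H. rewrite H in L. injection L. lra.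
Qed.

(** The substitution [t = v^2]. *)
Lemma Gamma_half : Gamma (1 / 2) = sqrt PI.
Proof.
  assert (H := Gamma_lim (1 / 2) ltac:(lra)).
  assert (E : forall n, Gseq (1 / 2) n = 2 * gauss_half (sqrt (INR (S (S n)))) - 2 * gauss_half (sqrt (/ INR (S (S n))))).
  { intros n. unfold Gseq. pose proof (INR_SS n). pose proof (inv_INR_SS n).
    set (b := INR (S (S n))) in *.
    apply is_RInt_unique.
    apply (is_RInt_derive (fun t => 2 * gauss_half (sqrt t))).
    - intros t ht. rewrite Rmin_left in ht by lra. assert (h0 : 0 < t) by lra.
      pose proof (sqrt_lt_R0 t h0) as hq. pose proof (sqrt_sqrt t ltac:(lra)) as hqq.
      assert (d1 : is_derive sqrt t (/ (2 * sqrt t))).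
      { auto_derive; [exact h0|]. field. lra. }
      pose proof (is_derive_comp gauss_half sqrt t _ _ (is_derive_gauss_half (sqrt t)) d1) as d2.
      pose proof (is_derive_scal (fun t => gauss_half (sqrt t)) t 2 _ d2) as d3.
      replace (gam_f (1 / 2) t) with (2 * (/ (2 * sqrt t) * exp (- sqrt t ^ 2))); [exact d3|].
      unfold gam_f. replace (1 / 2 - 1) with (- / 2) by field.
      rewrite Rpower_Ropp, Rpower_sqrt by exact h0.
      replace (sqrt t ^ 2) with t by (rewrite <- hqq at 1; ring). field. lra.
    - intros t ht. rewrite Rmin_left in ht by lra.
      apply (ex_derive_continuous (gam_f (1 / 2))), ex_derive_gam_f. lra. }
  assert (hinf : is_lim_seq (fun n => sqrt (INR (S (S n)))) p_infty).
  { apply (filterlim_comp _ _ _ (fun n => INR (S (S n))) sqrt _ (Rbar_locally p_infty)).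
    - apply (is_lim_seq_incr_1 (fun n => INR (S n))), is_lim_seq_INR_S.
    - apply filterlim_sqrt_p. }
  assert (L : is_lim_seq (Gseq (1 / 2)) (2 * (sqrt PI / 2) - 2 * 0)).
  { apply is_lim_seq_ext with (1 := fun n => eq_sym (E n)).
    apply is_lim_seq_minus'.
    - apply (is_lim_seq_scal_l _ 2 (Finite _)). apply gauss_half_lim, hinf.
    - apply (is_lim_seq_scal_l _ 2 (Finite _)).
      replace 0 with (gauss_half (sqrt 0)).
      2:{ rewrite sqrt_0. unfold gauss_half. rewrite RInt_point. reflexivity. }
      apply (is_lim_seq_continuous (fun x => gauss_half (sqrt x)) (fun n => / INR (S (S n)))).
      + apply (continuity_pt_comp sqrt gauss_half); [apply continuity_pt_sqrt; lra|].
        apply continuity_pt_filterlim, (ex_derive_continuous gauss_half). eexists. apply is_derive_gauss_half.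
      + apply (is_lim_seq_incr_1 (fun n => / INR (S n))). apply is_lim_seq_inv_INR. }
  apply is_lim_seq_unique in L. apply is_lim_seq_unique in H. rewrite H in L. injection L. lra.
Qed.

Lemma rising_pos (s : R) (k : nat) : 0 < s -> 0 < rising s k.
Proof.
  intros h. induction k as [|k IH]; cbn [rising]; [lra|]. pose proof (pos_INR k). nra.
Qed.

Lemma Gamma_rising (s : R) (k : nat) : 0 < s -> Gamma (INR k + s) = rising s k * Gamma s.
Proof.
  intros h. induction k as [|k IH].
  - cbn [INR rising]. rewrite Rplus_0_l. ring.
  - rewrite S_INR. replace (INR k + 1 + s) with (INR k + s + 1) by ring.
    pose proof (pos_INR k). rewrite Gamma_succ, IH by lra. cbn [rising]. ring.
Qed.

Lemma rising_double (k : nat) : rising (1 / 2) (2 * k) = 4 ^ k * (rising (1 / 4) k * rising (3 / 4) k).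
Proof.
  induction k as [|k IH]; [cbn; ring|].
  replace (2 * S k)%nat with (S (S (2 * k))) by lia. cbn [rising pow]. rewrite IH, (S_INR (2 * k)), mult_INR.
  cbn [INR]. field.
Qed.

(** The duplication formula at integers. *)
Lemma Gamma_double (n : nat) :
  Gamma (1 / 2) * Gamma (2 * INR (S n)) = 2 * 4 ^ n * (Gamma (INR (S n)) * Gamma (INR (S n) + 1 / 2)).
Proof.
  induction n as [|n IH].
  - cbn [INR pow]. replace (2 * 1) with (1 + 1) by ring.
    rewrite (Rplus_comm 1 (1 / 2)), !Gamma_succ, Gamma_1 by lra. field.
  - pose proof (INR_S_pos n) as h. rewrite (S_INR (S n)). set (x := INR (S n)) in *.
    replace (2 * (x + 1)) with (2 * x + 1 + 1) by ring.
    replace (x + 1 + 1 / 2) with (x + 1 / 2 + 1) by ring.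
    rewrite !(Gamma_succ (2 * x + 1)), (Gamma_succ (2 * x)), (Gamma_succ x), (Gamma_succ (x + 1 / 2)) by lra.
    transitivity ((2 * x + 1) * (2 * x) * (Gamma (1 / 2) * Gamma (2 * x))); [ring|rewrite IH].
    cbn [pow]. field.
Qed.

(** Products over [j + 1/4] and [j + 3/4] together run over the half-integers, so the quotient of
    the two sides is, for every k, a quotient of ratios [gratio] that all tend to 1. *)
Theorem Gamma_quarter : Gamma (1 / 4) * Gamma (3 / 4) = sqrt 2 * PI.
Proof.
  set (r := fun n => gratio (1 / 4) (INR (S n)) * gratio (3 / 4) (INR (S n)) /
     (gratio (1 / 2) (2 * INR (S n)) * gratio (1 / 2) (INR (S n)))).
  assert (hr : is_lim_seq r (1 * 1 / (1 * 1))).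
  { apply is_lim_seq_div'; [| |lra].
    - apply is_lim_seq_mult'; apply gratio_INR_lim; lra.
    - apply is_lim_seq_mult'; [|apply gratio_INR_lim; lra].
      apply gratio_lim; [lra|intros n; pose proof (INR_S_pos n); lra|].
      apply is_lim_seq_scal_infty; [lra|apply is_lim_seq_INR_S]. }
  assert (E : forall n, Gamma (1 / 4) * Gamma (3 / 4) = sqrt 2 * PI * r n).
  { intros n. pose proof (INR_S_pos n) as hx. unfold r, gratio.
    set (k := S n) in *. set (x := INR k) in *.
    pose proof (Gamma_rising (1 / 4) k ltac:(lra)) as g1. pose proof (Gamma_rising (3 / 4) k ltac:(lra)) as g3.
    pose proof (Gamma_rising (1 / 2) (2 * k) ltac:(lra)) as g2. rewrite rising_double, mult_INR in g2.
    fold x in g1, g3, g2. cbn [INR] in g2. replace (1 + 1) with 2 in g2 by ring.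
    pose proof (Gamma_double n) as gd. fold k x in gd.
    rewrite g1, g3, g2.
    pose proof (Gamma_pos x hx) as p0. pose proof (Gamma_pos (1 / 2) ltac:(lra)) as p1.
    pose proof (Gamma_pos (x + 1 / 2) ltac:(lra)) as p2. pose proof (Gamma_pos (2 * x) ltac:(lra)) as p3.
    pose proof (rising_pos (1 / 4) k ltac:(lra)) as q1. pose proof (rising_pos (3 / 4) k ltac:(lra)) as q3.
    assert (hG : Gamma (2 * x) = 2 * 4 ^ n * (Gamma x * Gamma (x + 1 / 2)) / Gamma (1 / 2)).
    { rewrite <- gd. field. lra. }
    rewrite hG.
    replace (Rpower (2 * x) (1 / 2)) with (sqrt 2 * Rpower x (1 / 2)).
    2:{ rewrite <- Rpower_mult_distr by lra. f_equal. replace (1 / 2) with (/ 2) by field.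
        symmetry. apply Rpower_sqrt; lra. }
    assert (hpx : Rpower x (1 / 4) * Rpower x (3 / 4) = x).
    { rewrite <- Rpower_plus. replace (1 / 4 + 3 / 4) with 1 by field. apply Rpower_1; exact hx. }
    assert (hpy : Rpower x (1 / 2) * Rpower x (1 / 2) = x).
    { rewrite <- Rpower_plus. replace (1 / 2 + 1 / 2) with 1 by field. apply Rpower_1; exact hx. }
    pose proof (Rpower_pos x (1 / 4)). pose proof (Rpower_pos x (3 / 4)). pose proof (Rpower_pos x (1 / 2)).
    assert (hP : PI = Gamma (1 / 2) * Gamma (1 / 2)).
    { rewrite Gamma_half. symmetry. apply sqrt_sqrt. pose proof PI_RGT_0; lra. }
    pose proof (sqrt_lt_R0 2 ltac:(lra)) as hs2. pose proof (sqrt_sqrt 2 ltac:(lra)) as hss.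
    assert (h4 : 0 < 4 ^ n) by (apply pow_lt; lra).
    rewrite hP. unfold k. cbn [pow]. fold k.
    set (R1 := rising (1 / 4) k) in *. set (R3 := rising (3 / 4) k) in *.
    set (a := Rpower x (1 / 4)) in *. set (b := Rpower x (3 / 4)) in *. set (c := Rpower x (1 / 2)) in *.
    set (A := Gamma (1 / 4)). set (B := Gamma (3 / 4)). set (h := Gamma (1 / 2)) in *.
    set (G := Gamma x) in *. set (H' := Gamma (x + 1 / 2)) in *. set (f := 4 ^ n) in *. set (w := sqrt 2) in *.
    transitivity (A * B * (w * w * (c * c)) / (2 * (a * b))); [rewrite hss, hpy, hpx; field; lra|].
    field. repeat split; lra. }
  assert (L : is_lim_seq (fun _ : nat => Gamma (1 / 4) * Gamma (3 / 4)) (sqrt 2 * PI * (1 * 1 / (1 * 1)))).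
  { apply is_lim_seq_ext with (fun n => sqrt 2 * PI * r n); [intros; symmetry; apply E|].
    apply (is_lim_seq_scal_l r _ (Finite _)). exact hr. }
  apply is_lim_seq_unique in L. rewrite Lim_seq_const in L. injection L as L. rewrite L. field.
Qed.

(** The product of the quotients [(4k+3)/(4k+1)] for [k < M]. *)
Definition odd_quot (M : nat) : R := rising (3 / 4) M / rising (1 / 4) M.

Lemma odd_quot_lim :
  is_lim_seq (fun n => odd_quot (S n) / Rpower (INR (S n)) (1 / 2)) (Gamma (1 / 4) / Gamma (3 / 4)).
Proof.
  pose proof (Gamma_pos (1 / 4) ltac:(lra)) as h1. pose proof (Gamma_pos (3 / 4) ltac:(lra)) as h3.
  apply is_lim_seq_ext with (fun n => Gamma (1 / 4) / Gamma (3 / 4) *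
     (gratio (3 / 4) (INR (S n)) / gratio (1 / 4) (INR (S n)))).
  - intros n. unfold odd_quot, gratio. pose proof (INR_S_pos n) as hx.
    rewrite !Gamma_rising by lra. set (x := INR (S n)) in *.
    pose proof (rising_pos (1 / 4) (S n) ltac:(lra)). pose proof (Gamma_pos x hx).
    pose proof (Rpower_pos x (1 / 4)). pose proof (Rpower_pos x (1 / 2)).
    replace (Rpower x (3 / 4)) with (Rpower x (1 / 4) * Rpower x (1 / 2)) by (rewrite <- Rpower_plus; f_equal; field).
    field. repeat split; lra.
  - replace (Finite (Gamma (1 / 4) / Gamma (3 / 4))) with
      (Rbar_mult (Finite (Gamma (1 / 4) / Gamma (3 / 4))) (Finite (1 / 1))) by (cbn; f_equal; field; lra).
    apply is_lim_seq_scal_l. apply is_lim_seq_div'; [apply gratio_INR_lim; lra|apply gratio_INR_lim; lra|lra].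
Qed.

(** * The Bessel functions for large argument *)

Definition cosh_term (x : R) (m : nat) : R := x ^ (2 * m) / INR (fact (2 * m)).
Definition sinh_term (x : R) (m : nat) : R := x ^ (2 * m + 1) / INR (fact (2 * m + 1)).

Lemma exp_series_R (x : R) : is_series (fun n => x ^ n / INR (fact n)) (exp x).
Proof.
  pose proof (is_exp_Reals x) as H. apply is_pseries_R in H.
  eapply is_series_ext; [|exact H]. intros n. unfold Rdiv. eqR. ring.
Qed.

Lemma pow_m1_mul (x : R) (n : nat) : (- x) ^ n = (-1) ^ n * x ^ n.
Proof. rewrite <- Rpow_mult_distr. f_equal. ring. Qed.

Lemma pow_m1_even (m : nat) : (-1) ^ (2 * m) = 1.
Proof. rewrite pow_mult. replace ((-1) ^ 2) with 1 by ring. apply pow1. Qed.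

Lemma pow_m1_odd (m : nat) : (-1) ^ (2 * m + 1) = -1.
Proof. rewrite pow_add, pow_m1_even. ring. Qed.

Lemma cosh_series (x : R) : is_series (cosh_term x) (cosh x).
Proof.
  pose proof (is_series_scal_l (/ 2) _ _ (is_series_pairs _ _
    (is_series_plus _ _ _ _ (exp_series_R x) (exp_series_R (- x))))) as H.
  replace (cosh x) with (/ 2 * (exp x + exp (- x))) by (unfold cosh; field).
  eapply is_series_ext; [|exact H]. intros m. cbv beta.
  change (/ 2 * ((x ^ (2 * m) / INR (fact (2 * m)) + (- x) ^ (2 * m) / INR (fact (2 * m)))
    + (x ^ (2 * m + 1) / INR (fact (2 * m + 1)) + (- x) ^ (2 * m + 1) / INR (fact (2 * m + 1)))) = cosh_term x m).
  rewrite !(pow_m1_mul x), pow_m1_even, pow_m1_odd. unfold cosh_term. field.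
  split; apply INR_fact_neq_0.
Qed.

Lemma sinh_series (x : R) : is_series (sinh_term x) (sinh x).
Proof.
  pose proof (is_series_scal_l (/ 2) _ _ (is_series_pairs _ _
    (is_series_minus _ _ _ _ (exp_series_R x) (exp_series_R (- x))))) as H.
  replace (sinh x) with (/ 2 * (exp x - exp (- x))) by (unfold sinh; field).
  eapply is_series_ext; [|exact H]. intros m. cbv beta.
  change (/ 2 * ((x ^ (2 * m) / INR (fact (2 * m)) - (- x) ^ (2 * m) / INR (fact (2 * m)))
    + (x ^ (2 * m + 1) / INR (fact (2 * m + 1)) - (- x) ^ (2 * m + 1) / INR (fact (2 * m + 1)))) = sinh_term x m).
  rewrite !(pow_m1_mul x), pow_m1_even, pow_m1_odd. unfold sinh_term. field.
  split; apply INR_fact_neq_0.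
Qed.

Lemma is_series_shift0 (a : nat -> R) (l : R) : a 0%nat = 0 ->
  is_series (fun n => a (S n)) l -> is_series a l.
Proof.
  intros h0 h. replace l with (plus l (opp (a 0%nat))) in h.
  - pose proof (is_series_decr_1 a l) as H. apply H. exact h.
  - rewrite h0. unfold plus, opp; cbn. ring.
Qed.

Lemma cosh_term_succ (x : R) (m : nat) :
  2 * INR (S m) * cosh_term x (S m) = x * sinh_term x m /\
  (2 * INR m + 1) * sinh_term x m = x * cosh_term x m.
Proof.
  unfold cosh_term, sinh_term. split.
  - replace (2 * S m)%nat with (S (2 * m + 1)) by lia.
    rewrite fact_simpl, mult_INR. replace (INR (S (2 * m + 1))) with (2 * INR (S m)).
    + cbn [pow]. pose proof (INR_S_pos m). pose proof (INR_fact_neq_0 (2 * m + 1)). field. lra.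
    + rewrite !S_INR, plus_INR, mult_INR. cbn [INR]. ring.
  - replace (2 * m + 1)%nat with (S (2 * m)) by lia.
    rewrite fact_simpl, mult_INR. replace (INR (S (2 * m))) with (2 * INR m + 1).
    + cbn [pow]. pose proof (INR_odd_pos m). pose proof (INR_fact_neq_0 (2 * m)). field. lra.
    + rewrite S_INR, mult_INR. cbn [INR]. ring.
Qed.

Lemma cosh_moment1 (x : R) : is_series (fun m => 2 * INR m * cosh_term x m) (x * sinh x).
Proof.
  apply is_series_shift0; [cbn; ring|].
  eapply is_series_ext; [|exact (is_series_scal_l x _ _ (sinh_series x))].
  intros m. symmetry. apply (proj1 (cosh_term_succ x m)).
Qed.

Lemma cosh_moment2 (x : R) :
  is_series (fun m => 2 * INR m * (2 * INR m - 1) * cosh_term x m) (x ^ 2 * cosh x).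
Proof.
  apply is_series_shift0; [cbn; ring|].
  eapply is_series_ext; [|exact (is_series_scal_l (x ^ 2) _ _ (cosh_series x))].
  intros m. symmetry. destruct (cosh_term_succ x m) as [h1 h2].
  change (2 * INR (S m) * (2 * INR (S m) - 1) * cosh_term x (S m) = x ^ 2 * cosh_term x m).
  transitivity ((2 * INR (S m) - 1) * (2 * INR (S m) * cosh_term x (S m))); [ring|]. rewrite h1.
  rewrite S_INR. transitivity (x * ((2 * INR m + 1) * sinh_term x m)); [ring|]. rewrite h2. ring.
Qed.

(** The weights [x^(2m) / (2m)!] have mean nearly x and variance of the order of x. *)
Lemma cosh_variance (x : R) :
  is_series (fun m => (2 * INR m - x) ^ 2 * cosh_term x m) (2 * x ^ 2 * exp (- x) + x * sinh x).
Proof.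
  pose proof (is_series_plus _ _ _ _ (cosh_moment2 x)
    (is_series_plus _ _ _ _ (is_series_scal_l (1 - 2 * x) _ _ (cosh_moment1 x))
      (is_series_scal_l (x ^ 2) _ _ (cosh_series x)))) as H.
  replace (2 * x ^ 2 * exp (- x) + x * sinh x)
    with (x ^ 2 * cosh x + ((1 - 2 * x) * (x * sinh x) + x ^ 2 * cosh x)) by (unfold cosh, sinh; field).
  eapply is_series_ext; [|exact H]. intros m. cbv beta.
  change (2 * INR m * (2 * INR m - 1) * cosh_term x m +
    ((1 - 2 * x) * (2 * INR m * cosh_term x m) + x ^ 2 * cosh_term x m) = (2 * INR m - x) ^ 2 * cosh_term x m).
  ring.
Qed.

Lemma rising_half_fact (m : nat) : rising (1 / 2) m * (4 ^ m * INR (fact m)) = INR (fact (2 * m)).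
Proof.
  induction m as [|m IH]; [cbn; ring|].
  replace (2 * S m)%nat with (S (S (2 * m))) by lia.
  rewrite (fact_simpl (S (2 * m))), (fact_simpl (2 * m)), (fact_simpl m), !mult_INR, <- IH.
  cbn [rising pow]. rewrite (S_INR (S (2 * m))), (S_INR (2 * m)), (S_INR m), mult_INR. cbn [INR]. field.
Qed.

(** In terms of [cosh_term] the coefficients of the Bessel series become quotients of values of
    the Gamma function, by the duplication identity for factorials. *)
Lemma bessel_term (x s c : R) (m : nat) : 0 < x ->
  Rpower (x / 2) (2 * INR m + s) / (INR (fact m) * c) =
  Rpower (x / 2) s * (cosh_term x m * (Gamma (INR m + 1 / 2) / (sqrt PI * c))).
Proof.
  intros hx. rewrite Gamma_rising, Gamma_half by lra.
  pose proof (rising_half_fact m) as hr. pose proof (INR_fact_neq_0 m) as h1.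
  pose proof (INR_fact_neq_0 (2 * m)) as h2. pose proof PI_RGT_0 as hP.
  pose proof (sqrt_lt_R0 PI hP) as hs. assert (h4 : 0 < 4 ^ m) by (apply pow_lt; lra).
  assert (e : Rpower (x / 2) (2 * INR m + s) = x ^ (2 * m) / 4 ^ m * Rpower (x / 2) s).
  { rewrite Rpower_plus. f_equal.
    replace (2 * INR m) with (INR (2 * m)) by (rewrite mult_INR; cbn [INR]; ring).
    rewrite Rpower_pow by lra. unfold Rdiv at 1. rewrite Rpow_mult_distr. unfold Rdiv. f_equal.
    rewrite pow_mult. replace ((/ 2) ^ 2) with (/ 4) by field. apply pow_inv. }
  rewrite e. unfold cosh_term.
  assert (er : rising (1 / 2) m = INR (fact (2 * m)) / (4 ^ m * INR (fact m))).
  { rewrite <- hr. field. split; [exact h1|lra]. }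
  rewrite er.
  destruct (Req_dec c 0) as [->|hc].
  - rewrite !Rmult_0_r. unfold Rdiv. rewrite Rinv_0. ring.
  - field. repeat split; try assumption; lra.
Qed.

Lemma cosh_term_nonneg (x : R) (m : nat) : 0 <= cosh_term x m.
Proof.
  unfold cosh_term. apply Rmult_le_pos.
  - rewrite pow_mult. apply pow_le, pow2_ge_0.
  - left. apply Rinv_0_lt_compat, INR_fact_lt_0.
Qed.

Lemma Rpower_quarter_pow (p : R) : 0 < p -> Rpower p (1 / 4) ^ 4 = p.
Proof.
  intros h. rewrite <- Rpower_pow by apply Rpower_pos. rewrite Rpower_mult.
  replace (1 / 4 * INR 4) with 1 by (cbn; field). apply Rpower_1, h.
Qed.

Lemma quarter_root_diff (p y : R) : 0 < p -> 0 < y ->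
  Rabs (Rpower p (1 / 4) - Rpower y (1 / 4)) <= Rabs (p - y) / Rpower y (1 / 4) ^ 3.
Proof.
  intros hp hy. pose proof (Rpower_pos p (1 / 4)). pose proof (Rpower_pos y (1 / 4)).
  rewrite <- (Rpower_quarter_pow p hp) at 2. rewrite <- (Rpower_quarter_pow y hy) at 2.
  set (P := Rpower p (1 / 4)) in *. set (Y := Rpower y (1 / 4)) in *.
  assert (hY : 0 < Y ^ 3) by (apply pow_lt; lra).
  apply Rmult_le_reg_r with (Y ^ 3); [exact hY|].
  unfold Rdiv. rewrite Rmult_assoc, Rinv_l, Rmult_1_r by lra.
  replace (P ^ 4 - Y ^ 4) with ((P - Y) * (P ^ 3 + P ^ 2 * Y + P * Y ^ 2 + Y ^ 3)) by ring.
  rewrite Rabs_mult. apply Rmult_le_compat_l; [apply Rabs_pos|].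
  assert (0 <= P ^ 3) by (apply pow_le; lra). assert (0 <= P ^ 2 * Y) by (apply Rmult_le_pos; [apply pow2_ge_0|lra]).
  assert (0 <= P * Y ^ 2) by (apply Rmult_le_pos; [lra|apply pow2_ge_0]).
  rewrite Rabs_pos_eq by lra. lra.
Qed.

Lemma Rpower_quarter_le (p : R) : 0 < p -> Rpower p (1 / 4) <= 3 / 4 + p / 4.
Proof.
  intros h. pose proof (exp_tangent (1 / 4) (ln p) ltac:(lra)) as H. rewrite exp_ln in H by exact h.
  unfold Rpower. lra.
Qed.

Section Bessel.
Variable y : R.
Hypothesis hy : 1 <= y.
Let x := 2 * y.

Lemma cosh_var_le : 2 * x ^ 2 * exp (- x) + x * sinh x <= 3 * x * cosh x.
Proof.
  assert (hx : 2 <= x) by (unfold x; lra).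
  pose proof (exp_neg_lt1 x ltac:(lra)) as he. pose proof (cosh_ge_1 x).
  assert (sinh x <= cosh x) by (unfold sinh, cosh; lra).
  assert (h1 : x * exp (- x) <= 1).
  { rewrite exp_Ropp. pose proof (exp_ineq1_le x). apply Rmult_le_reg_r with (exp x); [lra|].
    rewrite Rmult_assoc, Rinv_l by lra. lra. }
  nra.
Qed.

(** The weights [v m] are within 1 of [(m + 1/4)^(1/4)], which by concentration of [cosh_term]
    may be replaced by its value [y^(1/4)] at the mean; what is left is the series of cosh. *)
Lemma bessel_first : Rabs (BesselI (-3 / 4) x - cosh x / sqrt (PI * y)) <=
  3 / Rpower y (1 / 4) * (cosh x / sqrt (PI * y)).
Proof.
  assert (hx : 2 <= x) by (unfold x; lra). pose proof PI_RGT_0 as hP.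
  pose proof (sqrt_lt_R0 PI hP) as hsP. pose proof (cosh_ge_1 x) as hch.
  set (d := fun m : nat => Rpower (INR m + 1 / 4) (1 / 4)).
  set (v := fun m : nat => gratio (1 / 4) (INR m + 1 / 4) * d m).
  assert (hm0 : forall m : nat, 0 < INR m + 1 / 4) by (intros m; pose proof (pos_INR m); lra).
  assert (hd : forall m, 0 < d m <= 1 + INR m).
  { intros m. split; [apply Rpower_pos|]. unfold d.
    pose proof (Rpower_quarter_le _ (hm0 m)). pose proof (pos_INR m). lra. }
  assert (hv : forall m, Rabs (v m - d m) <= 1).
  { intros m. unfold v. destruct (gratio_bounds (1 / 4) _ (hm0 m) ltac:(lra)) as [r1 r2].
    destruct (hd m) as [d1 d2]. pose proof (pos_INR m) as hp.
    set (r := gratio (1 / 4) (INR m + 1 / 4)) in *.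
    rewrite Rabs_left1 by nra.
    assert (h1 : 1 - r <= (1 / 4) / (INR m + 1 / 4 + 1 / 4)).
    { replace ((1 / 4) / (INR m + 1 / 4 + 1 / 4)) with (1 - (INR m + 1 / 4) / (INR m + 1 / 4 + 1 / 4)) by (field; lra).
      lra. }
    assert (h2 : (1 / 4) / (INR m + 1 / 4 + 1 / 4) * (1 + INR m) <= 1).
    { apply Rmult_le_reg_r with (INR m + 1 / 4 + 1 / 4); [lra|].
      replace ((1 / 4) / (INR m + 1 / 4 + 1 / 4) * (1 + INR m) * (INR m + 1 / 4 + 1 / 4))
        with (1 / 4 * (1 + INR m)) by (field; lra). lra. }
    replace (- (r * d m - d m)) with ((1 - r) * d m) by ring.
    eapply Rle_trans; [|exact h2]. apply Rmult_le_compat; lra. }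
  set (a := cosh_term x).
  assert (ha : forall m, 0 <= a m) by (intros; apply cosh_term_nonneg).
  set (Y := Rpower y (1 / 4)).
  assert (hY1 : 1 <= Y).
  { apply Rle_trans with (Rpower y 0); [rewrite Rpower_O; lra|apply Rle_Rpower; lra]. }
  assert (hY4 : Y ^ 4 = y) by (apply Rpower_quarter_pow; lra).
  set (q := sqrt x).
  assert (hq : q * q = x) by (apply sqrt_sqrt; lra).
  assert (hq0 : 0 < q) by (apply sqrt_lt_R0; lra).
  set (b := fun m => a m * (1 + / Y ^ 3 * (1 / 4 + (2 * INR m - x) ^ 2 / (4 * q) + q / 4))).
  assert (hY3 : 0 < Y ^ 3) by (apply pow_lt; lra).
  assert (hpt : forall m, Rabs (a m * (v m - Y)) <= b m).
  { intros m. rewrite Rabs_mult, (Rabs_pos_eq (a m)) by apply ha. unfold b.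
    apply Rmult_le_compat_l; [apply ha|].
    replace (v m - Y) with ((v m - d m) + (d m - Y)) by ring.
    eapply Rle_trans; [apply Rabs_triang|]. apply Rplus_le_compat; [apply hv|].
    pose proof (quarter_root_diff (INR m + 1 / 4) y (hm0 m) ltac:(lra)) as H. fold (d m) Y in H.
    eapply Rle_trans; [exact H|]. unfold Rdiv at 1. rewrite Rmult_comm.
    apply Rmult_le_compat_l; [left; apply Rinv_0_lt_compat, hY3|].
    replace (INR m + 1 / 4 - y) with ((2 * INR m - x) / 2 + 1 / 4) by (unfold x; field).
    eapply Rle_trans; [apply Rabs_triang|]. rewrite (Rabs_pos_eq (1 / 4)) by lra.
    unfold Rdiv at 1. rewrite Rabs_mult, (Rabs_pos_eq (/ 2)) by lra.
    set (D := 2 * INR m - x).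
    assert (Rabs D * / 2 <= D ^ 2 / (4 * q) + q / 4); [|lra].
    apply Rmult_le_reg_r with (4 * q); [lra|].
    replace ((D ^ 2 / (4 * q) + q / 4) * (4 * q)) with (D ^ 2 + q * q) by (field; lra).
    rewrite <- (pow2_abs D). pose proof (pow2_ge_0 (Rabs D - q)). nra. }
  set (B := cosh x + / Y ^ 3 * (1 / 4 * cosh x + (2 * x ^ 2 * exp (- x) + x * sinh x) / (4 * q) + q / 4 * cosh x)).
  assert (hB : is_series b B).
  { pose proof (is_series_plus _ _ _ _ (is_series_scal_l (1 + / Y ^ 3 * (1 / 4 + q / 4)) _ _ (cosh_series x))
      (is_series_scal_l (/ Y ^ 3 * / (4 * q)) _ _ (cosh_variance x))) as H.
    replace B with ((1 + / Y ^ 3 * (1 / 4 + q / 4)) * cosh x + / Y ^ 3 * / (4 * q) * (2 * x ^ 2 * exp (- x) + x * sinh x))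
      by (unfold B; field; lra).
    eapply is_series_ext; [|exact H]. intros m. cbv beta.
    change ((1 + / Y ^ 3 * (1 / 4 + q / 4)) * cosh_term x m +
      / Y ^ 3 * / (4 * q) * ((2 * INR m - x) ^ 2 * cosh_term x m) = b m).
    unfold b, a. field. lra. }
  assert (exd : ex_series (fun m => a m * (v m - Y))) by (apply ex_series_dom with (1 := hpt); eexists; exact hB).
  assert (exa : ex_series (fun m => Y * a m)) by (apply ex_series_scalR; eexists; apply cosh_series).
  assert (hI : BesselI (-3 / 4) x = Rpower y (-3 / 4) / sqrt PI * (Series (fun m => a m * (v m - Y)) + Y * cosh x)).
  { unfold BesselI.
    replace (Y * cosh x) with (Series (fun m => Y * a m))
      by (rewrite Series_scal_l; f_equal; apply is_series_unique, cosh_series).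
    rewrite <- Series_plus by assumption. rewrite <- Series_scal_l. apply Series_ext. intros m.
    rewrite bessel_term by lra. replace (x / 2) with y by (unfold x; field).
    replace (INR m + -3 / 4 + 1) with (INR m + 1 / 4) by field.
    unfold v, gratio, d, a. replace (INR m + 1 / 4 + 1 / 4) with (INR m + 1 / 2) by field.
    pose proof (Gamma_pos _ (hm0 m)). pose proof (Rpower_pos (INR m + 1 / 4) (1 / 4)). field. lra. }
  assert (hS : Rabs (Series (fun m => a m * (v m - Y))) <= B).
  { rewrite <- (is_series_unique _ _ hB).
    eapply Rle_trans; [apply Series_Rabs|].
    - apply ex_series_dom with b; [intros m; rewrite Rabs_Rabsolu; apply hpt|eexists; exact hB].
    - apply Series_le; [|eexists; exact hB]. intros m; split; [apply Rabs_pos|apply hpt]. }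
  assert (hBle : B <= 3 * cosh x).
  { pose proof cosh_var_le as hvar.
    assert (h1 : (2 * x ^ 2 * exp (- x) + x * sinh x) / (4 * q) <= 3 / 4 * q * cosh x).
    { apply Rmult_le_reg_r with (4 * q); [lra|]. unfold Rdiv at 1. rewrite Rmult_assoc, Rinv_l, Rmult_1_r by lra.
      eapply Rle_trans; [exact hvar|]. rewrite <- hq. right. field. }
    assert (h2 : / Y ^ 3 * (1 / 4 * cosh x + (2 * x ^ 2 * exp (- x) + x * sinh x) / (4 * q) + q / 4 * cosh x)
       <= / Y ^ 3 * ((1 / 4 + q) * cosh x)).
    { apply Rmult_le_compat_l; [left; apply Rinv_0_lt_compat, hY3|]. lra. }
    assert (h3 : / Y ^ 3 * (1 / 4 + q) <= 2).
    { apply Rmult_le_reg_l with (Y ^ 3); [exact hY3|]. rewrite <- Rmult_assoc, Rinv_r, Rmult_1_l by lra.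
      assert (q <= 3 / 2 * Y ^ 2).
      { apply Rsqr_incr_0_var; [|nra]. unfold Rsqr. rewrite hq. unfold x. rewrite <- hY4.
        assert (0 < Y ^ 4) by (apply pow_lt; lra). lra. }
      assert (1 <= Y ^ 2) by nra. assert (Y ^ 2 <= Y ^ 3) by nra. lra. }
    assert (/ Y ^ 3 * ((1 / 4 + q) * cosh x) <= 2 * cosh x).
    { rewrite <- Rmult_assoc. apply Rmult_le_compat_r; lra. }
    unfold B. lra. }
  assert (hsq : sqrt (PI * y) = sqrt PI * Y ^ 2).
  { rewrite sqrt_mult by lra. f_equal. rewrite <- hY4. replace (Y ^ 4) with ((Y ^ 2) ^ 2) by ring.
    apply sqrt_pow2. apply pow2_ge_0. }
  assert (hR : Rpower y (-3 / 4) = / Y ^ 3).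
  { replace (-3 / 4) with (- (3 / 4)) by field. rewrite Rpower_Ropp. f_equal. unfold Y.
    rewrite <- Rpower_pow by apply Rpower_pos. rewrite Rpower_mult. f_equal. cbn; field. }
  rewrite hI, hsq, hR.
  replace (/ Y ^ 3 / sqrt PI * (Series (fun m => a m * (v m - Y)) + Y * cosh x) - cosh x / (sqrt PI * Y ^ 2))
    with (/ Y ^ 3 / sqrt PI * Series (fun m => a m * (v m - Y))) by (field; lra).
  replace (3 / Y * (cosh x / (sqrt PI * Y ^ 2))) with (/ Y ^ 3 / sqrt PI * (3 * cosh x)) by (field; lra).
  assert (0 < / Y ^ 3 / sqrt PI).
  { apply Rmult_lt_0_compat; apply Rinv_0_lt_compat; lra. }
  rewrite Rabs_mult, (Rabs_pos_eq (/ Y ^ 3 / sqrt PI)) by lra.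
  apply Rmult_le_compat_l; lra.
Qed.

Lemma Gamma_sub_quarter (m : nat) : Gamma (INR m + -5 / 4 + 1) = Gamma (INR m + 3 / 4) / (INR m - 1 / 4).
Proof.
  destruct m as [|m].
  - cbn [INR]. replace (0 + -5 / 4 + 1) with (- (1 / 4)) by field.
    unfold Gamma at 1. assert (e : Gamma_shift (- (1 / 4)) = 1%nat).
    { unfold Gamma_shift. rewrite Ropp_involutive.
      replace (up (1 / 4)) with 1%Z; [reflexivity|]. apply tech_up; lra. }
    rewrite e. cbn [INR rising]. replace (- (1 / 4) + 1) with (0 + 3 / 4) by field.
    rewrite <- Gamma_pos_eq by lra. replace (0 + 3 / 4) with (3 / 4) by field. field.
  - rewrite S_INR. pose proof (pos_INR m).
    replace (INR m + 1 + 3 / 4) with (INR m + 3 / 4 + 1) by ring.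
    replace (INR m + 1 + -5 / 4 + 1) with (INR m + 3 / 4) by field.
    rewrite Gamma_succ by lra. field. lra.
Qed.

(** A crude bound by the first moment: this function is multiplied by a smaller power of n. *)
Lemma bessel_second : Rabs (BesselI (-5 / 4) x) <= 6 / Rpower y (1 / 4) * cosh x.
Proof.
  assert (hx : 2 <= x) by (unfold x; lra). pose proof PI_RGT_0 as hP. pose proof PI2_1 as hP1.
  pose proof (sqrt_lt_R0 PI hP) as hsP. pose proof (cosh_ge_1 x) as hch.
  assert (hsP1 : 1 <= sqrt PI) by (rewrite <- sqrt_1; apply sqrt_le_1; lra).
  set (w := fun m : nat => Gamma (INR m + 1 / 2) / (sqrt PI * Gamma (INR m + -5 / 4 + 1))).
  assert (hw : forall m, Rabs (w m) <= 3 * (1 + INR m)).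
  { intros m. unfold w. rewrite Gamma_sub_quarter. pose proof (pos_INR m) as hm.
    assert (hne : INR m - 1 / 4 <> 0).
    { destruct m as [|m]; [cbn; lra|]. rewrite S_INR. pose proof (pos_INR m). lra. }
    pose proof (Gamma_pos (INR m + 1 / 2) ltac:(lra)) as g1. pose proof (Gamma_pos (INR m + 3 / 4) ltac:(lra)) as g2.
    replace (Gamma (INR m + 1 / 2) / (sqrt PI * (Gamma (INR m + 3 / 4) / (INR m - 1 / 4))))
      with (Gamma (INR m + 1 / 2) / Gamma (INR m + 3 / 4) * / sqrt PI * (INR m - 1 / 4)) by (field; lra).
    destruct (gratio_bounds (1 / 4) (INR m + 1 / 2) ltac:(lra) ltac:(lra)) as [r1 _].
    assert (h1 : Gamma (INR m + 1 / 2) <= 3 * Gamma (INR m + 3 / 4)).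
    { unfold gratio in r1. replace (INR m + 1 / 2 + 1 / 4) with (INR m + 3 / 4) in r1 by field.
      assert (hp : 1 / 2 <= Rpower (INR m + 1 / 2) (1 / 4)).
      { apply Rle_trans with (Rpower (1 / 2) (1 / 4)).
        - rewrite <- (Rpower_1 (1 / 2)) at 1 by lra.
          unfold Rpower. apply exp_mono. assert (ln (1 / 2) < 0) by (rewrite <- ln_1; apply ln_increasing; lra). lra.
        - apply Rle_Rpower_l; lra. }
      set (p := Rpower (INR m + 1 / 2) (1 / 4)) in *.
      assert (h2 : 2 / 3 <= (INR m + 1 / 2) / (INR m + 3 / 4)).
      { apply Rmult_le_reg_r with (INR m + 3 / 4); [lra|].
        replace ((INR m + 1 / 2) / (INR m + 3 / 4) * (INR m + 3 / 4)) with (INR m + 1 / 2) by (field; lra). lra. }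
      assert (h3 : 2 / 3 * (p * Gamma (INR m + 1 / 2)) <= Gamma (INR m + 3 / 4)).
      { apply Rmult_le_reg_r with (/ (p * Gamma (INR m + 1 / 2))); [apply Rinv_0_lt_compat; nra|].
        rewrite Rmult_assoc, Rinv_r by nra. unfold Rdiv in *. lra. }
      nra. }
    rewrite !Rabs_mult. unfold Rdiv at 1. rewrite Rabs_pos_eq.
    2:{ apply Rmult_le_pos; [lra|left; apply Rinv_0_lt_compat; lra]. }
    rewrite (Rabs_pos_eq (/ sqrt PI)) by (left; apply Rinv_0_lt_compat; lra).
    assert (h4 : Rabs (INR m - 1 / 4) <= 1 + INR m) by (apply Rabs_le; lra).
    assert (h5 : Gamma (INR m + 1 / 2) * / Gamma (INR m + 3 / 4) <= 3).
    { apply Rmult_le_reg_r with (Gamma (INR m + 3 / 4)); [lra|]. rewrite Rmult_assoc, Rinv_l by lra. lra. }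
    assert (h6 : 0 <= Gamma (INR m + 1 / 2) * / Gamma (INR m + 3 / 4))
      by (apply Rmult_le_pos; [lra|left; apply Rinv_0_lt_compat; lra]).
    assert (h7 : 0 < / sqrt PI <= 1).
    { split; [apply Rinv_0_lt_compat; lra|]. rewrite <- Rinv_1. apply Rinv_le_contravar; lra. }
    apply Rmult_le_compat; [nra|apply Rabs_pos|nra|exact h4]. }
  set (a := cosh_term x).
  assert (ha : forall m, 0 <= a m) by (intros; apply cosh_term_nonneg).
  set (b := fun m => 3 * (a m + / 2 * (2 * INR m * a m))).
  assert (hb : is_series b (3 * (cosh x + / 2 * (x * sinh x)))).
  { exact (is_series_scal_l 3 _ _ (is_series_plus _ _ _ _ (cosh_series x)
      (is_series_scal_l (/ 2) _ _ (cosh_moment1 x)))). }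
  assert (hle : forall m, Rabs (a m * w m) <= b m).
  { intros m. rewrite Rabs_mult, Rabs_pos_eq by apply ha. unfold b. specialize (hw m). specialize (ha m).
    replace (3 * (a m + / 2 * (2 * INR m * a m))) with (a m * (3 * (1 + INR m))) by field.
    apply Rmult_le_compat_l; assumption. }
  assert (hI : BesselI (-5 / 4) x = Rpower y (-5 / 4) * Series (fun m => a m * w m)).
  { unfold BesselI. rewrite <- Series_scal_l. apply Series_ext. intros m.
    rewrite bessel_term by lra. replace (x / 2) with y by (unfold x; field). reflexivity. }
  assert (hS : Rabs (Series (fun m => a m * w m)) <= 3 * (cosh x + / 2 * (x * sinh x))).
  { rewrite <- (is_series_unique _ _ hb). eapply Rle_trans; [apply Series_Rabs|].
    - apply ex_series_dom with b; [intros m; rewrite Rabs_Rabsolu; apply hle|eexists; exact hb].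
    - apply Series_le; [|eexists; exact hb]. intros m; split; [apply Rabs_pos|apply hle]. }
  assert (hsc : sinh x <= cosh x) by (pose proof (exp_pos (- x)); unfold sinh, cosh; lra).
  assert (hS2 : 3 * (cosh x + / 2 * (x * sinh x)) <= 6 * y * cosh x) by (unfold x in *; nra).
  assert (hR : Rpower y (-5 / 4) * y = / Rpower y (1 / 4)).
  { rewrite <- (Rpower_1 y) at 2 by lra. rewrite <- Rpower_plus, <- Rpower_Ropp. f_equal. field. }
  rewrite hI, Rabs_mult, (Rabs_pos_eq (Rpower _ _)) by (left; apply Rpower_pos).
  pose proof (Rpower_pos y (-5 / 4)).
  apply Rle_trans with (Rpower y (-5 / 4) * (6 * y * cosh x)).
  - apply Rmult_le_compat_l; lra.
  - right. transitivity (6 * cosh x * (Rpower y (-5 / 4) * y)); [ring|]. rewrite hR. unfold Rdiv. ring.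
Qed.

End Bessel.

(** * Limits of the two logarithms at 0 *)

Lemma ln_cosh_le (t : R) : 0 <= t <= 1 -> ln (cosh t) <= 2 * t ^ 2.
Proof.
  intros h. pose proof (cosh_ge_1 t). pose proof (ln_le_sub1 (cosh t) ltac:(lra)).
  pose proof (cosh_sub1_le t h). lra.
Qed.

Lemma hart_near_0 (x : R) : 0 < x <= 2 -> 0 <= hart x + ln (x / 2) / 2 <= x ^ 2 / 4.
Proof.
  intros h. rewrite hart_eq by lra. set (t := x / 2). assert (ht : 0 < t <= 1) by (unfold t; lra).
  pose proof (sinh_pos t ltac:(lra)). pose proof (cosh_ge_1 t). pose proof (sinh_ge t ltac:(lra)).
  pose proof (sinh_le_mul_cosh t ltac:(lra)). pose proof (ln_cosh_le t ltac:(lra)).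
  rewrite ln_div by lra.
  pose proof (ln_mono t (sinh t) ltac:(lra) ltac:(lra)).
  pose proof (ln_mono (sinh t) (t * cosh t) ltac:(lra) ltac:(lra)) as h5. rewrite ln_mult in h5 by lra.
  replace (x ^ 2 / 4) with (t ^ 2) by (unfold t; field). lra.
Qed.

Section NearZero.
Variable sq : nat -> R.
Hypothesis hpos : forall n, 0 < sq n.
Hypothesis hlim : is_lim_seq sq 0.

Lemma hart_lim (c : R) : 0 < c -> is_lim_seq (fun n => hart (c * sq n) + ln (sq n) / 2) (- ln (c / 2) / 2).
Proof.
  intros hc.
  assert (hcs : is_lim_seq (fun n => c * sq n) 0) by (apply is_lim_seq_scal0, hlim).
  assert (hq : is_lim_seq (fun n => hart (c * sq n) + ln (c * sq n / 2) / 2) 0).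
  { apply is_lim_seq_spec in hcs. destruct (hcs (mkposreal 2 Rlt_0_2)) as [N hN]. cbn [pos] in hN.
    apply is_lim_seq_le_le_loc with (fun _ => 0) (fun n => c ^ 2 / 4 * (sq n * sq n)).
    - exists N. intros n hn. specialize (hN n hn). rewrite Rminus_0_r in hN. apply Rabs_def2 in hN.
      specialize (hpos n). pose proof (hart_near_0 (c * sq n) ltac:(nra)) as H.
      replace (c ^ 2 / 4 * (sq n * sq n)) with ((c * sq n) ^ 2 / 4) by field. exact H.
    - apply is_lim_seq_const.
    - replace (Finite 0) with (Finite (c ^ 2 / 4 * (0 * 0))) by (f_equal; ring).
      apply (is_lim_seq_scal_l _ (c ^ 2 / 4) (Finite (0 * 0))). apply is_lim_seq_mult'; exact hlim. }
  apply is_lim_seq_ext with (fun n => (hart (c * sq n) + ln (c * sq n / 2) / 2) + - ln (c / 2) / 2).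
  - intros n. specialize (hpos n). replace (c * sq n / 2) with (c / 2 * sq n) by field.
    rewrite ln_mult by lra. field.
  - replace (Finite (- ln (c / 2) / 2)) with (Finite (0 + - ln (c / 2) / 2)) by (f_equal; ring).
    apply is_lim_seq_plus'; [exact hq|apply is_lim_seq_const].
Qed.

Lemma od_alt_lim (j : nat) :
  is_lim_seq (fun n => od_alt (sq n) j + ln (sq n) / 2) (- ln ((2 * INR j + 1) / 2) / 2).
Proof.
  eapply is_lim_seq_ext; [|apply (hart_lim (2 * INR j + 1) (INR_odd_pos j))].
  intros n. cbv beta. unfold od_alt. do 2 f_equal. ring.
Qed.

Lemma odd_quot_pos (M : nat) : 0 < odd_quot M.
Proof.
  unfold odd_quot. pose proof (rising_pos (3 / 4) M ltac:(lra)). pose proof (rising_pos (1 / 4) M ltac:(lra)).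
  apply Rmult_lt_0_compat; [assumption|apply Rinv_0_lt_compat; assumption].
Qed.

Lemma alt_psum_lim (M : nat) :
  is_lim_seq (fun n => psum (fun j => (-1) ^ j * od_alt (sq n) j) (2 * M)) (ln (odd_quot M) / 2).
Proof.
  induction M as [|M IH].
  - apply is_lim_seq_ext with (fun _ => 0); [reflexivity|].
    unfold odd_quot. cbn [rising]. replace (1 / 1) with 1 by field. rewrite ln_1.
    replace (0 / 2) with 0 by field. apply is_lim_seq_const.
  - apply is_lim_seq_ext with (fun n => psum (fun j => (-1) ^ j * od_alt (sq n) j) (2 * M)
      + ((od_alt (sq n) (2 * M) + ln (sq n) / 2) - (od_alt (sq n) (2 * M + 1) + ln (sq n) / 2))).
    + intros n. replace (2 * S M)%nat with (S (S (2 * M))) by lia. cbn [psum].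
      replace (S (2 * M)) with (2 * M + 1)%nat by lia. rewrite pow_m1_even, pow_m1_odd. ring.
    + replace (Finite (ln (odd_quot (S M)) / 2)) with (Finite (ln (odd_quot M) / 2 +
        (- ln ((2 * INR (2 * M) + 1) / 2) / 2 - - ln ((2 * INR (2 * M + 1) + 1) / 2) / 2))).
      * apply is_lim_seq_plus'; [exact IH|]. apply is_lim_seq_minus'; apply od_alt_lim.
      * f_equal. pose proof (odd_quot_pos M) as hq. pose proof (pos_INR M) as hM.
        rewrite plus_INR, !mult_INR. cbn [INR]. replace (1 + 1) with 2 by ring.
        assert (e : odd_quot (S M) = odd_quot M * ((2 * (2 * INR M + 1) + 1) / 2 / ((2 * (2 * INR M) + 1) / 2))).
        { unfold odd_quot. cbn [rising]. pose proof (rising_pos (1 / 4) M ltac:(lra)). field. lra. }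
        rewrite e. set (A := (2 * (2 * INR M + 1) + 1) / 2). set (B := (2 * (2 * INR M) + 1) / 2).
        assert (hA : 0 < A) by (unfold A; lra). assert (hB : 0 < B) by (unfold B; lra).
        rewrite ln_mult, ln_div; [field|lra|lra|lra|].
        apply Rmult_lt_0_compat; [lra|apply Rinv_0_lt_compat; lra].
Qed.

(** The odd part exceeds [- ln s / 4] by a constant, found by letting first s tend to 0 and then
    the number M of explicitly summed pairs tend to infinity. *)
Lemma odz_asymp : is_lim_seq (fun n => Re (odz (RtoC (sq n))) + ln (sq n) / 4)
  (ln (Gamma (1 / 4) / Gamma (3 / 4)) / 2 - ln 2 / 4).
Proof.
  set (L := ln (Gamma (1 / 4) / Gamma (3 / 4)) / 2 - ln 2 / 4).
  set (lo := fun M : nat => ln (odd_quot M) / 2 - ln ((4 * INR M + 1) / 2) / 4).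
  set (hi := fun M : nat => ln (odd_quot M) / 2 - ln ((4 * INR M + 1) / 2) / 2 + ln ((4 * INR M + 3) / 2) / 4).
  assert (Hlo : forall M, is_lim_seq (fun n => psum (fun j => (-1) ^ j * od_alt (sq n) j) (2 * M)
     + (od_alt (sq n) (2 * M) + ln (sq n) / 2) / 2) (lo M)).
  { intros M. unfold lo.
    replace (ln (odd_quot M) / 2 - ln ((4 * INR M + 1) / 2) / 4)
      with (ln (odd_quot M) / 2 + - ln ((2 * INR (2 * M) + 1) / 2) / 2 * / 2).
    - apply is_lim_seq_plus'; [apply alt_psum_lim|].
      apply (is_lim_seq_scal_r _ (/ 2) (Finite _)), od_alt_lim.
    - rewrite mult_INR. cbn [INR]. replace (2 * ((1 + 1) * INR M)) with (4 * INR M) by ring. field. }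
  assert (Hhi : forall M, is_lim_seq (fun n => psum (fun j => (-1) ^ j * od_alt (sq n) j) (2 * M)
     + ((od_alt (sq n) (2 * M) + ln (sq n) / 2) - (od_alt (sq n) (2 * M + 1) + ln (sq n) / 2) / 2)) (hi M)).
  { intros M. unfold hi.
    replace (ln (odd_quot M) / 2 - ln ((4 * INR M + 1) / 2) / 2 + ln ((4 * INR M + 3) / 2) / 4)
      with (ln (odd_quot M) / 2 + (- ln ((2 * INR (2 * M) + 1) / 2) / 2
         - - ln ((2 * INR (2 * M + 1) + 1) / 2) / 2 * / 2)).
    - apply is_lim_seq_plus'; [apply alt_psum_lim|]. apply is_lim_seq_minus'; [apply od_alt_lim|].
      apply (is_lim_seq_scal_r _ (/ 2) (Finite _)), od_alt_lim.
    - rewrite plus_INR, mult_INR. cbn [INR]. replace (2 * ((1 + 1) * INR M)) with (4 * INR M) by ring.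
      replace (2 * ((1 + 1) * INR M + 1) + 1) with (4 * INR M + 3) by ring. field. }
  pose proof (Gamma_pos (1 / 4) ltac:(lra)) as g1. pose proof (Gamma_pos (3 / 4) ltac:(lra)) as g3.
  assert (hG : 0 < Gamma (1 / 4) / Gamma (3 / 4)) by (apply Rmult_lt_0_compat; [lra|apply Rinv_0_lt_compat; lra]).
  assert (hinv : is_lim_seq (fun M => / INR (S M)) 0) by apply is_lim_seq_inv_INR.
  assert (hlin : forall c, is_lim_seq (fun M => ln (2 + c * / INR (S M))) (ln 2)).
  { intros c. apply is_lim_seq_ln; [lra|]. replace (Finite 2) with (Finite (2 + 0)) by (f_equal; ring).
    apply is_lim_seq_plus'; [apply is_lim_seq_const|apply is_lim_seq_scal0, hinv]. }
  assert (hq := is_lim_seq_ln _ _ hG odd_quot_lim).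
  assert (eqq : forall M, ln (odd_quot (S M) / Rpower (INR (S M)) (1 / 2)) = ln (odd_quot (S M)) - ln (INR (S M)) / 2).
  { intros M. rewrite ln_div by (apply odd_quot_pos || apply Rpower_pos). unfold Rpower. rewrite ln_exp. field. }
  assert (eli : forall c M, -4 <= c -> 4 * INR (S M) + c > 0 -> ln ((4 * INR (S M) + c) / 2) = ln (INR (S M)) + ln (2 + c / 2 * / INR (S M))).
  { intros c M _ hc. pose proof (INR_S_pos M) as hM. rewrite <- ln_mult.
    - f_equal. field. lra.
    - exact hM.
    - apply Rmult_lt_reg_r with (2 * INR (S M)); [lra|].
      replace ((2 + c / 2 * / INR (S M)) * (2 * INR (S M))) with (4 * INR (S M) + c) by (field; lra). lra. }
  assert (Llo : is_lim_seq (fun M => lo (S M)) L).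
  { apply is_lim_seq_ext with (fun M => ln (odd_quot (S M) / Rpower (INR (S M)) (1 / 2)) * / 2
      - ln (2 + 1 / 2 * / INR (S M)) * / 4).
    - intros M. pose proof (INR_S_pos M). unfold lo. rewrite eqq, eli by lra. field.
    - unfold L, Rdiv. apply is_lim_seq_minus'.
      + apply (is_lim_seq_scal_r _ (/ 2) (Finite _)). exact hq.
      + apply (is_lim_seq_scal_r _ (/ 4) (Finite _)). apply hlin. }
  assert (Lhi : is_lim_seq (fun M => hi (S M)) L).
  { apply is_lim_seq_ext with (fun M => ln (odd_quot (S M) / Rpower (INR (S M)) (1 / 2)) * / 2
      - (ln (2 + 1 / 2 * / INR (S M)) * / 2 - ln (2 + 3 / 2 * / INR (S M)) * / 4)).
    - intros M. pose proof (INR_S_pos M). unfold hi. rewrite eqq, !eli by lra. field.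
    - replace L with (ln (Gamma (1 / 4) / Gamma (3 / 4)) * / 2 - (ln 2 * / 2 - ln 2 * / 4)) by (unfold L; field).
      apply is_lim_seq_minus'; [apply (is_lim_seq_scal_r _ (/ 2) (Finite _)); exact hq|].
      apply is_lim_seq_minus'; [apply (is_lim_seq_scal_r _ (/ 2) (Finite _))|apply (is_lim_seq_scal_r _ (/ 4) (Finite _))];
        apply hlin. }
  apply is_lim_seq_spec. intros eps.
  assert (he2 : 0 < eps / 2) by (pose proof (cond_pos eps); lra).
  apply is_lim_seq_spec in Llo. apply is_lim_seq_spec in Lhi.
  destruct (Llo (mkposreal _ he2)) as [M1 h1]. destruct (Lhi (mkposreal _ he2)) as [M2 h2]. cbn [pos] in h1, h2.
  set (M := Nat.max M1 M2). specialize (h1 M ltac:(lia)). specialize (h2 M ltac:(lia)).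
  pose proof (Hlo (S M)) as k1. pose proof (Hhi (S M)) as k2.
  apply is_lim_seq_spec in k1. apply is_lim_seq_spec in k2.
  destruct (k1 (mkposreal _ he2)) as [N1 n1]. destruct (k2 (mkposreal _ he2)) as [N2 n2]. cbn [pos] in n1, n2.
  exists (Nat.max N1 N2). intros n hn. specialize (n1 n ltac:(lia)). specialize (n2 n ltac:(lia)).
  destruct (odz_sandwich (sq n) (S M) (hpos n)) as [s1 s2].
  replace (2 * S M + 1)%nat with (S (2 * S M)) in s2, n2 by lia. cbn [psum] in s2.
  rewrite pow_m1_even in s2.
  apply Rabs_def2 in h1. apply Rabs_def2 in h2. apply Rabs_def2 in n1. apply Rabs_def2 in n2.
  apply Rabs_def1; lra.
Qed.

Lemma l1_lim_0 (c : R) : is_lim_seq (fun n => l1 (c * sq n)) (ln 2).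
Proof.
  replace 2 with (1 + 1) by ring. apply l1_lim; [lra|].
  replace (Finite 1) with (Finite (exp (- (c * 0)))) by (f_equal; rewrite Rmult_0_r, Ropp_0; apply exp_0).
  apply (is_lim_seq_continuous exp).
  - apply derivable_continuous_pt, derivable_pt_exp.
  - apply (is_lim_seq_opp _ (Finite (c * 0))). apply (is_lim_seq_scal_l _ c (Finite 0)), hlim.
Qed.

Lemma evz_asymp : is_lim_seq (fun n => zeta2 / 8 / sq n - Re (evz (RtoC (sq n)))) (ln 2 / 4).
Proof.
  apply is_lim_seq_le_le with (fun n => l1 (1 * sq n) * / 4) (fun n => ln 2 / 2 - l1 (2 * sq n) * / 4).
  - intros n. rewrite Rmult_1_l. pose proof (evz_real_sandwich (sq n) (hpos n)). lra.
  - apply (is_lim_seq_scal_r _ (/ 4) (Finite _)). apply l1_lim_0.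
  - replace (ln 2 / 4) with (ln 2 / 2 - ln 2 * / 4) by field.
    apply is_lim_seq_minus'; [apply is_lim_seq_const|].
    apply (is_lim_seq_scal_r _ (/ 4) (Finite _)). apply l1_lim_0.
Qed.

End NearZero.

(** * The saddle point for the n-th coefficient *)

(** The value of s at which the saddle lies on the real axis: [radius v ^ 2 = PI^2 / (48 v)]. *)
Definition radius (v : R) : R := PI / sqrt (48 * v).

Lemma radius_pos (v : R) : 0 < v -> 0 < radius v.
Proof.
  intros h. unfold radius. pose proof PI_RGT_0.
  apply Rmult_lt_0_compat; [lra|apply Rinv_0_lt_compat, sqrt_lt_R0; lra].
Qed.

Lemma radius_sqr (v : R) : 0 < v -> v * radius v = zeta2 / 8 / radius v.
Proof.
  intros h. rewrite basel. pose proof (radius_pos v h) as hr.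
  assert (e : v * (radius v * radius v) = PI ^ 2 / 48).
  { unfold radius. pose proof (sqrt_sqrt (48 * v) ltac:(lra)) as hs. pose proof (sqrt_lt_R0 (48 * v) ltac:(lra)).
    replace (PI / sqrt (48 * v) * (PI / sqrt (48 * v))) with (PI ^ 2 / (sqrt (48 * v) * sqrt (48 * v))) by (field; lra).
    rewrite hs. field. lra. }
  apply Rmult_eq_reg_r with (radius v); [|lra].
  replace (PI ^ 2 / 6 / 8 / radius v * radius v) with (PI ^ 2 / 48) by (field; lra).
  rewrite <- e. ring.
Qed.

Lemma exp_inv_le (s : R) : 0 < s -> exp (- / (400 * s)) <= 384000000 * s ^ 3.
Proof.
  intros h. assert (hy : 0 < / (400 * s)) by (apply Rinv_0_lt_compat; lra).
  set (t := / (400 * s)) in *. pose proof (exp_ge_cubic t ltac:(lra)) as H.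
  rewrite exp_Ropp. replace (384000000 * s ^ 3) with (/ (t ^ 3 / 6)).
  2:{ unfold t. field. lra. }
  assert (0 < t ^ 3) by (apply pow_lt; lra).
  apply Rinv_le_contravar; [lra|]. pose proof (pow2_ge_0 t). lra.
Qed.

(** The prefactor of the error term is a power of [1/s]. *)
Lemma scale_sqr_le (v : R) : 0 < v ->
  (sqrt (v * radius v) / radius v) ^ 2 <= 1 / 3 / radius v ^ 3.
Proof.
  intros h. pose proof (radius_pos v h) as hr. pose proof (radius_sqr v h) as e. rewrite basel in e.
  pose proof PI_4. pose proof PI_RGT_0.
  replace ((sqrt (v * radius v) / radius v) ^ 2)
    with (sqrt (v * radius v) * sqrt (v * radius v) / radius v ^ 2) by (field; lra).
  rewrite sqrt_sqrt by nra. rewrite e.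
  replace (PI ^ 2 / 6 / 8 / radius v / radius v ^ 2) with (PI ^ 2 / 48 * / radius v ^ 3) by (field; lra).
  unfold Rdiv at 2. apply Rmult_le_compat_r; [left; apply Rinv_0_lt_compat, pow_lt, hr|]. nra.
Qed.

Lemma scale_exp_le (v : R) : 0 < v ->
  (sqrt (v * radius v) / radius v * exp (- / (400 * radius v))) ^ 2 <= 384000000 ^ 2 / 3 * radius v ^ 3.
Proof.
  intros h. pose proof (radius_pos v h) as hr. rewrite Rpow_mult_distr.
  pose proof (scale_sqr_le v h) as h1. pose proof (exp_inv_le (radius v) hr) as h2.
  pose proof (exp_pos (- / (400 * radius v))).
  apply Rle_trans with (1 / 3 / radius v ^ 3 * (384000000 * radius v ^ 3) ^ 2).
  - apply Rmult_le_compat; [apply pow2_ge_0|apply pow2_ge_0|exact h1|apply pow_incr; lra].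
  - right. field. lra.
Qed.

Section Final.
Variable g : nat -> R.
Hypothesis Hg : forall q : C, Cmod q < 1 ->
     is_pseries (fun n => RtoC (g n)) q
       (Cinv (qpoch_inf2 q (Copp (Cpow q 3)) (Cpow q 4))).

(** For such n the error in [saddle_estimate] is below 1/5, whereas the Gaussian integral exceeds 4/3. *)
Theorem coef_pos (n : nat) : 2.4 * 10 ^ 14 <= INR n -> 0 < g n.
Proof.
  intros hn. assert (hv : 240000000000000 <= INR n) by lra.
  set (s := radius (INR n)). assert (hs0 : 0 < s) by (apply radius_pos; lra).
  pose proof (radius_sqr (INR n) ltac:(lra)) as e. fold s in e.
  pose proof PI_4 as hp4. pose proof PI2_3_2 as hp3.
  assert (e2 : INR n * s * s = PI ^ 2 / 48).
  { rewrite e, basel. field. lra. }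
  assert (hs : s <= 4 / 100000000).
  { apply Rnot_lt_le. intros hc.
    assert (INR n * s * s <= 1 / 3) by (rewrite e2; nra).
    assert (240000000000000 * (4 / 100000000) * (4 / 100000000) <= INR n * s * s); [|lra].
    apply Rmult_le_compat; try lra. apply Rmult_le_compat; lra. }
  pose proof (saddle_estimate n s ltac:(lra) e g Hg) as H.
  set (N := INR n * s) in *. set (c := sqrt N / s) in *.
  assert (hN : 4000000 <= N).
  { apply Rmult_le_reg_r with s; [exact hs0|]. rewrite e2.
    assert (9 <= PI ^ 2) by nra. lra. }
  assert (hq : 2000 <= sqrt N).
  { rewrite <- (sqrt_square 2000) by lra. apply sqrt_le_1; lra. }
  assert (hc : 1 <= c).
  { unfold c. apply Rmult_le_reg_r with s; [exact hs0|]. unfold Rdiv. rewrite Rmult_assoc, Rinv_l by lra. lra. }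
  pose proof (gauss_int_ge (c * (PI / 2)) ltac:(nra)) as hG.
  assert (hw : exp (- (2 * Re (odz (RtoC s)))) <= 1 / 1000).
  { eapply Rle_trans; [apply exp_odz_le, hs0|].
    rewrite <- (sqrt_square (1 / 1000)) by lra. apply sqrt_le_1; lra. }
  assert (hce : c * exp (- / (400 * s)) <= 1 / 100).
  { pose proof (scale_exp_le (INR n) ltac:(lra)) as h. fold s N c in h.
    apply Rsqr_incr_0_var; [|lra]. unfold Rsqr.
    replace (c * exp (- / (400 * s)) * (c * exp (- / (400 * s)))) with ((c * exp (- / (400 * s))) ^ 2) by ring.
    eapply Rle_trans; [exact h|].
    assert (s ^ 3 <= (4 / 100000000) ^ 3) by (apply pow_incr; lra). lra. }
  assert (hqi : 21 / sqrt N <= 21 / 2000).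
  { unfold Rdiv. apply Rmult_le_compat_l; [lra|]. apply Rinv_le_contravar; lra. }
  assert (hP : 0 < 2 * PI * c * (g n * exp (- N) * exp (- (Re (evz (RtoC s)) + Re (odz (RtoC s)))))).
  { apply Rabs_le_between in H. pose proof (exp_pos (- (2 * Re (odz (RtoC s))))).
    assert (PI * (21 / sqrt N + 4 * exp (- (2 * Re (odz (RtoC s))))) <= 4 * (21 / 2000 + 4 / 1000)).
    { apply Rmult_le_compat; try lra.
      assert (0 < 21 / sqrt N) by (apply Rmult_lt_0_compat; [lra|apply Rinv_0_lt_compat; lra]). lra. }
    assert (3 * PI * (c * exp (- / (400 * s))) <= 12 * (1 / 100)).
    { pose proof (exp_pos (- / (400 * s))). apply Rmult_le_compat; try lra. nra. }
    lra. }
  apply Rnot_le_lt. intros hc0.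
  assert (0 <= 2 * PI * c) by nra.
  pose proof (exp_pos (- N)). pose proof (exp_pos (- (Re (evz (RtoC s)) + Re (odz (RtoC s))))).
  assert (g n * exp (- N) <= 0) by nra.
  assert (g n * exp (- N) * exp (- (Re (evz (RtoC s)) + Re (odz (RtoC s)))) <= 0) by nra.
  nra.
Qed.

End Final.

(** * The asymptotic formula *)

Definition nu (n : nat) : R := INR (S n).
Definition rad (n : nat) : R := radius (nu n).
Definition expo (n : nat) : R := nu n * rad n.

Lemma nu_pos (n : nat) : 0 < nu n. Proof. apply INR_S_pos. Qed.
Lemma rad_pos (n : nat) : 0 < rad n. Proof. apply radius_pos, nu_pos. Qed.
Lemma expo_pos (n : nat) : 0 < expo n.
Proof. unfold expo. pose proof (nu_pos n). pose proof (rad_pos n). nra. Qed.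

Lemma ln_rad (n : nat) : ln (rad n) = ln PI - (ln 48 + ln (nu n)) / 2.
Proof.
  unfold rad, radius. pose proof (nu_pos n). pose proof PI_RGT_0.
  rewrite ln_div by (try apply sqrt_lt_R0; lra). f_equal.
  rewrite <- Rpower_sqrt by lra. unfold Rpower. rewrite ln_exp, ln_mult by lra. field.
Qed.

Lemma ln_expo (n : nat) : ln (expo n) = ln PI + (ln (nu n) - ln 48) / 2.
Proof.
  unfold expo. rewrite ln_mult by (apply nu_pos || apply rad_pos). rewrite ln_rad. field.
Qed.

Lemma ln_48 : ln 48 = 4 * ln 2 + ln 3.
Proof.
  replace 48 with (2 * 2 * (2 * 2) * 3) by ring. rewrite !ln_mult by lra. ring.
Qed.

Lemma ln_nu_lim : is_lim_seq (fun n => ln (nu n)) p_infty.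
Proof.
  apply (filterlim_comp _ _ _ nu ln _ (Rbar_locally p_infty)); [apply is_lim_seq_INR_S|apply is_lim_ln_p].
Qed.

(** A negative power of n tends to 0. *)
Lemma exp_neg_ln_nu_lim (a b : R) : 0 < a -> is_lim_seq (fun n => exp (b - a * ln (nu n))) 0.
Proof.
  intros ha.
  apply is_lim_seq_ext with (fun n => exp b * / exp (a * ln (nu n))).
  - intros n. rewrite <- exp_Ropp, <- exp_plus. f_equal.
  - apply is_lim_seq_scal0. replace (Finite 0) with (Rbar_inv p_infty) by reflexivity.
    apply is_lim_seq_inv; [|discriminate].
    apply (filterlim_comp _ _ _ (fun n => a * ln (nu n)) exp _ (Rbar_locally p_infty)); [|apply is_lim_exp_p].
    exact (is_lim_seq_scal_infty a _ ha ln_nu_lim).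
Qed.

Lemma rad_lim : is_lim_seq rad 0.
Proof.
  eapply is_lim_seq_ext; [|apply (exp_neg_ln_nu_lim (1 / 2) (ln PI - ln 48 / 2)); lra].
  intros n. cbv beta. rewrite <- (exp_ln (rad n)) by apply rad_pos. rewrite ln_rad. f_equal. field.
Qed.

Lemma sqrt_exp_ln (x : R) : 0 < x -> sqrt x = exp (ln x / 2).
Proof. intros h. rewrite <- Rpower_sqrt by exact h. unfold Rpower. f_equal. field. Qed.

Lemma expo_lim : is_lim_seq expo p_infty.
Proof.
  apply (is_lim_seq_ext (fun n => exp ((ln PI - ln 48 / 2) + 1 / 2 * ln (nu n)))).
  - intros n. rewrite <- (exp_ln (expo n)) by apply expo_pos. f_equal. rewrite ln_expo. field.
  - apply (filterlim_comp _ _ _ (fun n => (ln PI - ln 48 / 2) + 1 / 2 * ln (nu n)) exp _ (Rbar_locally p_infty));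
      [|apply is_lim_exp_p].
    change (is_lim_seq (fun n => (ln PI - ln 48 / 2) + 1 / 2 * ln (nu n)) p_infty).
    apply is_lim_seq_plus with (Finite (ln PI - ln 48 / 2)) p_infty;
      [apply is_lim_seq_const| |reflexivity].
    apply is_lim_seq_scal_infty; [lra|exact ln_nu_lim].
Qed.

Definition scale (n : nat) : R := sqrt (expo n) / rad n.

Lemma scale_pos (n : nat) : 0 < scale n.
Proof.
  unfold scale. pose proof (rad_pos n). pose proof (sqrt_lt_R0 _ (expo_pos n)).
  apply Rmult_lt_0_compat; [lra|apply Rinv_0_lt_compat; lra].
Qed.

Lemma ln_scale (n : nat) : ln (scale n) = ln (expo n) / 2 - ln (rad n).
Proof.
  unfold scale. rewrite ln_div by (apply rad_pos || apply sqrt_lt_R0, expo_pos).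
  rewrite sqrt_exp_ln by apply expo_pos. rewrite ln_exp. reflexivity.
Qed.

Lemma scale_exp_lim : is_lim_seq (fun n => scale n * exp (- / (400 * rad n))) 0.
Proof.
  assert (H : is_lim_seq (fun n => sqrt (384000000 ^ 2 / 3 * rad n ^ 3)) (sqrt (384000000 ^ 2 / 3 * 0))).
  { apply (is_lim_seq_continuous sqrt).
    - apply continuity_pt_sqrt. lra.
    - apply (is_lim_seq_scal_l _ _ (Finite 0)).
      apply is_lim_seq_ext with (fun n => rad n * (rad n * rad n)); [intros; ring|].
      replace (Finite 0) with (Finite (0 * (0 * 0))) by (f_equal; ring).
      apply is_lim_seq_mult'; [|apply is_lim_seq_mult']; apply rad_lim. }
  rewrite Rmult_0_r, sqrt_0 in H.
  refine (is_lim_seq_le_le (fun _ => 0) _ _ _ _ (is_lim_seq_const 0) H).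
  intros n. pose proof (scale_pos n) as hc. pose proof (exp_pos (- / (400 * rad n))). split; [nra|].
  rewrite <- (sqrt_pow2 (scale n * exp (- / (400 * rad n)))) by nra.
  apply sqrt_le_1_alt. apply (scale_exp_le (nu n) (nu_pos n)).
Qed.

Section Asymptotics.
Variable g : nat -> R.
Hypothesis Hg : forall q : C, Cmod q < 1 ->
     is_pseries (fun n => RtoC (g n)) q
       (Cinv (qpoch_inf2 q (Copp (Cpow q 3)) (Cpow q 4))).

Lemma normalized_lim : is_lim_seq (fun n => 2 * PI * scale n *
   (g (S n) * exp (- expo n) * exp (- (Re (evz (RtoC (rad n))) + Re (odz (RtoC (rad n))))))) (sqrt PI).
Proof.
  pose proof PI_RGT_0 as hP. pose proof PI2_1 as hP1.
  assert (hsc : is_lim_seq scale p_infty).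
  { apply is_lim_seq_le_p_loc with expo; [|apply expo_lim].
    assert (h := rad_lim). apply is_lim_seq_spec in h. destruct (h (mkposreal 1 Rlt_0_1)) as [N hN]. cbn [pos] in hN.
    assert (h2 := expo_lim). apply is_lim_seq_spec in h2. destruct (h2 1) as [N2 hN2].
    exists (Nat.max N N2). intros n hn. specialize (hN n ltac:(lia)). specialize (hN2 n ltac:(lia)).
    rewrite Rminus_0_r in hN. apply Rabs_def2 in hN. pose proof (rad_pos n) as hr.
    (* the product of expo and rad is constant, so expo * rad <= sqrt expo from some rank on *)
    unfold scale. pose proof (radius_sqr (nu n) (nu_pos n)) as e. fold (rad n) (expo n) in e.
    rewrite basel in e. pose proof PI_4.
    assert (e2 : expo n * rad n = PI ^ 2 / 48) by (rewrite e; field; lra).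
    apply Rmult_le_reg_r with (rad n); [exact hr|]. unfold Rdiv. rewrite Rmult_assoc, Rinv_l, Rmult_1_r, e2 by lra.
    apply Rle_trans with 1; [nra|]. rewrite <- sqrt_1. apply sqrt_le_1; lra. }
  assert (hV : is_lim_seq (fun n => scale n * (PI / 2)) p_infty).
  { apply is_lim_seq_le_p_loc with scale; [|exact hsc].
    exists 0%nat. intros n _. pose proof (scale_pos n). nra. }
  assert (hG := gauss_int_lim _ hV).
  assert (hw : is_lim_seq (fun n => exp (- (2 * Re (odz (RtoC (rad n)))))) 0).
  { apply is_lim_seq_le_le with (fun _ => 0) (fun n => sqrt (rad n * / 2)).
    - intros n. split; [left; apply exp_pos|apply exp_odz_le, rad_pos].
    - apply is_lim_seq_const.
    - rewrite <- sqrt_0. replace 0 with (0 * / 2) by ring. apply (is_lim_seq_continuous sqrt).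
      + apply continuity_pt_sqrt. lra.
      + apply (is_lim_seq_scal_r _ (/ 2) (Finite 0)), rad_lim. }
  assert (hsN : is_lim_seq (fun n => 21 / sqrt (expo n)) 0).
  { unfold Rdiv. apply is_lim_seq_scal0. replace (Finite 0) with (Rbar_inv p_infty) by reflexivity.
    apply is_lim_seq_inv; [|discriminate].
    apply (filterlim_comp _ _ _ expo sqrt _ (Rbar_locally p_infty)); [apply expo_lim|].
    apply filterlim_sqrt_p. }
  assert (hErr : is_lim_seq (fun n => PI * (21 / sqrt (expo n) + 4 * exp (- (2 * Re (odz (RtoC (rad n))))))
     + 3 * PI * (scale n * exp (- / (400 * rad n)))) 0).
  { replace (Finite 0) with (Finite (PI * (0 + 4 * 0) + 3 * PI * 0)) by (f_equal; ring).
    apply is_lim_seq_plus'.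
    - apply (is_lim_seq_scal_l _ PI (Finite _)). apply is_lim_seq_plus'; [exact hsN|].
      apply (is_lim_seq_scal_l _ 4 (Finite _)), hw.
    - apply (is_lim_seq_scal_l _ (3 * PI) (Finite _)), scale_exp_lim. }
  assert (hD : is_lim_seq (fun n => 2 * PI * scale n *
     (g (S n) * exp (- expo n) * exp (- (Re (evz (RtoC (rad n))) + Re (odz (RtoC (rad n))))))
     - gauss_int (scale n * (PI / 2))) 0).
  { apply is_lim_seq_abs_0. refine (is_lim_seq_le_le_loc (fun _ => 0) _ _ _ _ (is_lim_seq_const 0) hErr).
    assert (h := rad_lim). apply is_lim_seq_spec in h.
    destruct (h (mkposreal (1 / 10000000) ltac:(lra))) as [N hN]. cbn [pos] in hN.
    exists N. intros n hn. specialize (hN n hn). rewrite Rminus_0_r in hN. apply Rabs_def2 in hN.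
    pose proof (rad_pos n). split; [apply Rabs_pos|].
    pose proof (saddle_estimate (S n) (rad n) ltac:(lra) (radius_sqr (nu n) (nu_pos n)) g Hg) as E.
    exact E. }
  replace (Finite (sqrt PI)) with (Finite (0 + sqrt PI)) by (f_equal; ring).
  eapply is_lim_seq_ext; [|exact (is_lim_seq_plus' _ _ _ _ hD hG)]. intros n. cbv beta. ring.
Qed.

(** The order of magnitude of the coefficient; the exponential growth is carried by a hyperbolic
    cosine because the Bessel functions are compared with one. *)
Definition order_n (n : nat) : R := cosh (2 * expo n) / exp (ln (scale n) + ln (rad n) / 4).

Definition lim_const : R := exp (ln (Gamma (1 / 4)) - ln PI - 3 / 4 * ln 2).

Lemma order_n_pos (n : nat) : 0 < order_n n.
Proof.
  unfold order_n. pose proof (cosh_ge_1 (2 * expo n)).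
  apply Rmult_lt_0_compat; [lra|apply Rinv_0_lt_compat, exp_pos].
Qed.

Lemma Gamma_quot_ln : ln (Gamma (1 / 4) / Gamma (3 / 4)) = 2 * ln (Gamma (1 / 4)) - ln 2 / 2 - ln PI.
Proof.
  pose proof (Gamma_pos (1 / 4) ltac:(lra)) as h1. pose proof (Gamma_pos (3 / 4) ltac:(lra)) as h3.
  pose proof PI_RGT_0. pose proof (sqrt_lt_R0 2 ltac:(lra)).
  pose proof (f_equal ln Gamma_quarter) as e. rewrite !ln_mult in e by lra.
  rewrite (sqrt_exp_ln 2), ln_exp in e by lra. rewrite ln_div by lra. lra.
Qed.

Lemma exp_neg_expo_lim : is_lim_seq (fun n => exp (- (4 * expo n))) 0.
Proof.
  apply is_lim_seq_le_le_loc with (fun _ => 0) (fun n => / expo n).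
  - exists 0%nat. intros n _. pose proof (expo_pos n) as h. split; [left; apply exp_pos|].
    rewrite exp_Ropp. apply Rinv_le_contravar; [exact h|]. pose proof (exp_ineq1_le (4 * expo n)). lra.
  - apply is_lim_seq_const.
  - replace (Finite 0) with (Rbar_inv p_infty) by reflexivity.
    apply is_lim_seq_inv; [apply expo_lim|discriminate].
Qed.

(** The limits of the two logarithms on the axis turn [normalized_lim] into an explicit asymptotic
    value. *)
Lemma coef_over_order : is_lim_seq (fun n => g (S n) / order_n n) lim_const.
Proof.
  pose proof PI_RGT_0 as hP.
  pose proof (odz_asymp rad rad_pos rad_lim) as hO. pose proof (evz_asymp rad rad_pos rad_lim) as hE.
  assert (hexp : is_lim_seq (fun n => exp ((Re (odz (RtoC (rad n))) + ln (rad n) / 4)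
      - (zeta2 / 8 / rad n - Re (evz (RtoC (rad n))))))
      (exp (ln (Gamma (1 / 4) / Gamma (3 / 4)) / 2 - ln 2 / 4 - ln 2 / 4))).
  { apply (is_lim_seq_continuous exp); [apply derivable_continuous_pt, derivable_pt_exp|].
    apply is_lim_seq_minus'; assumption. }
  pose proof (is_lim_seq_mult' _ _ _ _ normalized_lim hexp) as hM.
  assert (hden : is_lim_seq (fun n => PI * (1 + exp (- (4 * expo n)))) (PI * (1 + 0))).
  { apply (is_lim_seq_scal_l _ PI (Finite _)). apply is_lim_seq_plus'; [apply is_lim_seq_const|apply exp_neg_expo_lim]. }
  pose proof (is_lim_seq_div' _ _ _ _ hM hden ltac:(lra)) as hQ.
  replace lim_const with (sqrt PI * exp (ln (Gamma (1 / 4) / Gamma (3 / 4)) / 2 - ln 2 / 4 - ln 2 / 4) / (PI * (1 + 0))).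
  - eapply is_lim_seq_ext; [|exact hQ]. intros n. cbv beta.
    pose proof (radius_sqr (nu n) (nu_pos n)) as e. fold (rad n) (expo n) in e. rewrite <- e.
    set (O := Re (odz (RtoC (rad n)))). set (V := Re (evz (RtoC (rad n)))). set (N := expo n) in *.
    pose proof (scale_pos n) as hs.
    assert (E : exp (- N) * exp (- (V + O)) * exp (O + ln (rad n) / 4 - (N - V)) = exp (ln (rad n) / 4) * exp (- (2 * N))).
    { rewrite <- !exp_plus. f_equal. ring. }
    assert (Ec : cosh (2 * N) = (1 + exp (- (4 * N))) / (2 * exp (- (2 * N)))).
    { unfold cosh. replace (- (4 * N)) with (- (2 * N) + - (2 * N)) by ring. rewrite exp_plus.
      replace (exp (2 * N)) with (/ exp (- (2 * N))) by (rewrite exp_Ropp, Rinv_inv; reflexivity).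
      pose proof (exp_pos (- (2 * N))). field. lra. }
    unfold order_n. fold N. rewrite Ec, exp_plus, exp_ln by exact hs.
    pose proof (exp_pos (- (2 * N))). pose proof (exp_pos (- (4 * N))). pose proof (exp_pos (ln (rad n) / 4)).
    transitivity (2 * PI * scale n * g (S n) * (exp (- N) * exp (- (V + O)) * exp (O + ln (rad n) / 4 - (N - V)))
      / (PI * (1 + exp (- (4 * N))))); [unfold Rdiv; ring|].
    rewrite E. field. repeat split; lra.
  - rewrite Gamma_quot_ln, Rplus_0_r, Rmult_1_r, (sqrt_exp_ln PI) by exact hP.
    replace PI with (exp (ln PI)) at 3 by (apply exp_ln; exact hP).
    unfold Rdiv at 1. rewrite <- exp_Ropp, <- !exp_plus. unfold lim_const. f_equal. field.
Qed.

Lemma bessel_arg (n : nat) : PI / 2 * sqrt (INR (S n) / 3) = 2 * expo n.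
Proof.
  fold (nu n). pose proof (nu_pos n) as hv. pose proof PI_RGT_0.
  pose proof (expo_pos n) as hx.
  rewrite <- (exp_ln (2 * expo n)) by lra. rewrite ln_mult, ln_expo, ln_48 by lra.
  rewrite (sqrt_exp_ln (nu n / 3)), ln_div by (try apply Rmult_lt_0_compat; lra).
  replace (PI / 2) with (exp (ln PI - ln 2)).
  - rewrite <- exp_plus. f_equal. field.
  - unfold Rminus. rewrite exp_plus, exp_Ropp, !exp_ln by lra. reflexivity.
Qed.

Definition term1 (n : nat) : R := Rpower PI (1/4) * Gamma (1/4)
          / (Rpower 2 (9/4) * Rpower 3 (3/8) * Rpower (INR n) (3/8))
          * BesselI (-3/4) (PI / 2 * sqrt (INR n / 3)).
Definition term2 (n : nat) : R := (-1) ^ n * (Rpower PI (3/4) * Gamma (3/4)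
          / (Rpower 2 (11/4) * Rpower 3 (5/8) * Rpower (INR n) (5/8)))
          * BesselI (-5/4) (PI / 2 * sqrt (INR n / 3)).

Lemma inv_quarter_lim : is_lim_seq (fun n => / Rpower (expo n) (1 / 4)) 0.
Proof.
  eapply is_lim_seq_ext; [|apply (exp_neg_ln_nu_lim (1 / 8) (- (1 / 4 * (ln PI - ln 48 / 2)))); lra].
  intros n. cbv beta. unfold Rpower. rewrite <- exp_Ropp, ln_expo. f_equal. field.
Qed.

Lemma expo_ge1 : exists N, forall n, (N <= n)%nat -> 1 <= expo n.
Proof.
  assert (h2 := expo_lim). apply is_lim_seq_spec in h2. destruct (h2 1) as [N hN].
  exists N. intros n hn. specialize (hN n hn). lra.
Qed.

Lemma term1_over_order : is_lim_seq (fun n => term1 (S n) / order_n n) lim_const.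
Proof.
  pose proof PI_RGT_0 as hP. pose proof (Gamma_pos (1 / 4) ltac:(lra)) as hg.
  set (r := fun n => BesselI (-3 / 4) (2 * expo n) / (cosh (2 * expo n) / sqrt (PI * expo n))).
  assert (hden : forall n, 0 < cosh (2 * expo n) / sqrt (PI * expo n)).
  { intros n. pose proof (cosh_ge_1 (2 * expo n)). pose proof (expo_pos n).
    apply Rmult_lt_0_compat; [lra|apply Rinv_0_lt_compat, sqrt_lt_R0; nra]. }
  assert (hr : is_lim_seq r 1).
  { replace (Finite 1) with (Finite (0 + 1)) by (f_equal; ring).
    apply is_lim_seq_ext with (fun n => (r n - 1) + 1); [intros; ring|].
    apply is_lim_seq_plus'; [|apply is_lim_seq_const].
    assert (h3 : is_lim_seq (fun n => 3 * / Rpower (expo n) (1 / 4)) 0) by apply is_lim_seq_scal0, inv_quarter_lim.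
    apply is_lim_seq_abs_0. refine (is_lim_seq_le_le_loc (fun _ => 0) _ _ _ _ (is_lim_seq_const 0) h3).
    destruct expo_ge1 as [N hN]. exists N. intros n hn. split; [apply Rabs_pos|].
    pose proof (bessel_first (expo n) (hN n hn)) as B. pose proof (hden n) as hd. unfold r.
    set (D := cosh (2 * expo n) / sqrt (PI * expo n)) in *. set (I := BesselI (-3 / 4) (2 * expo n)) in *.
    replace (I / D - 1) with ((I - D) * / D) by (field; lra).
    rewrite Rabs_mult, (Rabs_pos_eq (/ D)) by (left; apply Rinv_0_lt_compat, hd).
    apply Rmult_le_reg_r with D; [exact hd|]. rewrite Rmult_assoc, Rinv_l, Rmult_1_r by lra. exact B. }
  apply is_lim_seq_ext with (fun n => lim_const * r n).
  - intros n. unfold term1. rewrite bessel_arg. unfold r, order_n. fold (nu n).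
    pose proof (cosh_ge_1 (2 * expo n)) as hc. pose proof (expo_pos n) as he.
    rewrite (sqrt_exp_ln (PI * expo n)), ln_mult by (try nra; lra).
    assert (E : Rpower PI (1 / 4) * Gamma (1 / 4) / (Rpower 2 (9 / 4) * Rpower 3 (3 / 8) * Rpower (nu n) (3 / 8))
       * exp (ln (scale n) + ln (rad n) / 4) = lim_const * exp ((ln PI + ln (expo n)) / 2)).
    { rewrite <- (exp_ln (Gamma (1 / 4))) at 1 by exact hg. unfold Rpower, lim_const, Rdiv at 1.
      rewrite <- !exp_plus, <- exp_Ropp, <- !exp_plus. f_equal.
      rewrite ln_scale, ln_rad, ln_48. field. }
    pose proof (exp_pos ((ln PI + ln (expo n)) / 2)) as h1. pose proof (exp_pos (ln (scale n) + ln (rad n) / 4)) as h2.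
    set (I := BesselI (-3 / 4) (2 * expo n)) in *.
    transitivity (lim_const * exp ((ln PI + ln (expo n)) / 2) * I / cosh (2 * expo n)); [field; lra|].
    rewrite <- E. field.
    pose proof (Rpower_pos 2 (9 / 4)). pose proof (Rpower_pos 3 (3 / 8)). pose proof (Rpower_pos (nu n) (3 / 8)).
    repeat split; lra.
  - replace lim_const with (lim_const * 1) at 1 by ring.
    apply (is_lim_seq_scal_l _ lim_const (Finite 1)), hr.
Qed.

Lemma term2_over_order : is_lim_seq (fun n => term2 (S n) / order_n n) 0.
Proof.
  pose proof PI_RGT_0 as hP. pose proof (Gamma_pos (3 / 4) ltac:(lra)) as hg.
  set (K := ln (Gamma (3 / 4)) + 3 / 4 * ln PI - 11 / 4 * ln 2 - 5 / 8 * ln 3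
     + 1 / 4 * (ln PI - ln 48 / 2) - 3 / 4 * (ln PI - ln 48 / 2)).
  assert (hlim : is_lim_seq (fun n => 6 * exp (K + (ln 48 / 2) - 1 / 8 * ln (nu n) - ln 48 / 2)) 0).
  { apply is_lim_seq_scal0. apply is_lim_seq_ext with (fun n => exp (K - 1 / 8 * ln (nu n))).
    - intros n. f_equal. ring.
    - apply exp_neg_ln_nu_lim. lra. }
  apply is_lim_seq_abs_0. refine (is_lim_seq_le_le_loc (fun _ => 0) _ _ _ _ (is_lim_seq_const 0) hlim).
  destruct expo_ge1 as [N hN]. exists N. intros n hn. split; [apply Rabs_pos|].
  pose proof (bessel_second (expo n) (hN n hn)) as B.
  unfold term2. rewrite bessel_arg. unfold order_n. fold (nu n).
  pose proof (cosh_ge_1 (2 * expo n)) as hc.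
  pose proof (exp_pos (ln (scale n) + ln (rad n) / 4)) as hX.
  set (X := exp (ln (scale n) + ln (rad n) / 4)) in *. set (I := BesselI (-5 / 4) (2 * expo n)) in *.
  set (P := Rpower PI (3 / 4) * Gamma (3 / 4) / (Rpower 2 (11 / 4) * Rpower 3 (5 / 8) * Rpower (nu n) (5 / 8))).
  assert (hPp : 0 < P).
  { unfold P. pose proof (Rpower_pos PI (3 / 4)). pose proof (Rpower_pos 2 (11 / 4)).
    pose proof (Rpower_pos 3 (5 / 8)). pose proof (Rpower_pos (nu n) (5 / 8)).
    apply Rmult_lt_0_compat; [nra|apply Rinv_0_lt_compat].
    apply Rmult_lt_0_compat; [apply Rmult_lt_0_compat|]; assumption. }
  replace ((-1) ^ S n * P * I / (cosh (2 * expo n) / X)) with ((-1) ^ S n * (P * X * / cosh (2 * expo n) * I))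
    by (field; lra).
  rewrite Rabs_mult, Rabs_pow_m1, Rmult_1_l, Rabs_mult.
  assert (hci : 0 < / cosh (2 * expo n)) by (apply Rinv_0_lt_compat; lra).
  assert (hPX : 0 < P * X) by nra.
  rewrite (Rabs_pos_eq (P * X * / cosh (2 * expo n))) by nra.
  apply Rle_trans with (P * X * / cosh (2 * expo n) * (6 / Rpower (expo n) (1 / 4) * cosh (2 * expo n))).
  - apply Rmult_le_compat_l; [nra|exact B].
  - pose proof (Rpower_pos (expo n) (1 / 4)) as hy.
    replace (P * X * / cosh (2 * expo n) * (6 / Rpower (expo n) (1 / 4) * cosh (2 * expo n)))
      with (6 * (P * X / Rpower (expo n) (1 / 4))) by (field; lra).
    apply Rmult_le_compat_l; [lra|]. right.
    unfold P, X. rewrite <- (exp_ln (Gamma (3 / 4))) at 1 by exact hg. unfold Rpower, Rdiv at 1 2.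
    rewrite <- !exp_plus, <- !exp_Ropp, <- !exp_plus. f_equal.
    rewrite ln_scale, ln_rad, ln_expo. unfold K. field.
Qed.

Lemma coef_asymp : is_lim_seq (fun n => g n / (term1 n + term2 n)) 1.
Proof.
  apply is_lim_seq_incr_1.
  assert (hK : 0 < lim_const) by apply exp_pos.
  apply is_lim_seq_ext with (fun n => (g (S n) / order_n n) / (term1 (S n) / order_n n + term2 (S n) / order_n n)).
  - intros n. pose proof (order_n_pos n) as ho.
    replace (term1 (S n) / order_n n + term2 (S n) / order_n n) with ((term1 (S n) + term2 (S n)) * / order_n n)
      by (field; lra).
    unfold Rdiv. rewrite Rinv_mult, Rinv_inv.
    transitivity (g (S n) * / (term1 (S n) + term2 (S n)) * (/ order_n n * order_n n)); [ring|].
    rewrite Rinv_l by lra. ring.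
  - replace (Finite 1) with (Finite (lim_const / (lim_const + 0))) by (f_equal; field; lra).
    apply is_lim_seq_div'; [apply coef_over_order| |lra].
    apply is_lim_seq_plus'; [apply term1_over_order|apply term2_over_order].
Qed.

End Asymptotics.

Theorem theorem1p2 (g : nat -> R)
  (Hg : forall q : C, Cmod q < 1 ->
     is_pseries (fun n => RtoC (g n)) q
       (Cinv (qpoch_inf2 q (Copp (Cpow q 3)) (Cpow q 4)))) :
  is_lim_seq
    (fun n : nat =>
       g n /
       (Rpower PI (1/4) * Gamma (1/4)
          / (Rpower 2 (9/4) * Rpower 3 (3/8) * Rpower (INR n) (3/8))
          * BesselI (-3/4) (PI / 2 * sqrt (INR n / 3))
        + (-1) ^ n * (Rpower PI (3/4) * Gamma (3/4)
          / (Rpower 2 (11/4) * Rpower 3 (5/8) * Rpower (INR n) (5/8)))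
          * BesselI (-5/4) (PI / 2 * sqrt (INR n / 3))))
    1
  /\ (forall n : nat, 2.4 * 10 ^ 14 <= INR n -> 0 < g n).
Proof.
  split.
  - exact (coef_asymp g Hg).
  - intros n hn. exact (coef_pos g Hg n hn).
Qed.
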